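(* Let $M$ be a flat surface in $\mathbb{E}^3$. Then $M$ has harmonic mean curvature function if and only if $M$ is given by open parts of the following surfaces: (1) the planes; (2) the circular cylinders; (3) the Cornu cylinders $C\times\mathbb{R}$, i.e., the right cylinders on the Cornu spiral curves $C$; (4) the cones with vertex at a point $p$ whose rays cut the unit sphere $S^{2}_{p}(1)$ centered at $p$ in a curve $\beta(s)$ of which the curvature in $S^{2}_{p}(1)$ is given by $c_1 \cos s + c_2 \sin s$, where $s$ is an arclength parameter of $\beta$ and $c_1$ and $c_2$ are two nonzero constants.
   Context: Surfaces are smooth, connected and carry the induced metric; flat means zero Gauss curvature. The mean curvature function is the function $\alpha$ with $H=\alpha\xi$, where $H=\frac12\operatorname{trace}h$ is the mean curvature vector and $\xi$ a local unit normal field (so $\alpha$ is determined up to sign). It is harmonic if $\Delta\alpha=0$ for the Laplace operator $\Delta$ of $M$. A Cornu spiral is a planar curve whose curvature function in terms of an arclength parameter $s$ is $\kappa(s)=as+b$ for real constants $a\neq0$ and $b$. The curvature of $\beta$ in $S^2_p(1)$ is its (signed) geodesic curvature in that sphere. By the standard local description of flat surfaces, the paper regards a flat surface in $\mathbb{E}^3$ as locally a cylinder, a cone, or a tangential developable surface. *)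

(* Defs.v *)
From HB Require Import structures.
From mathcomp Require Import all_boot all_order all_algebra.
From mathcomp Require Import all_classical all_reals all_analysis.

Set Implicit Arguments.
Unset Strict Implicit.
Unset Printing Implicit Defensive.

Import Order.TTheory GRing.Theory Num.Theory.
Import numFieldNormedType.Exports.

Local Open Scope classical_set_scope.
Local Open Scope ring_scope.

Section Euclidean.
Variable R : realType.

(* The library norm on row vectors is the sup norm (same topology); the
   Euclidean metric enters only through [dot]. *)
Definition dot n (u v : 'rV[R]_n) : R := \sum_(i < n) u 0 i * v 0 i.

Definition vec3 (a b c : R) : 'rV[R]_3 := \row_j nth 0 [:: a; b; c] j.

Definition cross (u v : 'rV[R]_3) : 'rV[R]_3 :=
  vec3 (u 0 1 * v 0 2 - u 0 2 * v 0 1)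
       (u 0 2 * v 0 0 - u 0 0 * v 0 2)
       (u 0 0 * v 0 1 - u 0 1 * v 0 0).

(* u |-> u *m A + p is then a rigid motion, possibly orientation-reversing. *)
Definition orthogonal_mx (A : 'M[R]_3) : Prop := A *m A^T = 1%:M.

Definition open_interval (J : set R) : Prop := open J /\ is_interval J.

End Euclidean.

Definition partial (R : realType) (W : normedModType R) (i : 'I_2)
    (f : 'rV[R]_2 -> W) : 'rV[R]_2 -> W :=
  'D_(delta_mx 0 i) f.

Section Smooth.
Variable R : realType.

(* All partial derivatives of order at most n exist and are continuous on the
   open set U (continuity at lower orders follows). *)
Fixpoint Cn (W : normedModType R) (n : nat) (U : set 'rV[R]_2)
    (f : 'rV[R]_2 -> W) : Prop :=
  match n with
  | 0 => forall q, U q -> {for q, continuous f}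
  | m.+1 => forall i, (forall q, U q -> derivable f q (delta_mx 0 i)) /\
                      Cn m U (partial i f)
  end.

Definition smooth_on (W : normedModType R) (U : set 'rV[R]_2)
    (f : 'rV[R]_2 -> W) : Prop := forall n, Cn n U f.

Definition smooth_curve_on (W : normedModType R) (J : set R) (c : R -> W) :
    Prop :=
  forall n s, J s -> derivable (derive1n n c) s 1.

End Smooth.

Section Patch.
Variable R : realType.
Implicit Types (y : 'rV[R]_2 -> 'rV[R]_3) (q : 'rV[R]_2).

Definition normal y q : 'rV[R]_3 := cross (partial 0 y q) (partial 1 y q).

Definition regular_patch (U : set 'rV[R]_2) y : Prop :=
  [/\ open U, smooth_on U y & forall q, U q -> normal y q != 0].

Definition first_form y q : 'M[R]_2 :=
  \matrix_(i, j) dot (partial i y q) (partial j y q).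

Definition unit_normal y q : 'rV[R]_3 :=
  (Num.sqrt (dot (normal y q) (normal y q)))^-1 *: normal y q.

Definition second_form y q : 'M[R]_2 :=
  \matrix_(i, j) dot (partial i (partial j y) q) (unit_normal y q).

Definition gauss_curvature y q : R :=
  \det (second_form y q) / \det (first_form y q).

(* h(d_i, d_j): the normal component of the second derivative of y *)
Definition vector_second_form y q (i j : 'I_2) : 'rV[R]_3 :=
  second_form y q i j *: unit_normal y q.

Definition mean_curvature_vector y q : 'rV[R]_3 :=
  2^-1 *: \sum_i \sum_j
    invmx (first_form y q) i j *: vector_second_form y q i j.

(* See [mean_curvature_vectorE]. Exchanging the two parameters reverses the
   unit normal, hence the sign. *)
Definition mean_curvature y q : R :=
  dot (mean_curvature_vector y q) (unit_normal y q).

(* Laplace operator of the metric induced by y, in the coordinates q. *)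
Definition laplacian y (f : 'rV[R]_2 -> R) q : R :=
  (Num.sqrt (\det (first_form y q)))^-1 *
  \sum_i partial i (fun z => Num.sqrt (\det (first_form y z)) *
           \sum_j invmx (first_form y z) i j * partial j f z : R) q.

Lemma dotZl n a (u v : 'rV[R]_n) : dot (a *: u) v = a * dot u v.
Proof.
by rewrite /dot mulr_sumr; apply: eq_bigr => i _; rewrite mxE mulrA.
Qed.

Lemma dotC n (u v : 'rV[R]_n) : dot u v = dot v u.
Proof. by apply: eq_bigr => i _; rewrite mulrC. Qed.

Lemma dot_ge0 n (u : 'rV[R]_n) : 0 <= dot u u.
Proof. by apply: sumr_ge0 => i _; rewrite -expr2 sqr_ge0. Qed.

Lemma dot_eq0 n (u : 'rV[R]_n) : (dot u u == 0) = (u == 0).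
Proof.
apply/idP/eqP => [|->]; last by rewrite /dot big1 // => i _; rewrite mxE mul0r.
rewrite psumr_eq0 => [/allP u0|i _]; last by rewrite -expr2 sqr_ge0.
apply/rowP => i; rewrite mxE; apply/eqP.
by have := u0 i (mem_index_enum i); rewrite mulf_eq0 orbb.
Qed.

Lemma unit_normal1 y q : normal y q != 0 ->
  dot (unit_normal y q) (unit_normal y q) = 1.
Proof.
move=> n0; rewrite dotZl dotC dotZl mulrA -invfM -expr2.
by rewrite sqr_sqrtr ?dot_ge0// mulVf// dot_eq0.
Qed.

Lemma mean_curvature_vectorE y q : normal y q != 0 ->
  mean_curvature_vector y q = mean_curvature y q *: unit_normal y q.
Proof.
move=> n0.
have [a Ha] : exists a, mean_curvature_vector y q = a *: unit_normal y q.
  exists (2^-1 * \sum_i \sum_j invmx (first_form y q) i j * second_form y q i j).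
  rewrite -scalerA scaler_suml; congr (_ *: _); apply: eq_bigr => i _.
  by rewrite scaler_suml; apply: eq_bigr => j _; rewrite scalerA.
by rewrite /mean_curvature Ha dotZl unit_normal1// mulr1.
Qed.

End Patch.

Section Surface.
Variables (R : realType) (M : topologicalType) (x : M -> 'rV[R]_3).

(* phi is a homeomorphism of the open set U of the plane onto an open subset
   of M which makes x a smooth immersion. *)
Definition local_chart (U : set 'rV[R]_2) (phi : 'rV[R]_2 -> M) : Prop :=
  [/\ forall q, U q -> {for q, continuous phi},
      {in U &, injective phi},
      forall V : set 'rV[R]_2, open V -> V `<=` U -> open (phi @` V) &
      regular_patch U (x \o phi)].

(* A smooth connected 2-manifold M immersed in E^3 by x. Two local charts with
   overlapping images differ by a diffeomorphism, because x is an immersion in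
   both; so the local charts form the maximal atlas of the only smooth structure
   on M for which x is a smooth immersion. *)
Definition immersed_surface : Prop :=
  [/\ hausdorff_space M, @second_countable M, connected [set: M] &
      forall m, exists U phi, local_chart U phi /\ (phi @` U) m].

Definition flat : Prop := forall U phi, local_chart U phi ->
  forall q, U q -> gauss_curvature (x \o phi) q = 0.

Definition harmonic_mean_curvature : Prop :=
  forall U phi, local_chart U phi ->
  forall q, U q -> laplacian (x \o phi) (mean_curvature (x \o phi)) q = 0.

(* M is given by open parts of the surface S parametrized by D: near each
   point, x is, in a suitable chart, the restriction of S to an open subset of
   D. Because S may intersect itself, this is not stated in terms of the point
   set S @` D. *)
Definition open_part_of (D : set 'rV[R]_2) (S : 'rV[R]_2 -> 'rV[R]_3) : Prop :=
  forall m, exists U phi, [/\ local_chart U phi, (phi @` U) m, U `<=` D &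
    forall q, U q -> x (phi q) = S q].

End Surface.

Section Models.
Variable R : realType.

Definition plane (A : 'M[R]_3) (p : 'rV[R]_3) (q : 'rV[R]_2) : 'rV[R]_3 :=
  vec3 (q 0 0) (q 0 1) 0 *m A + p.

Definition right_cylinder (A : 'M[R]_3) (p : 'rV[R]_3) (c : R -> 'rV[R]_2)
    (q : 'rV[R]_2) : 'rV[R]_3 :=
  vec3 (c (q 0 0) 0 0) (c (q 0 0) 0 1) (q 0 1) *m A + p.

Definition circle (r : R) (t : R) : 'rV[R]_2 :=
  \row_j nth 0 [:: r * cos t; r * sin t] j.

Definition arclength_curve n (J : set R) (c : R -> 'rV[R]_n) : Prop :=
  [/\ open_interval J, smooth_curve_on J c &
      forall s, J s -> dot (derive1 c s) (derive1 c s) = 1].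

(* signed curvature of a plane curve parametrized by arclength *)
Definition plane_curvature (c : R -> 'rV[R]_2) (s : R) : R :=
  derive1 c s 0 0 * derive1n 2 c s 0 1 - derive1 c s 0 1 * derive1n 2 c s 0 0.

Definition cornu_spiral (J : set R) (c : R -> 'rV[R]_2) : Prop :=
  arclength_curve J c /\
  exists a b, a != 0 /\ forall s, J s -> plane_curvature c s = a * s + b.

Definition curve_on_unit_sphere (p : 'rV[R]_3) (J : set R)
    (c : R -> 'rV[R]_3) : Prop :=
  forall s, J s -> dot (c s - p) (c s - p) = 1.

(* signed geodesic curvature, in the unit sphere centered at p, of a curve of
   that sphere parametrized by arclength *)
Definition sphere_curvature (p : 'rV[R]_3) (c : R -> 'rV[R]_3) (s : R) : R :=
  dot (derive1n 2 c s) (cross (c s - p) (derive1 c s)).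

Definition cone (p : 'rV[R]_3) (c : R -> 'rV[R]_3) (q : 'rV[R]_2) :
    'rV[R]_3 :=
  p + q 0 1 *: (c (q 0 0) - p).

End Models.

(* Main.v *)
Require Import Defs.
From HB Require Import structures.
From mathcomp Require Import all_boot all_order all_algebra.
From mathcomp Require Import all_classical all_reals all_analysis.
From mathcomp Require Import ring lra.

(* Idea. A flat surface has local coordinates in which the metric is Euclidean;
   let h be the second form there (det h = 0) and lam its trace, twice the mean
   curvature, which is harmonic. Where lam <> 0, the Codazzi equations let h and
   the gradient of lam determine a vector field (P, Q) in the kernel of h. Two
   prolongations of the harmonicity of lam force pi = P - i Q to solve
   d pi = pi^2 d zeta, hence pi is either identically zero or
   1 / (zeta0 - zeta) for a constant zeta0. If pi = pi1 at the point zeta = 0,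
   then |1 - pi1 zeta|^2 lam is affine, so this persists across the zeros of
   lam; hence on each coordinate disc either lam vanishes identically, or the
   straight rulings of the surface are parallel (a cylinder), or they all meet
   in one point (a cone); tangent developables are excluded.
   A cylinder or cone over a curve of curvature k in arclength s has
   mean curvature - k / (2 rho), with rho = 1 or rho = t, and Laplacian
   - (k'' + sigma k) / (2 rho^3), with sigma = 0 or 1: harmonicity says that k is
   affine, respectively a combination of cos s and sin s. Two such models
   that overlap differ by an affine change of (s, t), so maximal
   solutions of the Frenet equations make the local model global on a
   connected surface. For a cone, a shift of s makes both constants nonzero. *)

Set Implicit Arguments.
Unset Strict Implicit.
Unset Printing Implicit Defensive.

Import Order.TTheory GRing.Theory Num.Theory.
Import numFieldNormedType.Exports.

Local Open Scope classical_set_scope.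
Local Open Scope ring_scope.

(** Geometrically [(P, Q)] points along the ruling towards its focal point, and its length is the
    inverse of the distance; d pi = pi^2 d zeta says that the focal point is the same for all
    rulings, which excludes an edge of regression. The obstacle is the zero set of lam, where h
    vanishes and no ruling is defined. There P and Q are recovered from the second derivatives of
    lam as long as its gradient is nonzero, and the explicit solution shows that lam and its
    gradient never vanish together, unless lam is identically zero on the disc. A chart is only
    known to be a homeomorphism that makes x an immersion. Smooth transition maps, Euclidean
    coordinates and the invariance of the Laplacian are therefore derived from the inverse function
    theorem and the Poincare lemma. No orientation is chosen: a change of charts may reverse the
    unit normal, so a sign s with s * s = 1 accompanies each of them. *)

Local Notation e_ i := (delta_mx 0 i : 'rV_2).

(** * Calculus on the coordinate plane *)

Section Calculus.
Variable R : realType.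
Implicit Types (f g : 'rV[R]_2 -> R) (p q : 'rV[R]_2).

Lemma addr_subK (a b : R) : a + (b - a) = b.
Proof. by rewrite addrC subrK. Qed.

Lemma addrC_addKr (a b : R) : a + b - a = b.
Proof. by rewrite addrC addKr. Qed.

Definition pt (a b : R) : 'rV[R]_2 := \row_j nth 0 [:: a; b] j.

Lemma ord2 (i : 'I_2) : i = 0 \/ i = 1.
Proof. by case: i => [[|[|//]]] ?; [left|right]; apply/val_inj. Qed.

Lemma ptE q : q = pt (q 0 0) (q 0 1).
Proof.
by apply/rowP => i; rewrite mxE; have [->|->] := ord2 i.
Qed.

Lemma rV2P p q : p 0 0 = q 0 0 -> p 0 1 = q 0 1 -> p = q.
Proof. by move=> e0 e1; rewrite (ptE p) (ptE q) e0 e1. Qed.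

Lemma ptE0 a b : pt a b 0 0 = a. Proof. by rewrite mxE. Qed.
Lemma ptE1 a b : pt a b 0 1 = b. Proof. by rewrite mxE. Qed.

Lemma rV_norm_le n (u : 'rV[R]_n) (a : R) :
  0 <= a -> (forall i, `|u 0 i| <= a) -> `|u| <= a.
Proof.
move=> a0 ua; rewrite [leLHS]/Num.Def.normr/= mx_normrE.
by apply: bigmax_le => // -[i j] _ /=; rewrite (ord1 i).
Qed.

Lemma rV_norm_ge n (u : 'rV[R]_n) i : `|u 0 i| <= `|u|.
Proof.
rewrite [leRHS]/Num.Def.normr/= mx_normrE.
exact: (le_bigmax _ (fun ij => `|u ij.1 ij.2|) (0, i)).
Qed.

Lemma rV_norm_lt n (u : 'rV[R]_n) (a : R) :
  0 < a -> (forall i, `|u 0 i| < a) -> `|u| < a.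
Proof.
move=> a0 ua; rewrite [ltLHS]/Num.Def.normr/= mx_normrE.
by apply: bigmax_lt => // -[i j] _ /=; rewrite (ord1 i).
Qed.

Lemma rV_normS n (u v : 'rV[R]_n) :
  (forall i, `|u 0 i| <= `|v 0 i|) -> `|u| <= `|v|.
Proof.
move=> uv; apply: rV_norm_le => // i.
by apply: le_trans (uv i) _; exact: rV_norm_ge.
Qed.

Lemma rVballP n (p q : 'rV[R]_n) r : ball p r q <-> `|p - q| < r.
Proof. by rewrite -ball_normE. Qed.

Lemma continuous_epsP (V W : normedModType R) (f : V -> W) (p : V) :
  {for p, continuous f} <->
  forall e : R, 0 < e ->
    exists2 d : R, 0 < d & forall z : V, ball p d z -> `|f p - f z| < e.
Proof.
split=> [/cvgrPdist_lt cf e e0|cf].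
  have := cf e e0; rewrite -nbhs_nearE => /nbhs_ballP[d /= d0 dB].
  by exists d.
apply/cvgrPdist_lt => e e0; have [d d0 dB] := cf e e0.
by rewrite -nbhs_nearE; apply/nbhs_ballP; exists d.
Qed.

Lemma is_derive_line (V W : normedModType R) (f : V -> W) (q v : V) (t : R) :
  derivable f (q + t *: v) v ->
  is_derive t 1 (fun s => f (q + s *: v)) ('D_v f (q + t *: v)).
Proof.
have E : (fun h : R => h^-1 *: (((fun s => f (q + s *: v)) \o shift t) (h *: 1) -
           f (q + t *: v))) =
         (fun h => h^-1 *: ((f \o shift (q + t *: v)) (h *: v) - f (q + t *: v))).
  apply/funext => h /=; rewrite scalerDl [h *: 1]mulr1 addrCA.
  by [].
by move=> df; apply: DeriveDef; rewrite /derivable /derive E.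
Qed.

(** The two inequalities say that t lies between 0 and h whatever the sign of h, so that one
    statement serves increments of both signs. *)
Lemma MVT_line (V : normedModType R) (f : V -> R) (q v : V) (h : R) :
  (forall t, `|t| <= `|h| -> `|t - h| <= `|h| -> derivable f (q + t *: v) v) ->
  exists t, [/\ `|t| <= `|h|, `|t - h| <= `|h| &
    f (q + h *: v) - f q = 'D_v f (q + t *: v) * h].
Proof.
move=> df.
pose g s := f (q + s *: v).
have dg t : `|t| <= `|h| -> `|t - h| <= `|h| ->
    is_derive t 1 g ('D_v f (q + t *: v)).
  by move=> th th'; exact/is_derive_line/df.
have cg (i : interval R) :
    (forall t, t \in i -> `|t| <= `|h| /\ `|t - h| <= `|h|) ->
    {within [set` i], continuous g}.
  move=> ih; apply: derivable_within_continuous => t /ih[th th'].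
  by have [] := dg t th th'.
have [h0|h0] := leP 0 h.
- have B t : t \in `[0, h]%R -> `|t| <= `|h| /\ `|t - h| <= `|h|.
    rewrite in_itv /= => /andP[t0 th].
    by rewrite (ger0_norm t0) (ger0_norm h0) distrC ger0_norm ?subr_ge0// lerBlDr lerDl.
  have [||c cI] := @MVT_segment R g (fun t => 'D_v f (q + t *: v)) 0 h h0.
  + move=> t /subset_itv_oo_cc/B[? ?]; exact: dg.
  + exact: cg.
  rewrite /g scale0r addr0 subr0 => E; exists c; have [? ?] := B c cI; split => //.
- have B t : t \in `[h, 0]%R -> `|t| <= `|h| /\ `|t - h| <= `|h|.
    rewrite in_itv /= => /andP[th t0].
    by rewrite (ler0_norm t0) (ltr0_norm h0) ger0_norm ?subr_ge0// lerN2 gerDr.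
  have [||c cI] := @MVT_segment R g (fun t => 'D_v f (q + t *: v)) h 0 (ltW h0).
  + move=> t /subset_itv_oo_cc/B[? ?]; exact: dg.
  + exact: cg.
  rewrite /g scale0r addr0 sub0r mulrN => E; exists c; have [? ?] := B c cI.
  by split => //; rewrite -[LHS]opprB E opprK.
Qed.


Lemma MVT2 f p r q q' : ball p r q -> ball p r q' ->
  (forall z, ball p r z -> forall i, derivable f z (e_ i)) ->
  exists x : 'I_2 -> 'rV[R]_2,
    [/\ forall i, ball p r (x i), forall i, `|x i - q'| <= `|q - q'| &
      f q - f q' = partial 0 f (x 0) * (q 0 0 - q' 0 0) +
                   partial 1 f (x 1) * (q 0 1 - q' 0 1)].
Proof.
move=> /rVballP pq /rVballP pq' df.
have r0 : 0 < r by apply: le_lt_trans pq.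
have conv (a b c : R) : `|b - c| <= `|a - c| -> `|b - a| <= `|a - c| ->
    forall d, `|d - a| < r -> `|d - c| < r -> `|d - b| < r.
  move=> h1 h2 d; rewrite !ltr_norml => /andP[? ?] /andP[? ?].
  have [ac|ac] := leP c a.
    move: h1 h2; rewrite (ger0_norm (x := a - c)) ?subr_ge0//.
    rewrite !ler_norml => /andP[? ?] /andP[? ?]; apply/andP; split; lra.
  move: h1 h2; rewrite (ltr0_norm (x := a - c)) ?subr_lt0//.
  rewrite !ler_norml => /andP[? ?] /andP[? ?]; apply/andP; split; lra.
have co (u v : 'rV[R]_2) i : `|u - v| < r -> `|u 0 i - v 0 i| < r.
  move=> uv; apply: le_lt_trans uv; have := rV_norm_ge (u - v) i.
  by rewrite !mxE.
pose h0 := q 0 0 - q' 0 0; pose h1 := q 0 1 - q' 0 1.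
have B1 t : `|t| <= `|h1| -> `|t - h1| <= `|h1| -> ball p r (q' + t *: e_ 1).
  move=> th th'; apply/rVballP/rV_norm_lt => // j.
  have [->|->] := ord2 j; rewrite !mxE/=.
    rewrite mulr0 addr0; exact: co.
  rewrite mulr1; apply: (conv (q 0 1) _ (q' 0 1)); [| |exact: co|exact: co].
    by rewrite addrC_addKr.
  by have -> : q' 0 1 + t - q 0 1 = t - h1 by rewrite /h1; ring.
have [t1 [t1a t1b E1]] := MVT_line (fun t a b => df _ (B1 t a b) 1).
have B0 t : `|t| <= `|h0| -> `|t - h0| <= `|h0| ->
    ball p r (q' + h1 *: e_ 1 + t *: e_ 0).
  move=> th th'; apply/rVballP/rV_norm_lt => // j.
  have [->|->] := ord2 j; rewrite !mxE/=.
    rewrite mulr1 mulr0 addr0; apply: (conv (q 0 0) _ (q' 0 0)); [| |exact: co|exact: co].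
      by rewrite addrC_addKr.
    by have -> : q' 0 0 + t - q 0 0 = t - h0 by rewrite /h0; ring.
  rewrite mulr0 mulr1 addr0 /h1 addr_subK; exact: co.
have [t0 [t0a t0b E0]] := MVT_line (fun t a b => df _ (B0 t a b) 0).
exists (fun i => if i == 0 then q' + h1 *: e_ 1 + t0 *: e_ 0 else q' + t1 *: e_ 1).
split => [i|i|].
- by case: ifP => _; [exact: B0|exact: B1].
- case: ifP => _; apply: rV_normS => j; have [->|->] := ord2 j; rewrite !mxE/=.
  + by rewrite mulr0 mulr1 addr0 addrC_addKr.
  + by rewrite mulr0 mulr1 addr0 addrC_addKr.
  + by rewrite mulr0 addr0 subrr normr0.
  + by rewrite mulr1 addrC_addKr.
- rewrite /= -/h0 -/h1 -[X in X = _](subrKA (f (q' + h1 *: e_ 1))) -E1.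
  rewrite /partial -E0; congr (f _ - _ + _); apply: rV2P; rewrite !mxE /=.
    by rewrite mulr1 mulr0 addr0 /h0 addr_subK.
  by rewrite mulr0 mulr1 addr0 /h1 addr_subK.
Qed.

(** Caratheodory's form of differentiability. The coefficients are the partial derivatives at the
    intermediate points of [MVT2], hence continuous at p. The increment of f becomes an exact linear
    combination, into which a map can be substituted without an error term. *)
Lemma caratheodory f p r : 0 < r ->
  (forall z, ball p r z -> forall i, derivable f z (e_ i)) ->
  (forall i, {for p, continuous (partial i f)}) ->
  exists A : 'I_2 -> 'rV[R]_2 -> R,
    [/\ forall q, ball p r q -> f q - f p =
          A 0 q * (q 0 0 - p 0 0) + A 1 q * (q 0 1 - p 0 1),
        forall i, {for p, continuous (A i)} & forall i, A i p = partial i f p].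
Proof.
move=> r0 df cf.
have pp : ball p r p by apply/rVballP; rewrite subrr normr0.
have /choice[X HX] : forall q, exists x : 'I_2 -> 'rV[R]_2,
    (forall i, `|x i - p| <= `|q - p|) /\ (ball p r q ->
      f q - f p = partial 0 f (x 0) * (q 0 0 - p 0 0) +
                   partial 1 f (x 1) * (q 0 1 - p 0 1)).
  move=> q; have [pq|npq] := pselect (ball p r q); last first.
    by exists (fun=> p); split => // i; rewrite subrr normr0.
  by have [x [? ? ?]] := MVT2 pq pp df; exists x.
have Xp i : X p i = p.
  have [/(_ i)] := HX p; rewrite subrr normr0 normr_le0 subr_eq0 => /eqP //.
exists (fun i q => partial i f (X q i)); split => [q pq|i|i]; last by rewrite Xp.
- by have [_] := HX q; exact.
- apply/continuous_epsP => e e0; rewrite Xp.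
  have /continuous_epsP/(_ e e0)[d d0 dB] := cf i.
  exists d => // q /rVballP pq; apply: dB; apply/rVballP.
  rewrite distrC; apply: le_lt_trans (_ : `|q - p| < d); last by rewrite distrC.
  by have [+ _] := HX q; exact.
Qed.

End Calculus.

(** * The chain rule for directional derivatives *)

Section Chain.
Variable R : realType.
Implicit Types (f g : 'rV[R]_2 -> R) (p q : 'rV[R]_2).

(** Turns a directional derivative into an ordinary one, so that the one-variable chain rule
    applies. *)
Lemma is_derive1P (V W : normedModType R) (f : V -> W) (x v : V) d :
  is_derive x v f d <-> is_derive (0 : R) 1 (fun h => f (h *: v + x)) d.
Proof.
have E : 'D_1 (fun h : R => f (h *: v + x)) 0 = 'D_v f x.
  rewrite /derive; set g1 := fun h => h^-1 *: _; set g2 := fun h => h^-1 *: _.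
  suff -> : g1 = g2 by [].
  apply/funext => h; rewrite /g1 /g2 /=.
  by rewrite addr0 scale0r add0r [_%:A]mulr1.
split=> -[df <-].
  by apply: DeriveDef => //; exact: (derivable1P _ _ _).1 df.
by apply: DeriveDef; [exact: (derivable1P _ _ _).2 df|rewrite E].
Qed.

Lemma is_derive_comp1 (V : normedModType R) (k : R -> R) (g : V -> R) (q v : V)
    dk dg :
  is_derive (g q) 1 k dk -> is_derive q v g dg ->
  is_derive q v (fun z => k (g z)) (dk * dg).
Proof.
move=> hk /is_derive1P hg; apply/is_derive1P.
have hk' : is_derive (g (0 *: v + q)) 1 k dk by rewrite scale0r add0r.
by have := is_derive1_comp (f := k) (g := fun h => g (h *: v + q)) hk' hg.
Qed.

Lemma derivable_line_cvg (V W : normedModType R) (f : V -> W) (x v : V) :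
  derivable f x v -> f (h *: v + x) @[h --> (0 : R)^'] --> f x.
Proof.
move=> /derivable1P/derivable1_diffP/differentiable_continuous.
by move=> /continuous_withinNx; rewrite scale0r add0r.
Qed.

Lemma is_derive_mx (V : normedModType R) n (f : V -> 'rV[R]_n) (x v : V) d :
  is_derive x v f d <-> forall i, is_derive x v (fun z => f z 0 i) (d 0 i).
Proof.
split=> [[df <-] i|df].
  have fi : derivable (fun z => f z 0 i) x v by exact: (derivable_mxP _ _ _).1.
  by apply: DeriveDef => //; rewrite derive_mx// mxE.
have fi : derivable f x v.
  by apply/derivable_mxP => i j; rewrite (ord1 i); have [] := df j.
apply: DeriveDef => //; rewrite derive_mx//; apply/rowP => i; rewrite mxE.
by have [_ <-] := df i.
Qed.

(* By [caratheodory] the difference quotient of f o t is a combination, with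
   coefficients continuous at [t q], of those of the coordinates of t. *)
Lemma is_derive_chain (V : normedModType R) (t : V -> 'rV[R]_2) (q v : V)
    (f : 'rV[R]_2 -> R) (r : R) (dt : 'rV[R]_2) :
  0 < r ->
  (forall z, ball (t q) r z -> forall i, derivable f z (e_ i)) ->
  (forall i, {for t q, continuous (partial i f)}) ->
  is_derive q v t dt ->
  is_derive q v (fun z => f (t z))
    (partial 0 f (t q) * dt 0 0 + partial 1 f (t q) * dt 0 1).
Proof.
move=> r0 df cf ht.
have [A [fA cA Ap]] := caratheodory r0 df cf.
have /is_derive_mx hti := ht.
have tl : t (h *: v + q) @[h --> (0 : R)^'] --> t q.
  by apply: derivable_line_cvg; have [] := ht.
have cq i : h^-1 * (t (h *: v + q) 0 i - t q 0 i) @[h --> (0 : R)^'] --> dt 0 i.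
  by have [d <-] := hti i; exact: d.
have cAi i : A i (t (h *: v + q)) @[h --> (0 : R)^'] --> partial i f (t q).
  rewrite -Ap; exact: (cvg_comp _ _ tl (cA i)).
have L : h^-1 * (f (t (h *: v + q)) - f (t q)) @[h --> (0 : R)^'] -->
    partial 0 f (t q) * dt 0 0 + partial 1 f (t q) * dt 0 1.
  apply: cvg_trans (cvgD (cvgM (cAi 0) (cq 0)) (cvgM (cAi 1) (cq 1))).
  have tB : \forall h \near (0 : R)^', ball (t q) r (t (h *: v + q)).
    by apply: (tl (ball (t q) r)); apply/nbhs_ballP; exists r.
  apply: near_eq_cvg; near=> h => /=.
  rewrite fA; last by near: h.
  by rewrite !fctE /=; ring.
have E : 'D_v (fun z => f (t z)) q =
  partial 0 f (t q) * dt 0 0 + partial 1 f (t q) * dt 0 1 by exact: cvg_lim L.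
by apply: DeriveDef => //; apply/cvg_ex; eexists; exact: L.
Unshelve. all: by end_near. Qed.

End Chain.

(** * Functions of class C^n on an open set *)

Section Cn.
Variable R : realType.
Implicit Types (f g : 'rV[R]_2 -> R) (p q : 'rV[R]_2) (U : set 'rV[R]_2).

Lemma near_open (T : topologicalType) (U : set T) (P : T -> Prop) (q : T) :
  open U -> U q -> (forall z, U z -> P z) -> \forall z \near q, P z.
Proof.
move=> oU Uq UP; have := open_nbhs_nbhs (conj oU Uq).
by apply: filterS => z; exact: UP.
Qed.

Lemma cont_ext (T T' : topologicalType) (U : set T) (f g : T -> T') (q : T) :
  open U -> U q -> (forall z, U z -> f z = g z) ->
  {for q, continuous f} -> {for q, continuous g}.
Proof.
move=> oU Uq fg; rewrite /prop_for /continuous_at -fg//.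
by apply: cvg_trans; apply: near_eq_cvg; apply: (near_open oU Uq) => z /fg.
Qed.

Section continuity_at.
Variables (T : topologicalType) (f g : T -> R) (q : T).
Hypotheses (cf : {for q, continuous f}) (cg : {for q, continuous g}).

Lemma contC a : {for q, continuous (fun=> a : R)}. Proof. exact: cvg_cst. Qed.
Lemma contD : {for q, continuous (fun z => f z + g z)}.
Proof. exact: cvgD. Qed.
Lemma contB : {for q, continuous (fun z => f z - g z)}.
Proof. exact: cvgB. Qed.
Lemma contM : {for q, continuous (fun z => f z * g z)}.
Proof. exact: cvgM. Qed.
Lemma contV : f q != 0 -> {for q, continuous (fun z => (f z)^-1)}.
Proof. by move=> f0; exact: cvgV. Qed.

End continuity_at.

Lemma open_ball_sub U q : open U -> U q ->
  exists2 r : R, 0 < r & forall z, ball q r z -> U z.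
Proof.
move=> oU Uq; have /nbhs_ballP[r /= r0 rU] := open_nbhs_nbhs (conj oU Uq).
by exists r.
Qed.

Section ext.
Variables (W : normedModType R) (U : set 'rV[R]_2).
Hypothesis oU : open U.

Lemma partial_ext i (f g : 'rV[R]_2 -> W) q : U q -> (forall z, U z -> f z = g z) ->
  partial i f q = partial i g q.
Proof.
by move=> Uq fg; apply: near_eq_derive; exact: near_open Uq fg.
Qed.

Lemma derivable_ext (f g : 'rV[R]_2 -> W) q v : U q ->
  (forall z, U z -> f z = g z) -> derivable f q v -> derivable g q v.
Proof.
by move=> Uq fg; apply: near_eq_derivable; apply: (near_open oU Uq) => z /fg.
Qed.

Lemma Cn_ext n (f g : 'rV[R]_2 -> W) : (forall z, U z -> f z = g z) ->
  Cn n U f -> Cn n U g.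
Proof.
elim: n f g => [|n IH] f g fg /= hf.
  by move=> q Uq; apply: (cont_ext oU Uq fg); exact: hf.
move=> i; have [df cf] := hf i; split.
  by move=> q Uq; apply: derivable_ext (df q Uq).
by apply: IH cf => z Uz; exact: partial_ext.
Qed.

End ext.

Lemma Cn_subset (W : normedModType R) n U U' (f : 'rV[R]_2 -> W) : U' `<=` U ->
  Cn n U f -> Cn n U' f.
Proof.
move=> sU; elim: n f => [|n IH] f /= hf; first by move=> q /sU; exact: hf.
by move=> i; have [df cf] := hf i; split; [move=> q /sU; exact: df|exact: IH].
Qed.

Lemma smooth_subset (W : normedModType R) U U' (f : 'rV[R]_2 -> W) :
  U' `<=` U -> smooth_on U f -> smooth_on U' f.
Proof. by move=> sU sf n; apply: Cn_subset (sf n). Qed.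

(** For positive order [Cn] says nothing about the continuity of [f] itself; it is read off from the
    increment formula of [caratheodory]. This makes the classes decreasing in n. *)
Lemma C1_C0 U f : open U -> Cn 1 U f -> Cn 0 U f.
Proof.
move=> oU cf q Uq; have [r r0 rU] := open_ball_sub oU Uq.
have [||A [fA cA _]] := @caratheodory R f q r r0.
- by move=> z /rU Uz i; have [+ _] := cf i; exact.
- by move=> i; have [_ +] := cf i; exact.
have cqi i : {for q, continuous (fun z : 'rV[R]_2 => z 0 i)}.
  exact: coord_continuous.
have cg : {for q, continuous (fun z => A 0 z * (z 0 0 - q 0 0) +
    A 1 z * (z 0 1 - q 0 1) + f q)}.
  apply: contD; last exact: contC.
  by apply: contD; apply: contM (cA _) _; apply: contB (cqi _) _; exact: contC.
apply/continuous_epsP => e e0; have /continuous_epsP/(_ e e0)[d d0 dB] := cg.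
exists (Num.min d r); first by rewrite lt_min d0.
move=> z /rVballP; rewrite lt_min => /andP[/rVballP zd /rVballP zr].
by have := dB z zd; rewrite !subrr !mulr0 !add0r -fA// subrK.
Qed.

Lemma Cn_S n U f : open U -> Cn n.+1 U f -> Cn n U f.
Proof.
move=> oU; elim: n f => [|n IH] f; first exact: C1_C0.
by move=> cf i; have [df cf'] := cf i; split => //; exact: IH.
Qed.

Lemma Cn_partial n U f i : Cn n.+1 U f -> Cn n U (partial i f).
Proof. by move=> /(_ i)[]. Qed.

Lemma Cn_derive n U f i q : Cn n.+1 U f -> U q ->
  is_derive q (e_ i) f (partial i f q).
Proof. by move=> /(_ i)[df _] Uq; apply: DeriveDef => //; exact: df. Qed.

(** The induction step of all the closure properties: it suffices to exhibit a formula for the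
    derivative and to bound the regularity of that formula. *)
Lemma CnS_from (W : normedModType R) n U (f : 'rV[R]_2 -> W) (df : 'I_2 -> 'rV[R]_2 -> W) :
  open U -> (forall q i, U q -> is_derive q (e_ i) f (df i q)) ->
  (forall i, Cn n U (df i)) -> Cn n.+1 U f.
Proof.
move=> oU hf cdf i; split.
  by move=> q Uq; have [] := hf q i Uq.
by apply: Cn_ext (cdf i) => // z Uz; have [_ <-] := hf z i Uz.
Qed.

Lemma Cn_cst n U a : open U -> Cn n U (fun=> a : R).
Proof.
move=> oU; elim: n a => [|n IH] a; first by move=> q _; exact: contC.
apply: (@CnS_from _ n U _ (fun _ _ => 0)) => // q i Uq; exact: is_derive_cst.
Qed.

Lemma CnD n U f g : open U -> Cn n U f -> Cn n U g ->
  Cn n U (fun z => f z + g z).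
Proof.
move=> oU; elim: n f g => [|n IH] f g cf cg.
  by move=> q Uq; apply: contD; [exact: cf|exact: cg].
apply: (@CnS_from _ n U _ (fun i z => partial i f z + partial i g z)) => // [q i Uq|i].
  by apply: is_deriveD; exact: Cn_derive Uq.
by apply: IH; exact: Cn_partial.
Qed.

Lemma CnM n U f g : open U -> Cn n U f -> Cn n U g ->
  Cn n U (fun z => f z * g z).
Proof.
move=> oU; elim: n f g => [|n IH] f g cf cg.
  by move=> q Uq; apply: contM; [exact: cf|exact: cg].
apply: (@CnS_from _ n U _ (fun i z => f z * partial i g z + g z * partial i f z)) => //
    [q i Uq|i].
  by apply: is_deriveM; exact: Cn_derive Uq.
apply: CnD => //; apply: IH; by [exact: Cn_S|exact: Cn_partial].
Qed.

Lemma CnN n U f : open U -> Cn n U f -> Cn n U (fun z => - f z).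
Proof.
move=> oU cf; have := CnM oU (Cn_cst n (-1) oU) cf.
by apply: Cn_ext => // z _; rewrite mulN1r.
Qed.

Lemma CnB n U f g : open U -> Cn n U f -> Cn n U g ->
  Cn n U (fun z => f z - g z).
Proof. by move=> oU cf cg; apply: CnD => //; exact: CnN. Qed.

Lemma Cn_coord n U i : open U -> Cn n U (fun z => z 0 i).
Proof.
move=> oU; case: n => [|n].
  by move=> q _; exact: coord_continuous.
apply: (@CnS_from _ n U _ (fun j _ => (j == i)%:R : R)) => // [q j _|j]; last exact: Cn_cst.
have : is_derive q (e_ j) (id : 'rV[R]_2 -> _) (e_ j) by exact: is_derive_id.
by move=> /is_derive_mx/(_ i); rewrite mxE eqxx eq_sym.
Qed.

Lemma CnV n U f : open U -> (forall q, U q -> f q != 0) -> Cn n U f ->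
  Cn n U (fun z => (f z)^-1).
Proof.
move=> oU f0; elim: n => [|n IH] cf.
  by move=> q Uq; apply: contV; [exact: cf|exact: f0].
apply: (@CnS_from _ n U _ (fun i z => - ((f z)^-1 * (f z)^-1) * partial i f z)) => // [q
    i Uq|i].
  have hf := Cn_derive i cf Uq; apply: DeriveDef.
    by apply: derivableV; [exact: f0|have [] := hf].
  rewrite deriveV; [|exact: f0|by have [] := hf].
  by rewrite expr2 invfM.
have IH' := IH (Cn_S oU cf).
by apply: CnM => //; [apply: CnN => //; exact: CnM|exact: Cn_partial].
Qed.

Lemma Cn_sqrt n U f : open U -> (forall q, U q -> 0 < f q) -> Cn n U f ->
  Cn n U (fun z => Num.sqrt (f z)).
Proof.
move=> oU f0; elim: n => [|n IH] cf.
  by move=> q Uq; apply: continuous_comp; [exact: cf|exact: sqrt_continuous].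
apply: (@CnS_from _ n U _ (fun i z => (2 * Num.sqrt (f z))^-1 * partial i f z)) => // [q
    i Uq|i].
  apply: is_derive_comp1; last exact: Cn_derive Uq.
  by apply: is_derive1_sqrt; exact: f0.
apply: CnM => //; last exact: Cn_partial.
apply: CnV => //.
  by move=> q Uq; rewrite mulf_neq0// gt_eqF// sqrtr_gt0 f0.
by apply: CnM => //; [exact: Cn_cst|exact/IH/Cn_S].
Qed.

Lemma Cn_cos_sin n U f : open U -> Cn n U f ->
  Cn n U (fun z => cos (f z)) /\ Cn n U (fun z => sin (f z)).
Proof.
move=> oU; elim: n => [|n IH] cf.
  split=> q Uq; apply: (@continuous_comp _ _ _ f); [exact: cf| |exact: cf|].
    exact: continuous_cos.
  exact: continuous_sin.
have [cc cs] := IH (Cn_S oU cf).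
split.
  apply: (@CnS_from _ n U _ (fun i z => - sin (f z) * partial i f z)) => // [q i Uq|i].
    by apply: is_derive_comp1; exact: Cn_derive Uq.
  by apply: CnM => //; [exact: CnN|exact: Cn_partial].
apply: (@CnS_from _ n U _ (fun i z => cos (f z) * partial i f z)) => // [q i Uq|i].
  by apply: is_derive_comp1; exact: Cn_derive Uq.
by apply: CnM => //; exact: Cn_partial.
Qed.

Lemma Cn_mx n U k (y : 'rV[R]_2 -> 'rV[R]_k) : open U ->
  Cn n U y <-> forall i, Cn n U (fun z => y z 0 i).
Proof.
move=> oU; elim: n y => [|n IH] y.
  split=> cy.
    move=> i q Uq; apply: (@continuous_comp _ _ _ y (fun u : 'rV_k => u 0 i)).
      exact: cy.
    exact: coord_continuous.
  move=> q Uq; apply/continuous_epsP => e e0.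
  have /choice[d Hd] : forall i, exists d : R, 0 < d /\
      forall z, ball q d z -> `|y q 0 i - y z 0 i| < e.
    move=> i; have /continuous_epsP/(_ e e0)[d d0 dB] := cy i q Uq.
    by exists d.
  pose m := \big[Num.min/1]_i d i.
  have m0 : 0 < m by apply: lt_bigmin => // i _; have [] := Hd i.
  exists m => // z qz; apply: rV_norm_lt => // i; rewrite !mxE.
  have [_] := Hd i; apply; apply: le_ball qz.
  exact: bigmin_le_cond.
have comp i j : (forall q, U q -> derivable y q (e_ i)) -> forall q, U q ->
   partial i y q 0 j = partial i (fun z => y z 0 j) q.
  by move=> dy q Uq; rewrite /partial derive_mx ?mxE//; exact: dy.
split=> cy.
  move=> j i; have [dy cdy] := cy i; split.
    by move=> q Uq; have /derivable_mxP := dy q Uq; exact.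
  by apply: Cn_ext ((IH _).1 cdy j) => // z Uz; exact: comp.
move=> i; have dy q : U q -> derivable y q (e_ i).
  move=> Uq; apply/derivable_mxP => k0 j; rewrite (ord1 k0).
  by have [+ _] := cy j i; exact.
split => //; apply/IH => j.
by apply: Cn_ext (Cn_partial i (cy j)) => // z Uz; rewrite comp.
Qed.

(** Induction on n with [f] varying, since the chain rule brings in the partial derivatives of [f].
    Only [t] has limited regularity: this asymmetry is what the bootstrap for inverse maps needs. *)
Lemma Cn_comp n U U' f (t : 'rV[R]_2 -> 'rV[R]_2) : open U -> open U' ->
  (forall q, U q -> U' (t q)) -> smooth_on U' f -> Cn n U t ->
  Cn n U (fun z => f (t z)).
Proof.
move=> oU oU' UU'; elim: n f => [|n IH] f sf ct.
  move=> q Uq; apply: continuous_comp; first exact: ct.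
  by have := sf 0%N (t q); apply; exact: UU'.
have ct' := (Cn_mx _ _ oU).1 ct.
apply: (@CnS_from _ n U _ (fun i z => partial 0 f (t z) * partial i t z 0 0 +
  partial 1 f (t z) * partial i t z 0 1)) => // [q i Uq|i].
  have [r r0 rU] := open_ball_sub oU' (UU' q Uq).
  apply: (is_derive_chain r0).
  - by move=> z /rU Uz j; have [+ _] := sf 1%N j; exact.
  - by move=> j; have [_ +] := sf 1%N j; apply; exact: UU'.
  - by have [dt _] := ct i; apply: DeriveDef => //; exact: dt.
have smp j : Cn n U (fun z => partial j f (t z)).
  apply: IH => [m|]; first by have [_] := sf m.+1 j.
  by apply/Cn_mx => // k; apply: Cn_S => //; exact: ct'.
have cti : forall k, Cn n U (fun z => partial i t z 0 k).
  by apply/Cn_mx => //; have [] := ct i.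
by apply: CnD => //; apply: CnM.
Qed.

End Cn.

Fact pd_sig : {d : forall (R : realType) (W : normedModType R), 'I_2 ->
  ('rV[R]_2 -> W) -> 'rV[R]_2 -> W | d = @partial}.
Proof. by exists @partial. Qed.

(* [partial], sealed: comparing two distinct partial derivatives by conversion
   is intractable *)
Definition pd (R : realType) (W : normedModType R) (i : 'I_2)
    (f : 'rV[R]_2 -> W) : 'rV[R]_2 -> W := sval pd_sig R W i f.

Lemma pdE (R : realType) (W : normedModType R) (i : 'I_2) (f : 'rV[R]_2 -> W) :
  pd i f = partial i f.
Proof. by rewrite /pd; case: pd_sig => d /= ->. Qed.

(** * Smooth functions, derivation rules and the symmetry of second derivatives *)

Section Smooth.
Variable R : realType.
Implicit Types (f g : 'rV[R]_2 -> R) (p q : 'rV[R]_2) (U : set 'rV[R]_2).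

Lemma smooth_ext (W : normedModType R) U (f g : 'rV[R]_2 -> W) : open U ->
  (forall z, U z -> f z = g z) -> smooth_on U f -> smooth_on U g.
Proof. by move=> oU fg sf n; apply: Cn_ext (sf n). Qed.

Lemma smooth_pd (W : normedModType R) U i (f : 'rV[R]_2 -> W) :
  smooth_on U f -> smooth_on U (pd i f).
Proof. by rewrite pdE => sf n; have [] := sf n.+1 i. Qed.

Lemma smooth_derivable (W : normedModType R) U i (f : 'rV[R]_2 -> W) q :
  smooth_on U f -> U q -> derivable f q (e_ i).
Proof. by move=> sf Uq; have [+ _] := sf 1%N i; exact. Qed.

Lemma smooth_is_derive (W : normedModType R) U i (f : 'rV[R]_2 -> W) q :
  smooth_on U f -> U q -> is_derive q (e_ i) f (pd i f q).
Proof. by rewrite pdE => sf Uq; apply: DeriveDef => //; exact: smooth_derivable Uq. Qed.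

Lemma is_derive_pd (W : normedModType R) i (f : 'rV[R]_2 -> W) q d :
  is_derive q (e_ i) f d -> pd i f q = d.
Proof. by rewrite pdE => -[]. Qed.

Lemma pd_ext (W : normedModType R) U i (f g : 'rV[R]_2 -> W) q : open U -> U q ->
  (forall z, U z -> f z = g z) -> pd i f q = pd i g q.
Proof. by rewrite !pdE => oU; exact: partial_ext. Qed.

Lemma MVT2_pd f p r q q' : ball p r q -> ball p r q' ->
  (forall z, ball p r z -> forall i, derivable f z (e_ i)) ->
  exists x : 'I_2 -> 'rV[R]_2,
    [/\ forall i, ball p r (x i), forall i, `|x i - q'| <= `|q - q'| &
      f q - f q' = pd 0 f (x 0) * (q 0 0 - q' 0 0) +
                   pd 1 f (x 1) * (q 0 1 - q' 0 1)].
Proof. by rewrite !pdE; exact: MVT2. Qed.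

Lemma MVT_pd f q i (h : R) :
  (forall t, `|t| <= `|h| -> `|t - h| <= `|h| -> derivable f (q + t *: e_ i) (e_ i)) ->
  exists t, [/\ `|t| <= `|h|, `|t - h| <= `|h| &
    f (q + h *: e_ i) - f q = pd i f (q + t *: e_ i) * h].
Proof. by rewrite pdE; exact: MVT_line. Qed.

Lemma caratheodory_pd f p r : 0 < r ->
  (forall z, ball p r z -> forall i, derivable f z (e_ i)) ->
  (forall i, {for p, continuous (pd i f)}) ->
  exists A : 'I_2 -> 'rV[R]_2 -> R,
    [/\ forall q, ball p r q -> f q - f p =
          A 0 q * (q 0 0 - p 0 0) + A 1 q * (q 0 1 - p 0 1),
        forall i, {for p, continuous (A i)} & forall i, A i p = pd i f p].
Proof.
move=> r0 df cf; have [i|A [fA cA Ap]] := caratheodory r0 df; first by rewrite -pdE.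
by exists A; split => // i; rewrite pdE.
Qed.

Lemma smooth_continuous (W : normedModType R) U (f : 'rV[R]_2 -> W) q :
  smooth_on U f -> U q -> {for q, continuous f}.
Proof. by move=> sf; exact: sf 0%N q. Qed.

(** Serves functions that are given by different formulas near different points. *)
Lemma smooth_local (W : normedModType R) U (f : 'rV[R]_2 -> W) :
  (forall q, U q -> exists V, [/\ open V, V q & smooth_on V f]) -> smooth_on U f.
Proof.
move=> H n; elim: n f H => [|n IH] f H.
  by move=> q /H[V [oV Vq sf]]; exact: (sf 0%N).
move=> i; split=> [q /H[V [oV Vq sf]]|]; first exact: smooth_derivable Vq.
apply: IH => q /H[V [oV Vq sf]]; exists V; split => //; by rewrite -pdE; exact: smooth_pd.
Qed.

Section closure.
Variable U : set 'rV[R]_2.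
Hypothesis oU : open U.
Variables (f g : 'rV[R]_2 -> R).
Hypotheses (sf : smooth_on U f) (sg : smooth_on U g).

Lemma smooth_cst a : smooth_on U (fun=> a : R).
Proof. by move=> n; exact: Cn_cst. Qed.
Lemma smoothD : smooth_on U (fun z => f z + g z).
Proof. by move=> n; exact: CnD. Qed.
Lemma smoothM : smooth_on U (fun z => f z * g z).
Proof. by move=> n; exact: CnM. Qed.
Lemma smoothN : smooth_on U (fun z => - f z).
Proof. by move=> n; exact: CnN. Qed.
Lemma smoothX n : smooth_on U (fun z => f z ^+ n).
Proof.
elim: n => [|n IH]; first exact: smooth_cst.
move=> m; have := CnM oU (sf m) (IH m).
by apply: Cn_ext => // z _; rewrite exprS.
Qed.
Lemma smoothV : (forall q, U q -> f q != 0) -> smooth_on U (fun z => (f z)^-1).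
Proof. by move=> f0 n; exact: CnV. Qed.
Lemma smooth_sqrt : (forall q, U q -> 0 < f q) ->
  smooth_on U (fun z => Num.sqrt (f z)).
Proof. by move=> f0 n; exact: Cn_sqrt. Qed.
Lemma smooth_cos : smooth_on U (fun z => cos (f z)).
Proof. by move=> n; have [] := Cn_cos_sin oU (sf n). Qed.
Lemma smooth_sin : smooth_on U (fun z => sin (f z)).
Proof. by move=> n; have [] := Cn_cos_sin oU (sf n). Qed.
Lemma smooth_coord i : smooth_on U (fun z => z 0 i).
Proof. by move=> n; exact: Cn_coord. Qed.
End closure.

Section vector_closure.
Variables (U : set 'rV[R]_2) (k : nat).
Hypothesis oU : open U.
Implicit Types a b : 'rV[R]_2 -> 'rV[R]_k.

Lemma smooth_mx a : smooth_on U a <-> forall i, smooth_on U (fun z => a z 0 i).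
Proof.
split=> sa => [i n|n]; first exact: ((Cn_mx _ _ oU).1 (sa n)).
by apply/(Cn_mx _ _ oU) => i; exact: sa.
Qed.

Lemma smooth_comp_mx a i : smooth_on U a -> smooth_on U (fun z => a z 0 i).
Proof. by move=> /smooth_mx; exact. Qed.

Lemma smooth_vcst (v : 'rV[R]_k) : smooth_on U (fun=> v).
Proof. by apply/smooth_mx => i; exact: smooth_cst. Qed.

Lemma smooth_vadd a b : smooth_on U a -> smooth_on U b ->
  smooth_on U (fun z => a z + b z).
Proof.
move=> sa sb; apply/smooth_mx => i.
apply: smooth_ext (smoothD oU (smooth_comp_mx i sa) (smooth_comp_mx i sb)) => //.
by move=> z _; rewrite mxE.
Qed.

Lemma smooth_scale (f : 'rV[R]_2 -> R) a : smooth_on U f -> smooth_on U a ->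
  smooth_on U (fun z => f z *: a z).
Proof.
move=> sf sa; apply/smooth_mx => i.
apply: smooth_ext (smoothM oU sf (smooth_comp_mx i sa)) => //.
by move=> z _; rewrite mxE.
Qed.

Lemma smooth_vopp a : smooth_on U a -> smooth_on U (fun z => - a z).
Proof.
move=> sa; apply: smooth_ext (smooth_scale (smooth_cst oU (-1)) sa) => // z _.
by rewrite scaleN1r.
Qed.

Lemma smooth_sum (I : finType) (h : I -> 'rV[R]_2 -> R) :
  (forall i, smooth_on U (h i)) -> smooth_on U (fun z => \sum_i h i z).
Proof.
move=> sh.
rewrite (_ : (fun z => _) = (fun z => (\sum_i h i) z)); last first.
  by apply/funext => z; rewrite fct_sumE.
elim/big_ind : _ => //; first exact: (smooth_cst oU 0).
move=> F G sF sG; exact: (smoothD oU sF sG).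
Qed.

Lemma smooth_dot a b : smooth_on U a -> smooth_on U b ->
  smooth_on U (fun z => dot (a z) (b z)).
Proof.
move=> sa sb; apply: smooth_sum => i.
exact: (smoothM oU (smooth_comp_mx i sa) (smooth_comp_mx i sb)).
Qed.
End vector_closure.

Lemma smooth_comp U U' f (t : 'rV[R]_2 -> 'rV[R]_2) : open U -> open U' ->
  (forall q, U q -> U' (t q)) -> smooth_on U' f -> smooth_on U t ->
  smooth_on U (fun z => f (t z)).
Proof. by move=> oU oU' UU' sf st n; exact: (Cn_comp oU oU' UU' sf (st n)). Qed.

Lemma smooth_vcomp k U U' (f : 'rV[R]_2 -> 'rV[R]_k) (t : 'rV[R]_2 -> 'rV[R]_2) :
  open U -> open U' ->
  (forall q, U q -> U' (t q)) -> smooth_on U' f -> smooth_on U t ->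
  smooth_on U (fun z => f (t z)).
Proof.
move=> oU oU' UU' /(smooth_mx oU') sf st; apply/(smooth_mx oU) => i.
exact: (@smooth_comp U U' (fun z => f z 0 i)).
Qed.

Section derivation_rules.
Variables (V : normedModType R) (q v : V).
Implicit Types (F G : V -> R).

Lemma is_dC (W : normedModType R) (a : W) : is_derive q v (fun=> a) 0.
Proof. exact: is_derive_cst. Qed.
Lemma is_dD (W : normedModType R) (F G : V -> W) dF dG : is_derive q v F dF ->
  is_derive q v G dG -> is_derive q v (fun z => F z + G z) (dF + dG).
Proof. exact: is_deriveD. Qed.
Lemma is_dN (W : normedModType R) (F : V -> W) dF : is_derive q v F dF ->
  is_derive q v (fun z => - F z) (- dF).
Proof. exact: is_deriveN. Qed.
Lemma is_dM F G dF dG : is_derive q v F dF -> is_derive q v G dG ->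
  is_derive q v (fun z => F z * G z) (F q * dG + G q * dF).
Proof. exact: is_deriveM. Qed.
Lemma is_dX F n dF : is_derive q v F dF ->
  is_derive q v (fun z => F z ^+ n) (n%:R * F q ^+ n.-1 * dF).
Proof.
rewrite (_ : (fun z => _) = F ^+ n); first exact: is_deriveX.
by apply/funext => z; rewrite exprfctE.
Qed.
Lemma is_dV F dF : F q != 0 -> is_derive q v F dF ->
  is_derive q v (fun z => (F z)^-1) (- (F q ^- 2) * dF).
Proof.
move=> F0 [hF <-]; apply: DeriveDef; first exact: derivableV.
by rewrite deriveV.
Qed.
Lemma is_dcos F dF : is_derive q v F dF ->
  is_derive q v (fun z => cos (F z)) (- sin (F q) * dF).
Proof. exact: is_derive_comp1. Qed.
Lemma is_dsin F dF : is_derive q v F dF ->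
  is_derive q v (fun z => sin (F z)) (cos (F q) * dF).
Proof. exact: is_derive_comp1. Qed.

Variable k : nat.
Implicit Types (a b : V -> 'rV[R]_k).

Lemma is_dcoord a da i : is_derive q v a da ->
  is_derive q v (fun z => a z 0 i) (da 0 i).
Proof. by move=> /is_derive_mx. Qed.

Lemma is_dscale F a dF da : is_derive q v F dF -> is_derive q v a da ->
  is_derive q v (fun z => F z *: a z) (dF *: a q + F q *: da).
Proof.
move=> hF /is_derive_mx ha; apply/is_derive_mx => i.
have := is_dM hF (ha i); rewrite !mxE addrC (mulrC (a q 0 i)).
by congr is_derive; apply/funext => z; rewrite mxE.
Qed.

Lemma is_dsum (I : finType) (h : I -> V -> R) dh :
  (forall i, is_derive q v (h i) (dh i)) ->
  is_derive q v (fun z => \sum_i h i z) (\sum_i dh i).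
Proof.
move=> hh.
rewrite (_ : (fun z => _) = \sum_i h i); last first.
  by apply/funext => z; rewrite fct_sumE.
elim/big_ind2 : _ => //; first exact: is_derive_cst.
by move=> *; exact: is_deriveD.
Qed.

Lemma is_ddot a b da db : is_derive q v a da -> is_derive q v b db ->
  is_derive q v (fun z => dot (a z) (b z)) (dot da (b q) + dot (a q) db).
Proof.
move=> /is_derive_mx ha /is_derive_mx hb; rewrite /dot -big_split/=.
apply: is_dsum => i; apply: (is_derive_eq (is_dM (ha i) (hb i))).
by rewrite addrC [b q 0 i * _]mulrC.
Qed.

End derivation_rules.

(** The second difference is the increment in direction i of the increment in direction j; the mean
    value theorem is applied once in each direction. *)
Lemma second_difference U f q (i j : 'I_2) (h : R) : open U -> smooth_on U f ->
  0 < h -> (forall z, `|z - q| <= 2 * h -> U z) ->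
  exists2 x, `|x - q| <= 2 * h &
    f (q + h *: e_ i + h *: e_ j) - f (q + h *: e_ i) - f (q + h *: e_ j) + f q =
    h ^+ 2 * pd j (pd i f) x.
Proof.
move=> oU sf h0 hU.
have ne (k : 'I_2) : `|e_ k : 'rV[R]_2| <= 1.
  by apply: rV_norm_le => // l; rewrite !mxE eqxx /=; case: eqP; rewrite ?normr1 ?normr0.
have B a b : `|a| <= h -> `|b| <= h -> `|q + a *: e_ i + b *: e_ j - q| <= 2 * h.
  move=> ah bh; rewrite -(addrA q) [q + _]addrC addrK (le_trans (ler_normD _ _))//.
  rewrite mulr_natl mulr2n lerD// normrZ -[leRHS]mulr1 ler_pM//.
pose F z := f (z + h *: e_ j) - f z.
have hh : `|h| = h by rewrite gtr0_norm.
have dsh a b : `|a| <= h -> `|b| <= h ->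
    is_derive (q + a *: e_ i) (e_ i) (fun z => f (z + b *: e_ j))
      (pd i f (q + a *: e_ i + b *: e_ j)).
  move=> ah bh; have := smooth_is_derive i sf (hU _ (B _ _ ah bh)).
  move=> /is_derive1P hd; apply/is_derive1P.
  by move: hd; congr is_derive; apply/funext => t; rewrite addrA.
have dF t : `|t| <= h -> is_derive (q + t *: e_ i) (e_ i) F
    (pd i f (q + t *: e_ i + h *: e_ j) - pd i f (q + t *: e_ i)).
  move=> th; apply: is_dD; first by apply: dsh => //; rewrite hh.
  apply: is_dN; have := dsh t 0 th; rewrite normr0 => /(_ (ltW h0)).
  by rewrite scale0r addr0; congr is_derive; apply/funext => z; rewrite addr0.
have [|t [th _ E]] := @MVT_line R _ F q (e_ i) h.
  by rewrite hh => t th _; have [] := dF t th.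
rewrite hh in th.
have [|s [sh _ E']] := @MVT_line R _ (pd i f) (q + t *: e_ i) (e_ j) h.
  rewrite hh => s sh _; exact: (smooth_derivable (smooth_pd i sf) (hU _ (B _ _ th sh))).
rewrite hh in sh.
exists (q + t *: e_ i + s *: e_ j); first exact: B.
have [_ dFt] := dF t th.
rewrite [X in X = _](_ : _ = F (q + h *: e_ i) - F q); last first.
  by rewrite /F opprB addrA addrAC.
by rewrite E dFt E' (pdE j) /partial; ring.
Qed.

Lemma second_difference_sym f q u v :
  f (q + u + v) - f (q + u) - f (q + v) + f q =
  f (q + v + u) - f (q + v) - f (q + u) + f q.
Proof. by rewrite (addrAC q v); congr (_ + _); exact: addrAC. Qed.

Lemma sub_split (a b x y : R) : x = y -> a - b = (a - y) - (b - x).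
Proof. by move=> ->; ring. Qed.

(** The second difference is symmetric in its two increments, so the two mixed derivatives take a
    common value at two points arbitrarily close to q; their continuity carries the equality to
    q. *)
Lemma schwarz U f q (i j : 'I_2) : open U -> smooth_on U f -> U q ->
  pd i (pd j f) q = pd j (pd i f) q.
Proof.
move=> oU sf Uq; have [r r0 rU] := open_ball_sub oU Uq.
apply/eqP; rewrite -subr_eq0 -normr_le0; apply/ler_addgt0Pl => e e0; rewrite addr0.
have e20 : 0 < e / 2 by rewrite divr_gt0.
have C k l : {for q, continuous (pd k (pd l f))}.
  exact: smooth_continuous (smooth_pd k (smooth_pd l sf)) Uq.
have /continuous_epsP/(_ _ e20)[d1 d10 B1] := C i j.
have /continuous_epsP/(_ _ e20)[d2 d20 B2] := C j i.
pose m := Num.min r (Num.min d1 d2).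
have m0 : 0 < m by rewrite !lt_min r0 d10.
(* With increment m / 4 the intermediate points lie within m / 2 of q, strictly inside the domain
   and both balls of continuity. *)
have h0 : 0 < m / 4 by rewrite divr_gt0.
have hm : 2 * (m / 4) < m by lra.
have hU z : `|z - q| <= 2 * (m / 4) -> U z.
  move=> zq; apply/rU/rVballP; rewrite distrC (le_lt_trans zq)//.
  by rewrite (lt_le_trans hm)// ge_min lexx.
have [x xq E] := second_difference i j oU sf h0 hU.
have [y yq E'] := second_difference j i oU sf h0 hU.
have : pd j (pd i f) x = pd i (pd j f) y.
  have h20 : (m / 4) ^+ 2 != 0 by rewrite expf_neq0 ?gt_eqF.
  exact: (mulfI h20 (etrans (esym E) (etrans (second_difference_sym f q _ _) E'))).
move=> xy; apply: ltW; rewrite (splitr e) (sub_split _ _ xy) {E E' xy}.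
apply: le_lt_trans (ler_normB _ _) _; apply: ltrD.
  apply: B1; apply/rVballP; rewrite distrC (le_lt_trans yq)// (lt_le_trans hm)//.
  by rewrite !ge_min lexx orbT.
apply: B2; apply/rVballP; rewrite distrC (le_lt_trans xq)// (lt_le_trans hm)//.
by rewrite !ge_min lexx !orbT.
Qed.

Lemma pd0_cst p r f : (forall z, ball p r z -> forall i, is_derive z (e_ i) f 0) ->
  forall q, ball p r q -> f q = f p.
Proof.
move=> df q pq.
have r0 : 0 < r by have /rVballP := pq; exact: le_lt_trans.
have pp : ball p r p by apply/rVballP; rewrite subrr normr0.
have [|x [xb _ E]] := MVT2_pd pq pp (f := f).
  by move=> z zb i; have [] := df z zb i.
apply/eqP; rewrite -subr_eq0 E (is_derive_pd (df _ (xb 0) 0)) (is_derive_pd (df _ (xb 1) 1)).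
by rewrite !mul0r addr0.
Qed.

End Smooth.

Ltac smooth_open := first [assumption | exact: ball_open].

(* leaves open the side conditions of inverses and square roots *)
Ltac smooth :=
  lazymatch goal with
  | |- smooth_on _ (fun z => @Algebra.add _ (@?a z) (@?b z)) =>
      first [ apply: smoothD; [smooth_open | smooth | smooth]
            | apply: smooth_vadd; [smooth_open | smooth | smooth] ]
  | |- smooth_on _ (fun z => @Algebra.opp _ (@?a z)) =>
      first [ apply: smoothN; [smooth_open | smooth]
            | apply: smooth_vopp; [smooth_open | smooth] ]
  | |- smooth_on _ (fun z => @GRing.mul _ (@?a z) (@?b z)) =>
      apply: smoothM; [smooth_open | smooth | smooth]
  | |- smooth_on _ (fun z => @GRing.exp _ (@?a z) _) =>
      apply: smoothX; [smooth_open | smooth]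
  | |- smooth_on _ (fun z => @GRing.inv _ (@?a z)) =>
      apply: smoothV; [smooth_open | smooth | ]
  | |- smooth_on _ (fun z => Num.sqrt (@?a z)) =>
      apply: smooth_sqrt; [smooth_open | smooth | ]
  | |- smooth_on _ (fun z => cos (@?a z)) => apply: smooth_cos; [smooth_open | smooth]
  | |- smooth_on _ (fun z => sin (@?a z)) => apply: smooth_sin; [smooth_open | smooth]
  | |- smooth_on _ (fun z => dot (@?a z) (@?b z)) =>
      apply: smooth_dot; [smooth_open | smooth | smooth]
  | |- smooth_on _ (fun z => @GRing.scale _ _ (@?a z) (@?b z)) =>
      apply: smooth_scale; [smooth_open | smooth | smooth]
  | |- smooth_on _ (fun z => fun_of_matrix z _ ?i) =>
      apply: smooth_coord; smooth_open
  | |- smooth_on _ (fun z => fun_of_matrix (@?a z) _ ?i) =>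
      apply: smooth_comp_mx; [smooth_open | smooth]
  | |- smooth_on _ (fun z => pd ?i ?f z) =>
      apply: (@smooth_pd _ _ _ i f); smooth
  | |- smooth_on _ (pd ?i ?f) => apply: smooth_pd; smooth
  | |- smooth_on _ (fun z => ?f z) => change (smooth_on _ f); smooth
  | |- smooth_on _ (fun z => ?c) =>
      first [ apply: smooth_cst; smooth_open | apply: smooth_vcst; smooth_open ]
  | |- _ => first [assumption | idtac]
  end.

(* [Uq : U q], where the functions in the expression are smooth on [U] *)
Ltac der Uq :=
  lazymatch goal with
  | |- is_derive _ _ (fun z => @Algebra.add _ (@?a z) (@?b z)) _ =>
      apply: is_dD; der Uq
  | |- is_derive _ _ (fun z => @Algebra.opp _ (@?a z)) _ => apply: is_dN; der Uq
  | |- is_derive _ _ (fun z => @GRing.mul _ (@?a z) (@?b z)) _ =>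
      apply: is_dM; der Uq
  | |- is_derive _ _ (fun z => @GRing.exp _ (@?a z) _) _ => apply: is_dX; der Uq
  | |- is_derive _ _ (fun z => @GRing.inv _ (@?a z)) _ =>
      apply: is_dV; der Uq
  | |- is_derive _ _ (fun z => cos (@?a z)) _ => apply: is_dcos; der Uq
  | |- is_derive _ _ (fun z => sin (@?a z)) _ => apply: is_dsin; der Uq
  | |- is_derive _ _ (fun z => dot (@?a z) (@?b z)) _ =>
      apply: is_ddot; der Uq
  | |- is_derive _ _ (fun z => @GRing.scale _ _ (@?a z) (@?b z)) _ =>
      apply: is_dscale; der Uq
  | |- is_derive _ _ (fun z => fun_of_matrix (@?a z) _ ?i) _ =>
      apply: is_dcoord; der Uq
  | |- is_derive _ _ (fun z => z) _ => exact: is_derive_id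
  | |- is_derive _ _ (fun z => ?f z) _ =>
      first [ by apply: (smooth_is_derive (f := f) _ _ Uq); smooth
            | by apply: smooth_is_derive Uq; smooth ]
  | |- is_derive _ _ (fun z => ?c) _ => exact: is_dC
  | |- _ => first [ by apply: smooth_is_derive Uq; smooth | idtac ]
  end.

(** * Inverse functions and connectedness *)

Section Inverse.
Variable R : realType.
Implicit Types (f g : 'rV[R]_2 -> R) (p q : 'rV[R]_2) (U : set 'rV[R]_2).

Definition jac (f g : 'rV[R]_2 -> R) q :=
  pd 0 f q * pd 1 g q - pd 1 f q * pd 0 g q.

Lemma jac_smooth U f g : open U -> smooth_on U f -> smooth_on U g ->
  smooth_on U (jac f g).
Proof. by move=> oU sf sg; rewrite /jac; smooth. Qed.

Lemma line_cvg (V : normedModType R) (T : topologicalType) (t : V -> T) (q v : V) :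
  {for q, continuous t} -> t (h *: v + q) @[h --> (0 : R)^'] --> t q.
Proof.
move=> ct; have := derivable_line_cvg (@derivable_id R V q v).
by move=> /cvg_comp; apply; exact: ct.
Qed.

Lemma solve2 (a b c d x y u v : R) : a * d - b * c != 0 ->
  u = a * x + b * y -> v = c * x + d * y ->
  x = (d * u - b * v) / (a * d - b * c) /\ y = (a * v - c * u) / (a * d - b * c).
Proof. by move=> n0 -> ->; split; field. Qed.

Lemma solve2_eq0 (a b c d x y : R) : a * d - b * c != 0 ->
  a * x + b * y = 0 -> c * x + d * y = 0 -> x = 0 /\ y = 0.
Proof.
move=> n0 h h'; have [-> ->] := solve2 n0 (esym h) (esym h').
by rewrite !mulr0 subrr !mul0r.
Qed.

(* [t] is only assumed continuous; the linear system for its increments comes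
   from [caratheodory] *)
Lemma is_derive_inverse (V : normedModType R) (t : V -> 'rV[R]_2) (q v : V)
    (U : set 'rV[R]_2) f g df dg :
  open U -> smooth_on U f -> smooth_on U g -> U (t q) ->
  {for q, continuous t} -> jac f g (t q) != 0 ->
  is_derive q v (fun z => f (t z)) df -> is_derive q v (fun z => g (t z)) dg ->
  is_derive q v t (pt
    ((pd 1 g (t q) * df - pd 1 f (t q) * dg) / jac f g (t q))
    ((pd 0 f (t q) * dg - pd 0 g (t q) * df) / jac f g (t q))).
Proof.
move=> oU sf sg Uq ct J0 hf hg; have [r r0 rU] := open_ball_sub oU Uq.
have der (h : 'rV[R]_2 -> R) : smooth_on U h -> forall z, ball (t q) r z ->
    forall i, derivable h z (e_ i).
  by move=> sh z /rU Uz i; exact: smooth_derivable Uz.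
have con (h : 'rV[R]_2 -> R) : smooth_on U h ->
    forall i, {for t q, continuous (pd i h)}.
  by move=> sh i; exact: smooth_continuous (smooth_pd i sh) Uq.
have [A [fA cA Ap]] := caratheodory_pd r0 (der _ sf) (con _ sf).
have [B [gB cB Bp]] := caratheodory_pd r0 (der _ sg) (con _ sg).
have tl := line_cvg v ct.
have cAl i : A i (t (h *: v + q)) @[h --> (0 : R)^'] --> pd i f (t q).
  rewrite -Ap; exact: (cvg_comp _ _ tl (cA i)).
have cBl i : B i (t (h *: v + q)) @[h --> (0 : R)^'] --> pd i g (t q).
  rewrite -Bp; exact: (cvg_comp _ _ tl (cB i)).
have qf : h^-1 * (f (t (h *: v + q)) - f (t q)) @[h --> (0 : R)^'] --> df.
  by have [d <-] := hf; exact: d.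
have qg : h^-1 * (g (t (h *: v + q)) - g (t q)) @[h --> (0 : R)^'] --> dg.
  by have [d <-] := hg; exact: d.
pose D (h : R) := A 0 (t (h *: v + q)) * B 1 (t (h *: v + q)) -
  A 1 (t (h *: v + q)) * B 0 (t (h *: v + q)).
have cD : D h @[h --> (0 : R)^'] --> jac f g (t q).
  exact: (cvgB (cvgM (cAl 0) (cBl 1)) (cvgM (cAl 1) (cBl 0))).
have D0 : \forall h \near (0 : R)^', D h != 0 by exact: cvgr_neq0 cD J0.
have tB : \forall h \near (0 : R)^', ball (t q) r (t (h *: v + q)).
  by apply: (tl (ball (t q) r)); apply/nbhs_ballP; exists r.
have sol : \forall h \near (0 : R)^',
    h^-1 * (t (h *: v + q) 0 0 - t q 0 0) =
     (B 1 (t (h *: v + q)) * (h^-1 * (f (t (h *: v + q)) - f (t q))) -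
      A 1 (t (h *: v + q)) * (h^-1 * (g (t (h *: v + q)) - g (t q)))) / D h /\
    h^-1 * (t (h *: v + q) 0 1 - t q 0 1) =
     (A 0 (t (h *: v + q)) * (h^-1 * (g (t (h *: v + q)) - g (t q))) -
      B 0 (t (h *: v + q)) * (h^-1 * (f (t (h *: v + q)) - f (t q)))) / D h.
  near=> h; have hB : ball (t q) r (t (h *: v + q)) by near: h.
  have hD : D h != 0 by near: h.
  by apply: solve2 => //; [rewrite fA//|rewrite gB//]; ring.
have L0 : h^-1 * (t (h *: v + q) 0 0 - t q 0 0) @[h --> (0 : R)^'] -->
    (pd 1 g (t q) * df - pd 1 f (t q) * dg) / jac f g (t q).
  apply: cvg_trans (cvgM (cvgB (cvgM (cBl 1) qf) (cvgM (cAl 1) qg)) (cvgV J0 cD)).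
  apply: near_eq_cvg; near=> h.
  have [-> _] : h^-1 * (t (h *: v + q) 0 0 - t q 0 0) =
     (B 1 (t (h *: v + q)) * (h^-1 * (f (t (h *: v + q)) - f (t q))) -
      A 1 (t (h *: v + q)) * (h^-1 * (g (t (h *: v + q)) - g (t q)))) / D h /\
    h^-1 * (t (h *: v + q) 0 1 - t q 0 1) =
     (A 0 (t (h *: v + q)) * (h^-1 * (g (t (h *: v + q)) - g (t q))) -
      B 0 (t (h *: v + q)) * (h^-1 * (f (t (h *: v + q)) - f (t q)))) / D h
    by near: h.
  by [].
have L1 : h^-1 * (t (h *: v + q) 0 1 - t q 0 1) @[h --> (0 : R)^'] -->
    (pd 0 f (t q) * dg - pd 0 g (t q) * df) / jac f g (t q).
  apply: cvg_trans (cvgM (cvgB (cvgM (cAl 0) qg) (cvgM (cBl 0) qf)) (cvgV J0 cD)).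
  apply: near_eq_cvg; near=> h.
  have [_ ->] : h^-1 * (t (h *: v + q) 0 0 - t q 0 0) =
     (B 1 (t (h *: v + q)) * (h^-1 * (f (t (h *: v + q)) - f (t q))) -
      A 1 (t (h *: v + q)) * (h^-1 * (g (t (h *: v + q)) - g (t q)))) / D h /\
    h^-1 * (t (h *: v + q) 0 1 - t q 0 1) =
     (A 0 (t (h *: v + q)) * (h^-1 * (g (t (h *: v + q)) - g (t q))) -
      B 0 (t (h *: v + q)) * (h^-1 * (f (t (h *: v + q)) - f (t q)))) / D h
    by near: h.
  by [].
apply/is_derive_mx => i; have [->|->] := ord2 i; rewrite ?ptE0 ?ptE1.
  apply: DeriveDef; last exact: cvg_lim L0.
  by apply/cvg_ex; eexists; exact: L0.
apply: DeriveDef; last exact: cvg_lim L1.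
by apply/cvg_ex; eexists; exact: L1.
Unshelve. all: by end_near. Qed.

(** A bootstrap: the formula of [is_derive_inverse] involves [t] only through compositions with
    smooth functions, so that a [t] of class C^n has derivatives of class C^n. The composites with f
    and g need not be coordinates, which makes the lemma apply to transition maps as well. *)
Lemma smooth_inverse (U V : set 'rV[R]_2) (t : 'rV[R]_2 -> 'rV[R]_2) f g :
  open U -> open V -> smooth_on U f -> smooth_on U g ->
  (forall q, V q -> U (t q)) -> (forall q, V q -> {for q, continuous t}) ->
  (forall q, V q -> jac f g (t q) != 0) ->
  smooth_on V (fun z => f (t z)) -> smooth_on V (fun z => g (t z)) ->
  smooth_on V t.
Proof.
move=> oU oV sf sg tU ct J0 sft sgt.
pose F i z := (pd 1 g (t z) * pd i (fun z => f (t z)) z -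
  pd 1 f (t z) * pd i (fun z => g (t z)) z) / jac f g (t z).
pose G i z := (pd 0 f (t z) * pd i (fun z => g (t z)) z -
  pd 0 g (t z) * pd i (fun z => f (t z)) z) / jac f g (t z).
have dt q i : V q -> is_derive q (e_ i) t (pt (F i q) (G i q)).
  move=> Vq; apply: (is_derive_inverse oU sf sg (tU q Vq) (ct q Vq) (J0 q Vq));
  exact: smooth_is_derive Vq.
move=> n; elim: n => [|n IH]; first exact: ct.
have C (h : 'rV[R]_2 -> R) : smooth_on U h -> Cn n V (fun z => h (t z)).
  by move=> sh; exact: (Cn_comp oV oU tU sh IH).
have CV : Cn n V (fun z => (jac f g (t z))^-1).
  by apply: CnV => //; apply: C; exact: jac_smooth.
have P (h : 'rV[R]_2 -> R) i : smooth_on U h -> Cn n V (fun z => pd i h (t z)).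
  by move=> sh; apply: C; exact: smooth_pd.
have Q (h : 'rV[R]_2 -> R) i : smooth_on V h -> Cn n V (pd i h).
  by move=> sh; exact: (smooth_pd i sh).
apply/(Cn_mx _ _ oV) => k.
apply: (@CnS_from _ _ n V _ (fun i z => pt (F i z) (G i z) 0 k)) => //.
  by move=> q i Vq; have /is_derive_mx := dt q i Vq; exact.
move=> i; have [->|->] := ord2 k.
  apply: (@Cn_ext _ _ _ oV n (F i)) => [z _|]; first by rewrite ptE0.
  by apply: CnM => //; apply: CnB => //; apply: CnM => //; (exact: P || exact: Q).
apply: (@Cn_ext _ _ _ oV n (G i)) => [z _|]; first by rewrite ptE1.
by apply: CnM => //; apply: CnB => //; apply: CnM => //; (exact: P || exact: Q).
Qed.

(** Each of the two products moves by at most 2 M e + e^2 <= 3 M e, hence the determinant by at most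
    6 M e, which is less than 8 M e. *)
Lemma det_perturb (a b c d a' b' c' d' M e : R) : 0 < e -> e <= 1 -> 1 <= M ->
  [/\ `|a| <= M, `|b| <= M, `|c| <= M & `|d| <= M] ->
  `|a - a'| <= e -> `|b - b'| <= e -> `|c - c'| <= e -> `|d - d'| <= e ->
  8 * M * e <= `|a * b - c * d| -> a' * b' - c' * d' != 0.
Proof.
move=> e0 e1 M1 [aM bM cM dM] h1 h2 h3 h4 eJ.
apply/eqP => E; move: eJ; rewrite leNgt => /negP; apply.
have -> : a * b - c * d = (a - a') * b + a * (b - b') - (a - a') * (b - b')
   - ((c - c') * d + c * (d - d') - (c - c') * (d - d')).
  by rewrite -[LHS]subr0 -E; ring.
have T (x y X Y : R) : `|x| <= X -> `|y| <= Y -> - (X * Y) <= x * y <= X * Y.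
  by move=> xX yY; rewrite -ler_norml normrM ler_pM.
have /andP[? ?] := T _ _ _ _ h1 bM.
have /andP[? ?] := T _ _ _ _ aM h2.
have /andP[? ?] := T _ _ _ _ h1 h2.
have /andP[? ?] := T _ _ _ _ h3 dM.
have /andP[? ?] := T _ _ _ _ cM h4.
have /andP[? ?] := T _ _ _ _ h3 h4.
have ee : e * e <= e by rewrite ger_pMr.
have eM : e <= M * e by rewrite ler_pMl.
rewrite ltr_norml; apply/andP; split; lra.
Qed.

Lemma norm4_le (a b c d : R) : let M := 1 + `|a| + `|b| + `|c| + `|d| in
  [/\ `|a| <= M, `|b| <= M, `|c| <= M & `|d| <= M].
Proof.
have := (normr_ge0 a, normr_ge0 b, normr_ge0 c, normr_ge0 d).
by move=> [[[? ?] ?] ?] /=; split; lra.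
Qed.

(** The mean value theorem gives f and g intermediate points of their own, so the difference of two
    points with equal images solves a linear system whose four entries are taken at four different
    points. [det_perturb] keeps all such determinants nonzero near q. *)
Lemma jac_ball U f g q : open U -> smooth_on U f -> smooth_on U g -> U q ->
  jac f g q != 0 ->
  exists r, [/\ 0 < r, ball q r `<=` U, (forall z, ball q r z -> jac f g z != 0) &
    forall z z', ball q r z -> ball q r z' -> f z = f z' -> g z = g z' -> z = z'].
Proof.
move=> oU sf sg Uq J0.
have [r0 r00 rU] := open_ball_sub oU Uq.
pose M := 1 + `|pd 0 f q| + `|pd 1 f q| + `|pd 0 g q| + `|pd 1 g q|.
have M1 : 1 <= M by rewrite /M -!addrA lerDl !addr_ge0.
have M0 : 0 < M by apply: lt_le_trans M1.
pose e := Num.min 1 (`|jac f g q| / (8 * M)).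
have e0 : 0 < e by rewrite lt_min ltr01 divr_gt0 ?normr_gt0// mulr_gt0.
have e1 : e <= 1 by rewrite ge_min lexx.
have eJ : 8 * M * e <= `|jac f g q|.
  by rewrite mulrC -ler_pdivlMr ?mulr_gt0// ge_min lexx orbT.
have C (h : 'rV[R]_2 -> R) i : smooth_on U h -> exists2 d, 0 < d &
    forall z, ball q d z -> `|pd i h q - pd i h z| < e.
  move=> sh; have /continuous_epsP/(_ e e0) :=
    smooth_continuous (smooth_pd i sh) Uq.
  by [].
have [d1 d10 B1] := C f 0 sf; have [d2 d20 B2] := C f 1 sf.
have [d3 d30 B3] := C g 0 sg; have [d4 d40 B4] := C g 1 sg.
pose r := Num.min r0 (Num.min (Num.min d1 d2) (Num.min d3 d4)).
have rr : [/\ r <= r0, r <= d1, r <= d2, r <= d3 & r <= d4].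
  by rewrite /r; split; rewrite !ge_min lexx ?orbT.
have [rr0 rd1 rd2 rd3 rd4] := rr.
have r_0 : 0 < r by rewrite !lt_min r00 d10 d20 d30 d40.
have nz z1 z2 z3 z4 : ball q r z1 -> ball q r z2 -> ball q r z3 -> ball q r z4 ->
    pd 0 f z1 * pd 1 g z2 - pd 1 f z3 * pd 0 g z4 != 0.
  move=> /(le_ball rd1)/B1 h1 /(le_ball rd4)/B4 h2 /(le_ball rd2)/B2 h3 /(le_ball rd3)/B3 h4.
  have [m1 m2 m3 m4] := norm4_le (pd 0 f q) (pd 1 f q) (pd 0 g q) (pd 1 g q).
  exact: (det_perturb e0 e1 M1 (And4 m1 m4 m2 m3) (ltW h1) (ltW h2) (ltW h3) (ltW h4) eJ).
exists r; split => //.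
- by move=> z /(le_ball rr0)/rU.
- by move=> z zr; exact: nz.
- move=> z z' zr z'r fE gE.
  have df (h : 'rV[R]_2 -> R) : smooth_on U h -> forall x, ball q r x ->
      forall i, derivable h x (e_ i).
    by move=> sh x /(le_ball rr0)/rU Ux i; exact: smooth_derivable Ux.
  have [x [xr _]] := MVT2_pd zr z'r (df f sf).
  have [y [yr _]] := MVT2_pd zr z'r (df g sg).
  rewrite fE gE !subrr => Eg Ef.
  have [h0 h1] := solve2 (nz _ _ _ _ (xr 0) (yr 1) (xr 1) (yr 0)) Ef Eg.
  apply: rV2P; apply/eqP; rewrite -subr_eq0.
    by rewrite h0 !mulr0 subrr mul0r.
  by rewrite h1 !mulr0 subrr mul0r.
Qed.

Lemma continuous_norm_sub (V : normedModType R) (q : V) :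
  continuous (fun z : V => `|z - q|).
Proof.
move=> z; apply: (@continuous_comp _ _ _ (fun z => z - q) Num.norm).
  by apply: cvgB; [exact: cvg_id|exact: cvg_cst].
exact: norm_continuous.
Qed.

Lemma closed_norm_le (V : normedModType R) (q : V) (s : R) :
  closed [set z : V | `|z - q| <= s].
Proof.
apply: (@closed_comp _ _ (fun z : V => `|z - q|) [set x | x <= s]).
  by move=> z _; exact: continuous_norm_sub.
exact: closed_le.
Qed.

Lemma closed_norm_eq (V : normedModType R) (q : V) (s : R) :
  closed [set z : V | `|z - q| = s].
Proof.
apply: (@closed_comp _ _ (fun z : V => `|z - q|) [set x | x = s]).
  by move=> z _; exact: continuous_norm_sub.
exact: closed_eq.
Qed.

Lemma pd_min f q (r : R) i : 0 < r -> derivable f q (e_ i) ->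
  (forall z, ball q r z -> derivable f z (e_ i)) ->
  (forall z, ball q r z -> f q <= f z) -> pd i f q = 0.
Proof.
move=> r0 dfq df fmin.
have B t : t \in `](- r), r[%R -> ball q r (q + t *: e_ i).
  rewrite in_itv/= -ltr_norml => tr; apply/rVballP; rewrite opprD addNKr normrN.
  apply: rV_norm_lt => // j; rewrite !mxE eqxx /=.
  by case: eqP => _; rewrite ?mulr1// mulr0 normr0.
have rr : - r <= r by lra.
have d t : t \in `](- r), r[%R -> derivable (fun s : R => f (q + s *: e_ i)) t 1.
  by move=> /B/df/is_derive_line[].
have z0 : (0 : R) \in `](- r), r[%R by rewrite in_itv/= oppr_lt0 r0.
have [|_ E] := derive1_at_min rr d z0.
  by move=> t /B/fmin; rewrite scale0r addr0.
have := @is_derive_line R _ _ f q (e_ i) 0; rewrite scale0r addr0 => /(_ dfq)[_ E'].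
by rewrite pdE /partial -E' E.
Qed.

(* |F - y|^2 attains its minimum over a small closed square, and only in the
   interior because F is injective; there its gradient vanishes *)
Lemma open_image_ball U f g q s : open U -> smooth_on U f -> smooth_on U g ->
  0 < s -> (forall z, `|z - q| <= s -> U z) ->
  (forall z, `|z - q| <= s -> jac f g z != 0) ->
  (forall z, `|z - q| <= s -> f z = f q -> g z = g q -> z = q) ->
  exists2 d, 0 < d & forall y0 y1, `|y0 - f q| < d -> `|y1 - g q| < d ->
    exists z, [/\ ball q s z, f z = y0 & g z = y1].
Proof.
move=> oU sf sg s0 KU KJ Kinj.
pose K := [set z : 'rV[R]_2 | `|z - q| <= s].
pose S := [set z : 'rV[R]_2 | `|z - q| = s].
have bK : bounded_set K.
  exists (s + `|q|); split; first exact: num_real.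
  move=> x sx z /= zK; rewrite ltW// (le_lt_trans _ sx)//.
  by rewrite -[z](subrK q) (le_trans (ler_normD _ _))// lerD2r.
have cK : compact K.
  apply: bounded_closed_compact => //.
  exact: closed_norm_le.
have SK : S `<=` K by move=> z zs; rewrite /K/= zs.
have cS : compact S.
  apply: (subclosed_compact _ cK) => //.
  exact: closed_norm_eq.
pose Phi y0 y1 z := (f z - y0) ^+ 2 + (g z - y1) ^+ 2.
have sPhi y0 y1 : smooth_on U (Phi y0 y1) by rewrite /Phi; smooth.
have cPhi y0 y1 (A : set 'rV[R]_2) : A `<=` K -> {within A, continuous (Phi y0 y1)}.
  move=> AK; apply: continuous_in_subspaceT => z /set_mem/AK/KU Uz.
  exact: smooth_continuous (sPhi y0 y1) Uz.
have S0 : S !=set0.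
  exists (q + s *: e_ 0); rewrite /S/= addrC addKr normrZ gtr0_norm//.
  rewrite (_ : `|e_ 0| = 1) ?mulr1//; apply/eqP; rewrite eq_le; apply/andP; split.
    by apply: rV_norm_le => // i; rewrite !mxE eqxx /=; case: eqP; rewrite ?normr1 ?normr0.
  by apply: le_trans (rV_norm_ge _ 0); rewrite !mxE eqxx /= normr1.
have K0 : K !=set0 by exists q; rewrite /K/= subrr normr0 ltW.
have [c /set_mem cSS cmin] := EVT_min_rV S0 cS (cPhi (f q) (g q) S SK).
pose m := Phi (f q) (g q) c.
have m0 : 0 < m.
  rewrite lt_def; apply/andP; split; last by rewrite addr_ge0 ?sqr_ge0.
  apply/eqP => /eqP; rewrite paddr_eq0 ?sqr_ge0// !sqrf_eq0 !subr_eq0.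
  move=> /andP[/eqP h1 /eqP h2].
  have E : c = q by apply: Kinj => //; rewrite cSS.
  by move: cSS; rewrite /S/= E subrr normr0 => ss; rewrite -ss ltxx in s0.
(* As d^2 <= d <= m / 16, the value at q is at most m / 8. On the boundary m <= 2 Phi + 2 (m / 8),
   so Phi is at least 3 m / 8 there and the minimum is interior. *)
pose d := Num.min 1 (m / 16).
have d0 : 0 < d by rewrite lt_min ltr01 divr_gt0.
exists d => // y0 y1 h0 h1.
have dd (x : R) : `|x| < d -> x ^+ 2 <= m / 16.
  move=> xd; rewrite -real_normK ?num_real//.
  apply: (@le_trans _ _ (d * d)); first by rewrite expr2; apply: ler_pM => //; exact: ltW.
  by rewrite (le_trans (ler_piMl _ _))// ?(ltW d0)// ge_min lexx ?orbT.
have [z /set_mem zK zmin] := EVT_min_rV K0 cK (cPhi y0 y1 K (fun _ h => h)).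
have zq : Phi y0 y1 z <= m / 8.
  apply: (@le_trans _ _ (Phi y0 y1 q)); first by apply/zmin/mem_set;
      rewrite /K/= subrr normr0 ltW.
  have := dd _ h0; have := dd _ h1; rewrite /Phi => a b.
  rewrite -(sqrrN (f q - y0)) -(sqrrN (g q - y1)) !opprB; lra.
have zb : ball q s z.
  apply/rVballP; rewrite distrC lt_neqAle zK andbT; apply/eqP => zS.
  have := cmin z (mem_set zS); rewrite -/m /Phi.
  have := dd _ h0; have := dd _ h1; move: zq; rewrite /Phi.
  move: (f z) (g z) (f q) (g q) (m0) => a b a' b' mp.
  have := sqr_ge0 (a - y0 - (y0 - a')); have := sqr_ge0 (b - y1 - (y1 - b')).
  rewrite !expr2; lra.
exists z; have Uz := KU z zK.
have [r r0 rs] : exists2 r : R, 0 < r & forall x, ball z r x -> ball q s x.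
  by apply: open_ball_sub => //; exact: ball_open.
have gr i : pd i (Phi y0 y1) z = 0.
  apply: (@pd_min _ _ r) => //.
  - exact: smooth_derivable (sPhi y0 y1) Uz.
  - move=> x /rs/rVballP xq; apply: smooth_derivable (sPhi y0 y1) _.
    by apply: KU; rewrite distrC ltW.
  - by move=> x /rs/rVballP xq; apply: zmin; apply/mem_set; rewrite /K/= distrC ltW.
have grE i : (f z - y0) * pd i f z + (g z - y1) * pd i g z = 0.
  apply: (@mulfI _ 2); first by rewrite pnatr_eq0.
  rewrite mulr0 -(gr i); apply/esym/is_derive_pd; apply: is_derive_eq.
    by rewrite /Phi; der Uz.
  by rewrite /=; ring.
have J' : pd 0 f z * pd 1 g z - pd 0 g z * pd 1 f z != 0.
  by rewrite (mulrC (pd 0 g z)); exact: KJ.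
have [/eqP E0 /eqP E1] := solve2_eq0 J' (etrans (congr2 +%R (mulrC _ _) (mulrC _ _)) (grE 0))
  (etrans (congr2 +%R (mulrC _ _) (mulrC _ _)) (grE 1)).
by split => //; apply/eqP; rewrite -subr_eq0.
Qed.

Definition local_inverse f g q (r : R) (V : set 'rV[R]_2) (G : 'rV[R]_2 -> 'rV[R]_2) :=
  [/\ open V, smooth_on V G,
      forall v, V v -> [/\ ball q r (G v), f (G v) = v 0 0 & g (G v) = v 0 1] &
      forall z, ball q r z -> V (pt (f z) (g z)) /\ G (pt (f z) (g z)) = z].

Theorem inverse_function U f g q : open U -> smooth_on U f -> smooth_on U g ->
  U q -> jac f g q != 0 ->
  exists r V G, [/\ 0 < r, ball q r `<=` U, (forall z, ball q r z -> jac f g z != 0) &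
    local_inverse f g q r V G].
Proof.
move=> oU sf sg Uq J0.
have [r [r0 rU rJ rinj]] := jac_ball oU sf sg Uq J0.
pose V : set 'rV[R]_2 := [set v | exists2 z, ball q r z & f z = v 0 0 /\ g z = v 0 1].
have /choice[G HG] : forall v : 'rV[R]_2, exists z,
    V v -> [/\ ball q r z, f z = v 0 0 & g z = v 0 1].
  move=> v; have [[z zr [fz gz]]|nV] := pselect (V v); first by exists z.
  by exists 0.
have VF z : ball q r z -> V (pt (f z) (g z)).
  by move=> zr; exists z => //; rewrite ptE0 ptE1.
have GF z : ball q r z -> G (pt (f z) (g z)) = z.
  by move=> zr; have [? + +] := HG _ (VF z zr); rewrite ptE0 ptE1; exact: rinj.
have img z s : ball q r z -> 0 < s -> exists2 d, 0 < d &
    forall v, ball (pt (f z) (g z)) d v ->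
    exists x, [/\ ball z s x, ball q r x, f x = v 0 0 & g x = v 0 1].
  move=> zr s0; have [e e0 eB] : exists2 e : R, 0 < e & forall x, ball z e x -> ball q r x.
    by apply: open_ball_sub => //; exact: ball_open.
  pose s' := Num.min s (e / 2).
  have s'0 : 0 < s' by rewrite lt_min s0 divr_gt0.
  have Kr x : `|x - z| <= s' -> ball q r x.
    move=> xz; apply/eB/rVballP; rewrite distrC (le_lt_trans xz)// gt_min.
    by rewrite ltr_pdivrMr// ltr_pMr// ltr1n orbT.
  have [|||d d0 H] := open_image_ball (q := z) (s := s') oU sf sg s'0.
  - by move=> x /Kr/rU.
  - by move=> x /Kr/rJ.
  - by move=> x /Kr xr; exact: rinj.
  exists d => // v /rVballP vd.
  have h i : `|pt (f z) (g z) 0 i - v 0 i| < d.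
    by apply: le_lt_trans vd; have := rV_norm_ge (pt (f z) (g z) - v) i; rewrite !mxE.
  have [||x [xs fx gx]] := H (v 0 0) (v 0 1).
  - by have := h 0; rewrite ptE0 distrC.
  - by have := h 1; rewrite ptE1 distrC.
  exists x; split => //.
    by apply: le_ball xs; rewrite ge_min lexx.
  by apply: Kr; have /rVballP := xs; rewrite distrC => /ltW.
have vE v : V v -> v = pt (f (G v)) (g (G v)).
  by move=> /HG[_ -> ->]; exact: ptE.
have oV : open V.
  rewrite openE => v Vv; have [Gr _ _] := HG v Vv.
  have [d d0 H] := img (G v) 1 Gr ltr01.
  apply/nbhs_ballP; exists d => //= w; rewrite [in ball v](vE v Vv) => /H.
  by move=> [x [_ xr fx gx]]; exists x.
have cG v : V v -> {for v, continuous G}.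
  move=> Vv; apply/continuous_epsP => e e0; have [Gr _ _] := HG v Vv.
  have [d d0 H] := img (G v) e Gr e0.
  exists d => // w; rewrite [in ball v](vE v Vv) => /H[x [xe xr fx gx]].
  have -> : w = pt (f x) (g x) by rewrite fx gx -ptE.
  by rewrite GF//; exact/rVballP.
exists r, V, G; split => //; split => //; last first.
  by move=> z zr; split; [exact: VF|exact: GF].
apply: (smooth_inverse oU oV sf sg) => //.
- by move=> v /HG[/rU].
- by move=> v /HG[/rJ].
- apply: (@smooth_ext _ _ V (fun v => v 0 0)) => //; last by smooth.
  by move=> v /HG[].
- apply: (@smooth_ext _ _ V (fun v => v 0 1)) => //; last by smooth.
  by move=> v /HG[].
Qed.

Lemma segment_continuous (V : normedModType R) (p v : V) :
  continuous (fun t : R => p + t *: v).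
Proof.
by move=> t; apply: cvgD; [exact: cvg_cst|apply: cvgZr_tmp; exact: cvg_id].
Qed.

(** A ball is the union of its radii, which are connected and share the centre. *)
Lemma connected_ball p (r : R) : connected (ball p r).
Proof.
have [r0|r0] := leP r 0.
  rewrite (_ : ball p r = set0); first exact: connected0.
  rewrite -subset0 => z /rVballP pz.
  by have := le_lt_trans (normr_ge0 _) (lt_le_trans pz r0); rewrite ltxx.
pose seg (z : 'rV[R]_2) := (fun t : R => p + t *: (z - p)) @` `[0, 1].
rewrite (_ : ball p r = \bigcup_(z in ball p r) seg z); last first.
  apply/seteqP; split => [z pz|z [x /rVballP px [t]]].
    exists z => //; exists 1; last by rewrite scale1r addrC subrK.
    by rewrite /= in_itv/= ler01 lexx.
  rewrite /= in_itv/= => /andP[t0 t1] <-; apply/rVballP.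
  rewrite opprD addNKr normrN normrZ ger0_norm//.
  by rewrite distrC in px; apply: le_lt_trans px; exact: ler_piMl.
apply: bigcup_connected.
  exists p => z pz; exists 0; last by rewrite scale0r addr0.
  by rewrite /= in_itv/= ler01 lexx.
move=> z pz; apply: connected_continuous_connected.
  by apply/connected_intervalP; exact: interval_is_interval.
apply: continuous_subspaceT => t.
exact: segment_continuous.
Qed.

Lemma ball_clopen p (r : R) (A : set 'rV[R]_2) : open A -> A `<=` ball p r ->
  A !=set0 -> (forall z, ball p r z -> (forall e, 0 < e -> exists2 x,
      ball z e x & A x) -> A z) ->
  A = ball p r.
Proof.
move=> oA AB A0 cA; apply: (connected_ball (p := p) (r := r)) => //.
  by exists A => //; apply/esym/setIidPr.
exists (closure A); first exact: closed_closure.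
apply/seteqP; split => [z Az|z [zB Az]].
  by split; [exact: AB|exact: subset_closure].
apply: cA => // e e0; have [x [Ax xe]] := Az _ (nbhsx_ballx z e e0).
by exists x.
Qed.

End Inverse.

(** * The Poincare lemma *)

Section Poincare.
Variable R : realType.
Implicit Types (f g : 'rV[R]_2 -> R) (p q : 'rV[R]_2) (U : set 'rV[R]_2).

Lemma MVT_R (F dF : R -> R) (a b : R) :
  (forall t, `|t - a| <= `|b - a| -> `|t - b| <= `|b - a| -> is_derive t 1 F (dF t)) ->
  exists2 t, `|t - a| <= `|b - a| /\ `|t - b| <= `|b - a| &
    F b - F a = dF t * (b - a).
Proof.
move=> hF; have [|t [ta tb]] := @MVT_line R _ F a 1 (b - a).
  move=> t ta tb; rewrite [t *: 1]mulr1.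
  have [] // := hF (a + t); first by rewrite addrC_addKr.
  by rewrite (_ : a + t - b = t - (b - a))//; ring.
rewrite [(b - a) *: 1]mulr1 [t *: 1]mulr1 addr_subK => E.
have h1 : `|a + t - a| <= `|b - a| by rewrite addrC_addKr.
have h2 : `|a + t - b| <= `|b - a|.
  by rewrite (_ : a + t - b = t - (b - a))//; ring.
exists (a + t) => //; rewrite E; congr (_ * _).
by have [] := hF _ h1 h2.
Qed.

(** The integral from c - r, shifted so as to vanish at c. Continuity is assumed on the closed
    interval, where integrability is needed, and differentiability is obtained on the open one. *)
Lemma antiderivative (f : R -> R) (c r : R) :
  (forall x, `|x - c| <= r -> {for x, continuous f}) ->
  exists2 F : R -> R, F c = 0 & forall x, `|x - c| < r -> is_derive x 1 F (f x).
Proof.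
move=> cf.
have [r0|r0] := leP r 0.
  exists (fun=> 0) => // x xr; have := le_lt_trans (normr_ge0 _) (lt_le_trans xr r0).
  by rewrite ltxx.
pose mu := @lebesgue_measure R.
pose F x := (\int[mu]_(t in `[c - r, x]) f t)%R.
have fi : mu.-integrable `[c - r, c + r] (EFin \o f).
  apply: continuous_compact_integrable; first exact: segment_compact.
  apply: continuous_in_subspaceT => x /set_mem; rewrite /= in_itv/= => /andP[? ?].
  by apply: cf; rewrite ler_norml; lra.
exists (fun x => F x - F c); first by rewrite subrr.
move=> x; rewrite ltr_norml => /andP[h1 h2].
have [|||dF EF] := @continuous_FTC1_closed R f (c - r) x (c + r) _ fi.
- by lra.
- by lra.
- by apply: cf; rewrite ler_norml; lra.
have hF : is_derive x 1 F (f x) := DeriveDef dF (etrans (esym (derive1E F x)) EF).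
by apply: is_derive_eq (is_dD hF (is_dC x 1 (- F c))) _; rewrite addr0.
Qed.

Lemma est_mul (h A t b C r : R) : `|A| <= C -> `|t| <= `|h| -> `|b| <= r ->
  `|h * (A * t) * b| <= C * r * h ^+ 2.
Proof.
move=> AC th br; rewrite -(real_normK (num_real h)) !normrM.
have -> : C * r * `|h| ^+ 2 = `|h| * (C * `|h|) * r by ring.
by rewrite ler_pM ?mulr_ge0// ler_wpM2l// ler_pM.
Qed.

(** The potential integrates P along the horizontal line through q and then Q along the vertical
    one. Its vertical derivative is immediate; the horizontal one would need differentiation under
    the integral, replaced here by an estimate of second order in the increment. *)
Lemma poincare U (P Q : 'rV[R]_2 -> R) q : open U -> smooth_on U P -> smooth_on U Q -> U q ->
  (forall z, U z -> pd 1 P z = pd 0 Q z) ->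
  exists r s, [/\ 0 < r, ball q r `<=` U, smooth_on (ball q r) s,
    forall z, ball q r z -> pd 0 s z = P z &
    forall z, ball q r z -> pd 1 s z = Q z].
Proof.
move=> oU sP sQ Uq PQ.
pose Q2 := pd 0 (pd 0 Q).
have sQ2 : smooth_on U Q2 by rewrite /Q2; smooth.
have [r0 r00 r0U] := open_ball_sub oU Uq.
have /continuous_epsP/(_ 1 ltr01)[r1 r10 r1C] := smooth_continuous sQ2 Uq.
pose C := `|Q2 q| + 1.
(* The half leaves room for the closed square of half side r, on which the primitives and the bound
   [C] on the second derivative of Q are needed. *)
pose r := Num.min r0 r1 / 2.
have r_0 : 0 < r by rewrite divr_gt0// lt_min r00.
have rr0 : r < r0 by rewrite ltr_pdivrMr// gt_min; apply/orP; left; lra.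
have rr1 : r < r1 by rewrite ltr_pdivrMr// gt_min; apply/orP; right; lra.
have rU x y : `|x - q 0 0| <= r -> `|y - q 0 1| <= r -> U (pt x y).
  move=> hx hy; apply/r0U/rVballP/rV_norm_lt => // i; rewrite !mxE distrC.
  by have [->|->] := ord2 i => /=; exact: le_lt_trans rr0.
have rC x y : `|x - q 0 0| <= r -> `|y - q 0 1| <= r -> `|Q2 (pt x y)| <= C.
  move=> hx hy; rewrite /C -lerBlDl; apply: le_trans (lerB_dist _ _) _.
  rewrite distrC ltW//; apply/r1C/rVballP/rV_norm_lt => // i; rewrite !mxE distrC.
  by have [->|->] := ord2 i => /=; exact: le_lt_trans rr1.
have lineE x y t : pt x y + t *: e_ 0 = pt (x + t) y.
  by apply: rV2P; rewrite !mxE /= ?mulr1 ?mulr0 ?addr0.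
have lineE1 x y t : pt x y + t *: e_ 1 = pt x (y + t).
  by apply: rV2P; rewrite !mxE /= ?mulr1 ?mulr0 ?addr0.
have d1 (f : 'rV[R]_2 -> R) x y : smooth_on U f -> U (pt x y) ->
    is_derive y 1 (fun t => f (pt x t)) (pd 1 f (pt x y)).
  move=> sf Uxy; have := smooth_is_derive 1 sf Uxy => /is_derive1P H.
  apply/is_derive1P; move: H; congr is_derive; apply/funext => t.
  by rewrite addrC lineE1 [t *: 1]mulr1 addrC.
have d0 (f : 'rV[R]_2 -> R) x y : smooth_on U f -> U (pt x y) ->
    is_derive x 1 (fun t => f (pt t y)) (pd 0 f (pt x y)).
  move=> sf Uxy; have := smooth_is_derive 0 sf Uxy => /is_derive1P H.
  apply/is_derive1P; move: H; congr is_derive; apply/funext => t.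
  by rewrite addrC lineE [t *: 1]mulr1 addrC.
have c1 (f : R -> R) (x d : R) : is_derive x 1 f d -> {for x, continuous f}.
  by move=> [df _]; exact/differentiable_continuous/derivable1_diffP.
have qr1 : `|q 0 1 - q 0 1| <= r by rewrite subrr normr0 ltW.
have [S1 _ dS1] := @antiderivative (fun x => P (pt x (q 0 1))) (q 0 0) r
  (fun x hx => c1 _ _ _ (d0 P x _ sP (rU _ _ hx qr1))).
have /choice[S2 HS2] : forall x, exists F : R -> R, `|x - q 0 0| <= r -> F (q 0 1) = 0 /\
    forall y, `|y - q 0 1| < r -> is_derive y 1 F (Q (pt x y)).
  move=> x; have [hx|hx] := pselect (`|x - q 0 0| <= r); last by exists (fun=> 0).
  have [F F0 dF] := @antiderivative (fun y => Q (pt x y)) (q 0 1) r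
    (fun y hy => c1 _ _ _ (d1 Q _ _ sQ (rU _ _ hx hy))).
  by exists F.
pose s (z : 'rV[R]_2) : R := S1 (z 0 0) + S2 (z 0 0) (z 0 1).
have key x y : `|x - q 0 0| < r -> `|y - q 0 1| < r ->
    is_derive x 1 (fun x => S2 x y) (P (pt x y) - P (pt x (q 0 1))).
  move=> hx hy; set L := P (pt x y) - _.
  have [h0 h00 hB] : exists2 h0 : R, 0 < h0 & forall h, `|h| < h0 -> `|x + h - q 0 0| <= r.
    exists (r - `|x - q 0 0|); first by rewrite subr_gt0.
    move=> h hh; rewrite addrAC (le_trans (ler_normD _ _))//.
    by rewrite -lerBrDl ltW.
  have est h : `|h| < h0 -> `|S2 (x + h) y - S2 x y - h * L| <= C * r * h ^+ 2.
    move=> hh; have hxh := hB h hh.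
    have [S20 dS2] := HS2 x (ltW hx); have [S2h0 dS2h] := HS2 (x + h) hxh.
    (* [D] vanishes at [e = q 0 1], and its derivative in e is the first-order Taylor remainder of Q
       in h, because P and Q satisfy the closedness relation. That remainder is O(h^2) uniformly in
       e, hence so is [D y]. *)
    pose D e := S2 (x + h) e - S2 x e - h * (P (pt x e) - P (pt x (q 0 1))).
    have between e : `|e - q 0 1| <= `|y - q 0 1| -> `|e - q 0 1| < r.
      by move=> he; exact: le_lt_trans hy.
    have dD e : `|e - q 0 1| <= `|y - q 0 1| ->
        is_derive e 1 D (Q (pt (x + h) e) - Q (pt x e) - h * pd 0 Q (pt x e)).
      move=> /between he.
      have Uxe : U (pt x e) by apply: rU; exact: ltW.
      have hP := d1 P x e sP Uxe.
      apply: is_derive_eq (is_dD (is_dD (dS2h e he) (is_dN (dS2 e he)))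
        (is_dN (is_dM (is_dC e 1 h) (is_dD hP (is_dC e 1 (- P (pt x (q 0 1)))))))) _.
      by rewrite addr0 mulr0 addr0 PQ.
    have [e [he _]] := @MVT_R D _ (q 0 1) y (fun e h1 _ => dD e h1).
    have -> : D (q 0 1) = 0 by rewrite /D S20 S2h0 !subrr mulr0 subrr.
    rewrite subr0 {1}/D -/L => ->.
    have er := ltW (between e he).
    have [|t [th _]] := @MVT_pd R Q (pt x e) 0 h.
      move=> t th _; rewrite lineE; apply: smooth_derivable sQ _; apply: rU => //.
      by apply: hB; exact: le_lt_trans hh.
    rewrite !lineE => ->.
    have [|t' [th' _]] := @MVT_pd R (pd 0 Q) (pt x e) 0 t.
      move=> t' th' _; rewrite lineE; apply: smooth_derivable (smooth_pd 0 sQ) _.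
      apply: rU => //; apply: hB; apply: le_lt_trans hh; exact: le_trans th.
    rewrite !lineE -/Q2 => Et.
    have -> : pd 0 Q (pt (x + t) e) * h - h * pd 0 Q (pt x e) =
       h * (Q2 (pt (x + t') e) * t) by rewrite -Et; ring.
    apply: (est_mul _ th (ltW hy)).
    by apply: rC => //; apply: hB; apply: le_lt_trans hh; exact: le_trans th.
  have L0 : h^-1 * (S2 (x + h) y - S2 x y) @[h --> (0 : R)^'] --> L.
    apply/cvgrPdist_le => e e0.
    pose d := Num.min h0 (e / (C * r + 1)).
    have C0 : 0 <= C by rewrite addr_ge0.
    have Cr1 : 0 < C * r + 1 by rewrite ltr_wpDl// mulr_ge0// ltW.
    have d_0 : 0 < d by rewrite lt_min h00 divr_gt0.
    near=> h.
    have hn0 : h != 0 by near: h; exact: nbhs_dnbhs_neq.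
    have hd : `|h| < d by near: h; exact: dnbhs0_lt.
    have hh0 : `|h| < h0 by move: hd; rewrite lt_min => /andP[].
    have he : `|h| * (C * r + 1) <= e.
      by move: hd; rewrite lt_min ltr_pdivlMr// => /andP[_ /ltW].
    rewrite distrC (_ : h^-1 * _ - L = h^-1 * (S2 (x + h) y - S2 x y - h * L)); last by field.
    rewrite normrM normfV -(ler_pM2l (x := `|h|)) ?normr_gt0// mulrA mulfV ?normr_eq0// mul1r.
    apply: le_trans (est h hh0) _; rewrite -real_normK ?num_real// expr2.
    rewrite mulrCA ler_wpM2l// mulrC; apply: le_trans he.
    by rewrite ler_wpM2l// lerDl.
  have E : (fun h => h^-1 *: (((fun x => S2 x y) \o shift x) (h *: (1 : R)) - S2 x y)) =
      (fun h : R => h^-1 * (S2 (x + h) y - S2 x y)).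
    by apply/funext => h; rewrite /= [h *: 1]mulr1 (addrC h).
  apply: DeriveDef; first by apply/cvg_ex; exists L; rewrite E.
  by rewrite /derive E; exact: cvg_lim L0.
have sq z : ball q r z -> `|z 0 0 - q 0 0| < r /\ `|z 0 1 - q 0 1| < r.
  move=> /rVballP zq; split; rewrite distrC; apply: le_lt_trans zq;
    by [have := rV_norm_ge (q - z) 0; rewrite !mxE|
        have := rV_norm_ge (q - z) 1; rewrite !mxE].
have ds0 z : ball q r z -> is_derive z (e_ 0) s (P z).
  move=> /sq[h0 h1]; apply/is_derive1P.
  have -> : (fun h : R => s (h *: e_ 0 + z)) =
      (fun h => S1 (z 0 0 + h) + S2 (z 0 0 + h) (z 0 1)).
    apply/funext => h; rewrite addrC /s; congr (S1 _ + S2 _ _);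
    by rewrite !mxE /= ?mulr1 ?mulr0 ?addr0.
  have sh (f : R -> R) (x d : R) : is_derive x 1 f d -> is_derive (0 : R) 1 (fun h => f
      (x + h)) d.
    move=> /is_derive1P; congr is_derive; apply/funext => h.
    by rewrite [h *: 1]mulr1 addrC.
  apply: is_derive_eq (is_dD (sh _ _ _ (dS1 _ h0)) (sh _ _ _ (key _ _ h0 h1))) _.
  by rewrite addr_subK -ptE.
have ds1 z : ball q r z -> is_derive z (e_ 1) s (Q z).
  move=> /sq[h0 h1]; apply/is_derive1P.
  have -> : (fun h : R => s (h *: e_ 1 + z)) =
      (fun h => S1 (z 0 0) + S2 (z 0 0) (z 0 1 + h)).
    apply/funext => h; rewrite addrC /s; congr (S1 _ + S2 _ _);
    by rewrite !mxE /= ?mulr1 ?mulr0 ?addr0.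
  have sh (f : R -> R) (x d : R) : is_derive x 1 f d -> is_derive (0 : R) 1 (fun h => f
      (x + h)) d.
    move=> /is_derive1P; congr is_derive; apply/funext => h.
    by rewrite [h *: 1]mulr1 addrC.
  have [_ dS] := HS2 _ (ltW h0).
  apply: is_derive_eq (is_dD (is_dC (0 : R) 1 (S1 (z 0 0))) (sh _ _ _ (dS _ h1))) _.
  by rewrite add0r -ptE.
have bU : ball q r `<=` U.
  by move=> z /sq[? ?]; rewrite (ptE z); apply: rU; exact: ltW.
exists r, s; split => //.
- have oB : open (ball q r) by exact: ball_open.
  have ds z i : ball q r z -> is_derive z (e_ i) s (if i == 0 then P z else Q z).
    by have [->|->] := ord2 i => zr; [exact: ds0|exact: ds1].
  have sm i n : Cn n (ball q r) (fun z => if i == 0 :> 'I_2 then P z else Q z).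
    by have [->|->] := ord2 i; apply: Cn_subset bU _; [exact: sP|exact: sQ].
  have Sn n : Cn n.+1 (ball q r) s.
    exact: (CnS_from (df := fun (i : 'I_2) z => if i == 0 then P z else Q z)).
  by case=> [|n]; [exact: Cn_S|].
- by move=> z /ds0/is_derive_pd.
- by move=> z /ds1/is_derive_pd.
Unshelve. all: by end_near. Qed.

End Poincare.

(** * Fundamental forms *)

Section Vectors.
Variable R : realType.
Implicit Types u v w a b : 'rV[R]_3.

Lemma ord3 (i : 'I_3) : [\/ i = 0, i = 1 | i = 2].
Proof.
by case: i => [[|[|[|//]]]] ?; [apply: Or31|apply: Or32|apply: Or33]; apply/val_inj.
Qed.

Lemma rV3P u v : u 0 0 = v 0 0 -> u 0 1 = v 0 1 -> u 0 2 = v 0 2 -> u = v.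
Proof. by move=> h0 h1 h2; apply/rowP => i; have [->|->|->] := ord3 i. Qed.

Lemma vec30 (a b c : R) : vec3 a b c 0 0 = a. Proof. by rewrite mxE. Qed.
Lemma vec31 (a b c : R) : vec3 a b c 0 1 = b. Proof. by rewrite mxE. Qed.
Lemma vec32 (a b c : R) : vec3 a b c 0 2 = c. Proof. by rewrite mxE. Qed.
Definition vec3E := (vec30, vec31, vec32).

Lemma dot3E u v : dot u v = u 0 0 * v 0 0 + u 0 1 * v 0 1 + u 0 2 * v 0 2.
Proof.
rewrite /dot !big_ord_recl big_ord0 addr0 addrA.
by congr (_ * _ + _ * _ + _ * _); congr (_ _ _); apply/val_inj.
Qed.

Lemma cross0E u v : cross u v 0 0 = u 0 1 * v 0 2 - u 0 2 * v 0 1.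
Proof. by rewrite vec3E. Qed.
Lemma cross1E u v : cross u v 0 1 = u 0 2 * v 0 0 - u 0 0 * v 0 2.
Proof. by rewrite vec3E. Qed.
Lemma cross2E u v : cross u v 0 2 = u 0 0 * v 0 1 - u 0 1 * v 0 0.
Proof. by rewrite vec3E. Qed.
Definition crossE := (cross0E, cross1E, cross2E).

Lemma rv_addE n (u v : 'rV[R]_n) i : (u + v) 0 i = u 0 i + v 0 i.
Proof. by rewrite mxE. Qed.
Lemma rv_scaleE n (c : R) (u : 'rV[R]_n) i : (c *: u) 0 i = c * u 0 i.
Proof. by rewrite mxE. Qed.
Lemma rv_oppE n (u : 'rV[R]_n) i : (- u) 0 i = - u 0 i.
Proof. by rewrite mxE. Qed.
Definition rvE := (rv_addE, rv_scaleE, rv_oppE).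

Lemma dotDl n (u v w : 'rV[R]_n) : dot (u + v) w = dot u w + dot v w.
Proof. by rewrite /dot -big_split/=; apply: eq_bigr => i _; rewrite mxE mulrDl. Qed.
Lemma dotDr n (u v w : 'rV[R]_n) : dot w (u + v) = dot w u + dot w v.
Proof. by rewrite dotC dotDl !(dotC w). Qed.
Lemma dotZr n c (u v : 'rV[R]_n) : dot u (c *: v) = c * dot u v.
Proof. by rewrite dotC dotZl dotC. Qed.
Lemma dotNl n (u v : 'rV[R]_n) : dot (- u) v = - dot u v.
Proof. by rewrite -scaleN1r dotZl mulN1r. Qed.
Lemma dotNr n (u v : 'rV[R]_n) : dot u (- v) = - dot u v.
Proof. by rewrite dotC dotNl dotC. Qed.
Lemma dot0l n (u : 'rV[R]_n) : dot 0 u = 0.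
Proof. by rewrite /dot big1// => i _; rewrite mxE mul0r. Qed.
Lemma dot0r n (u : 'rV[R]_n) : dot u 0 = 0.
Proof. by rewrite dotC dot0l. Qed.

Lemma cross_dot u v a b :
  dot (cross u v) (cross a b) = dot u a * dot v b - dot u b * dot v a.
Proof. by rewrite !dot3E !crossE; ring. Qed.
Lemma dot_crossl u v : dot (cross u v) u = 0.
Proof. by rewrite dot3E !crossE; ring. Qed.
Lemma dot_crossr u v : dot (cross u v) v = 0.
Proof. by rewrite dot3E !crossE; ring. Qed.
Lemma crossZl c u v : cross (c *: u) v = c *: cross u v.
Proof. by apply: rV3P; rewrite !(crossE, rvE); ring. Qed.
Lemma crossZr c u v : cross u (c *: v) = c *: cross u v.
Proof. by apply: rV3P; rewrite !(crossE, rvE); ring. Qed.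
Lemma crossC u v : cross u v = - cross v u.
Proof. by apply: rV3P; rewrite !(crossE, rvE); ring. Qed.
Lemma cross_lin2 (a b c d : R) u v :
  cross (a *: u + b *: v) (c *: u + d *: v) = (a * d - b * c) *: cross u v.
Proof. by apply: rV3P; rewrite !(crossE, rvE); ring. Qed.
Lemma crossDr u v w : cross w (u + v) = cross w u + cross w v.
Proof. by apply: rV3P; rewrite !(crossE, rvE); ring. Qed.
Lemma cross_cross u v w : cross u (cross v w) = dot u w *: v - dot u v *: w.
Proof. by apply: rV3P; rewrite !(crossE, rvE) !dot3E; ring. Qed.

(** Coordinates of w in the basis u, v, u x v by Cramer's rule, with the Gram determinant cleared
    from the denominator. *)
Lemma cross_basis u v w : dot (cross u v) (cross u v) *: w =
  (dot w u * dot v v - dot w v * dot u v) *: u +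
  (dot w v * dot u u - dot w u * dot u v) *: v + dot w (cross u v) *: cross u v.
Proof. by apply: rV3P; rewrite !rvE !dot3E !crossE; ring. Qed.

Lemma orthonormal_basis u v w : dot u u = 1 -> dot v v = 1 -> dot u v = 0 ->
  w = dot w u *: u + dot w v *: v + dot w (cross u v) *: cross u v.
Proof.
move=> uu vv uv; have := cross_basis u v w.
by rewrite cross_dot uu vv uv dotC uv !mulr0 !mulr1 !subr0 scale1r.
Qed.

End Vectors.

Section Forms.
Variable R : realType.
Implicit Types (y : 'rV[R]_2 -> 'rV[R]_3) (q : 'rV[R]_2).

Lemma sum2E (V : nmodType) (F : 'I_2 -> V) : \sum_(i < 2) F i = F 0 + F 1.
Proof.
rewrite !big_ord_recl big_ord0 addr0.
by congr (F _ + F _); apply/val_inj.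
Qed.

Lemma det22 (A : 'M[R]_2) : \det A = A 0 0 * A 1 1 - A 0 1 * A 1 0.
Proof.
rewrite (expand_det_row _ 0) !big_ord_recl big_ord0 addr0 /cofactor !det_mx11 !mxE /=.
rewrite expr0 mul1r expr1 mulN1r mulrN.
by congr (_ * _ - _ * _); congr (A _ _); apply/val_inj.
Qed.

Lemma invmx22 (A : 'M[R]_2) : \det A != 0 ->
  [/\ invmx A 0 0 = A 1 1 / \det A, invmx A 0 1 = - A 0 1 / \det A,
      invmx A 1 0 = - A 1 0 / \det A & invmx A 1 1 = A 0 0 / \det A].
Proof.
move=> A0; have uA : A \in unitmx by rewrite unitmxE unitfE.
have adj : \adj A = \matrix_(i, j) (if i == j then A (1 - i) (1 - j) else - A i j).
  apply/matrixP => i j; rewrite !mxE /cofactor det_mx11 !mxE.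
  have [->|->] := ord2 i; have [->|->] := ord2 j => /=.
  - by rewrite expr0 mul1r; congr (A _ _); apply/val_inj.
  - by rewrite expr1 mulN1r; congr (- A _ _); apply/val_inj.
  - by rewrite expr1 mulN1r; congr (- A _ _); apply/val_inj.
  - by rewrite sqrrN expr1n mul1r; congr (A _ _); apply/val_inj.
rewrite /invmx uA adj.
split; rewrite !mxE /= mulrC; congr (_ / _) => //; congr (A _ _); exact/val_inj.
Qed.

Definition gdet y q := dot (pd 0 y q) (pd 0 y q) *
  dot (pd 1 y q) (pd 1 y q) - dot (pd 0 y q) (pd 1 y q) ^+ 2.

Lemma normal_pdE y q : normal y q = cross (pd 0 y q) (pd 1 y q).
Proof. by rewrite /normal !pdE. Qed.

Lemma first_formE y q i j : first_form y q i j = dot (pd i y q) (pd j y q).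
Proof. by rewrite mxE !pdE. Qed.

Lemma gdetE y q : \det (first_form y q) = gdet y q.
Proof. by rewrite det22 !first_formE (dotC (pd 1 y q) (pd 0 y q)) /gdet expr2. Qed.

Lemma gdet_normal y q : gdet y q = dot (normal y q) (normal y q).
Proof. by rewrite normal_pdE cross_dot (dotC (pd 1 y q) (pd 0 y q)) /gdet expr2. Qed.

Lemma gdet_gt0 y q : normal y q != 0 -> 0 < gdet y q.
Proof. by move=> n0; rewrite gdet_normal lt_def dot_eq0 n0 dot_ge0. Qed.

Definition hform y i j q := dot (pd i (pd j y) q) (unit_normal y q).

Lemma second_formE y q i j : second_form y q i j = hform y i j q.
Proof. by rewrite mxE /hform !pdE. Qed.

Lemma mean_curvatureE y q : normal y q != 0 -> mean_curvature y q =
  (dot (pd 1 y q) (pd 1 y q) * hform y 0 0 q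
   - dot (pd 0 y q) (pd 1 y q) * (hform y 0 1 q + hform y 1 0 q)
   + dot (pd 0 y q) (pd 0 y q) * hform y 1 1 q) / (2 * gdet y q).
Proof.
move=> n0; have d0 := gdet_gt0 n0.
have [|i00 i01 i10 i11] := @invmx22 (first_form y q).
  by rewrite gdetE gt_eqF.
rewrite /mean_curvature /mean_curvature_vector dotZl.
have -> : \sum_(i < 2) \sum_(j < 2) invmx (first_form y q) i j *:
    vector_second_form y q i j = (\sum_(i < 2) \sum_(j < 2)
     invmx (first_form y q) i j * hform y i j q) *: unit_normal y q.
  rewrite scaler_suml; apply: eq_bigr => i _; rewrite scaler_suml.
  by apply: eq_bigr => j _; rewrite /vector_second_form second_formE scalerA.
rewrite dotZl unit_normal1// mulr1 !sum2E.
rewrite i00 i01 i10 i11 !first_formE gdetE (dotC (pd 1 y q) (pd 0 y q)).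
move: d0; move: (gdet y q) (dot _ _) (dot _ _) (dot _ _) (hform _ _ _ _) (hform _ _ _ _)
    (hform _ _ _ _) (hform _ _ _ _).
move=> D a b c h1 h2 h3 h4 D0; field.
by rewrite gt_eqF.
Qed.

(** [lapW0] and [lapW1] are the components of sqrt(g) grad f, for g the determinant of the metric.
    For a 2 by 2 matrix, sqrt(g) times the inverse is the adjugate divided by sqrt(g). *)
Definition lapW0 y (f : 'rV[R]_2 -> R) q :=
  (dot (pd 1 y q) (pd 1 y q) * pd 0 f q -
   dot (pd 0 y q) (pd 1 y q) * pd 1 f q) / Num.sqrt (gdet y q).
Definition lapW1 y (f : 'rV[R]_2 -> R) q :=
  (dot (pd 0 y q) (pd 0 y q) * pd 1 f q -
   dot (pd 0 y q) (pd 1 y q) * pd 0 f q) / Num.sqrt (gdet y q).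

Lemma laplacianE U y f q : open U -> (forall z, U z -> normal y z != 0) -> U q ->
  laplacian y f q = (Num.sqrt (gdet y q))^-1 *
    (pd 0 (lapW0 y f) q + pd 1 (lapW1 y f) q).
Proof.
move=> oU n0 Uq; rewrite /laplacian gdetE; congr (_ * _).
rewrite sum2E.
have key z : U z -> let s := Num.sqrt (gdet y z) in s != 0 /\ s ^+ 2 = gdet y z.
  move=> Uz s; have d0 := gdet_gt0 (n0 z Uz).
  by rewrite /s gt_eqF ?sqrtr_gt0//= sqr_sqrtr// ltW.
congr (_ + _); rewrite pdE; apply: (@partial_ext R _ U oU _ _ _ q Uq) => z Uz;
  rewrite sum2E;
  rewrite gdetE -?pdE;
  (have [|i00 i01 i10 i11] := @invmx22 (first_form y z);
    first by rewrite gdetE gt_eqF// gdet_gt0// n0);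
  have [s0 sE] := key z Uz; move: s0 sE.
  rewrite i00 i01 !first_formE gdetE /lapW0.
  move: (Num.sqrt (gdet y z)) => s; move: (gdet y z) (dot (pd 0 y z) (pd 1 y z))
    (dot (pd 1 y z) (pd 1 y z)) (pd 0 f z) (pd 1 f z).
  by move=> D a b c d s0 <-; field.
rewrite i10 i11 !first_formE gdetE /lapW1 (dotC (pd 1 y z) (pd 0 y z)).
move: (Num.sqrt (gdet y z)) => s; move: (gdet y z) (dot (pd 0 y z) (pd 1 y z))
  (dot (pd 0 y z) (pd 0 y z)) (pd 0 f z) (pd 1 f z).
by move=> D a b c d s0 <-; field.
Qed.

End Forms.

Section SmoothForms.
Variable R : realType.
Implicit Types (f g : 'rV[R]_2 -> R) (p q : 'rV[R]_2) (U : set 'rV[R]_2).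

Lemma smooth_cross U (a b : 'rV[R]_2 -> 'rV[R]_3) : open U ->
  smooth_on U a -> smooth_on U b -> smooth_on U (fun z => cross (a z) (b z)).
Proof.
move=> oU sa sb; apply/(smooth_mx oU) => i.
have [->|->|->] := ord3 i.
- apply: (@smooth_ext _ _ U (fun z => a z 0 1 * b z 0 2 - a z 0 2 * b z 0 1)) => //.
    by move=> z _; rewrite crossE.
  by smooth.
- apply: (@smooth_ext _ _ U (fun z => a z 0 2 * b z 0 0 - a z 0 0 * b z 0 2)) => //.
    by move=> z _; rewrite crossE.
  by smooth.
- apply: (@smooth_ext _ _ U (fun z => a z 0 0 * b z 0 1 - a z 0 1 * b z 0 0)) => //.
    by move=> z _; rewrite crossE.
  by smooth.
Qed.

Variables (U : set 'rV[R]_2) (y : 'rV[R]_2 -> 'rV[R]_3).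
Hypotheses (oU : open U) (sy : smooth_on U y) (n0 : forall q, U q -> normal y q != 0).

Lemma smooth_normal : smooth_on U (normal y).
Proof.
apply: (@smooth_ext _ _ U (fun z => cross (pd 0 y z) (pd 1 y z))) => //.
  by move=> z _; rewrite normal_pdE.
by apply: smooth_cross => //; smooth.
Qed.

Lemma smooth_gdet : smooth_on U (gdet y).
Proof. by rewrite /gdet; smooth. Qed.

Lemma smooth_unit_normal : smooth_on U (unit_normal y).
Proof.
have sn := smooth_normal; rewrite /unit_normal; smooth.
  by move=> q Uq; rewrite -gdet_normal gdet_gt0// n0.
by move=> q Uq; rewrite gt_eqF// sqrtr_gt0 -gdet_normal gdet_gt0// n0.
Qed.

Lemma smooth_hform i j : smooth_on U (hform y i j).
Proof. by have sn := smooth_unit_normal; rewrite /hform; smooth. Qed.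

Lemma smooth_mean_curvature : smooth_on U (mean_curvature y).
Proof.
have sh i j := smooth_hform i j; have sg := smooth_gdet.
apply: (@smooth_ext _ _ U (fun q =>
 (dot (pd 1 y q) (pd 1 y q) * hform y 0 0 q
   - dot (pd 0 y q) (pd 1 y q) * (hform y 0 1 q + hform y 1 0 q)
   + dot (pd 0 y q) (pd 0 y q) * hform y 1 1 q) / (2 * gdet y q))) => //.
  by move=> z Uz; rewrite -mean_curvatureE// n0.
smooth; try exact: sh.
by move=> q Uq; rewrite mulf_neq0// gt_eqF// gdet_gt0// n0.
Qed.

Lemma smooth_lapW f : smooth_on U f ->
  smooth_on U (lapW0 y f) /\ smooth_on U (lapW1 y f).
Proof.
have sg := smooth_gdet; have g0 q : U q -> 0 < gdet y q by move=> /n0/gdet_gt0.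
move=> sf; rewrite /lapW0 /lapW1; split; smooth => // q Uq; by rewrite ?gt_eqF ?sqrtr_gt0 ?g0.
Qed.

End SmoothForms.

(** * Invariance of the mean curvature and of its Laplacian under changes of parameters *)

Section Reparametrization.
Variables (R : realType) (U U' : set 'rV[R]_2) (t : 'rV[R]_2 -> 'rV[R]_2).
Hypotheses (oU : open U) (oU' : open U').
Hypotheses (tU : forall z, U z -> U' (t z)) (st : smooth_on U t).

Notation t0 := (fun z : 'rV[R]_2 => t z 0 0).
Notation t1 := (fun z : 'rV[R]_2 => t z 0 1).

Lemma pd_comp_is_derive (f : 'rV[R]_2 -> R) i z : smooth_on U' f -> U z ->
  is_derive z (e_ i) (fun x => f (t x))
    (pd 0 f (t z) * pd i t0 z + pd 1 f (t z) * pd i t1 z).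
Proof.
move=> sf Uz; have [r r0 rU] := open_ball_sub oU' (tU Uz).
have ht := smooth_is_derive i st Uz.
have /is_derive_mx hti := ht.
rewrite (is_derive_pd (hti 0)) (is_derive_pd (hti 1)) !(pdE _ f).
apply: (is_derive_chain r0) => //.
- by move=> x /rU Ux j; exact: smooth_derivable Ux.
- by move=> j; rewrite -pdE; apply: smooth_continuous (smooth_pd j sf) _; exact: tU.
Qed.

Lemma pd_vcomp_is_derive n (f : 'rV[R]_2 -> 'rV[R]_n) i z : smooth_on U' f -> U z ->
  is_derive z (e_ i) (fun x => f (t x))
    (pd i t0 z *: pd 0 f (t z) + pd i t1 z *: pd 1 f (t z)).
Proof.
move=> sf Uz; apply/is_derive_mx => k; rewrite !rvE.
have sfk : smooth_on U' (fun x => f x 0 k) by smooth.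
apply: is_derive_eq (pd_comp_is_derive i sfk Uz) _.
have h j := is_derive_pd (is_dcoord k (smooth_is_derive j sf (tU Uz))).
by rewrite !h mulrC [X in _ + X]mulrC.
Qed.

Variables (y y' : 'rV[R]_2 -> 'rV[R]_3) (s : R).
Hypotheses (sy' : smooth_on U' y') (n0' : forall z, U' z -> normal y' z != 0).
Hypotheses (yt : forall z, U z -> y z = y' (t z)).
Hypotheses (s2 : s * s = 1) (sJ : forall z, U z -> 0 < s * jac t0 t1 z).

Lemma reparam_pd i z : U z ->
  pd i y z = pd i t0 z *: pd 0 y' (t z) + pd i t1 z *: pd 1 y' (t z).
Proof.
move=> Uz; rewrite (pd_ext i oU Uz yt).
exact: is_derive_pd (pd_vcomp_is_derive i sy' Uz).
Qed.

Lemma reparam_normal z : U z -> normal y z = jac t0 t1 z *: normal y' (t z).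
Proof.
move=> Uz; rewrite !normal_pdE !reparam_pd// cross_lin2; congr (_ *: _).
by rewrite /jac (mulrC (pd 1 t0 z)).
Qed.

Let sJn z : U z -> Num.sqrt (jac t0 t1 z ^+ 2) = s * jac t0 t1 z.
Proof.
by move=> Uz; rewrite -[_ ^+ 2]mul1r -s2 -expr2 -exprMn sqrtr_sqr gtr0_norm// sJ.
Qed.

Let s0 : s != 0.
Proof. by apply/eqP => s0; move: s2; rewrite s0 mul0r => /esym/eqP; rewrite oner_eq0. Qed.

Let sV : s^-1 = s.
Proof. by apply: (mulfI s0); rewrite s2 mulfV. Qed.

Let J0 z : U z -> jac t0 t1 z != 0.
Proof. by move=> /sJ; apply: contraTneq => ->; rewrite mulr0 ltxx. Qed.

Lemma reparam_normal_neq0 z : U z -> normal y z != 0.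
Proof.
by move=> Uz; rewrite reparam_normal// scaler_eq0 negb_or J0// n0'//; exact: tU.
Qed.

(** [s] is the sign of the Jacobian: [s * jac] is its absolute value, the factor by which the length
    of the normal changes. *)
Lemma reparam_unit_normal z : U z -> unit_normal y z = s *: unit_normal y' (t z).
Proof.
move=> Uz; rewrite /unit_normal reparam_normal// dotZl dotZr mulrA -expr2.
rewrite sqrtrM ?sqr_ge0// sJn// !scalerA; congr (_ *: _).
have Jz := J0 Uz.
have : Num.sqrt (dot (normal y' (t z)) (normal y' (t z))) != 0.
  by rewrite gt_eqF// sqrtr_gt0 -gdet_normal gdet_gt0// n0'//; exact: tU.
move: (Num.sqrt _) => N N0; rewrite -{2}sV.
by field; rewrite s0 N0 Jz.
Qed.

Lemma reparam_gdet z : U z -> gdet y z = jac t0 t1 z ^+ 2 * gdet y' (t z).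
Proof.
by move=> Uz; rewrite !gdet_normal reparam_normal// dotZl dotZr mulrA -expr2.
Qed.

(** The second derivatives of [t] only multiply tangent vectors, which the unit normal annihilates;
    the second form is thus a tensor up to the sign of the normal. *)
Lemma reparam_hform i j z : U z -> hform y i j z = s *
  (pd j t0 z * (pd i t0 z * hform y' 0 0 (t z) + pd i t1 z * hform y' 1 0 (t z)) +
   pd j t1 z * (pd i t0 z * hform y' 0 1 (t z) + pd i t1 z * hform y' 1 1 (t z))).
Proof.
move=> Uz; rewrite {1}/hform.
rewrite (pd_ext i oU Uz (reparam_pd j)).
have -> : pd i (fun x => pd j t0 x *: pd 0 y' (t x) + pd j t1 x *: pd 1 y' (t x)) z =
   (pd i (pd j t0) z *: pd 0 y' (t z) + pd j t0 z *:
    (pd i t0 z *: pd 0 (pd 0 y') (t z) + pd i t1 z *: pd 1 (pd 0 y') (t z))) +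
   (pd i (pd j t1) z *: pd 1 y' (t z) + pd j t1 z *:
    (pd i t0 z *: pd 0 (pd 1 y') (t z) + pd i t1 z *: pd 1 (pd 1 y') (t z))).
  apply: is_derive_pd; apply: is_dD; apply: is_dscale;
    (try by apply: smooth_is_derive Uz; smooth);
    by apply: pd_vcomp_is_derive => //; smooth.
rewrite reparam_unit_normal// dotZr; congr (_ * _).
have k0 : dot (pd 0 y' (t z)) (unit_normal y' (t z)) = 0.
  by rewrite /unit_normal dotZr dotC normal_pdE dot_crossl mulr0.
have k1 : dot (pd 1 y' (t z)) (unit_normal y' (t z)) = 0.
  by rewrite /unit_normal dotZr dotC normal_pdE dot_crossr mulr0.
by rewrite !(dotDl, dotZl) k0 k1 !mulr0 !add0r.
Qed.

Lemma reparam_gram i j z : U z -> dot (pd i y z) (pd j y z) =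
  pd i t0 z * pd j t0 z * dot (pd 0 y' (t z)) (pd 0 y' (t z)) +
  (pd i t0 z * pd j t1 z + pd i t1 z * pd j t0 z) * dot (pd 0 y' (t z)) (pd 1 y' (t z)) +
  pd i t1 z * pd j t1 z * dot (pd 1 y' (t z)) (pd 1 y' (t z)).
Proof.
move=> Uz; rewrite !reparam_pd// !(dotDl, dotDr, dotZl, dotZr).
rewrite (dotC (pd 1 y' (t z)) (pd 0 y' (t z))).
move: (dot _ _) (dot (pd 0 y' (t z)) (pd 0 y' (t z))) (dot _ _) => A B C; ring.
Qed.

Lemma reparam_mean_curvature z : U z ->
  mean_curvature y z = s * mean_curvature y' (t z).
Proof.
move=> Uz; rewrite !mean_curvatureE//; [|exact/n0'/tU|exact: reparam_normal_neq0].
rewrite !reparam_hform// !reparam_gram// reparam_gdet//.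
have Jz := J0 Uz; have := gdet_gt0 (n0' (tU Uz)); move: Jz; rewrite /jac.
move: (gdet y' (t z)) (pd 0 t0 z) (pd 1 t0 z) (pd 0 t1 z) (pd 1 t1 z).
move: (dot (pd 0 y' (t z)) (pd 0 y' (t z))) (dot (pd 0 y' (t z)) (pd 1 y' (t z)))
  (dot (pd 1 y' (t z)) (pd 1 y' (t z))).
move: (hform y' 0 0 (t z)) (hform y' 1 0 (t z)) (hform y' 0 1 (t z)) (hform y' 1 1 (t z)).
move=> h1 h2 h3 h4 E F G D a b c d Jz D0; field.
by rewrite (gt_eqF D0) Jz.
Qed.

(** The field sqrt(g) grad f is a density, so it transforms by the cofactors of the Jacobian matrix
    of [t]. The sign in f cancels the sign in the square root of the metric determinant. *)
Lemma reparam_lapW (f f' : 'rV[R]_2 -> R) z : smooth_on U' f' ->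
  (forall z, U z -> f z = s * f' (t z)) -> U z ->
  lapW0 y f z = pd 1 t1 z * lapW0 y' f' (t z) - pd 1 t0 z * lapW1 y' f' (t z) /\
  lapW1 y f z = pd 0 t0 z * lapW1 y' f' (t z) - pd 0 t1 z * lapW0 y' f' (t z).
Proof.
move=> sf' ff' Uz.
have pf i : pd i f z = s * (pd 0 f' (t z) * pd i t0 z + pd 1 f' (t z) * pd i t1 z).
  rewrite (pd_ext i oU Uz ff'); apply: is_derive_pd.
  apply: is_derive_eq (is_dM (is_dC _ _ s) (pd_comp_is_derive i sf' Uz)) _.
  by rewrite mulr0 addr0.
rewrite /lapW0 /lapW1 !reparam_gram// reparam_gdet// sqrtrM ?sqr_ge0// sJn// !pf.
have Jz := J0 Uz; have N0 : Num.sqrt (gdet y' (t z)) != 0.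
  by rewrite gt_eqF// sqrtr_gt0 gdet_gt0// n0'//; exact: tU.
move: Jz N0; rewrite /jac.
move: (Num.sqrt (gdet y' (t z))) (pd 0 t0 z) (pd 1 t0 z) (pd 0 t1 z) (pd 1 t1 z).
move: (dot (pd 0 y' (t z)) (pd 0 y' (t z))) (dot (pd 0 y' (t z)) (pd 1 y' (t z)))
  (dot (pd 1 y' (t z)) (pd 1 y' (t z))) (pd 0 f' (t z)) (pd 1 f' (t z)).
move=> E F G f0 f1 N a b c d Jz N0.
by split; field; rewrite s0 N0 Jz.
Qed.

(** The rows of the cofactor matrix are divergence free by the symmetry of second derivatives, so
    the divergence in [reparam_lapW] is just multiplied by the Jacobian; division by sqrt(g) leaves
    the sign [s]. *)
Lemma reparam_laplacian z : U z ->
  laplacian y (mean_curvature y) z =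
  s * laplacian y' (mean_curvature y') (t z).
Proof.
move=> Uz; have st0 : smooth_on U t0 by smooth.
have st1 : smooth_on U t1 by smooth.
rewrite (laplacianE _ oU)//; last exact: reparam_normal_neq0.
rewrite (laplacianE _ oU')//; last exact: tU.
have sm := smooth_mean_curvature oU' sy' n0'.
have [sW0 sW1] := smooth_lapW oU' sy' n0' sm.
have W := reparam_lapW sm reparam_mean_curvature.
have D i k := smooth_is_derive i (smooth_pd k st0) Uz.
have E i k := smooth_is_derive i (smooth_pd k st1) Uz.
have C0 i := pd_comp_is_derive i sW0 Uz.
have C1 i := pd_comp_is_derive i sW1 Uz.
have d0 := etrans (pd_ext 0 oU Uz (fun x Ux => (W x Ux).1))
  (is_derive_pd (is_dD (is_dM (E 0 1) (C0 0)) (is_dN (is_dM (D 0 1) (C1 0))))).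
have d1 := etrans (pd_ext 1 oU Uz (fun x Ux => (W x Ux).2))
  (is_derive_pd (is_dD (is_dM (D 1 0) (C1 1)) (is_dN (is_dM (E 1 0) (C0 1))))).
rewrite {}d0 {}d1 (reparam_gdet Uz) (sqrtrM _ (sqr_ge0 _)) (sJn Uz) {D E C0 C1 W}.
rewrite (schwarz 0 1 oU st0 Uz) (schwarz 0 1 oU st1 Uz).
have N0 : Num.sqrt (gdet y' (t z)) != 0.
  by rewrite gt_eqF// sqrtr_gt0 gdet_gt0// n0'//; exact: tU.
have Jz := J0 Uz; move: Jz N0; rewrite /jac.
rewrite -{2}sV.
move: (Num.sqrt (gdet y' (t z))) (pd 0 t0 z) (pd 1 t0 z) (pd 0 t1 z) (pd 1 t1 z).
move: (pd 1 (pd 0 t0) z) (pd 1 (pd 0 t1) z).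
move: (lapW0 y' (mean_curvature y') (t z)) (lapW1 y' (mean_curvature y') (t z))
 (pd 0 (lapW0 y' (mean_curvature y')) (t z)) (pd 1 (lapW0 y' (mean_curvature y')) (t z))
 (pd 0 (lapW1 y' (mean_curvature y')) (t z)) (pd 1 (lapW1 y' (mean_curvature y')) (t z)).
move=> W0 W1 a1 a2 a3 a4 b1 b2 N a b c d Jz N0.
by field; rewrite s0 N0 Jz.
Qed.

End Reparametrization.

(** * Charts *)

Section Charts.
Variables (R : realType) (M : topologicalType) (x : M -> 'rV[R]_3).
Implicit Types (U V : set 'rV[R]_2) (phi : 'rV[R]_2 -> M).

Lemma smooth_pos_ball U (f : 'rV[R]_2 -> R) q : open U -> smooth_on U f -> U q ->
  0 < f q -> exists2 r : R, 0 < r & forall z, ball q r z -> U z /\ 0 < f z.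
Proof.
move=> oU sf Uq f0; have [r r0 rU] := open_ball_sub oU Uq.
have /continuous_epsP/(_ _ f0)[d d0 dB] := smooth_continuous sf Uq.
exists (Num.min r d); first by rewrite lt_min r0.
move=> z /rVballP; rewrite lt_min => /andP[zr zd]; split; first exact/rU/rVballP.
have := dB z ((rVballP _ _ _).2 zd); rewrite ltr_norml => /andP[_].
by rewrite ltrBlDr -ltrBlDl subrr.
Qed.

Lemma chart_reparam U V phi (G : 'rV[R]_2 -> 'rV[R]_2) :
  local_chart x U phi -> open V -> smooth_on V G -> (forall v, V v -> U (G v)) ->
  {in V &, injective G} -> (forall W, open W -> W `<=` V -> open (G @` W)) ->
  (forall v, V v -> jac (fun z => G z 0 0) (fun z => G z 0 1) v != 0) ->
  local_chart x V (phi \o G).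
Proof.
move=> [cphi iphi ophi [oU sy n0]] oV sG GU iG oG J0; split.
- move=> v Vv; apply: continuous_comp; first exact: smooth_continuous sG Vv.
  exact/cphi/GU.
- move=> v w Vv Vw /= E; apply: iG => //; apply: iphi => //; apply/mem_set/GU;
  exact: set_mem.
- move=> W oW WV; rewrite -image_comp; apply: ophi; first exact: oG.
  by move=> _ [v /WV Vv <-]; exact: GU.
- split => //; first exact: (smooth_vcomp oV oU GU sy sG).
  move=> v Vv; rewrite (@reparam_normal R V U G oV oU GU sG (x \o phi \o G) (x \o phi))//.
  by rewrite scaler_eq0 negb_or J0// n0//; exact: GU.
Qed.

Lemma image_preimage_open V V' (G F : 'rV[R]_2 -> 'rV[R]_2) : open V' ->
  smooth_on V' F -> (forall v, V v -> V' (G v) /\ F (G v) = v) ->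
  (forall z, V' z -> V (F z) /\ G (F z) = z) ->
  forall W, open W -> W `<=` V -> open (G @` W).
Proof.
move=> oV' sF GV FV W oW WV; rewrite openE => _ [w Ww <-].
have [V'G FG] := GV w (WV w Ww).
have cF := smooth_continuous sF V'G.
have [r r0 rV'] := open_ball_sub oV' V'G.
have [e e0 eW] := open_ball_sub oW Ww.
move: cF => /continuous_epsP/(_ e e0)[d d0 dB].
apply/nbhs_ballP; exists (Num.min r d); first by rewrite /= lt_min r0.
move=> z /rVballP; rewrite lt_min => /andP[/rVballP zr /rVballP zd].
have [VF GF] := FV z (rV' z zr).
exists (F z) => //; apply: eW; apply/rVballP.
by have := dB z zd; rewrite FG.
Qed.

Lemma jac_inverse U V (f g : 'rV[R]_2 -> R) (G : 'rV[R]_2 -> 'rV[R]_2) v :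
  open U -> open V -> smooth_on U f -> smooth_on U g -> smooth_on V G ->
  (forall v, V v -> [/\ U (G v), f (G v) = v 0 0 & g (G v) = v 0 1]) -> V v ->
  jac f g (G v) * jac (fun z => G z 0 0) (fun z => G z 0 1) v = 1.
Proof.
move=> oU oV sf sg sG GV Vv.
have GU z : V z -> U (G z) by move=> /GV[].
have df i := is_derive_pd (pd_comp_is_derive oU GU sG i sf Vv).
have dg i := is_derive_pd (pd_comp_is_derive oU GU sG i sg Vv).
have ef i : pd i (fun z => f (G z)) v = (i == 0)%:R.
  rewrite (pd_ext i oV Vv (g := fun z => z 0 0)); last by move=> z /GV[].
  by apply: is_derive_pd; apply: is_derive_eq (is_dcoord 0 (is_derive_id _ _)) _;
      rewrite mxE eqxx eq_sym.
have eg i : pd i (fun z => g (G z)) v = (i == 1)%:R.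
  rewrite (pd_ext i oV Vv (g := fun z => z 0 1)); last by move=> z /GV[].
  by apply: is_derive_pd; apply: is_derive_eq (is_dcoord 1 (is_derive_id _ _)) _;
      rewrite mxE eqxx eq_sym.
have f0 := etrans (esym (df 0)) (ef 0); have f1 := etrans (esym (df 1)) (ef 1).
have g0 := etrans (esym (dg 0)) (eg 0); have g1 := etrans (esym (dg 1)) (eg 1).
rewrite /= in f0 f1 g0 g1; rewrite /jac.
move: f0 f1 g0 g1.
move: (pd 0 f (G v)) (pd 1 f (G v)) (pd 0 g (G v)) (pd 1 g (G v)).
move: (pd 0 (fun z => G z 0 0) v) (pd 1 (fun z => G z 0 0) v)
  (pd 0 (fun z => G z 0 1) v) (pd 1 (fun z => G z 0 1) v).
move=> a b c d k l m n f0 f1 g0 g1.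
have -> : (k * n - l * m) * (a * d - b * c) =
  (k * a + l * c) * (m * b + n * d) - (k * b + l * d) * (m * a + n * c) by ring.
by rewrite (mulrC k) (mulrC l) in f0 *; rewrite f0 f1 g0 g1; ring.
Qed.

(** Introduces coordinates adapted to the geometry: any two functions with independent differentials
    at a point become the coordinates of a chart around it. *)
Lemma chart_inverse U phi (f g : 'rV[R]_2 -> R) q : local_chart x U phi ->
  smooth_on U f -> smooth_on U g -> U q -> jac f g q != 0 ->
  exists V G, [/\ local_chart x V (phi \o G), open V, smooth_on V G,
    (forall v, V v -> [/\ U (G v), f (G v) = v 0 0 & g (G v) = v 0 1]) &
    V (pt (f q) (g q)) /\ G (pt (f q) (g q)) = q].
Proof.
move=> cU sf sg Uq J0; have [_ _ _ [oU _ _]] := cU.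
have [r [V [G [r0 rU rJ [oV sG GV FV]]]]] := inverse_function oU sf sg Uq J0.
have GV' v : V v -> [/\ U (G v), f (G v) = v 0 0 & g (G v) = v 0 1].
  by move=> /GV[/rU].
have qq : ball q r q by apply/rVballP; rewrite subrr normr0.
exists V, G; split => //; last exact: FV.
pose F z := pt (f z) (g z).
have sF : smooth_on (ball q r) F.
  have oB : open (ball q r) by exact: ball_open.
  apply/(smooth_mx oB) => k.
  have sub : ball q r `<=` U by [].
  have [->|->] := ord2 k.
    apply: (@smooth_ext _ _ (ball q r) f _ oB _ (smooth_subset sub sf)) => z _.
    by rewrite ptE0.
  apply: (@smooth_ext _ _ (ball q r) g _ oB _ (smooth_subset sub sg)) => z _.
  by rewrite ptE1.
have FG v : V v -> F (G v) = v by move=> /GV[_ f1 g1]; rewrite /F f1 g1 -ptE.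
apply: (chart_reparam cU) => //.
- by move=> v /GV'[].
- by move=> v w /set_mem Vv /set_mem Vw E; rewrite -(FG v Vv) E FG.
- have GVb v : V v -> ball q r (G v) by move=> /GV[].
  exact: (@image_preimage_open V (ball q r) G F (ball_open q r) sF
    (fun v Vv => conj (GVb v Vv) (FG v Vv)) FV).
- move=> v Vv; apply/eqP => E0.
  have := jac_inverse oU oV sf sg sG GV' Vv; rewrite E0 mulr0 => /esym/eqP.
  by rewrite oner_eq0.
Qed.

(** The counterpart of [chart_inverse] for an explicit substitution [F], which only needs to be a
    local diffeomorphism at q. *)
Lemma chart_comp U phi V (F : 'rV[R]_2 -> 'rV[R]_2) q : local_chart x U phi ->
  open V -> smooth_on V F -> (forall v, V v -> U (F v)) -> V q ->
  jac (fun z => F z 0 0) (fun z => F z 0 1) q != 0 ->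
  exists r, [/\ 0 < r, ball q r `<=` V & local_chart x (ball q r) (phi \o F)].
Proof.
move=> cU oV sF FU Vq J0.
have sf : smooth_on V (fun z => F z 0 0) by smooth.
have sg : smooth_on V (fun z => F z 0 1) by smooth.
have [r [V' [G [r0 rV rJ [oV' sG GV FV]]]]] := inverse_function oV sf sg Vq J0.
have FE z : pt (F z 0 0) (F z 0 1) = F z by rewrite -ptE.
exists r; split => //.
apply: (chart_reparam cU) => //.
- exact: ball_open.
- exact: smooth_subset sF.
- by move=> v /rV; exact: FU.
- move=> v w /set_mem vr /set_mem wr E; have [_ <-] := FV v vr.
  by have [_ <-] := FV w wr; rewrite !FE E.
- apply: (@image_preimage_open (ball q r) V' F G) => //.
    by move=> v /FV; rewrite FE.
  by move=> z /GV[h1 h2 h3]; split => //; rewrite [RHS]ptE -h2 -h3 -ptE.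
Qed.

Lemma chart_subset U V phi : local_chart x U phi -> open V -> V `<=` U ->
  local_chart x V phi.
Proof.
move=> [cphi iphi ophi [oU sy n0]] oV VU; split.
- by move=> v /VU; exact: cphi.
- by move=> v w /set_mem/VU/mem_set h /set_mem/VU/mem_set h'; exact: iphi.
- by move=> W oW WV; apply: ophi => // z /WV/VU.
- by split => //; [exact: smooth_subset sy|move=> z /VU; exact: n0].
Qed.

(** Two charts are related by a map that is a priori only a homeomorphism. It is smooth because x is
    an immersion in the second chart: two of the coordinates of x are local coordinates there, and
    composed with [t] they are coordinates of x in the first chart. Shrinking the ball fixes the
    sign of the Jacobian. The last clause says that [t] covers a neighbourhood of q'. *)
Lemma transition U phi U' phi' q q' : local_chart x U phi -> local_chart x U' phi' ->
  U q -> U' q' -> phi q = phi' q' ->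
  exists r t s, [/\ 0 < r, ball q r `<=` U, smooth_on (ball q r) t,
    [/\ t q = q', s * s = 1 &
    forall z, ball q r z -> [/\ U' (t z), phi z = phi' (t z) &
      0 < s * jac (fun z => t z 0 0) (fun z => t z 0 1) z]] &
    forall e, 0 < e -> exists2 d, 0 < d & forall z', ball q' d z' ->
      exists z, [/\ ball q e z, ball q r z & t z = z']].
Proof.
move=> [cphi iphi ophi [oU sy n0]] [cphi' iphi' ophi' [oU' sy' n0']] Uq Uq' E.
have oO : open (phi' @` U') by exact: ophi'.
have [r1 r10 r1O] : exists2 r : R, 0 < r & forall z, ball q r z -> U z /\ (phi' @` U') (phi z).
  have [r r0 rU] := open_ball_sub oU Uq.
  have nO : nbhs (phi q) (phi' @` U').
    by apply: open_nbhs_nbhs; split => //; exists q'.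
  have /nbhs_ballP[e /= e0 eB] := cphi q Uq _ nO.
  exists (Num.min r e); first by rewrite lt_min r0.
  move=> z /rVballP; rewrite lt_min => /andP[/rVballP zr /rVballP ze].
  by split; [exact: rU|exact: eB].
have /choice[t Ht] : forall z, exists z', ball q r1 z -> U' z' /\ phi z = phi' z'.
  move=> z; have [zr|nz] := pselect (ball q r1 z); last by exists 0.
  by have [_ [z' U'z' <-]] := r1O z zr; exists z'.
have qr1 : ball q r1 q by apply/rVballP; rewrite subrr normr0.
have tq : t q = q'.
  have [Utq Etq] := Ht q qr1.
  by apply: iphi'; rewrite ?inE// -Etq.
(* Continuity of [t] comes from the openness of [phi']: the image of a small ball around [t z] is a
   neighbourhood of [phi z]. *)
have ct z : ball q r1 z -> {for z, continuous t}.
  move=> zr; have [U'tz Etz] := Ht z zr; apply/continuous_epsP => e e0.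
  have oW : open (ball (t z) e `&` U') by apply: openI => //; exact: ball_open.
  have oI : open (phi' @` (ball (t z) e `&` U')) by apply: ophi' => // v [].
  have nI : nbhs (phi z) (phi' @` (ball (t z) e `&` U')).
    apply: open_nbhs_nbhs; split => //; exists (t z) => //; split => //.
    by apply/rVballP; rewrite subrr normr0.
  have [Uz _] := r1O z zr.
  have /nbhs_ballP[d /= d0 dB] := cphi z Uz _ nI.
  have [c c0 cB] : exists2 c : R, 0 < c & forall v, ball z c v -> ball q r1 v.
    by apply: open_ball_sub => //; exact: ball_open.
  exists (Num.min d c); first by rewrite lt_min d0.
  move=> v /rVballP; rewrite lt_min => /andP[/rVballP vd /rVballP vc].
  have [w [wb U'w] Ew] := dB v vd; have [U'tv Etv] := Ht v (cB v vc).
  have -> : t v = w by apply: iphi'; rewrite ?inE// Ew.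
  exact/rVballP.
pose y := x \o phi; pose y' := x \o phi'.
have yt z : ball q r1 z -> y z = y' (t z) by move=> /Ht[_ h]; rewrite /y /y' /= h.
(* If every pair of coordinates of [y'] had zero Jacobian at q', all three components of the normal
   of [y'] would vanish. *)
have [f [g [sf sg J0 [ft gt]]]] : exists f g, [/\ smooth_on U' f, smooth_on U' g,
    jac f g q' != 0 & smooth_on (ball q r1) (fun z => f (t z)) /\
      smooth_on (ball q r1) (fun z => g (t z))].
  have b1U : ball q r1 `<=` U by move=> z /r1O[].
  have sy1 : smooth_on (ball q r1) y by exact: smooth_subset sy.
  have C k : smooth_on U' (fun z => y' z 0 k) /\ smooth_on (ball q r1) (fun z => y' (t z) 0 k).
    split; first by smooth.
    apply: (@smooth_ext _ _ _ (fun z => y z 0 k)); first exact: ball_open.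
      by move=> z /yt ->.
    by smooth.
  have P i k : pd i (fun z => y' z 0 k) q' = pd i y' q' 0 k.
    exact: is_derive_pd (is_dcoord k (smooth_is_derive i sy' Uq')).
  suff [k [l kl]] : exists k l, jac (fun z => y' z 0 k) (fun z => y' z 0 l) q' != 0.
    have [k1 k2] := C k; have [l1 l2] := C l.
    by exists (fun z => y' z 0 k), (fun z => y' z 0 l); split.
  apply: contrapT => H; have /negP := n0' q' Uq'; apply; apply/eqP.
  have Z k l : jac (fun z => y' z 0 k) (fun z => y' z 0 l) q' = 0.
    by apply/eqP/negPn/negP => kl; apply: H; exists k, l.
  rewrite normal_pdE; apply: rV3P; rewrite crossE mxE.
  - by rewrite -(Z 1 2) /jac !P (mulrC (pd 1 y' q' 0 1)).
  - by rewrite -(Z 2 0) /jac !P (mulrC (pd 1 y' q' 0 2)).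
  - by rewrite -(Z 0 1) /jac !P (mulrC (pd 1 y' q' 0 0)).
have [r2 [r20 r2U r2J _]] := jac_ball oU' sf sg Uq' J0.
have /continuous_epsP/(_ r2 r20)[r3 r30 r3B] := ct q qr1.
pose r4 := Num.min r1 r3.
have r40 : 0 < r4 by rewrite lt_min r10.
have b4 z : ball q r4 z -> ball q r1 z /\ ball q' r2 (t z).
  move=> /rVballP; rewrite lt_min => /andP[/rVballP zr1 /rVballP zr3]; split => //.
  by apply/rVballP; rewrite -tq; exact: r3B.
have b41 : ball q r4 `<=` ball q r1 by move=> z /b4[].
have o4 : open (ball q r4) by exact: ball_open.
have st : smooth_on (ball q r4) t.
  apply: (smooth_inverse oU' o4 sf sg).
  - by move=> z /b4[_ /r2U].
  - by move=> z /b41; exact: ct.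
  - by move=> z /b4[_ /r2J].
  - exact: smooth_subset ft.
  - exact: smooth_subset gt.
have q4 : ball q r4 q by apply/rVballP; rewrite subrr normr0.
have t4U z : ball q r4 z -> U' (t z) by move=> /b41/Ht[].
pose J := jac (fun z => t z 0 0) (fun z => t z 0 1).
have Jq : J q != 0.
  apply/eqP => J0q; have := n0 q Uq.
  have := @reparam_normal R (ball q r4) U' t o4 oU' t4U st y y' sy'
    (fun z zr => yt z (b41 z zr)) q q4.
  by rewrite -/(J q) J0q scale0r => ->; rewrite eqxx.
have sJ : smooth_on (ball q r4) J by apply: jac_smooth => //; smooth.
have [s s2 sJq] : exists2 s : R, s * s = 1 & 0 < s * J q.
  have [Jp|Jn] := ltrP 0 (J q); first by exists 1; rewrite ?mul1r.
  exists (-1); first by rewrite mulrNN mul1r.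
  by rewrite mulN1r oppr_gt0 lt_neqAle Jq.
have ssJ : smooth_on (ball q r4) (fun z => s * J z) by smooth.
have [r r0 rB] := smooth_pos_ball o4 ssJ q4 sJq.
exists r, t, s; split => //.
- by move=> z /rB[/b41/r1O[]].
- by apply: smooth_subset st => z /rB[].
- split => // z /rB[z4 Jz]; split => //; first exact: t4U.
  by have [] := Ht z (b41 z z4).
- move=> e e0.
  have oI : open (phi @` (ball q (Num.min e r))).
    apply: ophi; first exact: ball_open.
    move=> z zr; apply: (r1O z _).1; apply/b41; apply: (rB z _).1.
    by apply: le_ball zr; rewrite ge_min lexx orbT.
  have m0 : 0 < Num.min e r by rewrite lt_min e0.
  have nI : nbhs (phi' q') (phi @` (ball q (Num.min e r))).
    apply: open_nbhs_nbhs; split => //; exists q => //.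
    by apply/rVballP; rewrite subrr normr0.
  have /nbhs_ballP[d /= d0 dB] := cphi' q' Uq' _ nI.
  have [c c0 cB] := open_ball_sub oU' Uq'.
  exists (Num.min d c); first by rewrite lt_min d0.
  move=> v /rVballP; rewrite lt_min => /andP[/rVballP vd /rVballP vc].
  have [z zm Ez] := dB v vd.
  have zr : ball q r z by apply: le_ball zm; rewrite ge_min lexx orbT.
  exists z; split => //; first by apply: le_ball zm; rewrite ge_min lexx.
  have z4 := (rB z zr).1; have [U'tz Etz] := Ht z (b41 z z4).
  by apply: iphi'; rewrite ?inE//; [exact: cB|rewrite -Etz].
Qed.

End Charts.

(** * Flat coordinates *)

Section FlatChart.
Variable R : realType.

Lemma dot_basis (u v a b : 'rV[R]_3) : dot u u = 1 -> dot v v = 1 -> dot u v = 0 ->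
  dot a b = dot a u * dot b u + dot a v * dot b v +
    dot a (cross u v) * dot b (cross u v).
Proof.
move=> uu vv uv; rewrite {1}(orthonormal_basis a uu vv uv) !dotDl !dotZl.
by rewrite (dotC u b) (dotC v b) (dotC _ b).
Qed.

Lemma is_derive_dot_cst (V : normedModType R) n (U : set V) (a b : V -> 'rV[R]_n)
    (q v : V) (k : R) da db : open U -> U q -> (forall z, U z -> dot (a z) (b z) = k) ->
  is_derive q v a da -> is_derive q v b db -> dot da (b q) = - dot (a q) db.
Proof.
move=> oU Uq abk ha hb; apply/eqP; rewrite -addr_eq0; apply/eqP.
have [_ <-] := is_ddot ha hb.
rewrite (near_eq_derive (g := fun=> k)); first exact: derive_cst.
by apply: (near_open oU Uq) => z /abk.
Qed.

(** Let o be the connection coefficient of the frame and let its angle of rotation have derivative t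
    = - o; then the rotated vector has no tangential derivative. The pairs (cos, sin) and (- sin,
    cos) give the two rotated vectors. *)
Lemma rotated_derivative (c s t o k l : R) (E F dE dF : 'rV[R]_3) :
  dot dE E = 0 -> dot dF F = 0 -> dot dF E = - o -> dot dE F = o ->
  dot E E = 1 -> dot F F = 1 -> dot E F = 0 -> t = - o -> k = - (s * t) -> l = c * t ->
  dot ((k *: E + c *: dE) + (l *: F + s *: dF)) E = 0 /\
  dot ((k *: E + c *: dE) + (l *: F + s *: dF)) F = 0.
Proof.
move=> h1 h2 h3 h4 h5 h6 h7 -> -> ->.
rewrite !(dotDl, dotZl) h1 h2 h3 h4 h5 h6 h7 (dotC F E) h7.
by split; ring.
Qed.

Lemma rotated_frame (c s : R) (E F : 'rV[R]_3) : c ^+ 2 + s ^+ 2 = 1 ->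
  dot E E = 1 -> dot F F = 1 -> dot E F = 0 ->
  [/\ dot (c *: E + s *: F) (c *: E + s *: F) = 1,
      dot (- s *: E + c *: F) (- s *: E + c *: F) = 1,
      dot (c *: E + s *: F) (- s *: E + c *: F) = 0 &
      cross (c *: E + s *: F) (- s *: E + c *: F) = cross E F].
Proof.
move=> cs h1 h2 h3.
rewrite !(dotDl, dotDr, dotZl, dotZr) (dotC F E) h1 h2 h3 cross_lin2.
split; [by rewrite -[RHS]cs; ring|by rewrite -[RHS]cs; ring|by ring|].
by rewrite [X in X *: _](_ : _ = 1) ?scale1r// -[RHS]cs; ring.
Qed.

Lemma pd_coord n U i (f : 'rV[R]_2 -> 'rV[R]_n) q k : smooth_on U f -> U q ->
  pd i (fun z => f z 0 k) q = pd i f q 0 k.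
Proof. by move=> sf Uq; exact: is_derive_pd (is_dcoord k (smooth_is_derive i sf Uq)). Qed.

Lemma vschwarz n U (f : 'rV[R]_2 -> 'rV[R]_n) q (i j : 'I_2) : open U ->
  smooth_on U f -> U q -> pd i (pd j f) q = pd j (pd i f) q.
Proof.
move=> oU sf Uq; apply/rowP => k.
have sfk : smooth_on U (fun z => f z 0 k) by smooth.
have E l m : pd l (pd m f) q 0 k = pd l (pd m (fun z => f z 0 k)) q.
  rewrite -(pd_coord l k (smooth_pd m sf) Uq); apply: (pd_ext l oU Uq) => z Uz.
  by rewrite (pd_coord m k sf Uz).
by rewrite !E (schwarz i j oU sfk Uq).
Qed.

Variables (U : set 'rV[R]_2) (y : 'rV[R]_2 -> 'rV[R]_3).
Hypotheses (oU : open U) (sy : smooth_on U y).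
Hypothesis (n0 : forall q, U q -> normal y q != 0).
Hypothesis h0 : forall q, U q ->
  hform y 0 0 q * hform y 1 1 q = hform y 0 1 q * hform y 1 0 q.

(** [E1] and [E2] are the Gram-Schmidt frame of the coordinate vectors, [sa] the length of the first
    one and [sd] the area of their parallelogram. *)
Let a q := dot (pd 0 y q) (pd 0 y q).
Let b q := dot (pd 0 y q) (pd 1 y q).
Let sa q := Num.sqrt (a q).
Let sd q := Num.sqrt (gdet y q).
Let E1 q := (sa q)^-1 *: pd 0 y q.
Let al q := a q / (sa q * sd q).
Let be q := - (b q / (sa q * sd q)).
Let E2 q := al q *: pd 1 y q + be q *: pd 0 y q.

Let a0 q : U q -> 0 < a q.
Proof.
move=> Uq; rewrite lt_def dot_ge0 dot_eq0 andbT; apply/eqP => y0.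
by have := n0 Uq; rewrite normal_pdE y0 -[X in cross X _](scale0r 0) crossZl scale0r eqxx.
Qed.

Let sa0 q : U q -> sa q != 0. Proof. by move=> /a0 h; rewrite gt_eqF// sqrtr_gt0. Qed.
Let sd0 q : U q -> 0 < sd q.
Proof. by move=> /n0/gdet_gt0 h; rewrite sqrtr_gt0. Qed.

Let ssa : smooth_on U sa. Proof. rewrite /sa /a; smooth; exact: a0. Qed.
Let ssd : smooth_on U sd.
Proof.
have sg := smooth_gdet oU sy; rewrite /sd; smooth.
by move=> q /n0/gdet_gt0.
Qed.

Let saE q : U q -> sa q ^+ 2 = a q.
Proof. by move=> /a0/ltW h; rewrite sqr_sqrtr. Qed.
Let sdE q : U q -> sd q ^+ 2 = gdet y q.
Proof. by move=> /n0/gdet_gt0/ltW h; rewrite sqr_sqrtr. Qed.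

Let sal : smooth_on U al.
Proof.
rewrite /al /a; smooth.
by move=> q Uq; rewrite mulf_neq0 ?sa0// gt_eqF// sd0.
Qed.
Let sbe : smooth_on U be.
Proof.
rewrite /be /b; smooth.
by move=> q Uq; rewrite mulf_neq0 ?sa0// gt_eqF// sd0.
Qed.
Let sE1 : smooth_on U E1.
Proof. by rewrite /E1; smooth; exact: sa0. Qed.
Let sE2 : smooth_on U E2.
Proof. by rewrite /E2; smooth. Qed.

Let E11 q : U q -> dot (E1 q) (E1 q) = 1.
Proof.
move=> Uq; rewrite dotZl dotZr -/(a q) -saE//; field; exact: sa0.
Qed.

Let E12 q : U q -> dot (E1 q) (E2 q) = 0.
Proof.
move=> Uq; rewrite /E1 /E2 dotZl dotDr !dotZr -/(a q) -/(b q) /al /be.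
have s1 := sa0 Uq; have s2 := lt0r_neq0 (sd0 Uq).
by field; rewrite s1 s2.
Qed.

Let E22 q : U q -> dot (E2 q) (E2 q) = 1.
Proof.
move=> Uq; rewrite /E2 !(dotDl, dotDr, dotZl, dotZr) (dotC (pd 1 y q) (pd 0 y q)).
rewrite -/(a q) -/(b q) /al /be.
have s1 := sa0 Uq; have s2 := lt0r_neq0 (sd0 Uq).
have e1 := saE Uq; have := sdE Uq; rewrite /gdet -/(a q) -/(b q).
set c := dot _ _ => e2.
have -> : c = (sd q ^+ 2 + b q ^+ 2) / a q.
  by rewrite e2; field; rewrite -e1 expf_neq0.
by rewrite -e1; field; rewrite s1 s2.
Qed.

Let E1xE2 q : U q -> cross (E1 q) (E2 q) = unit_normal y q.
Proof.
move=> Uq.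
rewrite /E1 -[_ *: _]addr0 -[X in _ + X](scale0r (pd 1 y q)) /E2 (addrC (al q *: _)).
rewrite cross_lin2 mul0r subr0 /unit_normal -gdet_normal -/(sd q) normal_pdE.
congr (_ *: _); have s1 := sa0 Uq; have s2 := lt0r_neq0 (sd0 Uq).
by rewrite /al -saE//; field; rewrite s1 s2.
Qed.

Let N := unit_normal y.

Let pdN q i : U q -> dot (pd i y q) (N q) = 0.
Proof.
move=> Uq; rewrite /N /unit_normal dotZr dotC normal_pdE.
by have [->|->] := ord2 i; rewrite ?dot_crossl ?dot_crossr mulr0.
Qed.

Let dE1N q i : U q -> dot (pd i E1 q) (N q) = (sa q)^-1 * hform y i 0 q.
Proof.
move=> Uq.
have D : is_derive q (e_ i) E1 (pd i (fun z => (sa z)^-1) q *: pd 0 y q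
    + (sa q)^-1 *: pd i (pd 0 y) q).
  by apply: is_dscale; apply: smooth_is_derive Uq; smooth; exact: sa0.
by rewrite (is_derive_pd D) dotDl !dotZl pdN// mulr0 add0r.
Qed.

Let dE2N q i : U q ->
  dot (pd i E2 q) (N q) = al q * hform y i 1 q + be q * hform y i 0 q.
Proof.
move=> Uq.
have D : is_derive q (e_ i) E2 ((pd i al q *: pd 1 y q
   + al q *: pd i (pd 1 y) q) + (pd i be q *: pd 0 y q
   + be q *: pd i (pd 0 y) q)).
  by apply: is_dD; apply: is_dscale; apply: smooth_is_derive Uq; smooth.
by rewrite (is_derive_pd D) !dotDl !dotZl !pdN// !mulr0 !add0r.
Qed.

Let om i q := dot (pd i E1 q) (E2 q).

Let som i : smooth_on U (om i).
Proof. by rewrite /om; smooth. Qed.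

Let dE i q : U q -> [/\ dot (pd i E1 q) (E1 q) = 0,
  dot (pd i E2 q) (E2 q) = 0 & dot (pd i E2 q) (E1 q) = - om i q].
Proof.
move=> Uq; have d1 := smooth_is_derive i sE1 Uq; have d2 := smooth_is_derive i sE2 Uq.
split.
- have := is_derive_dot_cst oU Uq E11 d1 d1; rewrite (dotC (E1 q)).
  by move=> /eqP; rewrite -addr_eq0 -mulr2n mulrn_eq0 => /eqP.
- have := is_derive_dot_cst oU Uq E22 d2 d2; rewrite (dotC (E2 q)).
  by move=> /eqP; rewrite -addr_eq0 -mulr2n mulrn_eq0 => /eqP.
- have := is_derive_dot_cst oU Uq E12 d1 d2; rewrite -/(om i q) => ->.
  by rewrite opprK dotC.
Qed.

(* the Gauss equation: the connection form of the frame (E1, E2) is closed *)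
Lemma connection_closed q : U q -> pd 1 (om 0) q = pd 0 (om 1) q.
Proof.
move=> Uq; have D i j : pd i (om j) q = dot (pd i (pd j E1) q) (E2 q) +
    dot (pd j E1 q) (pd i E2 q).
  by apply: is_derive_pd; apply: is_ddot; apply: smooth_is_derive Uq; smooth.
rewrite !D (vschwarz 1 0 oU sE1 Uq); congr (_ + _).
have B i j : dot (pd i E1 q) (pd j E2 q) = (sa q)^-1 * hform y i 0 q *
    (al q * hform y j 1 q + be q * hform y j 0 q).
  rewrite (dot_basis _ _ (E11 Uq) (E22 Uq) (E12 Uq)) E1xE2//.
  have [-> _ _] := dE i Uq; have [_ -> _] := dE j Uq.
  by rewrite mul0r mulr0 !add0r -/(N q) dE1N// dE2N.
rewrite !B; have := h0 Uq.
move: (hform y 0 0 q) (hform y 1 1 q) (hform y 0 1 q) (hform y 1 0 q) (sa q)^-1 (al q) (be q).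
move=> h00 h11 h01 h10 s A B' hh.
have -> : s * h00 * (A * h11 + B' * h10) = s * A * (h00 * h11) + s * B' * h00 * h10 by ring.
by rewrite hh; ring.
Qed.

(** As the connection form is closed, a rotation angle [th] with the opposite differential exists,
    and the rotated frame [e1], [e2] is parallel. The forms dot(dy, e1) and dot(dy, e2) are then
    closed, and their potentials [X], [Y] are Euclidean coordinates. *)
Lemma flat_coordinates q : U q -> exists (r : R) (e1 e2 : 'rV[R]_2 -> 'rV[R]_3) (X Y :
    'rV[R]_2 -> R),
  [/\ 0 < r, ball q r `<=` U, smooth_on (ball q r) X, smooth_on (ball q r) Y &
    forall z, ball q r z -> [/\ dot (e1 z) (e1 z) = 1, dot (e2 z) (e2 z) = 1,
      dot (e1 z) (e2 z) = 0 :> R,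
      forall i, pd i y z = pd i X z *: e1 z + pd i Y z *: e2 z & jac X Y z != 0]].
Proof.
move=> Uq.
have sN i : smooth_on U (fun z => - om i z) by have so := som i; smooth.
have [|r1 [th [r10 b1U sth th0 th1]]] := poincare oU (sN 0) (sN 1) Uq.
  move=> z Uz; rewrite (is_derive_pd (is_dN (smooth_is_derive 1 (som 0) Uz))).
  by rewrite (is_derive_pd (is_dN (smooth_is_derive 0 (som 1) Uz))) connection_closed.
have thE i z : ball q r1 z -> pd i th z = - om i z.
  by have [->|->] := ord2 i; [exact: th0|exact: th1].
have o1 : open (ball q r1) by exact: ball_open.
have q1 : ball q r1 q by apply/rVballP; rewrite subrr normr0.
have s1E1 := smooth_subset b1U sE1; have s1E2 := smooth_subset b1U sE2.
have s1y := smooth_subset b1U sy.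
pose e1 z := cos (th z) *: E1 z + sin (th z) *: E2 z.
pose e2 z := - sin (th z) *: E1 z + cos (th z) *: E2 z.
have se1 : smooth_on (ball q r1) e1 by rewrite /e1; smooth.
have se2 : smooth_on (ball q r1) e2 by rewrite /e2; smooth.
have tan z (v : 'rV[R]_3) i : ball q r1 z -> dot v (E1 z) = 0 -> dot v (E2 z) = 0 ->
    dot (pd i y z) v = 0.
  move=> zr v1 v2; have Uz := b1U z zr.
  by rewrite (dot_basis _ _ (E11 Uz) (E22 Uz) (E12 Uz)) v1 v2 E1xE2// pdN// !mulr0 mul0r !addr0.
have de1 i j z : ball q r1 z -> dot (pd i y z) (pd j e1 z) = 0.
  move=> zr; have Uz := b1U z zr.
  have D1 := smooth_is_derive j s1E1 zr; have D2 := smooth_is_derive j s1E2 zr.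
  have Dt := smooth_is_derive j sth zr.
  have -> := is_derive_pd (is_dD (is_dscale (is_dcos Dt) D1) (is_dscale (is_dsin Dt) D2)).
  have [d1 d2 d3] := dE j Uz.
  have [] := @rotated_derivative (cos (th z)) (sin (th z)) (pd j th z) _ _ _ _ _ _ _ d1 d2 d3
    erefl (E11 Uz) (E22 Uz) (E12 Uz) (thE j z zr) (mulNr _ _) erefl.
  exact: tan.
have de2 i j z : ball q r1 z -> dot (pd i y z) (pd j e2 z) = 0.
  move=> zr; have Uz := b1U z zr.
  have D1 := smooth_is_derive j s1E1 zr; have D2 := smooth_is_derive j s1E2 zr.
  have Dt := smooth_is_derive j sth zr.
  have -> := is_derive_pd (is_dD (is_dscale (is_dN (is_dsin Dt)) D1) (is_dscale (is_dcos
      Dt) D2)).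
  have [d1 d2 d3] := dE j Uz.
  have [] := @rotated_derivative (- sin (th z)) (cos (th z)) (pd j th z) _ _ _ _ _ _ _ d1 d2 d3
    erefl (E11 Uz) (E22 Uz) (E12 Uz) (thE j z zr) erefl erefl.
  exact: tan.
have closed e : smooth_on (ball q r1) e ->
    (forall i j z, ball q r1 z -> dot (pd i y z) (pd j e z) = 0) ->
    forall z, ball q r1 z -> pd 1 (fun z => dot (pd 0 y z) (e z)) z =
      pd 0 (fun z => dot (pd 1 y z) (e z)) z.
  move=> se de z zr.
  have D i j : pd j (fun z => dot (pd i y z) (e z)) z = dot (pd j (pd i y) z) (e z).
    have := is_derive_pd (is_ddot (smooth_is_derive j (smooth_pd i s1y) zr)
      (smooth_is_derive j se zr)).
    by rewrite de// addr0.
  by rewrite !D (vschwarz 1 0 o1 s1y zr).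
have sP e i : smooth_on (ball q r1) e -> smooth_on (ball q r1) (fun z => dot (pd i y z) (e z)).
  by move=> se; smooth.
have [r2 [X [r20 b2 sX X0 X1]]] := poincare o1 (sP _ 0 se1) (sP _ 1 se1) q1 (closed _ se1 de1).
have [r3 [Y [r30 b3 sY Y0 Y1]]] := poincare o1 (sP _ 0 se2) (sP _ 1 se2) q1 (closed _ se2 de2).
pose r := Num.min r2 r3.
have r0 : 0 < r by rewrite lt_min r20.
have rb2 : ball q r `<=` ball q r2 by apply: le_ball; rewrite ge_min lexx.
have rb3 : ball q r `<=` ball q r3 by apply: le_ball; rewrite ge_min lexx orbT.
exists r, e1, e2, X, Y; split => //.
- by move=> z /rb2/b2/b1U.
- exact: smooth_subset sX.
- exact: smooth_subset sY.
move=> z zr; have z1 := b2 z (rb2 z zr); have Uz := b1U z z1.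
have [n1 n2 n12 nc0] := rotated_frame (cos2Dsin2 (th z)) (E11 Uz) (E22 Uz) (E12 Uz).
rewrite -/(e1 z) -/(e2 z) in n1 n2 n12 nc0.
have nc : cross (e1 z) (e2 z) = unit_normal y z by rewrite nc0 E1xE2.
have XE i : pd i X z = dot (pd i y z) (e1 z).
  by have [->|->] := ord2 i; [rewrite (X0 z (rb2 z zr))|rewrite (X1 z (rb2 z zr))].
have YE i : pd i Y z = dot (pd i y z) (e2 z).
  by have [->|->] := ord2 i; [rewrite (Y0 z (rb3 z zr))|rewrite (Y1 z (rb3 z zr))].
split => //.
  move=> i; rewrite XE YE {1}(orthonormal_basis (pd i y z) n1 n2 n12) nc.
  by rewrite -/(N z) pdN// scale0r addr0.
rewrite /jac !XE !YE.
have -> : dot (pd 0 y z) (e1 z) * dot (pd 1 y z) (e2 z) -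
    dot (pd 1 y z) (e1 z) * dot (pd 0 y z) (e2 z) =
    dot (cross (pd 0 y z) (pd 1 y z)) (cross (e1 z) (e2 z)).
  by rewrite cross_dot; congr (_ - _); rewrite mulrC.
rewrite nc /unit_normal dotZr -normal_pdE -gdet_normal gt_eqF//.
by rewrite mulr_gt0// ?invr_gt0 ?sqrtr_gt0 gdet_gt0// n0.
Qed.

End FlatChart.

(** * Fundamental equations in Euclidean coordinates *)

Section FlatPatch.
Variable R : realType.
Implicit Types (y : 'rV[R]_2 -> 'rV[R]_3).

Definition isometric_on (U : set 'rV[R]_2) y := forall z, U z ->
  forall i j, dot (pd i y z) (pd j y z) = (i == j)%:R.

(** The inverse of the map [(X, Y)] of [flat_coordinates] is the chart; restricting it to a ball
    prepares the connectedness arguments. *)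
Lemma flat_chart (M : topologicalType) (x : M -> 'rV[R]_3) (m : M) :
  immersed_surface x -> flat x ->
  exists p r psi, [/\ 0 < r, local_chart x (ball p r) psi, psi p = m &
    isometric_on (ball p r) (x \o psi)].
Proof.
move=> [_ _ _ atl] fl; have [U [phi [cU [q Uq <-]]]] := atl m.
have [_ _ _ [oU sy n0]] := cU.
have h0 z : U z -> hform (x \o phi) 0 0 z * hform (x \o phi) 1 1 z =
    hform (x \o phi) 0 1 z * hform (x \o phi) 1 0 z.
  move=> Uz; have /eqP := fl U phi cU z Uz.
  rewrite /gauss_curvature gdetE mulf_eq0 invr_eq0 (gt_eqF (gdet_gt0 (n0 z Uz))) orbF.
  by rewrite det22 !second_formE subr_eq0 => /eqP.
have [r [e1 [e2 [X [Y [r0 rU sX sY H]]]]]] := flat_coordinates oU sy n0 h0 Uq.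
have ob : open (ball q r) by exact: ball_open.
have cb := chart_subset cU ob rU.
have qr : ball q r q by apply/rVballP; rewrite subrr normr0.
have [_ _ _ _ Jq] := H q qr.
have [V [G [cV oV sG GV [Vq Gq]]]] := chart_inverse cb sX sY qr Jq.
have [d d0 dV] := open_ball_sub oV Vq.
exists (pt (X q) (Y q)), d, (phi \o G); split => //.
- by apply: chart_subset cV _ _ => //; exact: ball_open.
- by rewrite /= Gq.
move=> v /dV Vv i j; have [Gv XG YG] := GV v Vv.
have GU z : V z -> ball q r (G z) by move=> /GV[].
have sb := smooth_subset rU sy.
have [n1 n2 n12 yE _] := H (G v) Gv.
have E k : pd k (x \o (phi \o G)) v = (k == 0)%:R *: e1 (G v) + (k == 1)%:R *: e2 (G v).
  rewrite (is_derive_pd (pd_vcomp_is_derive ob GU sG k sb Vv)) !yE.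
  have -> : (k == 0)%:R = pd k (fun z => X (G z)) v.
    rewrite (pd_ext k oV Vv (g := fun z => z 0 0)); last by move=> z /GV[].
    apply/esym/is_derive_pd; apply: is_derive_eq (is_dcoord 0 (is_derive_id _ _)) _.
    by rewrite mxE eqxx eq_sym.
  have -> : (k == 1)%:R = pd k (fun z => Y (G z)) v.
    rewrite (pd_ext k oV Vv (g := fun z => z 0 1)); last by move=> z /GV[].
    apply/esym/is_derive_pd; apply: is_derive_eq (is_dcoord 1 (is_derive_id _ _)) _.
    by rewrite mxE eqxx eq_sym.
  rewrite (is_derive_pd (pd_comp_is_derive ob GU sG k sX Vv)).
  rewrite (is_derive_pd (pd_comp_is_derive ob GU sG k sY Vv)).
  move: (pd k _ v) (pd k _ v) (pd 0 X _) (pd 1 X _) (pd 0 Y _) (pd 1 Y _) => a b c d' e f.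
  move: (e1 _) (e2 _) => u w.
  by apply: rV3P; rewrite !rvE; ring.
rewrite !E !(dotDl, dotDr, dotZl, dotZr) n1 n2 (dotC (e2 (G v))) n12.
by have [->|->] := ord2 i; have [->|->] := ord2 j; rewrite /=; ring.
Qed.

Variables (U : set 'rV[R]_2) (y : 'rV[R]_2 -> 'rV[R]_3).
Hypotheses (oU : open U) (sy : smooth_on U y) (iy : isometric_on U y).

Let gram z i j (Uz : U z) := iy Uz i j.

(** In an isometric patch the cross product of the coordinate vectors already has length 1, so the
    unit normal needs no division. *)
Definition unit_cross z := cross (pd 0 y z) (pd 1 y z).

Lemma gdet_flat z : U z -> gdet y z = 1.
Proof. by move=> Uz; rewrite /gdet !gram//= expr0n mulr1 subr0. Qed.

Lemma unit_cross1 z : U z -> dot (unit_cross z) (unit_cross z) = 1.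
Proof. by move=> Uz; rewrite /unit_cross -normal_pdE -gdet_normal gdet_flat. Qed.

Lemma unit_normal_flat z : U z -> unit_normal y z = unit_cross z.
Proof.
move=> Uz; rewrite /unit_normal -gdet_normal gdet_flat// sqrtr1 invr1 scale1r.
by rewrite normal_pdE.
Qed.

Lemma normal_flat_neq0 z : U z -> normal y z != 0.
Proof.
move=> Uz; rewrite -dot_eq0 -gdet_normal gdet_flat//; exact: oner_neq0.
Qed.

Lemma flat_tangent z a : U z -> dot a (pd 0 y z) = 0 -> dot a (pd 1 y z) = 0 ->
  a = dot a (unit_cross z) *: unit_cross z.
Proof.
move=> Uz a0 a1; have g := gram _ _ Uz.
rewrite {1}(orthonormal_basis a (g 0 0) (g 1 1) (g 0 1)).
by rewrite a0 a1 !scale0r !add0r.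
Qed.

Let dy i j z (Uz : U z) := smooth_is_derive i (smooth_pd j sy) Uz.

(** The array is symmetric in its first two indices ([S]) and, the metric being constant,
    antisymmetric in the last two ([T]). Alternating the two relations returns it with the opposite
    sign. *)
Lemma christoffel0 i j k z : U z -> dot (pd i (pd j y) z) (pd k y z) = 0.
Proof.
move=> Uz.
have S a b c : dot (pd a (pd b y) z) (pd c y z) = dot (pd b (pd a y) z) (pd c y z).
  by rewrite (vschwarz a b oU sy Uz).
have T a b c : dot (pd a (pd b y) z) (pd c y z) = - dot (pd a (pd c y) z) (pd b y z).
  rewrite (is_derive_dot_cst oU Uz (fun z Uz => gram b c Uz) (dy a b Uz) (dy a c Uz)).
  by rewrite dotC.
have : dot (pd i (pd j y) z) (pd k y z) = - dot (pd i (pd j y) z) (pd k y z).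
  by rewrite {1}T S T opprK S T S T opprK.
by move=> /eqP; rewrite -addr_eq0 -mulr2n mulrn_eq0 => /eqP.
Qed.

Lemma hformC i j z : U z -> hform y i j z = hform y j i z.
Proof. by move=> Uz; rewrite /hform (vschwarz i j oU sy Uz). Qed.

Lemma pd2_flat i j z : U z -> pd i (pd j y) z = hform y i j z *: unit_cross z.
Proof.
move=> Uz; rewrite {1}(flat_tangent Uz (christoffel0 i j 0 Uz) (christoffel0 i j 1 Uz)).
by rewrite /hform unit_normal_flat.
Qed.

Lemma smooth_unit_cross : smooth_on U unit_cross.
Proof. by apply: smooth_cross => //; smooth. Qed.

(** The Weingarten equation. As the coordinate frame is orthonormal, the matrix of the shape
    operator is the second form itself. *)
Lemma pd_unit_cross i z : U z ->
  pd i unit_cross z = - (hform y i 0 z *: pd 0 y z + hform y i 1 z *: pd 1 y z).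
Proof.
move=> Uz; have g := gram _ _ Uz.
have dn := smooth_is_derive i smooth_unit_cross Uz.
have t k : dot (pd i unit_cross z) (pd k y z) = - hform y i k z.
  rewrite (is_derive_dot_cst (k := 0) (b := pd k y) oU Uz _ dn (dy i k Uz)).
    by rewrite /hform unit_normal_flat// dotC.
  by move=> v Uv; have [->|->] := ord2 k; rewrite ?dot_crossl ?dot_crossr.
have t2 : dot (pd i unit_cross z) (unit_cross z) = 0.
  have := is_derive_dot_cst oU Uz unit_cross1 dn dn; rewrite (dotC (unit_cross z)).
  by move=> /eqP; rewrite -addr_eq0 -mulr2n mulrn_eq0 => /eqP.
rewrite {1}(orthonormal_basis (pd i unit_cross z) (g 0 0) (g 1 1) (g 0 1)).
by rewrite -/(unit_cross z) t2 scale0r addr0 !t !scaleNr opprD.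
Qed.

Lemma smooth_hform_flat i j : smooth_on U (hform y i j).
Proof. exact: smooth_hform oU sy normal_flat_neq0 i j. Qed.

(** Third derivatives of y commute. The derivative of the unit normal does not contribute: it is
    tangent, whereas the second derivatives of y are normal. *)
Lemma codazzi i j k z : U z -> pd k (hform y i j) z = pd i (hform y k j) z.
Proof.
move=> Uz.
have E a b c : pd a (hform y b c) z = dot (pd a (pd b (pd c y)) z) (unit_cross z).
  rewrite (pd_ext a oU Uz (g := fun v => dot (pd b (pd c y) v) (unit_cross v))); last first.
    by move=> v Uv; rewrite /hform unit_normal_flat.
  have d2 := smooth_is_derive a (smooth_pd b (smooth_pd c sy)) Uz.
  have dn := smooth_is_derive a smooth_unit_cross Uz.
  rewrite (is_derive_pd (is_ddot d2 dn)) pd2_flat// dotZl pd_unit_cross//.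
  by rewrite dotNr dotDr !dotZr /unit_cross dot_crossl dot_crossr !mulr0 addr0 oppr0
      mulr0 addr0.
by rewrite !E (vschwarz k i oU (smooth_pd j sy) Uz).
Qed.

Lemma mean_curvature_flat z : U z -> mean_curvature y z = (hform y 0 0 z + hform y 1 1 z) / 2.
Proof.
move=> Uz; rewrite mean_curvatureE ?normal_flat_neq0// gdet_flat// !gram//=.
by rewrite !mul1r mul0r subr0 mulr1.
Qed.

Lemma gauss_flat z : U z -> gauss_curvature y z = 0 ->
  hform y 0 0 z * hform y 1 1 z = hform y 0 1 z ^+ 2.
Proof.
move=> Uz; rewrite /gauss_curvature gdetE gdet_flat// divr1 det22 !second_formE.
by rewrite (hformC 1 0 Uz) -expr2 => /eqP; rewrite subr_eq0 => /eqP.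
Qed.

Lemma laplacian_flat (f : 'rV[R]_2 -> R) z : U z -> smooth_on U f ->
  laplacian y f z = pd 0 (pd 0 f) z + pd 1 (pd 1 f) z.
Proof.
move=> Uz sf; rewrite (laplacianE _ oU)//; last exact: normal_flat_neq0.
rewrite gdet_flat// sqrtr1 invr1 mul1r; congr (_ + _); apply: (pd_ext _ oU Uz) => v Uv.
  by rewrite /lapW0 !gram//= gdet_flat// sqrtr1 mul1r mul0r subr0 divr1.
by rewrite /lapW1 !gram//= gdet_flat// sqrtr1 mul1r mul0r subr0 divr1.
Qed.

Definition curv z := hform y 0 0 z + hform y 1 1 z.

Lemma smooth_curv : smooth_on U curv.
Proof. by have sh := smooth_hform_flat; rewrite /curv; smooth; exact: sh. Qed.

Lemma curv_harmonic z : U z ->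
  laplacian y (mean_curvature y) z = 0 -> pd 0 (pd 0 curv) z + pd 1 (pd 1 curv) z = 0.
Proof.
move=> Uz; have sc := smooth_curv.
have sm := smooth_mean_curvature oU sy normal_flat_neq0.
rewrite laplacian_flat// => H.
have E i v : U v -> pd i curv v = 2 * pd i (mean_curvature y) v.
  move=> Uv; rewrite (pd_ext i oU Uv (g := fun v => 2 * mean_curvature y v)).
    have d := is_dM (is_dC v (e_ i) (2 : R)) (smooth_is_derive i sm Uv).
    by rewrite (is_derive_pd d) mulr0 addr0.
  by move=> w Uw; rewrite mean_curvature_flat// mulrC divfK// pnatr_eq0.
have E2 i : pd i (pd i curv) z = 2 * pd i (pd i (mean_curvature y)) z.
  rewrite (pd_ext i oU Uz (E i)).
  have d := is_dM (is_dC z (e_ i) (2 : R)) (smooth_is_derive i (smooth_pd i sm) Uz).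
  by rewrite (is_derive_pd d) mulr0 addr0.
by rewrite !E2 -mulrDr H mulr0.
Qed.

End FlatPatch.

(** * The ruling of a flat patch of harmonic mean curvature *)

(** Ideal membership in certificate form: a caller supplies the multipliers [k] and [l], and [ring]
    checks the identity that remains. *)
Lemma eliminate (R : comPzRingType) (A B C k l G : R) : A = 0 -> B = 0 -> C = 0 ->
  G = C - k * B - l * A -> G = 0.
Proof. by move=> -> -> -> ->; rewrite !mulr0 !subr0. Qed.

Section Rulings.
Variables (R : realType) (V : set 'rV[R]_2) (i j : 'I_2) (L K N : 'rV[R]_2 -> R).
Hypotheses (oV : open V) (sL : smooth_on V L) (sK : smooth_on V K) (sN : smooth_on V N).
Hypothesis L0 : forall z, V z -> L z != 0.
Hypothesis gauss : forall z, V z -> L z * N z = K z ^+ 2.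
Hypothesis cod1 : forall z, V z -> pd j L z = pd i K z.
Hypothesis cod2 : forall z, V z -> pd j K z = pd i N z.
Variable lam : 'rV[R]_2 -> R.
Hypothesis lamD : forall z, lam z = L z + N z.
Hypothesis harm : forall z, V z -> pd i (pd i lam) z + pd j (pd j lam) z = 0.

(* (1, m) spans the image of the second form, (-m, 1) its kernel *)
Let m z := K z / L z.
Let a : 'rV[R]_2 -> R := pd i m.
Let b : 'rV[R]_2 -> R := pd i a.
Let c : 'rV[R]_2 -> R := pd i b.
Let d : 'rV[R]_2 -> R := pd i c.
Let l1 : 'rV[R]_2 -> R := pd i lam.
Let l2 : 'rV[R]_2 -> R := pd i l1.
Let l3 : 'rV[R]_2 -> R := pd i l2.

Let sm : smooth_on V m. Proof. by rewrite /m; smooth; exact: L0. Qed.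
Let sa : smooth_on V a. Proof. exact: smooth_pd. Qed.
Let sb : smooth_on V b. Proof. exact: smooth_pd. Qed.
Let sc : smooth_on V c. Proof. exact: smooth_pd. Qed.
Let slam : smooth_on V lam.
Proof.
apply: (smooth_ext (f := fun z => L z + N z)) => //; last by smooth.
Qed.
Let sl1 : smooth_on V l1. Proof. exact: smooth_pd. Qed.
Let sl2 : smooth_on V l2. Proof. exact: smooth_pd. Qed.

Let KE z : V z -> K z = m z * L z.
Proof. by move=> Vz; rewrite /m divfK// L0. Qed.
Let NE z : V z -> N z = m z ^+ 2 * L z.
Proof.
move=> Vz; apply: (mulfI (L0 Vz)); rewrite gauss// {1}KE//; ring.
Qed.
Let lamE z : V z -> lam z = (1 + m z ^+ 2) * L z.
Proof. by move=> Vz; rewrite lamD NE//; ring. Qed.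

Let m1 z : 1 + m z ^+ 2 != 0.
Proof. by rewrite gt_eqF// ltr_pwDl// sqr_ge0. Qed.

Let swap (f : 'rV[R]_2 -> R) z : smooth_on V f -> V z -> pd j (pd i f) z = pd i (pd j f) z.
Proof. by move=> sf Vz; exact: schwarz Vz. Qed.

Let D k (f : 'rV[R]_2 -> R) z (sf : smooth_on V f) (Vz : V z) := smooth_is_derive k sf Vz.

Let Lj z : V z -> pd j L z = a z * L z + m z * pd i L z.
Proof.
move=> Vz; rewrite cod1// (pd_ext i oV Vz KE).
by rewrite (is_derive_pd (is_dM (D i sm Vz) (D i sL Vz))) addrC mulrC.
Qed.

(** The derivative of m along the kernel (-m, 1) is zero: the kernel direction is constant along its
    own integral curves, so these are straight lines, the rulings. *)
Let mj z : V z -> pd j m z = m z * a z.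
Proof.
move=> Vz; apply: (mulIf (L0 Vz)).
have := cod2 Vz; rewrite (pd_ext j oV Vz KE) (pd_ext i oV Vz NE).
rewrite (is_derive_pd (is_dM (D j sm Vz) (D j sL Vz))).
rewrite (is_derive_pd (is_dM (is_dX 2 (D i sm Vz)) (D i sL Vz))) Lj//= -/(a z).
move: (pd j m z) (pd i L z) (L z) (m z) (a z) => mj Li L' m' a' H.
by apply/eqP; rewrite -subr_eq0; move/eqP: H; rewrite -subr_eq0 => /eqP H; apply/eqP;
  rewrite -[RHS]H; ring.
Qed.

(** This is d_j lam = d_i (m lam). Together with [mj] it removes every derivative in direction j,
    leaving only the derivatives of m and lam in direction i. *)
Let lamj z : V z -> pd j lam z = a z * lam z + m z * l1 z.
Proof.
move=> Vz; rewrite (pd_ext j oV Vz lamE) /l1 (pd_ext i oV Vz lamE) lamE//.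
have X k := is_derive_pd (is_dM (is_dD (is_dC z (e_ k) (1 : R)) (is_dX 2 (D k sm Vz))) (D
    k sL Vz)).
by rewrite !X Lj// mj//= -/(a z); ring.
Qed.

(** This and the next identities are the successive derivatives of [mj] and [lamj] in direction i,
    with the order of differentiation exchanged. *)
Let aj z : V z -> pd j a z = a z ^+ 2 + m z * b z.
Proof.
move=> Vz; rewrite /a swap// (pd_ext i oV Vz mj).
by rewrite (is_derive_pd (is_dM (D i sm Vz) (D i sa Vz))) -/(a z) -/(b z); ring.
Qed.

Let bj z : V z -> pd j b z = 3 * (a z * b z) + m z * c z.
Proof.
move=> Vz; rewrite /b swap// (pd_ext i oV Vz aj).
have X := is_dD (is_dX 2 (D i sa Vz)) (is_dM (D i sm Vz) (D i sb Vz)).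
by rewrite (is_derive_pd X) /= -/(a z) -/(b z) -/(c z); ring.
Qed.

Let cj z : V z -> pd j c z = 3 * b z ^+ 2 + 4 * (a z * c z) + m z * d z.
Proof.
move=> Vz; rewrite /c swap// (pd_ext i oV Vz bj).
have X := is_dD (is_dM (is_dC z (e_ i) (3 : R)) (is_dM (D i sa Vz) (D i sb Vz)))
  (is_dM (D i sm Vz) (D i sc Vz)).
by rewrite (is_derive_pd X) /= -/(a z) -/(b z) -/(c z) -/(d z); ring.
Qed.

Let l1j z : V z -> pd j l1 z = b z * lam z + 2 * (a z * l1 z) + m z * l2 z.
Proof.
move=> Vz; rewrite /l1 swap// (pd_ext i oV Vz lamj).
have X := is_dD (is_dM (D i sa Vz) (D i slam Vz)) (is_dM (D i sm Vz) (D i sl1 Vz)).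
by rewrite (is_derive_pd X) /= -/(a z) -/(b z) -/(l1 z) -/(l2 z); ring.
Qed.

Let l2j z : V z -> pd j l2 z =
  c z * lam z + 3 * (b z * l1 z) + 3 * (a z * l2 z) + m z * l3 z.
Proof.
move=> Vz; rewrite /l2 swap// (pd_ext i oV Vz l1j).
have X := is_dD (is_dD (is_dM (D i sb Vz) (D i slam Vz))
   (is_dM (is_dC z (e_ i) (2 : R)) (is_dM (D i sa Vz) (D i sl1 Vz))))
   (is_dM (D i sm Vz) (D i sl2 Vz)).
by rewrite (is_derive_pd X) /= -/(a z) -/(b z) -/(c z) -/(l1 z) -/(l2 z) -/(l3 z); ring.
Qed.

(** The Laplace equation for lam after the elimination of the derivatives in direction j. *)
Let Y z := (1 + m z ^+ 2) * l2 z + 4 * (a z * (m z * l1 z)) +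
  2 * ((a z ^+ 2 + m z * b z) * lam z).

Let Y0 z : V z -> Y z = 0.
Proof.
move=> Vz; rewrite -(harm Vz) /Y -/l1 -/(l2 z) (pd_ext j oV Vz lamj).
have X := is_dD (is_dM (D j sa Vz) (D j slam Vz)) (is_dM (D j sm Vz) (D j sl1 Vz)).
by rewrite (is_derive_pd X) aj// mj// lamj// l1j//; ring.
Qed.

Let pd_zero (F : 'rV[R]_2 -> R) k z : (forall v, V v -> F v = 0) -> V z -> pd k F z = 0.
Proof.
move=> F0 Vz; rewrite (pd_ext k oV Vz F0); exact: is_derive_pd (is_dC _ _ _).
Qed.

(** The first prolongation, d_j Y - m d_i Y - 3 a Y. Differentiating along the ruling cancels the
    third derivative of lam, and the multiple of Y cancels the second one. *)
Let Z z := 3 * ((1 + m z ^+ 2) * (b z * l1 z)) +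
  ((1 + m z ^+ 2) * c z + 6 * (a z * (b z * m z))) * lam z.

Let Z0 z : V z -> Z z = 0.
Proof.
move=> Vz.
have X k := is_derive_pd (is_dD (is_dD
   (is_dM (is_dD (is_dC z (e_ k) (1 : R)) (is_dX 2 (D k sm Vz))) (D k sl2 Vz))
   (is_dM (is_dC z (e_ k) (4 : R)) (is_dM (D k sa Vz) (is_dM (D k sm Vz) (D k sl1 Vz)))))
   (is_dM (is_dC z (e_ k) (2 : R)) (is_dM (is_dD (is_dX 2 (D k sa Vz))
      (is_dM (D k sm Vz) (D k sb Vz))) (D k slam Vz)))).
have Xi := etrans (esym (X i)) (pd_zero i Y0 Vz).
have Xj := etrans (esym (X j)) (pd_zero j Y0 Vz).
rewrite /= in Xi Xj.
move: Xi Xj; rewrite (mj Vz) (aj Vz) (bj Vz) (lamj Vz) (l1j Vz) (l2j Vz).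
have := Y0 Vz; rewrite /Y /Z.
rewrite -/(a z) -/(b z) -/(c z) -/(l1 z) -/(l2 z) -/(l3 z).
move: (m z) (a z) (b z) (c z) (lam z) (l1 z) (l2 z) (l3 z) => m' a' b' c' l l1' l2' l3'.
move=> HY Hi Hj.
by apply: (eliminate (k := m') (l := 3 * a') HY Hi Hj); ring.
Qed.

(** The second prolongation d_j Z - m d_i Z - 5 a Z equals 6 (1 + m^2) b^2 lam, whose other factors
    are nonzero. With b = 0 the slope m is affine in direction i, so the rulings are parallel or
    concurrent; this is where tangent developables are excluded. *)
Lemma ruling_b0 z : V z -> b z = 0.
Proof.
move=> Vz.
have X k := is_derive_pd (is_dD
   (is_dM (is_dC z (e_ k) (3 : R)) (is_dM (is_dD (is_dC z (e_ k) (1 : R))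
      (is_dX 2 (D k sm Vz))) (is_dM (D k sb Vz) (D k sl1 Vz))))
   (is_dM (is_dD (is_dM (is_dD (is_dC z (e_ k) (1 : R)) (is_dX 2 (D k sm Vz))) (D k sc Vz))
      (is_dM (is_dC z (e_ k) (6 : R)) (is_dM (D k sa Vz) (is_dM (D k sb Vz) (D k sm Vz)))))
     (D k slam Vz))).
have Xi := etrans (esym (X i)) (pd_zero i Z0 Vz).
have Xj := etrans (esym (X j)) (pd_zero j Z0 Vz).
rewrite /= in Xi Xj.
move: Xi Xj; rewrite (mj Vz) (aj Vz) (bj Vz) (cj Vz) (lamj Vz) (l1j Vz).
have := Z0 Vz; rewrite /Z.
rewrite -/(a z) -/(b z) -/(c z) -/(d z) -/(l1 z) -/(l2 z).
have lz : lam z != 0 by rewrite lamE// mulf_neq0 ?m1 ?L0.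
move: (m1 z) lz.
move: (m z) (a z) (b z) (c z) (d z) (lam z) (l1 z) (l2 z) => m' a' b' c' d' l l1' l2'.
move=> M0 l0 HZ Hi Hj.
have : 6 * ((1 + m' ^+ 2) * b' ^+ 2 * l) = 0.
  by apply: (eliminate (k := m') (l := 5 * a') HZ Hi Hj); ring.
move/eqP; rewrite !mulf_eq0 pnatr_eq0 (negbTE M0) (negbTE l0) /= orbF orbb.
by move/eqP.
Qed.

(** By [PE] and [QE] this is a (-m, 1) / (1 + m^2), a vector along the ruling. The expression in L,
    K, N and lam is preferred because exchanging i with j and L with N only exchanges P and Q; it
    keeps its meaning wherever lam is nonzero. *)
Let P z := (N z * pd i lam z - K z * pd j lam z) / lam z ^+ 2.
Let Q z := (L z * pd j lam z - K z * pd i lam z) / lam z ^+ 2.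

Let PE z : V z -> P z = - (a z * m z) / (1 + m z ^+ 2).
Proof.
move=> Vz; rewrite /P lamj// NE// KE// -/(l1 z) lamE//.
have l0 := L0 Vz; have := m1 z; move: (m z) (L z) (a z) (l1 z) l0 => m' L' a' l L'0 m'0.
by field; rewrite m'0 L'0.
Qed.

Let QE z : V z -> Q z = a z / (1 + m z ^+ 2).
Proof.
move=> Vz; rewrite /Q lamj// KE// -/(l1 z) lamE//.
have l0 := L0 Vz; have := m1 z; move: (m z) (L z) (a z) (l1 z) l0 => m' L' a' l L'0 m'0.
by field; rewrite m'0 L'0.
Qed.

(** In complex notation, with pi = P - i Q and Lambda the first partial derivative of lam minus i
    times the second, the equations read d pi = pi^2 d zeta and d Lambda = 2 pi Lambda d zeta. When
    pi is nonzero, the last identity expresses that lam is inversely proportional to the distance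
    from the focal point along each ruling. *)
Lemma ruling_field z : V z -> [/\ lam z != 0,
  [/\ pd i P z = P z ^+ 2 - Q z ^+ 2, pd j P z = 2 * (P z * Q z),
      pd i Q z = 2 * (P z * Q z) & pd j Q z = Q z ^+ 2 - P z ^+ 2],
  pd i (pd i lam) z = 2 * (P z * pd i lam z - Q z * pd j lam z),
  pd j (pd i lam) z = 2 * (P z * pd j lam z + Q z * pd i lam z) &
  P z * pd i lam z + Q z * pd j lam z = (P z ^+ 2 + Q z ^+ 2) * lam z].
Proof.
move=> Vz.
have dP k := is_derive_pd (is_dM (is_dN (is_dM (D k sa Vz) (D k sm Vz)))
   (is_dV (F := fun z => 1 + m z ^+ 2) (m1 z) (is_dD (is_dC z (e_ k) (1 : R)) (is_dX 2 (D
       k sm Vz))))).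
have dQ k := is_derive_pd (is_dM (D k sa Vz)
   (is_dV (F := fun z => 1 + m z ^+ 2) (m1 z) (is_dD (is_dC z (e_ k) (1 : R)) (is_dX 2 (D
       k sm Vz))))).
have ePi := etrans (pd_ext i oV Vz PE) (dP i).
have ePj := etrans (pd_ext j oV Vz PE) (dP j).
have eQi := etrans (pd_ext i oV Vz QE) (dQ i).
have eQj := etrans (pd_ext j oV Vz QE) (dQ j).
rewrite /= in ePi ePj eQi eQj.
rewrite ePi ePj eQi eQj (PE Vz) (QE Vz) (mj Vz) (aj Vz) (lamj Vz).
rewrite -/l1 (l1j Vz) -/(a z) -/(b z) -/(l2 z) (ruling_b0 Vz).
have lz : lam z != 0 by rewrite lamE// mulf_neq0 ?m1 ?L0.
have HY := Y0 Vz; rewrite /Y (ruling_b0 Vz) in HY.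
have L2 : l2 z = - (4 * (a z * (m z * l1 z)) + 2 * (a z ^+ 2 * lam z)) / (1 + m z ^+ 2).
  apply: (mulfI (m1 z)); rewrite mulrCA mulfV// mulr1.
  by apply/eqP; rewrite -subr_eq0; apply/eqP; rewrite -[RHS]HY; ring.
rewrite L2; move: (m1 z); move: (m z) (a z) (lam z) (l1 z) lz => m' a' l l1' l0 M0.
split => //; try by field.
by split; field.
Qed.

End Rulings.

(** * Continuation of the ruling field across the zeros of the trace *)

Section Continuation.
Variables (R : realType) (p : 'rV[R]_2) (r : R) (L K N : 'rV[R]_2 -> R).
Let B := ball p r.
Hypotheses (sL : smooth_on B L) (sK : smooth_on B K) (sN : smooth_on B N).
Hypothesis gauss : forall z, B z -> L z * N z = K z ^+ 2.
Hypothesis cod1 : forall z, B z -> pd 1 L z = pd 0 K z.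
Hypothesis cod2 : forall z, B z -> pd 1 K z = pd 0 N z.
Let lam z := L z + N z.
Hypothesis harm : forall z, B z -> pd 0 (pd 0 lam) z + pd 1 (pd 1 lam) z = 0.

Let lu : 'rV[R]_2 -> R := pd 0 lam.
Let lv : 'rV[R]_2 -> R := pd 1 lam.
Let oB : open B. Proof. exact: ball_open. Qed.
Let slam : smooth_on B lam. Proof. by rewrite /lam; smooth. Qed.
Let slu : smooth_on B lu. Proof. exact: smooth_pd. Qed.
Let slv : smooth_on B lv. Proof. exact: smooth_pd. Qed.
Let luv z : B z -> pd 0 lv z = pd 1 lu z.
Proof. by move=> Bz; exact: (schwarz 0 1 oB slam Bz). Qed.
Let lvv z : B z -> pd 1 lv z = - pd 0 lu z.
Proof. by move=> Bz; apply/eqP; rewrite -addr_eq0 addrC harm. Qed.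

Let P1 z := (N z * lu z - K z * lv z) / lam z ^+ 2.
Let Q1 z := (L z * lv z - K z * lu z) / lam z ^+ 2.
(** Obtained by solving for P and Q the two equations of [ruling_field] that give the second
    derivatives of lam; the determinant involves only the gradient of lam. *)
Let P2 z := (pd 0 lu z * lu z + pd 1 lu z * lv z) / (2 * (lu z ^+ 2 + lv z ^+ 2)).
Let Q2 z := (pd 1 lu z * lu z - pd 0 lu z * lv z) / (2 * (lu z ^+ 2 + lv z ^+ 2)).
(* [P1, Q1] and [P2, Q2] agree where both are defined, so (P, Q) is smooth
   across the zeros of [lam] at which its gradient does not vanish *)
Let P z := if lam z != 0 then P1 z else P2 z.
Let Q z := if lam z != 0 then Q1 z else Q2 z.

Let field_at (P Q : 'rV[R]_2 -> R) z := [/\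
  [/\ pd 0 P z = P z ^+ 2 - Q z ^+ 2, pd 1 P z = 2 * (P z * Q z),
      pd 0 Q z = 2 * (P z * Q z) & pd 1 Q z = Q z ^+ 2 - P z ^+ 2],
  pd 0 lu z = 2 * (P z * lu z - Q z * lv z),
  pd 1 lu z = 2 * (P z * lv z + Q z * lu z) &
  P z * lu z + Q z * lv z = (P z ^+ 2 + Q z ^+ 2) * lam z].

Let open_neq0 (f : 'rV[R]_2 -> R) : smooth_on B f -> open [set z | B z /\ f z != 0].
Proof.
move=> sf; rewrite openE => z [Bz fz].
have sf2 : smooth_on B (fun z => f z ^+ 2) by smooth.
have f20 : 0 < f z ^+ 2 by rewrite lt_def sqr_ge0 sqrf_eq0 fz.
have [d d0 dB] := smooth_pos_ball oB sf2 Bz f20.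
apply/nbhs_ballP; exists d => // w /dB[Bw]; split => //.
by apply: contraTneq b => ->; rewrite expr0n ltxx.
Qed.

(** If L vanishes at z, then N does not, because lam = L + N is nonzero there. In that case
    [ruling_field] is used with the two coordinates exchanged, and harmonicity converts the second
    derivatives back. *)
Let field1 z : B z -> lam z != 0 -> field_at P1 Q1 z.
Proof.
move=> Bz lz.
have [L0|L0] := eqVneq (L z) 0.
  have N0 : N z != 0 by move: lz; rewrite /lam L0 add0r.
  pose V := [set z | B z /\ N z != 0].
  have VB : V `<=` B by move=> w [].
  have := @ruling_field R V 1 0 N K L (open_neq0 sN) (smooth_subset VB sN)
    (smooth_subset VB sK) (smooth_subset VB sL) (fun w (h : V w) => h.2).
  move=> /(_ _ _ _ lam _ _ z (conj Bz N0))[|||||_ [h1 h2 h3 h4] h5 h6 h7].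
  - by move=> w [Bw _]; rewrite mulrC gauss.
  - by move=> w [Bw _]; rewrite cod2.
  - by move=> w [Bw _]; rewrite cod1.
  - by move=> w; rewrite addrC.
  - by move=> w [Bw _]; rewrite addrC harm.
  have k2 : pd 0 Q1 z = 2 * (Q1 z * P1 z) := h2.
  have k3 : pd 1 P1 z = 2 * (Q1 z * P1 z) := h3.
  have k5 : pd 1 lv z = 2 * (Q1 z * lv z - P1 z * lu z) := h5.
  have k6 : pd 0 lv z = 2 * (Q1 z * lu z + P1 z * lv z) := h6.
  have k7 : Q1 z * lv z + P1 z * lu z = (Q1 z ^+ 2 + P1 z ^+ 2) * lam z := h7.
  split.
  + by split; [exact: h4|rewrite k3; ring|rewrite k2; ring|exact: h1].
  + apply: oppr_inj; rewrite -lvv// k5.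
    by move: (P1 z) (Q1 z) (lu z) (lv z) => a b c d; ring.
  + by rewrite -luv// k6; ring.
  + by rewrite addrC k7 addrC.
pose V := [set z | B z /\ L z != 0].
have VB : V `<=` B by move=> w [].
have := @ruling_field R V 0 1 L K N (open_neq0 sL) (smooth_subset VB sL)
  (smooth_subset VB sK) (smooth_subset VB sN) (fun w (h : V w) => h.2).
move=> /(_ _ _ _ lam _ _ z (conj Bz L0))[|||||_ h1 h2 h3 h4].
- by move=> w [Bw _]; rewrite gauss.
- by move=> w [Bw _]; rewrite cod1.
- by move=> w [Bw _]; rewrite cod2.
- by [].
- by move=> w [Bw _]; exact: harm.
by split.
Qed.

Let Om := [set z | B z /\ lam z ^+ 2 + lu z ^+ 2 + lv z ^+ 2 != 0].

Let oOm : open Om.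
Proof. by apply: open_neq0; smooth. Qed.

Let OmP z : B z -> Om z <-> lam z != 0 \/ lu z ^+ 2 + lv z ^+ 2 != 0.
Proof.
move=> Bz; split=> [[_]|H].
  have [->|l0] := eqVneq (lam z) 0; last by left.
  by rewrite expr0n add0r; right.
split => //; rewrite -addrA paddr_eq0 ?sqr_ge0 ?addr_ge0 ?sqr_ge0// sqrf_eq0 negb_and.
by case: H => ->; rewrite ?orbT.
Qed.

Let same z : B z -> lam z != 0 -> lu z ^+ 2 + lv z ^+ 2 != 0 -> P1 z = P2 z /\ Q1 z = Q2 z.
Proof.
move=> Bz lz gz; have [_ h1 h2 _] := field1 Bz lz.
rewrite /P2 /Q2 h1 h2; move: (P1 z) (Q1 z) (lu z) (lv z) gz => a b c d gz.
by split; field.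
Qed.

Let PQ_smooth : smooth_on Om P /\ smooth_on Om Q.
Proof.
have near1 z : B z -> lam z != 0 -> exists V, [/\ open V, V z & forall w,
    V w -> B w /\ lam w != 0].
  by move=> Bz lz; exists [set w | B w /\ lam w != 0]; split => //; exact: open_neq0.
have near2 z : B z -> lu z ^+ 2 + lv z ^+ 2 != 0 -> exists V, [/\ open V, V z &
    forall w, V w -> B w /\ lu w ^+ 2 + lv w ^+ 2 != 0].
  move=> Bz gz; exists [set w | B w /\ lu w ^+ 2 + lv w ^+ 2 != 0]; split => //.
  by apply: open_neq0; smooth.
have E1 w : lam w != 0 -> P w = P1 w /\ Q w = Q1 w by rewrite /P /Q => ->.
have E2 w : B w -> lu w ^+ 2 + lv w ^+ 2 != 0 -> P w = P2 w /\ Q w = Q2 w.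
  by move=> Bw gw; rewrite /P /Q; case: ifPn => // lw; exact: same.
split; apply: smooth_local => z [Bz Oz].
- have /OmP := conj Bz Oz => /(_ Bz)[lz|gz].
    have [V [oV Vz VB]] := near1 z Bz lz; exists V; split => //.
    have VB' : V `<=` B by move=> w /VB[].
    apply: (smooth_ext (f := P1)) => //; first by move=> w /VB[_ /E1[->]].
    have [? ? ? ? ?] := And5 (smooth_subset VB' sN) (smooth_subset VB' slu)
      (smooth_subset VB' sK) (smooth_subset VB' slv) (smooth_subset VB' slam).
    by rewrite /P1; smooth => w /VB[_ lw]; rewrite expf_neq0.
  have [V [oV Vz VB]] := near2 z Bz gz; exists V; split => //.
  have VB' : V `<=` B by move=> w /VB[].
  apply: (smooth_ext (f := P2)) => //; first by move=> w /VB[Bw gw]; have [-> _] := E2 w Bw gw.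
  have [? ?] := conj (smooth_subset VB' slu) (smooth_subset VB' slv).
  by rewrite /P2; smooth => w /VB[_ gw]; rewrite mulf_neq0// pnatr_eq0.
- have /OmP := conj Bz Oz => /(_ Bz)[lz|gz].
    have [V [oV Vz VB]] := near1 z Bz lz; exists V; split => //.
    have VB' : V `<=` B by move=> w /VB[].
    apply: (smooth_ext (f := Q1)) => //; first by move=> w /VB[_ /E1[_ ->]].
    have [? ? ? ? ?] := And5 (smooth_subset VB' sL) (smooth_subset VB' slu)
      (smooth_subset VB' sK) (smooth_subset VB' slv) (smooth_subset VB' slam).
    by rewrite /Q1; smooth => w /VB[_ lw]; rewrite expf_neq0.
  have [V [oV Vz VB]] := near2 z Bz gz; exists V; split => //.
  have VB' : V `<=` B by move=> w /VB[].
  apply: (smooth_ext (f := Q2)) => //; first by move=> w /VB[Bw gw]; have [_ ->] := E2 w Bw gw.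
  have [? ?] := conj (smooth_subset VB' slu) (smooth_subset VB' slv).
  by rewrite /Q2; smooth => w /VB[_ gw]; rewrite mulf_neq0// pnatr_eq0.
Qed.

Let sP : smooth_on Om P. Proof. by have [] := PQ_smooth. Qed.
Let sQ : smooth_on Om Q. Proof. by have [] := PQ_smooth. Qed.

(** The zeros of lam have no interior in [Om]: on a ball where lam vanishes, its gradient vanishes
    too. Identities between smooth functions therefore extend from lam nonzero to all of [Om]. *)
Let dense (F : 'rV[R]_2 -> R) z : smooth_on Om F -> Om z ->
  (forall w, Om w -> lam w != 0 -> F w = 0) -> F z = 0.
Proof.
move=> sF Oz HF; apply/eqP/negPn/negP => Fz; have [Bz _] := Oz.
have sF2 : smooth_on Om (fun z => F z ^+ 2) by smooth.
have F20 : 0 < F z ^+ 2 by rewrite lt_def sqr_ge0 sqrf_eq0 Fz.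
have [d d0 dO] := smooth_pos_ball oOm sF2 Oz F20.
have l0 w : ball z d w -> lam w = 0.
  move=> /dO[Ow Fw]; apply/eqP/negPn/negP => lw.
  by move: Fw; rewrite HF// expr0n ltxx.
have zd : ball z d z by apply/rVballP; rewrite subrr normr0.
have g0 k : pd k lam z = 0.
  rewrite (pd_ext k (ball_open z d) zd l0); exact: is_derive_pd (is_dC _ _ _).
by have [_] := Oz; rewrite /lu /lv !g0 (l0 z zd) expr0n !addr0 eqxx.
Qed.

Let OmB : Om `<=` B. Proof. by move=> z []. Qed.

Let field z : Om z -> field_at P Q z.
Proof.
have F w : Om w -> lam w != 0 -> field_at P Q w.
  move=> [Bw _] lw; have [[h1 h2 h3 h4] h5 h6 h7] := field1 Bw lw.
  have oV := open_neq0 slam; have Vw : [set z | B z /\ lam z != 0] w by [].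
  have EP v : [set z | B z /\ lam z != 0] v -> P v = P1 v by move=> [_ lv0]; rewrite /P lv0.
  have EQ v : [set z | B z /\ lam z != 0] v -> Q v = Q1 v by move=> [_ lv0]; rewrite /Q lv0.
  rewrite /field_at !(pd_ext _ oV Vw EP) !(pd_ext _ oV Vw EQ) EP// EQ//.
have [? ? ?] := And3 (smooth_subset OmB slam) (smooth_subset OmB slu) (smooth_subset OmB slv).
have z0 (F1 F2 : 'rV[R]_2 -> R) : smooth_on Om F1 -> smooth_on Om F2 ->
    (forall w, Om w -> lam w != 0 -> F1 w = F2 w) -> forall z, Om z -> F1 z = F2 z.
  move=> s1 s2 H w Ow; apply/eqP; rewrite -subr_eq0; apply/eqP.
  apply: (dense (F := fun w => F1 w - F2 w)) => //; first by smooth.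
  by move=> v Ov lv0; rewrite H// subrr.
move=> Oz; split; [split| | |].
- apply: (z0 (pd 0 P) (fun z => P z ^+ 2 - Q z ^+ 2)) => //; [by smooth|by smooth|].
  by move=> w Ow lw; have [[]] := F w Ow lw.
- apply: (z0 (pd 1 P) (fun z => 2 * (P z * Q z))) => //; [by smooth|by smooth|].
  by move=> w Ow lw; have [[]] := F w Ow lw.
- apply: (z0 (pd 0 Q) (fun z => 2 * (P z * Q z))) => //; [by smooth|by smooth|].
  by move=> w Ow lw; have [[]] := F w Ow lw.
- apply: (z0 (pd 1 Q) (fun z => Q z ^+ 2 - P z ^+ 2)) => //; [by smooth|by smooth|].
  by move=> w Ow lw; have [[]] := F w Ow lw.
- apply: (z0 (pd 0 lu) (fun z => 2 * (P z * lu z - Q z * lv z))) => //; [by smooth|by smooth|].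
  by move=> w Ow lw; have [] := F w Ow lw.
- apply: (z0 (pd 1 lu) (fun z => 2 * (P z * lv z + Q z * lu z))) => //; [by smooth|by smooth|].
  by move=> w Ow lw; have [] := F w Ow lw.
- apply: (z0 (fun z => P z * lu z + Q z * lv z) (fun z => (P z ^+ 2 + Q z ^+ 2) * lam z))
    => //; [by smooth|by smooth|].
  by move=> w Ow lw; have [] := F w Ow lw.
Qed.

Let adherent (F : 'rV[R]_2 -> R) (A : set 'rV[R]_2) z k : {for z, continuous F} ->
  (forall e, 0 < e -> exists2 w, ball z e w & A w) -> (forall w, A w -> F w = k) -> F z = k.
Proof.
move=> /continuous_epsP cF adh FA; apply/eqP; rewrite -subr_eq0 -normr_le0.
apply/ler_addgt0Pl => e e0; rewrite addr0; have [d d0 dB] := cF e e0.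
by have [w wd Aw] := adh d d0; rewrite -(FA w Aw) ltW// dB.
Qed.

Section Base.
Variable z1 : 'rV[R]_2.
Hypothesis Oz1 : Om z1.
Let p1 := P z1.
Let q1 := Q z1.
Let x (z : 'rV[R]_2) := z 0 0 - z1 0 0.
Let y (z : 'rV[R]_2) := z 0 1 - z1 0 1.
(* with pi = P - i Q and zeta = x + i y, the solution of d pi = pi^2 d zeta is
   pi (1 - pi1 zeta) = pi1, where u + i w = 1 - pi1 zeta; [lam * D] is then
   affine *)
Let u z := 1 - (p1 * x z + q1 * y z).
Let w z := q1 * x z - p1 * y z.
Let D z := u z ^+ 2 + w z ^+ 2.
Let NP z := u z * p1 - w z * q1.
Let NQ z := w z * p1 + u z * q1.
Let gu := lu z1 - 2 * (lam z1 * p1).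
Let gv := lv z1 - 2 * (lam z1 * q1).
(** [Fu] and [Fv] are the partial derivatives of [D * lam]: the gradient of [D] is -2 times the
    vector ([NP], [NQ]). Since [D] is 1 at [z1], their values there are [gu] and [gv]. *)
Let Fu z := D z * lu z - 2 * (lam z * NP z).
Let Fv z := D z * lv z - 2 * (lam z * NQ z).
Let Fn z := D z * lam z - (gu * x z + gv * y z).

(** The points at which the explicit solution through [z1] is valid: the formula for pi, and
    [D * lam] affine together with its gradient. It is shown to be open and closed in the disc. *)
Let A := [set z | Om z /\ [/\ u z * P z + w z * Q z = p1, u z * Q z - w z * P z = q1,
  Fu z = gu, Fv z = gv & Fn z = lam z1]].

Let sx U : open U -> smooth_on U x. Proof. by move=> oU; rewrite /x; smooth. Qed.
Let sy U : open U -> smooth_on U y. Proof. by move=> oU; rewrite /y; smooth. Qed.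
Let su U : open U -> smooth_on U u.
Proof. by move=> oU; have := sx oU; have := sy oU => ? ?; rewrite /u; smooth. Qed.
Let sw U : open U -> smooth_on U w.
Proof. by move=> oU; have := sx oU; have := sy oU => ? ?; rewrite /w; smooth. Qed.

Let z1A : A z1.
Proof.
split => //; rewrite /Fu /Fv /Fn /D /NP /NQ /u /w /x /y !subrr -/p1 -/q1 /gu /gv.
by split; ring.
Qed.

Let sF : [/\ smooth_on B Fu, smooth_on B Fv & smooth_on B Fn].
Proof.
have [h1 h2 h3 h4] := And4 (sx oB) (sy oB) (su oB) (sw oB).
by rewrite /Fu /Fv /Fn /D /NP /NQ; split; smooth.
Qed.

(** The difficulty is that a limit point might leave [Om], where P and Q are not controlled. But if
    lam and its gradient vanished there, then [gu], [gv] and [lam z1] would be zero, and lam and its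
    gradient would vanish at [z1] as well. *)
Let A_closed z : B z -> (forall e, 0 < e -> exists2 x, ball z e x & A x) -> A z.
Proof.
move=> Bz adh; have [sFu sFv sFn] := sF.
have eu : Fu z = gu.
  by apply: (adherent (smooth_continuous sFu Bz) adh) => v [_ []].
have ev : Fv z = gv.
  by apply: (adherent (smooth_continuous sFv Bz) adh) => v [_ []].
have en : Fn z = lam z1.
  by apply: (adherent (smooth_continuous sFn Bz) adh) => v [_ []].
have Oz : Om z.
  apply/(OmP Bz); apply: contrapT => /not_orP[/negP/negPn/eqP l0 /negP/negPn].
  rewrite paddr_eq0 ?sqr_ge0// !sqrf_eq0 => /andP[/eqP u0 /eqP v0].
  have gu0 : gu = 0 by rewrite -eu /Fu l0 u0; ring.
  have gv0 : gv = 0 by rewrite -ev /Fv l0 v0; ring.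
  have l10 : lam z1 = 0 by rewrite -en /Fn l0 gu0 gv0; ring.
  have [_] := Oz1; rewrite l10.
  have -> : lu z1 = 0 by move: gu0; rewrite /gu l10 mul0r mulr0 subr0.
  have -> : lv z1 = 0 by move: gv0; rewrite /gv l10 mul0r mulr0 subr0.
  by rewrite expr0n !addr0 eqxx.
split => //; split => //.
- have h1 := su oOm; have h2 := sw oOm.
  have s1 : smooth_on Om (fun z => u z * P z + w z * Q z) by smooth.
  by apply: (adherent (smooth_continuous s1 Oz) adh) => v [_ []].
- have h1 := su oOm; have h2 := sw oOm.
  have s1 : smooth_on Om (fun z => u z * Q z - w z * P z) by smooth.
  by apply: (adherent (smooth_continuous s1 Oz) adh) => v [_ []].
Qed.

Let Dx z i : is_derive z (e_ i) x (i == 0)%:R.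
Proof.
apply: is_derive_eq (is_dD (is_dcoord 0 (is_derive_id z (e_ i))) (is_dC z (e_ i) (- z1 0 0))) _.
by rewrite addr0 mxE eqxx eq_sym.
Qed.
Let Dy z i : is_derive z (e_ i) y (i == 1)%:R.
Proof.
apply: is_derive_eq (is_dD (is_dcoord 1 (is_derive_id z (e_ i))) (is_dC z (e_ i) (- z1 0 1))) _.
by rewrite addr0 mxE eqxx eq_sym.
Qed.
Let Du z i : is_derive z (e_ i) u (- (p1 * (i == 0)%:R + q1 * (i == 1)%:R)).
Proof.
apply: is_derive_eq (is_dD (is_dC z (e_ i) (1 : R)) (is_dN (is_dD
  (is_dM (is_dC z (e_ i) p1) (Dx z i)) (is_dM (is_dC z (e_ i) q1) (Dy z i))))) _.
by rewrite !mulr0 !addr0 add0r.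
Qed.
Let Dw z i : is_derive z (e_ i) w (q1 * (i == 0)%:R - p1 * (i == 1)%:R).
Proof.
apply: is_derive_eq (is_dD
  (is_dM (is_dC z (e_ i) q1) (Dx z i)) (is_dN (is_dM (is_dC z (e_ i) p1) (Dy z i)))) _.
by rewrite !mulr0 !addr0.
Qed.
Let DD z i : is_derive z (e_ i) D (- (2 * (NP z * (i == 0)%:R + NQ z * (i == 1)%:R))).
Proof.
apply: is_derive_eq (is_dD (is_dX 2 (Du z i)) (is_dX 2 (Dw z i))) _.
by rewrite /NP /NQ /=; ring.
Qed.
Let DNP z i : is_derive z (e_ i) NP (- ((p1 ^+ 2 + q1 ^+ 2) * (i == 0)%:R)).
Proof.
apply: is_derive_eq (is_dD (is_dM (Du z i) (is_dC z (e_ i) p1))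
  (is_dN (is_dM (Dw z i) (is_dC z (e_ i) q1)))) _.
by rewrite /=; ring.
Qed.
Let DNQ z i : is_derive z (e_ i) NQ (- ((p1 ^+ 2 + q1 ^+ 2) * (i == 1)%:R)).
Proof.
apply: is_derive_eq (is_dD (is_dM (Dw z i) (is_dC z (e_ i) p1))
  (is_dM (Du z i) (is_dC z (e_ i) q1))) _.
by rewrite /=; ring.
Qed.

(** c + i e is 1 + pi zeta, and [C2] the square of its modulus. The quotient pi / (1 + pi zeta) is
    the value at [z1] of the solution that takes the value pi at z. *)
Let c z := 1 + (P z * x z + Q z * y z).
Let e z := P z * y z - Q z * x z.
Let C2 z := c z ^+ 2 + e z ^+ 2.

(** The value transported back to [z1], with real part [K0] and imaginary part - [K1], has zero
    derivative by the differential equation, so it keeps its value near a point of [A]. The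
    constancy of [Fu] and [Fv], and then of [Fn], follows from the equations for lam. *)
Let A_open : open A.
Proof.
rewrite openE => z0 [Oz0 [h1 h2 h3 h4 h5]].
have [x1 y1 u1 w1] := And4 (sx oOm) (sy oOm) (su oOm) (sw oOm).
have sc : smooth_on Om c by rewrite /c; smooth.
have se : smooth_on Om e by rewrite /e; smooth.
have sC : smooth_on Om C2 by rewrite /C2; smooth.
(* The real part of (1 - pi1 zeta)(1 + pi zeta) = 1, which shows that 1 + pi zeta does not vanish at
   [z0]. *)
have uc : u z0 * c z0 - w z0 * e z0 = 1.
  move: h1 h2; rewrite /u /w /c /e; move: (P z0) (Q z0) (x z0) (y z0) => P0 Q0 X0 Y0 h1 h2.
  apply/eqP; rewrite -subr_eq0; apply/eqP.
  apply: (eliminate (k := X0) (l := - Y0) (A := (1 - (p1 * X0 + q1 * Y0)) * Q0 - (q1 * X0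
      - p1 * Y0) * P0 - q1)
    (B := - ((1 - (p1 * X0 + q1 * Y0)) * P0 + (q1 * X0 - p1 * Y0) * Q0 - p1)) (C := 0)) => //.
  - by rewrite h2 subrr.
  - by rewrite h1 subrr oppr0.
  - by ring.
have C20 : 0 < C2 z0.
  rewrite lt_def addr_ge0 ?sqr_ge0// andbT /C2; apply/eqP => /eqP.
  rewrite paddr_eq0 ?sqr_ge0// !sqrf_eq0 => /andP[/eqP c0 /eqP e0].
  by move: uc; rewrite c0 e0 !mulr0 subr0 => /esym/eqP; rewrite oner_eq0.
have [d d0 dO] := smooth_pos_ball oOm sC Oz0 C20.
pose K0 z := (P z * c z - Q z * e z) * (C2 z)^-1.
pose K1 z := (Q z * c z + P z * e z) * (C2 z)^-1.
have DP v i (Ov : Om v) := smooth_is_derive i sP Ov.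
have DQ v i (Ov : Om v) := smooth_is_derive i sQ Ov.
have DK v i : ball z0 d v -> is_derive v (e_ i) K0 0 /\ is_derive v (e_ i) K1 0.
  move=> /dO[Ov Cv].
  have Dc := is_dD (is_dC v (e_ i) (1 : R)) (is_dD (is_dM (DP v i Ov) (Dx v i)) (is_dM
      (DQ v i Ov) (Dy v i))).
  have De := is_dD (is_dM (DP v i Ov) (Dy v i)) (is_dN (is_dM (DQ v i Ov) (Dx v i))).
  have DC : is_derive v (e_ i) C2 _ := is_dD (is_dX 2 Dc) (is_dX 2 De).
  have Cn : C2 v != 0 by rewrite gt_eqF.
  have [[f1 f2 f3 f4] _ _ _] := field Ov.
  have cE : c v = 1 + (P v * x v + Q v * y v) by [].
  have eE : e v = P v * y v - Q v * x v by [].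
  have CE : C2 v = c v ^+ 2 + e v ^+ 2 by [].
  split.
  - apply: is_derive_eq (is_dM (is_dD (is_dM (DP v i Ov) Dc) (is_dN (is_dM (DQ v i Ov)
      De))) (is_dV Cn DC)) _.
    have [->|->] := ord2 i; rewrite /= ?f1 ?f2 ?f3 ?f4 -/(c v) -/(e v) -/(C2 v);
      move: Cn; rewrite CE cE eE;
      move: (P v) (Q v) (x v) (y v) => P0 Q0 X0 Y0 Cn; field; exact: Cn.
  - apply: is_derive_eq (is_dM (is_dD (is_dM (DQ v i Ov) Dc) (is_dM (DP v i Ov) De))
      (is_dV Cn DC)) _.
    have [->|->] := ord2 i; rewrite /= ?f1 ?f2 ?f3 ?f4 -/(c v) -/(e v) -/(C2 v);
      move: Cn; rewrite CE cE eE;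
      move: (P v) (Q v) (x v) (y v) => P0 Q0 X0 Y0 Cn; field; exact: Cn.
have K0c := pd0_cst (fun v vd i => (DK v i vd).1).
have K1c := pd0_cst (fun v vd i => (DK v i vd).2).
have lin v : (P v = p1 * c v + q1 * e v -> Q v = q1 * c v - p1 * e v ->
    u v * P v + w v * Q v = p1 /\ u v * Q v - w v * P v = q1) /\
    (u v * P v + w v * Q v = p1 -> u v * Q v - w v * P v = q1 ->
    P v = p1 * c v + q1 * e v /\ Q v = q1 * c v - p1 * e v).
  have E1 : u v * P v + w v * Q v - p1 = P v - (p1 * c v + q1 * e v).
    by rewrite /u /w /c /e; move: (P v) (Q v) (x v) (y v) => P0 Q0 X0 Y0; ring.
  have E2 : u v * Q v - w v * P v - q1 = Q v - (q1 * c v - p1 * e v).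
    by rewrite /u /w /c /e; move: (P v) (Q v) (x v) (y v) => P0 Q0 X0 Y0; ring.
  split=> H1 H2; split; apply/eqP; rewrite -subr_eq0.
  - by rewrite E1 {1}H1 subrr.
  - by rewrite E2 {1}H2 subrr.
  - by rewrite -E1 H1 subrr.
  - by rewrite -E2 H2 subrr.
have [hP hQ] := (lin z0).2 h1 h2.
have K00 : K0 z0 = p1.
  rewrite /K0 hP hQ; apply: (canLR (mulfK _)); first by rewrite gt_eqF.
  by rewrite /C2; move: (c z0) (e z0) => C0 E0; ring.
have K10 : K1 z0 = q1.
  rewrite /K1 hP hQ; apply: (canLR (mulfK _)); first by rewrite gt_eqF.
  by rewrite /C2; move: (c z0) (e z0) => C0 E0; ring.
pose k := p1 ^+ 2 + q1 ^+ 2.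
have PQ v : ball z0 d v -> [/\ u v * P v + w v * Q v = p1, u v * Q v - w v * P v = q1,
    D v * P v = NP v, D v * Q v = NQ v & D v * (P v ^+ 2 + Q v ^+ 2) = k].
  move=> vd; have [Ov Cv] := dO v vd; have Cn : C2 v != 0 by rewrite gt_eqF.
  have E1 : P v * c v - Q v * e v = p1 * C2 v.
    by rewrite -K00 -(K0c v vd) /K0 mulfVK.
  have E2 : Q v * c v + P v * e v = q1 * C2 v.
    by rewrite -K10 -(K1c v vd) /K1 mulfVK.
  have [||H1 H2] := (lin v).1.
  - apply: (mulfI Cn); transitivity ((p1 * C2 v) * c v + (q1 * C2 v) * e v); last by ring.
    by rewrite -E1 -E2 /C2; move: (P v) (Q v) (c v) (e v) => P0 Q0 C0 E0; ring.
  - apply: (mulfI Cn); transitivity ((q1 * C2 v) * c v - (p1 * C2 v) * e v); last by ring.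
    by rewrite -E1 -E2 /C2; move: (P v) (Q v) (c v) (e v) => P0 Q0 C0 E0; ring.
  by split => //; rewrite /NP /NQ /D ?/k -{1}H1 -{1}H2;
    move: (P v) (Q v) (u v) (w v) => P0 Q0 U0 W0; ring.
have gB v : ball z0 d v -> B v by move=> /dO[[]].
have DF (F : 'rV[R]_2 -> R) : (forall v, ball z0 d v -> forall i, is_derive v (e_ i) F 0) ->
  forall v, ball z0 d v -> F v = F z0 := fun h v vd => pd0_cst h vd.
have Dl v i (Bv : B v) := smooth_is_derive i slam Bv.
have Dlu v i (Bv : B v) := smooth_is_derive i slu Bv.
have Dlv v i (Bv : B v) := smooth_is_derive i slv Bv.
have near v : ball z0 d v -> [/\ B v, D v * P v = NP v, D v * Q v = NQ v,
    NP v * lu v + NQ v * lv v = k * lam v &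
    pd 0 lu v = 2 * (P v * lu v - Q v * lv v) /\ pd 1 lu v = 2 * (P v * lv v + Q v * lu v)].
  move=> vd; have [Ov _] := dO v vd; have [_ f5 f6 f7] := field Ov.
  have [_ _ e1 e2 e3] := PQ v vd; split => //; first exact: gB.
  by rewrite -e1 -e2 -!mulrA -mulrDr f7 mulrA e3.
have Fuc v : ball z0 d v -> Fu v = gu.
  move=> vd; rewrite -h3; apply: DF vd => {}v vd i; have [Bv e1 e2 E [f5 f6]] := near v vd.
  apply: is_derive_eq (is_dD (is_dM (DD v i) (Dlu v i Bv)) (is_dN (is_dM (is_dC v (e_ i)
      (2 : R))
    (is_dM (Dl v i Bv) (DNP v i))))) _.
  have [->|->] := ord2 i; rewrite /= ?f5 ?f6 -/(lu v) -/(lv v) -/k.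
    move: E; rewrite -e1 -e2; move: (P v) (Q v) (lu v) (lv v) (lam v) (D v) => a b a' b' l D0 E.
    by apply: (eliminate (k := 2) (l := 0) (A := 0) (B := D0 * a * a' + D0 * b * b' - k *
        l) (C := 0)) => //; [rewrite E subrr|ring].
  by rewrite -e1 -e2; move: (P v) (Q v) (lu v) (lv v) (lam v) (D v) => a b a' b' l D0; ring.
have Fvc v : ball z0 d v -> Fv v = gv.
  move=> vd; rewrite -h4; apply: DF vd => {}v vd i; have [Bv e1 e2 E [f5 f6]] := near v vd.
  apply: is_derive_eq (is_dD (is_dM (DD v i) (Dlv v i Bv)) (is_dN (is_dM (is_dC v (e_ i)
      (2 : R))
    (is_dM (Dl v i Bv) (DNQ v i))))) _.
  have [->|->] := ord2 i; rewrite /= ?luv// ?lvv// ?f5 ?f6 -/(lu v) -/(lv v) -/k.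
    by rewrite -e1 -e2; move: (P v) (Q v) (lu v) (lv v) (lam v) (D v) => a b a' b' l D0; ring.
  move: E; rewrite -e1 -e2; move: (P v) (Q v) (lu v) (lv v) (lam v) (D v) => a b a' b' l D0 E.
  by apply: (eliminate (k := 2) (l := 0) (A := 0) (B := D0 * a * a' + D0 * b * b' - k *
      l) (C := 0)) => //; [rewrite E subrr|ring].
have Fnc v : ball z0 d v -> Fn v = lam z1.
  move=> vd; rewrite -h5; apply: DF vd => {}v vd i; have [Bv e1 e2 E [f5 f6]] := near v vd.
  apply: is_derive_eq (is_dD (is_dM (DD v i) (Dl v i Bv)) (is_dN (is_dD
    (is_dM (is_dC v (e_ i) gu) (Dx v i)) (is_dM (is_dC v (e_ i) gv) (Dy v i))))) _.
  rewrite -(Fuc v vd) -(Fvc v vd) /Fu /Fv.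
  by have [->|->] := ord2 i; rewrite /= -/(lu v) -/(lv v);
    move: (NP v) (NQ v) (lu v) (lv v) (lam v) (D v) => a b a' b' l D0; ring.
apply/nbhs_ballP; exists d => // v vd; have [Ov _] := dO v vd.
by split => //; have [? ? _ _ _] := PQ v vd; split => //; [exact: Fuc|exact: Fvc|exact: Fnc].
Qed.

Let AB : A = B.
Proof. exact: (ball_clopen A_open (fun z h => OmB h.1) (ex_intro _ z1 z1A) A_closed). Qed.

(** Where lam is nonzero this is the vanishing of the determinant; where lam = 0, it forces L^2 +
    K^2 = 0, so the whole second form is zero. *)
Let kernelPQ z : B z -> L z * P z + K z * Q z = 0 /\ K z * P z + N z * Q z = 0.
Proof.
move=> Bz; have [l0|l0] := eqVneq (lam z) 0.
  have N0 : N z = - L z by apply/eqP; rewrite -addr_eq0 addrC -/(lam z) l0.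
  have : L z ^+ 2 + K z ^+ 2 = 0 by rewrite -gauss// N0; ring.
  move/eqP; rewrite paddr_eq0 ?sqr_ge0// !sqrf_eq0 => /andP[/eqP L0 /eqP K0].
  by rewrite N0 L0 K0 oppr0 !mul0r addr0.
rewrite /P /Q l0 /P1 /Q1; have := gauss Bz; move: l0.
move: (L z) (K z) (N z) (lu z) (lv z) (lam z) => l k n a b s s0 g.
have H i1 i2 : i1 = 0 -> i1 * i2 = 0 :> R by move=> ->; rewrite mul0r.
split; rewrite !mulrA -mulrDl; apply: H.
  by apply: (eliminate (k := - a) (l := 0) (A := 0) (B := l * n - k ^+ 2) (C := 0)) =>
      //; [rewrite g subrr|ring].
by apply: (eliminate (k := - b) (l := 0) (A := 0) (B := l * n - k ^+ 2) (C := 0)) => //;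
    [rewrite g subrr|ring].
Qed.

Let dense_lam z d : 0 < d -> B z -> exists w, [/\ ball z d w, B w & lam w != 0].
Proof.
move=> d0 Bz; apply: contrapT => H.
have Oz : Om z by move: (Bz); rewrite -AB => -[].
have := open_ball_sub oB Bz => -[d' d'0 dB].
have m0 : 0 < Num.min d d' by rewrite lt_min d0.
have l0 v : ball z (Num.min d d') v -> lam v = 0.
  move=> /rVballP; rewrite lt_min => /andP[/rVballP v1 /rVballP v2].
  by apply/eqP/negPn/negP => lv0; apply: H; exists v; split => //; exact: dB.
have zd : ball z (Num.min d d') z by apply/rVballP; rewrite subrr normr0.
have g0 k : pd k lam z = 0.
  rewrite (pd_ext k (ball_open _ _) zd l0); exact: is_derive_pd (is_dC _ _ _).
by have [_] := Oz; rewrite /lu /lv !g0 (l0 z zd) expr0n !addr0 eqxx.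
Qed.

(** The vertex is the pole of pi, at zeta = 1 / pi1 = (p1 + i q1) / |pi1|^2. It is not in the disc,
    because the relations that hold on [A] would give pi1 = 0 there. *)
Let cone_case : p1 ^+ 2 + q1 ^+ 2 != 0 -> exists V : 'rV[R]_2, forall z, B z ->
  [/\ z <> V, L z * (z 0 0 - V 0 0) + K z * (z 0 1 - V 0 1) = 0 &
    K z * (z 0 0 - V 0 0) + N z * (z 0 1 - V 0 1) = 0].
Proof.
set k := _ + _ => k0; exists (z1 + pt (p1 / k) (q1 / k)) => z Bz.
have [Oz [h1 h2 _ _ _]] : A z by rewrite AB.
have eP : D z * P z = NP z.
  by rewrite /NP /D -{1}h1 -{1}h2; move: (P z) (Q z) (u z) (w z) => a b a' b'; ring.
have eQ : D z * Q z = NQ z.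
  by rewrite /NQ /D -{1}h1 -{1}h2; move: (P z) (Q z) (u z) (w z) => a b a' b'; ring.
have kP : NP z = - k * (z 0 0 - (z1 + pt (p1 / k) (q1 / k)) 0 0).
  by rewrite mxE ptE0 /NP /u /w /x /y /k; field.
have kQ : NQ z = - k * (z 0 1 - (z1 + pt (p1 / k) (q1 / k)) 0 1).
  by rewrite mxE ptE1 /NQ /u /w /x /y /k; field.
have [k1 k2] := kernelPQ Bz; have kn : - k != 0 by rewrite oppr_eq0.
split.
- move=> zV; have u0 : u z = 0.
    by rewrite /u /x /y zV !mxE /= /k; field.
  have w0 : w z = 0 by rewrite /w /x /y zV !mxE /= /k; field.
  move: h1 h2 k0; rewrite u0 w0 !mul0r addr0 subr0 /k => <- <-.
  by rewrite expr0n addr0 eqxx.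
- apply: (mulfI kn); rewrite mulr0 mulrDr !(mulrCA (- k)) -kP -kQ -eP -eQ.
  by rewrite !(mulrCA _ (D z)) -mulrDr k1 mulr0.
- apply: (mulfI kn); rewrite mulr0 mulrDr !(mulrCA (- k)) -kP -kQ -eP -eQ.
  by rewrite !(mulrCA _ (D z)) -mulrDr k2 mulr0.
Qed.

Let normalize (a b : R) : a ^+ 2 + b ^+ 2 != 0 ->
  (forall z, B z -> L z * a + K z * b = 0 /\ K z * a + N z * b = 0) ->
  exists f0 f1 : R, f0 ^+ 2 + f1 ^+ 2 = 1 /\
    forall z, B z -> L z * f0 + K z * f1 = 0 /\ K z * f0 + N z * f1 = 0.
Proof.
move=> ab0 H; pose n := Num.sqrt (a ^+ 2 + b ^+ 2).
have n2 : n ^+ 2 = a ^+ 2 + b ^+ 2 by rewrite sqr_sqrtr ?addr_ge0 ?sqr_ge0.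
exists (a / n), (b / n); split.
  by rewrite !exprMn -mulrDl -n2 -exprMn mulfV ?expr1n// -sqrf_eq0 n2.
by move=> z /H[h1 h2]; rewrite !mulrA -!mulrDl h1 h2 mul0r.
Qed.

(** With pi1 = 0 the field (P, Q) is zero and lam is affine. If its gradient is nonzero, P = Q = 0
    says that the gradient turned by a right angle is in the kernel. If lam is constant, (P, Q)
    carries no information, and the second form is shown to be constant instead. *)
Let cylinder_case : p1 ^+ 2 + q1 ^+ 2 = 0 ->
  exists f0 f1 : R, f0 ^+ 2 + f1 ^+ 2 = 1 /\
    forall z, B z -> L z * f0 + K z * f1 = 0 /\ K z * f0 + N z * f1 = 0.
Proof.
move/eqP; rewrite paddr_eq0 ?sqr_ge0// !sqrf_eq0 => /andP[/eqP p0 /eqP q0].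
have E z : B z -> [/\ P z = 0, Q z = 0, lu z = gu, lv z = gv &
    lam z = lam z1 + (gu * x z + gv * y z)].
  rewrite -{1}AB => -[_ [h1 h2 h3 h4 h5]].
  have u1 : u z = 1 by rewrite /u p0 q0; ring.
  have w0 : w z = 0 by rewrite /w p0 q0; ring.
  move: h1 h2 h3 h4 h5; rewrite /Fu /Fv /Fn /NP /NQ /D p0 q0 u1 w0.
  move=> h1 h2 <- <- <-; split; [rewrite -h1|rewrite -h2| | |]; ring.
have [g0|g0] := eqVneq (gv ^+ 2 + gu ^+ 2) 0.
  move/eqP: g0; rewrite paddr_eq0 ?sqr_ge0// !sqrf_eq0 => /andP[/eqP v0 /eqP u0].
  have lE z : B z -> lam z = lam z1.
    by move=> /E[_ _ _ _ ->]; rewrite u0 v0 !mul0r !addr0.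
  have l0 : lam z1 != 0.
    have [Bz1] := Oz1; have [_ _ -> -> _] := E z1 Bz1.
    by rewrite u0 v0 expr0n !addr0 sqrf_eq0.
  have DL z i (Bz : B z) := smooth_is_derive i sL Bz.
  have DK z i (Bz : B z) := smooth_is_derive i sK Bz.
  have NE z : B z -> N z = lam z1 - L z.
    by move=> Bz; rewrite -(lE z Bz) /lam; ring.
  (* The derivatives of the determinant relation, simplified by the Codazzi equations, form a
     homogeneous linear system for the derivatives of L and K. Its determinant (lam - 2 L)^2 + 4 K^2
     equals lam^2, which is nonzero. *)
  have part z : B z -> forall i, pd i L z = 0 /\ pd i K z = 0.
    move=> Bz.
    have nE i : pd i N z = - pd i L z.
      rewrite (pd_ext i oB Bz NE).
      by rewrite (is_derive_pd (is_dD (is_dC z (e_ i) (lam z1)) (is_dN (DL z i Bz)))) add0r.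
    have gE i : pd i L z * (lam z1 - 2 * L z) = 2 * (K z * pd i K z).
      have /(pd_ext i oB Bz) : forall v, B v -> L v * (lam z1 - L v) = K v ^+ 2.
        by move=> v Bv; rewrite -gauss// NE.
      rewrite (is_derive_pd (is_dM (DL z i Bz) (is_dD (is_dC z (e_ i) (lam z1)) (is_dN
          (DL z i Bz))))).
      rewrite (is_derive_pd (is_dX 2 (DK z i Bz))) /= => h.
      by move: h; move: (pd i L z) (pd i K z) (L z) (K z) (lam z1) => a b l k s h; lra.
    have g0 := gE 0; have g1 := gE 1; have c1 := cod1 Bz; have c2 := cod2 Bz.
    have gz := gauss Bz; rewrite NE// in gz; rewrite nE in c2.
    rewrite c1 c2 in g1.
    have [a0 b0] : pd 0 L z = 0 /\ pd 0 K z = 0.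
      move: l0 g0 g1 gz; move: (pd 0 L z) (pd 0 K z) (L z) (K z) (lam z1) => a b l k s s0
          g0 g1 gz.
      have s2 : s ^+ 2 != 0 by rewrite expf_neq0.
      split; apply: (mulfI s2); rewrite mulr0.
        apply: (eliminate (k := - (s - 2 * l)) (l := 2 * k) (A := 2 * (k * - a) - b * (s
            - 2 * l))
          (B := a * (s - 2 * l) - 2 * (k * b)) (C := 4 * a * (l * (s - l) - k ^+ 2))).
        - by rewrite g1 subrr.
        - by rewrite g0 subrr.
        - by rewrite gz subrr mulr0.
        - by ring.
      apply: (eliminate (k := (2 * k)) (l := (s - 2 * l)) (A := 2 * (k * - a) - b * (s - 2 * l))
          (B := a * (s - 2 * l) - 2 * (k * b)) (C := 4 * b * (l * (s - l) - k ^+ 2))).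
      - by rewrite g1 subrr.
      - by rewrite g0 subrr.
      - by rewrite gz subrr mulr0.
      - by ring.
    by move=> i; have [->|->] := ord2 i; rewrite ?c1 ?c2 a0 b0 ?oppr0.
  have Lc z : B z -> L z = L p.
    apply: pd0_cst => {}z Bz i; have [h _] := part z Bz i.
    by rewrite -h; exact: DL.
  have Kc z : B z -> K z = K p.
    apply: pd0_cst => {}z Bz i; have [_ h] := part z Bz i.
    by rewrite -h; exact: DK.
  have Nc z : B z -> N z = lam z1 - L p by move=> Bz; rewrite NE// Lc.
  have gp : L p * (lam z1 - L p) = K p ^+ 2.
    by have [Bz1 _] := Oz1; rewrite -(Nc z1 Bz1) -(Lc z1 Bz1) -(Kc z1 Bz1) gauss.
  (* Either row of a symmetric matrix of determinant 0, turned by a right angle, lies in the kernel;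
     the case distinction selects a nonzero row. *)
  have [L0|L0] := eqVneq (L p) 0.
    apply: (normalize (a := lam z1 - L p) (b := - K p)).
      rewrite L0 subr0 sqrrN; apply: contra l0.
      by rewrite paddr_eq0 ?sqr_ge0// !sqrf_eq0 => /andP[].
    move=> z Bz; rewrite (Nc z Bz) (Lc z Bz) (Kc z Bz); move: gp.
    move: (L p) (K p) (lam z1) => l k s g; split; last by ring.
    by rewrite g; ring.
  apply: (normalize (a := K p) (b := - L p)).
    rewrite sqrrN; apply: contra L0.
    by rewrite paddr_eq0 ?sqr_ge0// !sqrf_eq0 => /andP[].
  move=> z Bz; rewrite (Nc z Bz) (Lc z Bz) (Kc z Bz); move: gp.
  move: (L p) (K p) (lam z1) => l k s g; split; first by ring.
  by rewrite mulrN (mulrC _ l) g; ring.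
apply: (normalize (a := - gv) (b := gu)) => //; first by rewrite sqrrN.
move=> z Bz; have [P0 Q0 <- <- _] := E z Bz.
have [l0|l0] := eqVneq (lam z) 0.
  have N0 : N z = - L z by apply/eqP; rewrite -addr_eq0 addrC -/(lam z) l0.
  have : L z ^+ 2 + K z ^+ 2 = 0 by rewrite -gauss// N0; ring.
  move/eqP; rewrite paddr_eq0 ?sqr_ge0// !sqrf_eq0 => /andP[/eqP L0 /eqP K0].
  by rewrite N0 L0 K0 oppr0 !mul0r addr0.
move: P0 Q0; rewrite /P /Q l0 /P1 /Q1.
move=> /eqP; rewrite mulf_eq0 invr_eq0 expf_eq0 /= (negbTE l0) orbF => /eqP P0.
move=> /eqP; rewrite mulf_eq0 invr_eq0 expf_eq0 /= (negbTE l0) orbF => /eqP Q0.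
split; [apply: etrans _ (etrans (congr1 -%R Q0) (oppr0 _))|apply: etrans _ P0]; ring.
Qed.

Lemma base_trichotomy :
  (forall z d, 0 < d -> B z -> exists w, [/\ ball z d w, B w & lam w != 0]) /\
  ((exists f0 f1 : R, f0 ^+ 2 + f1 ^+ 2 = 1 /\
    forall z, B z -> L z * f0 + K z * f1 = 0 /\ K z * f0 + N z * f1 = 0) \/
  (exists V : 'rV[R]_2, forall z, B z ->
  [/\ z <> V, L z * (z 0 0 - V 0 0) + K z * (z 0 1 - V 0 1) = 0 &
    K z * (z 0 0 - V 0 0) + N z * (z 0 1 - V 0 1) = 0])).
Proof.
split; first exact: dense_lam.
have [k0|k0] := eqVneq (p1 ^+ 2 + q1 ^+ 2) 0; first by left; exact: cylinder_case.
by right; exact: cone_case.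
Qed.

End Base.

Lemma flat_trichotomy : (forall z, B z -> L z + N z = 0) \/
  (forall z d, 0 < d -> B z -> exists w, [/\ ball z d w, B w & L w + N w != 0]) /\
  ((exists f0 f1 : R, f0 ^+ 2 + f1 ^+ 2 = 1 /\
    forall z, B z -> L z * f0 + K z * f1 = 0 /\ K z * f0 + N z * f1 = 0) \/
  (exists V : 'rV[R]_2, forall z, B z ->
  [/\ z <> V, L z * (z 0 0 - V 0 0) + K z * (z 0 1 - V 0 1) = 0 &
    K z * (z 0 0 - V 0 0) + N z * (z 0 1 - V 0 1) = 0])).
Proof.
have [[z Oz]|H] := pselect (exists z, Om z); first by right; exact: (base_trichotomy Oz).
left => z Bz; apply/eqP/negPn/negP => l0; apply: H; exists z.
by apply/(OmP Bz); left.
Qed.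

End Continuation.

(** * Cylinders and cones *)

Section RuledSurfaces.
Variable R : realType.
Implicit Types (g w T : R -> 'rV[R]_3) (k : R -> R) (J : set R) (sg : bool).

(* [sg = false]: cylinder over the base curve g; [sg = true]: cone with vertex
   g (constant) over the spherical curve g + w. In both cases s is arclength,
   T the tangent of the base curve and k its (signed) curvature. *)
Definition frame_at sg (k : R) g w T (s : R) := [/\
  is_derive s 1 g ((1 - sg%:R) *: T s), is_derive s 1 w (sg%:R *: T s),
  is_derive s 1 T (- sg%:R *: w s + k *: cross (w s) (T s)) &
  [/\ dot (w s) (w s) = 1, dot (T s) (T s) = 1 & dot (w s) (T s) = 0]].

Definition rho sg (t : R) := 1 - sg%:R + sg%:R * t.

Definition surf g w (q : 'rV[R]_2) := g (q 0 0) + q 0 1 *: w (q 0 0).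

Definition dom sg J := [set q : 'rV[R]_2 | J (q 0 0) /\ 0 < rho sg (q 0 1)].

Lemma coord_continuous i : continuous (fun q : 'rV[R]_2 => q 0 i).
Proof.
move=> q; apply: (smooth_continuous (U := setT)) => //.
by apply: smooth_coord; exact: openT.
Qed.

Lemma open_coord J i : open J -> open [set q : 'rV[R]_2 | J (q 0 i)].
Proof. by move=> oJ; apply: (open_comp (D := J)) => // q _; exact: coord_continuous. Qed.

Lemma open_dom sg J : open J -> open (dom sg J).
Proof.
move=> oJ; apply: openI; first exact: open_coord.
have oT : open [set: 'rV[R]_2] by exact: openT.
have sr : smooth_on [set: 'rV[R]_2] (fun q => rho sg (q 0 1)) by rewrite /rho; smooth.
rewrite openE => q rq; have [d d0 dB] := smooth_pos_ball oT sr I rq.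
by apply/nbhs_ballP; exists d => // z /dB[].
Qed.

Lemma is_derive_lift (f : R -> R) (q : 'rV[R]_2) d i : is_derive (q 0 0) 1 f d ->
  is_derive q (e_ i) (fun z : 'rV[R]_2 => f (z 0 0)) ((i == 0)%:R * d).
Proof.
move=> df; apply: is_derive_eq (is_derive_comp1 df (is_dcoord 0 (is_derive_id q (e_ i)))) _.
by rewrite mxE eqxx mulrC eq_sym.
Qed.

Lemma is_derive_vlift n (f : R -> 'rV[R]_n) (q : 'rV[R]_2) d i : is_derive (q 0 0) 1 f d ->
  is_derive q (e_ i) (fun z : 'rV[R]_2 => f (z 0 0)) ((i == 0)%:R *: d).
Proof.
move=> /is_derive_mx df; apply/is_derive_mx => j.
rewrite rvE; exact: (is_derive_lift i (df j)).
Qed.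

Lemma is_derive_continuous (W : normedModType R) (f : R -> W) (s : R) d :
  is_derive s 1 f d -> {for s, continuous f}.
Proof. by move=> [h _]; exact/differentiable_continuous/derivable1_diffP. Qed.

Section Frame.
Variables (sg : bool) (k : R -> R) (J : set R) (g w T : R -> 'rV[R]_3).
Hypotheses (oJ : open J) (fr : forall s, J s -> frame_at sg (k s) g w T s).
Let U := [set q : 'rV[R]_2 | J (q 0 0)].
Let oU : open U. Proof. exact: open_coord. Qed.

(** A bootstrap: the right-hand sides of the frame equations are polynomial in k, w and T, so a
    frame of class C^n has derivatives of class C^n. *)
Lemma frame_smooth : smooth_on U (fun q => k (q 0 0)) ->
  [/\ smooth_on U (fun q => g (q 0 0)), smooth_on U (fun q => w (q 0 0)) &
      smooth_on U (fun q => T (q 0 0))].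
Proof.
move=> sk.
suff H n : [/\ Cn n U (fun q => g (q 0 0)), Cn n U (fun q => w (q 0 0)) & Cn n U (fun q
    => T (q 0 0))].
  by split=> n; have [] := H n.
elim: n => [|n [cg cw cT]].
  have C (f : R -> 'rV[R]_3) : (forall s, J s -> {for s,
      continuous f}) -> Cn 0 U (fun q => f (q 0 0)).
    move=> cf q Uq; apply: continuous_comp; first exact: coord_continuous.
    exact: cf.
  by split; apply: C => s /fr[d1 d2 d3 _]; apply: is_derive_continuous; eassumption.
have lin (a : R) (f : 'rV[R]_2 -> 'rV[R]_3) : Cn n U f -> Cn n U (fun q => a *: f q).
  move=> /(Cn_mx _ _ oU) cf; apply/(Cn_mx _ _ oU) => j.
  apply: (@Cn_ext _ _ _ oU _ (fun q => a * f q 0 j)) => [z _|]; first by rewrite rvE.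
  by apply: CnM => //; exact: Cn_cst.
split.
- apply: (CnS_from (df := fun i q => (i == 0)%:R *: ((1 - sg%:R) *: T (q 0 0)))) => //.
    by move=> q i Uq; apply: is_derive_vlift; have [] := fr Uq.
  by move=> i; exact: (lin _ _ (lin _ _ cT)).
- apply: (CnS_from (df := fun i q => (i == 0)%:R *: (sg%:R *: T (q 0 0)))) => //.
    by move=> q i Uq; apply: is_derive_vlift; have [] := fr Uq.
  by move=> i; exact: (lin _ _ (lin _ _ cT)).
- apply: (CnS_from (df := fun i q => (i == 0)%:R *: (- sg%:R *: w (q 0 0) +
      k (q 0 0) *: cross (w (q 0 0)) (T (q 0 0))))) => //.
    by move=> q i Uq; apply: is_derive_vlift; have [] := fr Uq.
  move=> i; apply: lin.
  move: cw cT => /(Cn_mx _ _ oU) cw /(Cn_mx _ _ oU) cT; apply/(Cn_mx _ _ oU) => j.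
  have cN : Cn n U (fun q => cross (w (q 0 0)) (T (q 0 0)) 0 j).
    have [->|->|->] := ord3 j.
    + apply: (@Cn_ext _ _ _ oU _ (fun q => w (q 0 0) 0 1 * T (q 0 0) 0 2 - w (q 0 0) 0 2
        * T (q 0 0) 0 1)) => [z _|]; first by rewrite crossE.
      by apply: CnB => //; apply: CnM.
    + apply: (@Cn_ext _ _ _ oU _ (fun q => w (q 0 0) 0 2 * T (q 0 0) 0 0 - w (q 0 0) 0 0
        * T (q 0 0) 0 2)) => [z _|]; first by rewrite crossE.
      by apply: CnB => //; apply: CnM.
    + apply: (@Cn_ext _ _ _ oU _ (fun q => w (q 0 0) 0 0 * T (q 0 0) 0 1 - w (q 0 0) 0 1
        * T (q 0 0) 0 0)) => [z _|]; first by rewrite crossE.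
      by apply: CnB => //; apply: CnM.
  apply: (@Cn_ext _ _ _ oU _ (fun q => - sg%:R * w (q 0 0) 0 j + k (q 0 0) * cross (w (q
      0 0)) (T (q 0 0)) 0 j)) => [z _|].
    by rewrite !rvE.
  apply: CnD => //; apply: CnM => //; exact: Cn_cst.
Qed.

Let D := dom sg J.
Let oD : open D. Proof. exact: open_dom. Qed.

Lemma surf_derive (q : 'rV[R]_2) : J (q 0 0) ->
  pd 0 (surf g w) q = rho sg (q 0 1) *: T (q 0 0) /\ pd 1 (surf g w) q = w (q 0 0).
Proof.
move=> Jq; have [dg dw _ _] := fr Jq.
have h i := is_derive_pd (is_dD (is_derive_vlift i dg)
  (is_dscale (is_dcoord 1 (is_derive_id q (e_ i))) (is_derive_vlift i dw))).
rewrite /surf !h /= !mxE /=; split; last by rewrite !scale0r scaler0 add0r addr0 scale1r.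
by rewrite /rho !scale1r scale0r add0r scalerA -scalerDl (mulrC _ sg%:R).
Qed.

Let surf0 q (Dq : D q) := (surf_derive Dq.1).1.
Let surf1 q (Dq : D q) := (surf_derive Dq.1).2.

Let rho_derive (q : 'rV[R]_2) i :
  is_derive q (e_ i) (fun z : 'rV[R]_2 => rho sg (z 0 1)) (sg%:R * (i == 1)%:R).
Proof.
apply: is_derive_eq (is_dD (is_dC q (e_ i) (1 - sg%:R : R)) (is_dM (is_dC q (e_ i) (sg%:R : R))
  (is_dcoord 1 (is_derive_id q (e_ i))))) _.
by rewrite mxE /= mulr0 addr0 add0r eq_sym.
Qed.

Let N (q : 'rV[R]_2) := cross (w (q 0 0)) (T (q 0 0)).

Let frameN q : D q -> [/\ dot (T (q 0 0)) (N q) = 0,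
    dot (w (q 0 0)) (N q) = 0 & dot (N q) (N q) = 1].
Proof.
move=> [Jq _]; have [_ _ _ [ww TT wT]] := fr Jq.
rewrite /N ![dot _ (cross _ _)]dotC dot_crossl dot_crossr cross_dot ww TT wT.
by rewrite mul0r subr0 mulr1.
Qed.

Lemma normal_surf q : D q -> normal (surf g w) q = - rho sg (q 0 1) *: N q.
Proof.
by move=> Dq; rewrite normal_pdE surf0// surf1// crossZl crossC scalerN scaleNr.
Qed.

Lemma normal_surf_neq0 q : D q -> normal (surf g w) q != 0.
Proof.
move=> Dq; have [_ r0] := Dq; rewrite normal_surf// scaler_eq0 oppr_eq0 gt_eqF//= -dot_eq0.
by have [_ _ ->] := frameN Dq; exact: oner_neq0.
Qed.

Lemma unit_normal_surf q : D q -> unit_normal (surf g w) q = - N q.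
Proof.
move=> Dq; have [_ r0] := Dq; have [_ _ NN] := frameN Dq.
rewrite /unit_normal normal_surf// dotZl dotZr NN mulr1 -expr2 sqrrN sqrtr_sqr ger0_norm ?ltW//.
by rewrite scalerA mulrN mulVf ?gt_eqF// scaleN1r.
Qed.

Lemma gram_surf q : D q -> [/\ dot (pd 0 (surf g w) q) (pd 0 (surf g w) q) = rho sg (q 0
    1) ^+ 2,
  dot (pd 0 (surf g w) q) (pd 1 (surf g w) q) = 0 & dot (pd 1 (surf g w) q) (pd 1 (surf g
      w) q) = 1].
Proof.
move=> Dq; have [Jq _] := Dq; have [_ _ _ [ww TT wT]] := fr Jq.
rewrite surf0// surf1// dotZl dotZr dotZl ww TT (dotC (T _)) wT; split => //; ring.
Qed.

Lemma gdet_surf q : D q -> gdet (surf g w) q = rho sg (q 0 1) ^+ 2.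
Proof. by move=> Dq; have [g1 g2 g3] := gram_surf Dq; rewrite /gdet g1 g2 g3; ring. Qed.

Lemma hform_surf q : D q -> [/\ hform (surf g w) 0 0 q = - (rho sg (q 0 1) * k (q 0 0)),
  hform (surf g w) 0 1 q = 0, hform (surf g w) 1 0 q = 0 & hform (surf g w) 1 1 q = 0].
Proof.
move=> Dq; have [Jq _] := Dq; have [_ dw dT _] := fr Jq.
have [TN wN NN] := frameN Dq.
have P0 i : pd i (pd 0 (surf g w)) q = (sg%:R * (i == 1)%:R) *: T (q 0 0) +
    rho sg (q 0 1) *: ((i == 0)%:R *: (- sg%:R *: w (q 0 0) + k (q 0 0) *: cross (w (q 0
        0)) (T (q 0 0)))).
  rewrite (pd_ext i oD Dq surf0).
  exact: is_derive_pd (is_dscale (rho_derive q i) (is_derive_vlift i dT)).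
have P1 i : pd i (pd 1 (surf g w)) q = (i == 0)%:R *: (sg%:R *: T (q 0 0)).
  rewrite (pd_ext i oD Dq surf1); exact: is_derive_pd (is_derive_vlift i dw).
rewrite /hform !P0 !P1 unit_normal_surf//= !(dotNr, dotDl, dotZl) -/(N q) TN wN NN.
by split; ring.
Qed.

Lemma mean_curvature_surf q : D q ->
  mean_curvature (surf g w) q = - (k (q 0 0) / (2 * rho sg (q 0 1))).
Proof.
move=> Dq; have [_ r0] := Dq; have [g1 g2 g3] := gram_surf Dq;
    have [h1 h2 h3 h4] := hform_surf Dq.
rewrite mean_curvatureE ?normal_surf_neq0// g1 g2 g3 h1 h2 h3 h4 gdet_surf//.
have : rho sg (q 0 1) != 0 by rewrite gt_eqF.
by move: (rho _ _) (k _) => r c r1; field.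
Qed.

Lemma laplacian_surf (k1 k2 : R -> R) q : (forall s, J s -> is_derive s 1 k (k1 s)) ->
  (forall s, J s -> is_derive s 1 k1 (k2 s)) -> D q ->
  laplacian (surf g w) (mean_curvature (surf g w)) q =
  - ((k2 (q 0 0) + sg%:R * k (q 0 0)) / (2 * rho sg (q 0 1) ^+ 3)).
Proof.
move=> dk dk1 Dq.
have r0 z : D z -> rho sg (z 0 1) != 0 by move=> [_]; rewrite lt_def => /andP[].
have r2 z : D z -> 2 * rho sg (z 0 1) != 0 by move=> Dz; rewrite mulf_neq0 ?r0// pnatr_eq0.
have sq z : D z -> Num.sqrt (gdet (surf g w) z) = rho sg (z 0 1).
  by move=> Dz; have [_ h] := Dz; rewrite gdet_surf// sqrtr_sqr ger0_norm// ltW.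
have d2 z i : D z -> is_derive z (e_ i) (fun z : 'rV[R]_2 => (2 * rho sg (z 0 1))^-1)
    (- (2 * rho sg (z 0 1)) ^- 2 * (2 * (sg%:R * (i == 1)%:R))).
  move=> Dz; apply: is_derive_eq (is_dV (F := fun z : 'rV[R]_2 => 2 * rho sg (z 0 1)) (r2
      z Dz) (is_dM (is_dC z (e_ i) (2 : R)) (rho_derive z i))) _.
  by rewrite mulr0 addr0.
have pm i z : D z -> pd i (mean_curvature (surf g w)) z =
    - (k (z 0 0) * (- (2 * rho sg (z 0 1)) ^- 2 * (2 * (sg%:R * (i == 1)%:R))) +
       (2 * rho sg (z 0 1))^-1 * ((i == 0)%:R * k1 (z 0 0))).
  move=> Dz; rewrite (pd_ext i oD Dz mean_curvature_surf).
  exact: is_derive_pd (is_dN (is_dM (is_derive_lift i (dk _ Dz.1)) (d2 z i Dz))).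
have W0 z : D z -> lapW0 (surf g w) (mean_curvature (surf g w)) z =
    - (2 * (2 * rho sg (z 0 1))^-1 ^+ 2 * k1 (z 0 0)).
  move=> Dz; have [g1 g2 g3] := gram_surf Dz.
  rewrite /lapW0 g2 g3 pm// sq//=; have := r0 z Dz.
  by move: (rho _ _) (k _) (k1 _) (pd _ _ _) => r a b c rn; field.
have W1 z : D z -> lapW1 (surf g w) (mean_curvature (surf g w)) z =
    sg%:R * (k (z 0 0) * (2 * rho sg (z 0 1))^-1).
  move=> Dz; have [g1 g2 g3] := gram_surf Dz.
  rewrite /lapW1 g1 g2 pm// sq//=; have := r0 z Dz.
  by move: (rho _ _) (k _) (k1 _) (pd _ _ _) => r a b c rn; field.
rewrite (laplacianE _ oD normal_surf_neq0 Dq) sq// (pd_ext 0 oD Dq W0) (pd_ext 1 oD Dq W1).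
have [Jq _] := Dq.
rewrite (is_derive_pd (is_dN (is_dM (is_dM (is_dC q (e_ 0) (2 : R)) (is_dX 2 (d2 q 0 Dq)))
  (is_derive_lift 0 (dk1 _ Jq))))).
rewrite (is_derive_pd (is_dM (is_dC q (e_ 1) (sg%:R : R)) (is_dM (is_derive_lift 1 (dk _
    Jq)) (d2 q 1 Dq)))).
have := r0 q Dq; rewrite /=; move: (rho _ _) (k _) (k1 _) (k2 _) => r a b c rn.
by case: sg; rewrite ?mulr1n ?mulr0n ?expr1; field.
Qed.

Lemma surf_smooth : smooth_on U (fun q => k (q 0 0)) -> smooth_on U (surf g w).
Proof.
move=> /frame_smooth[s1 s2 s3].
have sc := smooth_coord oU 1; rewrite /surf; apply: smooth_vadd => //.
by apply: smooth_scale.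
Qed.

End Frame.

End RuledSurfaces.

(** * Existence, uniqueness and affine changes of frames *)

Section Frames.
Variable R : realType.
Implicit Types (g w T : R -> 'rV[R]_3) (k : R -> R) (J : set R) (sg : bool).

Lemma open_disc (c d : R) : open [set s : R | `|s - c| < d].
Proof.
rewrite (_ : [set s | _] = ball c d); first exact: ball_open.
by apply/funext => s; rewrite /ball /= distrC.
Qed.

Lemma sqr1_neq0 (e : R) : e * e = 1 -> e != 0.
Proof.
by move=> e2; apply/eqP => h; move: e2; rewrite h mul0r => /esym/eqP; rewrite oner_eq0.
Qed.

Lemma cst_on J (F : R -> R) : is_interval J -> (forall s, J s -> is_derive s 1 F 0) ->
  forall s s', J s -> J s' -> F s = F s'.
Proof.
move=> iJ dF s s' Js Js'.
have [|t _] := @MVT_R R F (fun=> 0) s' s; last by rewrite mul0r => /eqP;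
    rewrite subr_eq0 => /eqP.
move=> t h1 h2; apply: dF; have [ss|/ltW ss] := leP s s'.
  move: h1 h2; rewrite (ler0_norm (x := s - s')) ?subr_le0// !ler_norml => h1 h2.
  by apply: (iJ s s') => //; apply/andP; split; lra.
move: h1 h2; rewrite (ger0_norm (x := s - s')) ?subr_ge0// !ler_norml => h1 h2.
by apply: (iJ s' s) => //; apply/andP; split; lra.
Qed.

Lemma vcst_on n J (F : R -> 'rV[R]_n) : is_interval J -> (forall s, J s -> is_derive s 1 F 0) ->
  forall s s', J s -> J s' -> F s = F s'.
Proof.
move=> iJ dF s s' Js Js'; apply/rowP => i; apply: (cst_on (F := fun s => F s 0 i) iJ) =>
    // z Jz.
by have /is_derive_mx/(_ i) := dF z Jz; rewrite mxE.
Qed.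

Lemma is_derive_open_ext (W : normedModType R) J (f h : R -> W) s d : open J -> J s ->
  (forall z, J z -> f z = h z) -> is_derive s 1 f d -> is_derive s 1 h d.
Proof.
move=> oJ Js fh df; apply: near_eq_is_derive df.
by apply: near_open oJ Js _ => z /fh.
Qed.

Lemma is_derive_affine n (f : R -> 'rV[R]_n) (a b s : R) d :
  is_derive (a * s + b) 1 f d -> is_derive s 1 (fun s => f (a * s + b)) (a *: d).
Proof.
move=> /is_derive_mx df; apply/is_derive_mx => i; rewrite rvE mulrC.
have da : is_derive s 1 (fun s => a * s + b) a.
  apply: is_derive_eq (is_dD (is_dM (is_dC s (1 : R) a) (is_derive_id s 1)) (is_dC s (1 :
      R) b)) _.
  by ring.
exact: (is_derive_comp1 (k := fun z => f z 0 i) (g := fun s : R => a * s + b) (df i) da).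
Qed.

Lemma is_dcross (V : normedModType R) (q v : V) (a b : V -> 'rV[R]_3) da db :
  is_derive q v a da -> is_derive q v b db ->
  is_derive q v (fun z => cross (a z) (b z)) (cross da (b q) + cross (a q) db).
Proof.
move=> /is_derive_mx ha /is_derive_mx hb; apply/is_derive_mx => i.
have [->|->|->] := ord3 i; rewrite rvE !crossE.
- rewrite (_ : (fun z => _) = (fun z => a z 0 1 * b z 0 2 - a z 0 2 * b z 0 1)); last first.
    by apply/funext => z; rewrite crossE.
  by apply: is_derive_eq (is_dD (is_dM (ha 1) (hb 2)) (is_dN (is_dM (ha 2) (hb 1)))) _; ring.
- rewrite (_ : (fun z => _) = (fun z => a z 0 2 * b z 0 0 - a z 0 0 * b z 0 2)); last first.
    by apply/funext => z; rewrite crossE.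
  by apply: is_derive_eq (is_dD (is_dM (ha 2) (hb 0)) (is_dN (is_dM (ha 0) (hb 2)))) _; ring.
- rewrite (_ : (fun z => _) = (fun z => a z 0 0 * b z 0 1 - a z 0 1 * b z 0 0)); last first.
    by apply/funext => z; rewrite crossE.
  by apply: is_derive_eq (is_dD (is_dM (ha 0) (hb 1)) (is_dN (is_dM (ha 1) (hb 0)))) _; ring.
Qed.

(** The general solution of k'' + sigma k = 0, with sigma = 1 exactly for cones. *)
Definition kap sg (a b s : R) := if sg then a * cos s + b * sin s else a * s + b.
Definition dkap sg (a b s : R) := if sg then b * cos s - a * sin s else a.

Lemma kap_derive sg (a b s : R) : is_derive s 1 (kap sg a b) (dkap sg a b s).
Proof.
rewrite /kap /dkap; case: sg.
  apply: is_derive_eq (is_dD (is_dM (is_dC s (1 : R) a) (is_dcos (is_derive_id s 1)))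
    (is_dM (is_dC s (1 : R) b) (is_dsin (is_derive_id s 1)))) _.
  by ring.
apply: is_derive_eq (is_dD (is_dM (is_dC s (1 : R) a) (is_derive_id s 1)) (is_dC s (1 :
    R) b)) _.
by ring.
Qed.

Lemma dkap_derive sg (a b s : R) : is_derive s 1 (dkap sg a b) (- (sg%:R * kap sg a b s)).
Proof.
rewrite /kap /dkap; case: sg.
  apply: is_derive_eq (is_dD (is_dM (is_dC s (1 : R) b) (is_dcos (is_derive_id s 1)))
    (is_dN (is_dM (is_dC s (1 : R) a) (is_dsin (is_derive_id s 1))))) _.
  by rewrite /=; ring.
by rewrite mul0r oppr0; exact: is_dC.
Qed.

(** For a cone, the pair (k, k') turned by the angle s is constant, and its two components are the
    coefficients; for a cylinder the slope k' is constant. *)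
Lemma kap_ode sg J (k k1 : R -> R) (s0 : R) : is_interval J -> J s0 ->
  (forall s, J s -> is_derive s 1 k (k1 s)) ->
  (forall s, J s -> is_derive s 1 k1 (- (sg%:R * k s))) ->
  exists a b, forall s, J s -> k s = kap sg a b s.
Proof.
move=> iJ Js0 dk dk1; case: sg dk1 => dk1; rewrite /kap.
  pose A s := k s * cos s - k1 s * sin s; pose B s := k s * sin s + k1 s * cos s.
  have dc (s : R) := is_dcos (is_derive_id s (1 : R)).
  have ds (s : R) := is_dsin (is_derive_id s (1 : R)).
  have cA s : J s -> A s = A s0.
    move=> Js; apply: (cst_on iJ) => // z Jz.
    apply: is_derive_eq (is_dD (is_dM (dk z Jz) (dc z)) (is_dN (is_dM (dk1 z Jz) (ds z)))) _.
    by rewrite /=; ring.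
  have cB s : J s -> B s = B s0.
    move=> Js; apply: (cst_on iJ) => // z Jz.
    apply: is_derive_eq (is_dD (is_dM (dk z Jz) (ds z)) (is_dM (dk1 z Jz) (dc z))) _.
    by rewrite /=; ring.
  exists (A s0), (B s0) => s Js; rewrite -(cA s Js) -(cB s Js) /A /B.
  rewrite -[LHS]mulr1 -(cos2Dsin2 s); ring.
have c1 s : J s -> k1 s = k1 s0.
  move=> Js; apply: (cst_on iJ) => // z Jz.
  by have := dk1 z Jz; rewrite mul0r oppr0.
exists (k1 s0), (k s0 - k1 s0 * s0) => s Js.
rewrite -(cst_on (F := fun s => k s - k1 s0 * s) iJ _ Js Js0); first by rewrite addrC subrK.
move=> z Jz; apply: is_derive_eq (is_dD (dk z Jz) (is_dN (is_dM (is_dC z (1 : R) (k1 s0))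
    (is_derive_id z 1)))) _.
by rewrite c1// mulr0 addr0 mulr1 subrr.
Qed.

Lemma kap_inj sg a b a' b' s : kap sg a b s = kap sg a' b' s ->
  dkap sg a b s = dkap sg a' b' s -> a = a' /\ b = b'.
Proof.
rewrite /kap /dkap; case: sg => [h1 h2|h1 h2]; last by split => //; move: h1;
    rewrite h2 => /addrI.
have cs := cos2Dsin2 s; split.
  rewrite -[LHS]mulr1 -[RHS]mulr1 -cs.
  transitivity ((a * cos s + b * sin s) * cos s - (b * cos s - a * sin s) * sin s);
      first by ring.
  by rewrite h1 h2; ring.
rewrite -[LHS]mulr1 -[RHS]mulr1 -cs.
transitivity ((a * cos s + b * sin s) * sin s + (b * cos s - a * sin s) * cos s); first by ring.
by rewrite h1 h2; ring.
Qed.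

Lemma kap_inj_open sg a b a' b' J s : open J -> J s ->
  (forall z, J z -> kap sg a b z = kap sg a' b' z) -> a = a' /\ b = b'.
Proof.
move=> oJ Js H; apply: (kap_inj (H s Js)).
have [_ <-] := is_derive_open_ext oJ Js H (kap_derive sg a b s).
by have [_ <-] := kap_derive sg a' b' s.
Qed.

Lemma kap_neq0_dense sg a b J s : (a != 0) || (b != 0) -> open J -> J s ->
  exists2 z, J z & kap sg a b z != 0.
Proof.
move=> ab oJ Js; apply: contrapT => H.
have [z Jz|a0 b0] := kap_inj_open (sg := sg) (a := a) (b := b) (a' := 0) (b' := 0) oJ Js.
  rewrite [RHS](_ : _ = 0); last by rewrite /kap; case: sg {H}; rewrite !mul0r addr0.
  by apply/eqP/negPn/negP => kz; apply: H; exists z.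
by move: ab; rewrite a0 b0 eqxx.
Qed.

Lemma dot_unit (n : nat) (u v : 'rV[R]_n) : dot u u = 1 -> dot v v = 1 ->
  dot u v <= 1 /\ (dot u v = 1 -> u = v).
Proof.
move=> uu vv; have E : dot (u - v) (u - v) = 2 - 2 * dot u v.
  by rewrite !(dotDl, dotDr, dotNl, dotNr) uu vv (dotC v u); ring.
split; first by have := dot_ge0 (u - v); rewrite E; lra.
move=> uv; apply/eqP; rewrite -subr_eq0 -dot_eq0 E uv; apply/eqP; ring.
Qed.

Section Uniqueness.
Variables (sg : bool) (k : R -> R) (J : set R).
Hypothesis iJ : is_interval J.

(* The frames agree because the sum of the three scalar products of corresponding
   unit vectors is constant, hence equal to its initial value 3. *)
Lemma frame_unique (g w T g' w' T' : R -> 'rV[R]_3) s0 :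
  (forall s, J s -> frame_at sg (k s) g w T s) ->
  (forall s, J s -> frame_at sg (k s) g' w' T' s) ->
  J s0 -> g s0 = g' s0 -> w s0 = w' s0 -> T s0 = T' s0 ->
  forall s, J s -> [/\ g s = g' s, w s = w' s & T s = T' s].
Proof.
move=> fr fr' J0 g0 w0 T0.
pose N s := cross (w s) (T s); pose N' s := cross (w' s) (T' s).
pose E s := dot (T s) (T' s) + (dot (N s) (N' s) + dot (w s) (w' s)).
have dN (a b c : R -> 'rV[R]_3) s : frame_at sg (k s) a b c s ->
    is_derive s 1 (fun s => cross (b s) (c s)) (- k s *: c s).
  move=> [_ dw dT [ww TT wT]]; apply: is_derive_eq (is_dcross dw dT) _.
  rewrite crossZl crossDr !crossZr cross_cross ww wT.
  have c0 (u : 'rV[R]_3) : cross u u = 0.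
    by apply: rV3P; rewrite crossE mxE; ring.
  by rewrite !c0 !scaler0 !add0r scale0r sub0r scale1r scalerN scaleNr.
have dE s : J s -> is_derive s 1 E 0.
  move=> Js; have := dN _ _ _ _ (fr s Js); have := dN _ _ _ _ (fr' s Js).
  have [_ dw dT _] := fr s Js; have [_ dw' dT' _] := fr' s Js => dN' dN1.
  apply: is_derive_eq (is_dD (is_ddot dT dT') (is_dD (is_ddot dN1 dN') (is_ddot dw dw'))) _.
  rewrite -/(N s) -/(N' s) !(dotDl, dotDr, dotZl, dotZr).
  move: (dot _ _) (dot _ _) (dot _ _) (dot _ _) => a b c d; ring.
have un (a b c : R -> 'rV[R]_3) s : frame_at sg (k s) a b c s ->
    [/\ dot (b s) (b s) = 1, dot (c s) (c s) = 1 & dot (cross (b s) (c s)) (cross (b s)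
        (c s)) = 1].
  move=> [_ _ _ [ww TT wT]]; split => //.
  by rewrite cross_dot ww TT wT mul0r subr0 mulr1.
have E0 : E s0 = 3.
  have [ww TT NN] := un _ _ _ _ (fr s0 J0).
  by rewrite /E /N /N' -w0 -T0 ww TT NN; ring.
have wT s : J s -> w s = w' s /\ T s = T' s.
  move=> Js; have Es : E s = 3 by rewrite -E0; exact: cst_on dE _ _ Js J0.
  have [ww TT NN] := un _ _ _ _ (fr s Js); have [ww' TT' NN'] := un _ _ _ _ (fr' s Js).
  have [w1 we] := dot_unit ww ww'; have [T1 Te] := dot_unit TT TT';
      have [N1 _] := dot_unit NN NN'.
  by move: Es; rewrite /E /N /N' => Es; split; [apply: we|apply: Te]; lra.
move=> s Js; have [ws Ts] := wT s Js; split => //.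
apply/eqP; rewrite -subr_eq0; apply/eqP.
rewrite (vcst_on (F := fun s => g s - g' s) iJ _ Js J0) ?g0 ?subrr// => z Jz.
have [dg _ _ _] := fr z Jz; have [dg' _ _ _] := fr' z Jz; have [_ Tz] := wT z Jz.
by apply: is_derive_eq (is_dD dg (is_dN dg')) _; rewrite Tz subrr.
Qed.

End Uniqueness.

Lemma frame_ext sg (c c' : R) J g w T g' w' T' s : open J -> J s ->
  (forall z, J z -> [/\ g z = g' z, w z = w' z & T z = T' z]) -> c = c' ->
  frame_at sg c g w T s -> frame_at sg c' g' w' T' s.
Proof.
move=> oJ Js H <- [dg dw dT d]; have [_ E2 E3] := H s Js.
split; rewrite -?E2 -?E3 //; [apply: is_derive_open_ext dg|apply: is_derive_open_ext
    dw|apply: is_derive_open_ext dT];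
  by [exact: oJ|exact: Js|move=> z /H[]].
Qed.

Definition frame_on sg k J g w T :=
  open_interval J /\ forall s, J s -> frame_at sg (k s) g w T s.

Lemma interval_cap J J' : open_interval J -> open_interval J' -> open_interval (J `&` J').
Proof.
move=> [oJ iJ] [oJ' iJ']; split; first exact: openI.
move=> a b [Ja Ja'] [Jb Jb'] c ab; split; [exact: (iJ a b)|exact: (iJ' a b)].
Qed.

Lemma frame_agree sg k J J' g w T g' w' T' s0 :
  frame_on sg k J g w T -> frame_on sg k J' g' w' T' -> J s0 -> J' s0 ->
  g s0 = g' s0 -> w s0 = w' s0 -> T s0 = T' s0 ->
  forall s, J s -> J' s -> [/\ g s = g' s, w s = w' s & T s = T' s].
Proof.
move=> [oiJ fr] [oiJ' fr'] J0 J0' g0 w0 T0 s Js Js'.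
have [_ iK] := interval_cap oiJ oiJ'.
apply: (frame_unique (s0 := s0) iK (k := k) (sg := sg)) => //.
  by move=> z [Jz _]; exact: fr.
by move=> z [_ Jz]; exact: fr'.
Qed.

Lemma interval_union (F : set (set R)) (s0 : R) :
  (forall J, F J -> open_interval J /\ J s0) ->
  open_interval [set s | exists2 J, F J & J s].
Proof.
move=> H; split.
  rewrite openE => s [J FJ Js]; have [[oJ _] _] := H J FJ.
  have : nbhs s J by apply: open_nbhs_nbhs; split.
  by apply: filterS => z Jz; exists J.
move=> a b [J FJ Ja] [J' FJ' Jb] c /andP[ac cb].
have [[_ iJ] J0] := H J FJ; have [[_ iJ'] J0'] := H J' FJ'.
have [cs|sc] := leP c s0.
  by exists J => //; apply: (iJ a s0) => //; rewrite ac.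
by exists J' => //; apply: (iJ' s0 b) => //; rewrite (ltW sc).
Qed.

(* The parameter k is given on all of R, so there is a largest solution: the
   union of all those with the same value at s0. *)
Lemma maximal_frame sg k J0 g0 w0 T0 s0 : frame_on sg k J0 g0 w0 T0 -> J0 s0 ->
  exists J g w T, [/\ frame_on sg k J g w T, J s0,
    [/\ g s0 = g0 s0, w s0 = w0 s0 & T s0 = T0 s0] &
    forall J' g' w' T' s1, frame_on sg k J' g' w' T' -> J' s1 -> J s1 ->
      g' s1 = g s1 -> w' s1 = w s1 -> T' s1 = T s1 ->
      forall s, J' s -> [/\ J s, g' s = g s, w' s = w s & T' s = T s]].
Proof.
move=> fr0 Js0.
pose fam J g w T := [/\ frame_on sg k J g w T, J s0, g s0 = g0 s0, w s0 = w0 s0 & T s0 = T0 s0].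
pose F := [set J | exists g w T, fam J g w T].
pose J := [set s | exists2 J, F J & J s].
have famJ K g w T s : fam K g w T -> K s -> J s.
  by move=> f Ks; exists K => //; exists g, w, T.
(* By [frame_agree] all members of the family defined at s have the same value there, so an
   arbitrary choice by [xget] is harmless; the default (0, 0, 0) only occurs outside [J]. *)
pose val s := [set v : 'rV[R]_3 * 'rV[R]_3 * 'rV[R]_3 |
  exists K g w T, [/\ fam K g w T, K s & v = (g s, w s, T s)]].
pose sol s := xget (0, 0, 0) (val s).
have agree K g w T s : fam K g w T -> K s -> sol s = (g s, w s, T s).
  move=> f Ks; rewrite /sol; case: xgetP => [v -> [K' [g' [w' [T' [f' Ks' ->]]]]]|/(_ (g
      s, w s, T s))[]].
    move: f f' => [fK Kz e1 e2 e3] [fK' Kz' e1' e2' e3'].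
    have [|||-> -> ->//] := frame_agree fK fK' Kz Kz' _ _ _ Ks Ks'; by rewrite ?e1 ?e2 ?e3.
  by exists K, g, w, T.
pose g s := (sol s).1.1; pose w s := (sol s).1.2; pose T s := (sol s).2.
have eqf K g' w' T' : fam K g' w' T' -> forall s, K s -> [/\ g' s = g s,
    w' s = w s & T' s = T s].
  by move=> f s Ks; rewrite /g /w /T (agree _ _ _ _ _ f Ks).
have oiJ : open_interval J.
  by apply: (interval_union (s0 := s0)) => K [g' [w' [T' [[]]]]].
have fam0 : fam J0 g0 w0 T0 by [].
have frJ : frame_on sg k J g w T.
  split => // s [K [g' [w' [T' f]]] Ks]; have [[[oK _] fr] _ _ _ _] := f.
  by apply: (frame_ext oK Ks (eqf _ _ _ _ f) erefl); exact: fr.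
have [e1 e2 e3] := eqf _ _ _ _ fam0 s0 Js0.
exists J, g, w, T; split => //; first exact: famJ fam0 Js0.
move=> J' g' w' T' s1 fr' J's1 Js1 h1 h2 h3.
have ag s : J s -> J' s -> [/\ g s = g' s, w s = w' s & T s = T' s].
  by move=> Js J's; apply: (frame_agree frJ fr' Js1 J's1).
pose mix (h h' : R -> 'rV[R]_3) s := if pselect (J s) then h s else h' s.
have mixJ s : J s -> [/\ g s = mix g g' s, w s = mix w w' s & T s = mix T T' s].
  by move=> Js; rewrite /mix; case: pselect.
have mixJ' s : J' s -> [/\ g' s = mix g g' s, w' s = mix w w' s & T' s = mix T T' s].
  move=> J's; rewrite /mix; case: pselect => // Js.
  by have [-> -> ->] := ag s Js J's.
have [[oJ' iJ'] f'] := fr'; have [oJ iJ] := oiJ.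
(* A solution that agrees with the union at one point can be glued to it, and the result is again a
   member of the family; hence its domain was already contained in [J]. *)
have fmix : fam (J `|` J') (mix g g') (mix w w') (mix T T').
  have [m1 m2 m3] := mixJ s0 (famJ _ _ _ _ _ fam0 Js0).
  split; [split|by left; exact: famJ fam0 Js0|by rewrite -m1|by rewrite -m2|by rewrite -m3].
    have := @interval_union [set K | K = J \/ K = J'] s1 _.
    rewrite (_ : [set s | _] = J `|` J'); first by apply => K [->|->].
    by apply/seteqP; split => [s [K [->|->]]|s [Ks|Ks]]; [left|right|exists J => //;
        left|exists J' => //; right].
  move=> s [Js|Js].
    by apply: (frame_ext oJ Js mixJ erefl); have [_] := frJ; exact.
  by apply: (frame_ext oJ' Js mixJ' erefl); exact: f'.
move=> s J's; have Js : J s by apply: famJ fmix _; right.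
by have [-> -> ->] := ag s Js J's.
Qed.

(** [eps] and [c] reverse and shift the arclength, [ep] reverses the rulings and [c1] slides the
    base curve along them. In a cone the rulings are measured from the vertex and t is positive, so
    only the first two are possible. *)
Lemma frame_affine sg (eps ep c c1 : R) k J g w T : eps * eps = 1 -> ep * ep = 1 ->
  (sg -> ep = 1 /\ c1 = 0) -> frame_on sg k J g w T ->
  frame_on sg (fun s => eps * ep * k (eps * s + c)) [set s | J (eps * s + c)]
    (fun s => g (eps * s + c) + c1 *: w (eps * s + c)) (fun s => ep *: w (eps * s + c))
    (fun s => eps *: T (eps * s + c)).
Proof.
move=> e2 p2 H [[oJ iJ] fr].
have e1 : eps = 1 \/ eps = -1.
  by have /eqP := e2; rewrite -expr2 sqrf_eq1 => /orP[] /eqP ->; [left|right].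
split; first split.
- apply: (open_comp (D := J) (f := fun s : R => eps * s + c)) => // s _.
  apply: (is_derive_continuous (d := eps)).
  apply: is_derive_eq (is_dD (is_dM (is_dC s (1 : R) eps) (is_derive_id s 1)) (is_dC s (1
      : R) c)) _.
  by ring.
- move=> a b Ja Jb d /andP[ad db]; case: e1 Ja Jb => ->.
    by rewrite /= !mul1r => Ja Jb; apply: (iJ _ _ Ja Jb); rewrite !lerD2r ad.
  by rewrite /= !mulN1r => Ja Jb; apply: (iJ _ _ Jb Ja); rewrite !lerD2r !lerN2 db.
- move=> s Js; have [dg dw dT [ww TT wT]] := fr _ Js.
  have Ag := is_derive_affine dg; have Aw := is_derive_affine dw;
      have AT := is_derive_affine dT.
  split.
  + apply: is_derive_eq (is_dD Ag (is_dscale (is_dC s (1 : R) c1) Aw)) _.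
    case: sg H {dg dw dT Ag Aw AT fr} => [/(_ isT)[_ ->]|_].
      by rewrite subrr !scale0r !scaler0 !addr0.
    by rewrite subr0 !scale0r !scaler0 !scale1r add0r addr0.
  + apply: is_derive_eq (is_dscale (is_dC s (1 : R) ep) Aw) _.
    case: sg H {dg dw dT Ag Aw AT fr} => [/(_ isT)[-> _]|_].
      by rewrite scale0r add0r !scale1r.
    by rewrite !scale0r !scaler0 addr0.
  + apply: is_derive_eq (is_dscale (is_dC s (1 : R) eps) AT) _.
    rewrite scale0r add0r scalerA e2 scale1r crossZl crossZr !scalerA.
    congr (_ + _).
      by case: sg H {dg dw dT Ag Aw AT fr} => [/(_ isT)[-> _]|_];
          rewrite ?mulr1 // !oppr0 !mul0r.
    congr (_ *: _).
    transitivity ((eps * eps) * (ep * ep) * k (eps * s + c)); last by ring.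
    by rewrite e2 p2; ring.
  + by rewrite !(dotZl, dotZr) ww TT wT !mulr1 !mulr0.
Qed.

Lemma surf_affine (eps ep c c1 : R) g w (q : 'rV[R]_2) :
  surf (fun s => g (eps * s + c) + c1 *: w (eps * s + c)) (fun s => ep *: w (eps * s + c)) q =
  surf g w (pt (eps * q 0 0 + c) (ep * q 0 1 + c1)).
Proof.
by rewrite /surf ptE0 ptE1 -addrA scalerA -scalerDl (addrC c1) (mulrC ep).
Qed.

(** The linear equation k'' + sigma k = 0 is invariant under reflections and translations of s. The
    coefficients do not both become zero because the substitution is invertible. *)
Lemma kap_affine sg (eps ep c a b : R) : eps * eps = 1 -> ep * ep = 1 ->
  (a != 0) || (b != 0) -> exists a' b', (a' != 0) || (b' != 0) /\
    forall s, eps * ep * kap sg a b (eps * s + c) = kap sg a' b' s.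
Proof.
move=> e2 p2 ab.
suff [a' [b' H]] : exists a' b', forall s, eps * ep * kap sg a b (eps * s + c) = kap sg a' b' s.
  exists a', b'; split => //; rewrite -negb_and; apply/negP => /andP[/eqP a0 /eqP b0].
  have [z _] := kap_neq0_dense sg ab openT (I : [set: R] 0).
  suff : eps * ep * kap sg a b z = 0.
    by move/eqP; rewrite !mulf_eq0 (negbTE (sqr1_neq0 e2)) (negbTE (sqr1_neq0 p2)) /= => ->.
  have := H (eps * (z - c)); rewrite mulrA e2 mul1r subrK => ->.
  by rewrite a0 b0 /kap; case: sg {H}; rewrite !mul0r addr0.
rewrite /kap; case: sg; last first.
  by exists (eps * ep * (a * eps)), (eps * ep * (a * c + b)) => s; ring.
exists (eps * ep * (a * cos c + b * sin c)), (ep * (b * cos c - a * sin c)) => s.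
rewrite cosD sinD.
have /eqP := e2; rewrite -expr2 sqrf_eq1 => /orP[] /eqP ->;
    rewrite ?mul1r ?mulN1r ?cosN ?sinN; ring.
Qed.

End Frames.

(** * Local models *)

Section Rectangle.
Variable R : realType.

Lemma ball2P (q0 q : 'rV[R]_2) d : 0 < d ->
  ball q0 d q <-> `|q 0 0 - q0 0 0| < d /\ `|q 0 1 - q0 0 1| < d.
Proof.
move=> d0; split=> [/rVballP h|[h0 h1]].
  by split; apply: le_lt_trans h; rewrite distrC;
    [have := rV_norm_ge (q0 - q) 0|have := rV_norm_ge (q0 - q) 1]; rewrite !mxE.
apply/rVballP; apply: rV_norm_lt => // i; rewrite !mxE distrC.
by have [->|->] := ord2 i.
Qed.

Lemma is_derive_slice (W : normedModType R) (U : set 'rV[R]_2) (f : 'rV[R]_2 -> W) (s t : R) :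
  smooth_on U f -> U (pt s t) -> is_derive s 1 (fun s => f (pt s t)) (pd 0 f (pt s t)).
Proof.
move=> sf Up.
have E z : pt z t = pt 0 t + z *: e_ 0.
  by apply: rV2P; rewrite !mxE /=; ring.
rewrite pdE /partial (_ : (fun s => f (pt s t)) = (fun z => f (pt 0 t + z *: e_ 0)));
    last first.
  by apply/funext => z; rewrite E.
rewrite (E s); have h := @smooth_derivable _ _ _ 0 _ _ sf Up; rewrite (E s) in h.
exact: (is_derive_line h).
Qed.

Variables (q0 : 'rV[R]_2) (d : R).
Hypothesis d0 : 0 < d.
Let B := ball q0 d.
Let oB : open B. Proof. exact: ball_open. Qed.
Let J := [set s : R | `|s - q0 0 0| < d].
Let t0 := q0 0 1.

Let JB s : J s -> B (pt s t0).
Proof. by move=> Js; apply/ball2P => //; rewrite ptE0 ptE1 subrr normr0. Qed.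

Let BJ q : B q -> J (q 0 0). Proof. by move=> /ball2P[]. Qed.

Let cst_t n (f : 'rV[R]_2 -> 'rV[R]_n) : smooth_on B f -> (forall q, B q -> pd 1 f q = 0) ->
  forall q, B q -> f q = f (pt (q 0 0) t0).
Proof.
move=> sf f1 q Bq; apply/rowP => j; apply/eqP; rewrite -subr_eq0; apply/eqP.
have [h0 h1] := (ball2P q0 q d0).1 Bq.
have E z : pt (q 0 0) t0 + z *: e_ 1 = pt (q 0 0) (t0 + z).
  by apply: rV2P; rewrite !mxE /=; ring.
have Bz z : `|z| <= `|q 0 1 - t0| -> B (pt (q 0 0) t0 + z *: e_ 1).
  move=> zl; rewrite E; apply/ball2P => //; rewrite ptE0 ptE1 -/t0 addrC_addKr.
  by split => //; exact: le_lt_trans zl h1.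
have sj : smooth_on B (fun q => f q 0 j) by smooth.
have [|z [zl _]] := MVT_pd (f := fun q => f q 0 j) (q := pt (q 0 0) t0) (i := 1) (h := q
    0 1 - t0).
  by move=> z zl _; apply: smooth_derivable sj _; exact: Bz.
rewrite E addr_subK -ptE => ->.
have Bz1 := Bz z zl.
by rewrite (is_derive_pd (is_dcoord j (smooth_is_derive 1 sf Bz1))) f1// mxE mul0r.
Qed.

Variables (sg : bool) (Y W T : 'rV[R]_2 -> 'rV[R]_3) (K : 'rV[R]_2 -> R).
Hypotheses (sY : smooth_on B Y) (sW : smooth_on B W) (sT : smooth_on B T) (sK : smooth_on B K).
Hypothesis pY : forall q, B q -> pd 0 Y q = rho sg (q 0 1) *: T q /\ pd 1 Y q = W q.
Hypothesis pW : forall q, B q -> pd 0 W q = sg%:R *: T q /\ pd 1 W q = 0.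
Hypothesis pT : forall q, B q ->
  pd 0 T q = - sg%:R *: W q + K q *: cross (W q) (T q) /\ pd 1 T q = 0.
Hypothesis onb : forall q, B q ->
  [/\ dot (W q) (W q) = 1, dot (T q) (T q) = 1 & dot (W q) (T q) = 0].

(** The equations make W and T independent of t, so they are curves. The base curve is recovered on
    the line t = t0 by going back along the ruling, [Y - t0 *: W]; the curvature is read off by
    comparing the components of T' along W x T. *)
Lemma frame_of_pde : exists k k1 k2 g w T', [/\ frame_on sg k J g w T',
  forall q, B q -> Y q = surf g w q, forall q, B q -> K q = k (q 0 0) &
  forall s, J s -> is_derive s 1 k (k1 s) /\ is_derive s 1 k1 (k2 s)].
Proof.
exists (fun s => K (pt s t0)), (fun s => pd 0 K (pt s t0)), (fun s => pd 0 (pd 0 K) (pt s t0)).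
exists (fun s => Y (pt s t0) - t0 *: W (pt s t0)), (fun s => W (pt s t0)),
    (fun s => T (pt s t0)).
have WE := cst_t sW (fun q Bq => (pW Bq).2); have TE := cst_t sT (fun q Bq => (pT Bq).2).
have dT s : J s -> is_derive s 1 (fun s => T (pt s t0)) (- sg%:R *: W (pt s t0) +
    K (pt s t0) *: cross (W (pt s t0)) (T (pt s t0))).
  by move=> Js; rewrite -(pT (JB Js)).1; exact: is_derive_slice sT (JB Js).
split.
- split.
    split; first exact: open_disc.
    move=> a b; rewrite /J /= !ltr_norml => /andP[a1 a2] /andP[b1 b2] c /andP[ac cb].
    by rewrite ltr_norml; apply/andP; split; lra.
  move=> s Js; have Bs := JB Js; split; last exact: onb.
  + apply: is_derive_eq (is_dD (is_derive_slice sY Bs) (is_dN (is_dscale (is_dC s (1 : R) t0)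
      (is_derive_slice sW Bs)))) _.
    rewrite (pY Bs).1 (pW Bs).1 ptE1 scale0r add0r scalerA -scalerBl /rho (mulrC t0) addrK//.
  + by rewrite -(pW Bs).1; exact: is_derive_slice sW Bs.
  + exact: dT.
- move=> q Bq; rewrite /surf.
  pose G q := Y q + - (q 0 1 *: W q).
  have sG : smooth_on B G by rewrite /G; smooth.
  suff GE : G q = G (pt (q 0 0) t0).
    move: GE; rewrite /G ptE1 => <-.
    by rewrite -(WE q Bq) subrK.
  apply: (cst_t sG) Bq => z Bz; rewrite /G.
  rewrite (is_derive_pd (is_dD (smooth_is_derive 1 sY Bz) (is_dN (is_dscale
    (is_dcoord 1 (is_derive_id z (e_ 1))) (smooth_is_derive 1 sW Bz))))).
  by rewrite (pY Bz).2 (pW Bz).2 scaler0 addr0 mxE /= scale1r subrr.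
- move=> q Bq; have Js := BJ Bq.
  have := (pT Bq).1; rewrite (pd_ext 0 oB Bq TE) (is_derive_pd (is_derive_vlift 0 (dT _
      Js))) scale1r.
  rewrite (WE q Bq) (TE q Bq) => /addrI/(congr1 (dot (cross (W (pt (q 0 0) t0)) (T (pt (q
      0 0) t0))))).
  have [h1 h2 h3] := onb (JB Js).
  by rewrite !dotZr cross_dot h1 h2 h3 mul0r subr0 !mulr1 => ->.
- move=> s Js; split; first exact: is_derive_slice sK (JB Js).
  exact: is_derive_slice (smooth_pd 0 sK) (JB Js).
Qed.

End Rectangle.

(** * A flat patch in coordinates adapted to its rulings *)

Section FlatRuled.
Variables (R : realType) (B : set 'rV[R]_2) (y : 'rV[R]_2 -> 'rV[R]_3).
Hypotheses (oB : open B) (sy : smooth_on B y) (iy : isometric_on B y).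
Variables (sg : bool) (Z0 : 'rV[R]_2) (f : R -> 'rV[R]_2).
Let e s := pt (- f s 0 1) (f s 0 0).
Hypothesis f1 : forall s, f s 0 0 ^+ 2 + f s 0 1 ^+ 2 = 1.
Hypothesis df : forall s : R, is_derive s 1 f (sg%:R *: e s).
Hypothesis sf : smooth_on [set: 'rV[R]_2] (fun q => f (q 0 0)).

(** Cartesian coordinates with one axis along the constant vector f when [sg] is false, polar
    coordinates centred at [Z0] when [sg] is true. In both cases the curves s = constant are the
    rulings of the patch, seen in the Euclidean plane. *)
Definition ruled_plane (q : 'rV[R]_2) := Z0 + ((1 - sg%:R) * q 0 0) *: e (q 0 0) + q 0 1
    *: f (q 0 0).
Local Notation F := ruled_plane.

Hypothesis kern : forall q, B (F q) -> forall i,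
  f (q 0 0) 0 0 * hform y 0 i (F q) + f (q 0 0) 0 1 * hform y 1 i (F q) = 0.

Let oT : open [set: 'rV[R]_2]. Proof. exact: openT. Qed.

Lemma ruled_plane_smooth : smooth_on [set: 'rV[R]_2] F.
Proof.
have se : smooth_on [set: 'rV[R]_2] (fun q => e (q 0 0)).
  apply/(smooth_mx oT) => i; have [->|->] := ord2 i.
    apply: (@smooth_ext _ _ _ (fun q => - f (q 0 0) 0 1)) => //;
        last exact: (smoothN oT (smooth_comp_mx oT 1 sf)).
    by move=> z _; rewrite /e ptE0.
  apply: (@smooth_ext _ _ _ (fun q => f (q 0 0) 0 0)) => //;
      last exact: (smooth_comp_mx oT 0 sf).
  by move=> z _; rewrite /e ptE1.
rewrite /ruled_plane. apply: smooth_vadd; [exact: oT | apply: smooth_vadd;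
    [exact: oT|apply: smooth_vcst; exact: oT|apply: smooth_scale;
    [exact: oT|apply: smoothM; [exact: oT | apply: smooth_cst;
    exact: oT|apply: smooth_coord; exact: oT]|exact: se]]|apply: smooth_scale;[exact:
    oT|apply: smooth_coord; exact: oT|exact: sf]].
Qed.

Let De (s : R) : is_derive s 1 e (- sg%:R *: f s).
Proof.
have /is_derive_mx d := df s; apply/is_derive_mx => i; have [->|->] := ord2 i.
  rewrite (_ : (fun _ => _) = (fun z => - f z 0 1)); last by apply/funext => z; rewrite ptE0.
  by apply: is_derive_eq (is_dN (d 1)) _; rewrite !rvE ptE1 mulNr.
rewrite (_ : (fun _ => _) = (fun z => f z 0 0)); last by apply/funext => z; rewrite ptE1.
by apply: is_derive_eq (d 0) _; rewrite !rvE ptE0 mulrN mulNr.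
Qed.

Lemma ruled_plane_derive q :
  is_derive q (e_ 0) F (rho sg (q 0 1) *: e (q 0 0)) /\ is_derive q (e_ 1) F (f (q 0 0)).
Proof.
have h i := is_dD (is_dD (is_dC q (e_ i) Z0) (is_dscale (is_dM (is_dC q (e_ i) (1 - sg%:R : R))
  (is_dcoord 0 (is_derive_id q (e_ i)))) (is_derive_vlift i (De (q 0 0)))))
  (is_dscale (is_dcoord 1 (is_derive_id q (e_ i))) (is_derive_vlift i (df (q 0 0)))).
split; apply: is_derive_eq (h _) _; rewrite !mxE /=.
  have Z j : (0 : 'rV[R]_2) 0 j = 0 by rewrite mxE.
  by apply: rV2P; rewrite !rvE Z /rho /e ?ptE0 ?ptE1; case: (sg); rewrite ?mulr1n ?mulr0n; ring.
by rewrite !(scale0r, scaler0, mulr0, addr0, add0r, scale1r).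
Qed.

Let D := [set q | B (F q)].
Let oD : open D.
Proof. by apply: (open_comp (D := B)) => // q _; exact: smooth_continuous
    ruled_plane_smooth I. Qed.
Let FD q : D q -> B (F q). Proof. by []. Qed.
Let sF : smooth_on D F. Proof. exact: smooth_subset ruled_plane_smooth. Qed.

Let pF q : (pd 0 (fun z => F z 0 0) q = rho sg (q 0 1) * - f (q 0 0) 0 1 /\
            pd 0 (fun z => F z 0 1) q = rho sg (q 0 1) * f (q 0 0) 0 0) /\
  (pd 1 (fun z => F z 0 0) q = f (q 0 0) 0 0 /\ pd 1 (fun z => F z 0 1) q = f (q 0 0) 0 1).
Proof.
have [/is_derive_mx h0 /is_derive_mx h1] := ruled_plane_derive q.
rewrite (is_derive_pd (h0 0)) (is_derive_pd (h0 1)) (is_derive_pd (h1 0)) (is_derive_pd (h1 1)).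
by rewrite !rvE ptE0 ptE1.
Qed.

Lemma ruled_plane_jac q : jac (fun z => F z 0 0) (fun z => F z 0 1) q = - rho sg (q 0 1).
Proof.
have [[h1 h2] [h3 h4]] := pF q; rewrite /jac h1 h2 h3 h4.
by rewrite -[RHS]mulr1 -(f1 (q 0 0)); ring.
Qed.

Let Y (q : 'rV[R]_2) := y (F q).
Let W (q : 'rV[R]_2) := f (q 0 0) 0 0 *: pd 0 y (F q) + f (q 0 0) 0 1 *: pd 1 y (F q).
Let T (q : 'rV[R]_2) := - f (q 0 0) 0 1 *: pd 0 y (F q) + f (q 0 0) 0 0 *: pd 1 y (F q).
Let K (q : 'rV[R]_2) := rho sg (q 0 1) * (f (q 0 0) 0 1 ^+ 2 * hform y 0 0 (F q)
  - 2 * f (q 0 0) 0 0 * f (q 0 0) 0 1 * hform y 0 1 (F q) + f (q 0 0) 0 0 ^+ 2 * hform y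
      1 1 (F q)).

(** The second form vanishes on the ruling f, so its trace is its value on the unit vector
    orthogonal to f. *)
Lemma ruled_curvature q : D q -> K q = rho sg (q 0 1) * curv y (F q).
Proof.
move=> Dq; have := kern Dq 0; have := kern Dq 1; rewrite /K /curv (hformC oB sy 1 0)//.
have := f1 (q 0 0); move: (f _ 0 0) (f _ 0 1) (hform y 0 0 _) (hform y 0 1 _) (hform y 1
    1 _) => a b l k n u h1 h0.
congr (_ * _); transitivity ((a ^+ 2 + b ^+ 2) * (l + n)); last by rewrite u mul1r.
apply/eqP; rewrite -subr_eq0; apply/eqP.
by apply: (eliminate (k := a) (l := b) h1 h0 (erefl 0)); ring.
Qed.

Let onbF q : D q -> [/\ dot (W q) (W q) = 1, dot (T q) (T q) = 1, dot (W q) (T q) = 0 &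
  cross (W q) (T q) = unit_cross y (F q)].
Proof.
move=> Dq; have g i j := iy Dq i j.
rewrite /W /T cross_lin2 !(dotDl, dotDr, dotZl, dotZr) !g /=.
have u := f1 (q 0 0); split.
- by rewrite -[RHS]u; ring.
- by rewrite -[RHS]u; ring.
- by ring.
- by rewrite (_ : _ - _ = 1) ?scale1r// -[RHS]u; ring.
Qed.

Let dy (j : 'I_2) q i : D q -> is_derive q (e_ i) (fun z => pd j y (F z))
  ((pd i (fun z => F z 0 0) q * hform y 0 j (F q) + pd i (fun z => F z 0 1) q * hform y 1
      j (F q))
    *: unit_cross y (F q)).
Proof.
move=> Dq; apply: is_derive_eq (pd_vcomp_is_derive oB FD sF i (smooth_pd j sy) Dq) _.
by rewrite !(pd2_flat oB sy iy _ _ Dq) !scalerA -scalerDl.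
Qed.

Let df0 q i (j : 'I_2) : is_derive q (e_ i) (fun z : 'rV[R]_2 => f (z 0 0) 0 j)
  ((i == 0)%:R * (sg%:R * e (q 0 0) 0 j)).
Proof.
apply: is_derive_eq (is_dcoord j (is_derive_vlift i (df (q 0 0)))) _.
by rewrite !rvE.
Qed.

Let pWF q : D q -> pd 0 W q = sg%:R *: T q /\ pd 1 W q = 0.
Proof.
move=> Dq; have [[h1 h2] [h3 h4]] := pF q.
have h i := is_derive_pd (is_dD (is_dscale (df0 q i 0) (dy 0 i Dq)) (is_dscale (df0 q i
    1) (dy 1 i Dq))).
have k0 := kern Dq 0; have k1 := kern Dq 1; have S := hformC oB sy 1 0 Dq.
rewrite S in k0; rewrite /W !h /T h1 h2 h3 h4 S /= !ptE0 !ptE1.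
move: (pd 0 y (F q)) (pd 1 y (F q)) (unit_cross y (F q)) (rho _ _) k0 k1 => u v n r.
move: (f _ 0 0) (f _ 0 1) (hform y 0 0 _) (hform y 0 1 _) (hform y 1 1 _) (sg%:R : R) =>
    a b l m k g k0 k1.
split; apply/rowP => j; rewrite ?rvE ?mxE ?rvE; apply/eqP; rewrite -subr_eq0; apply/eqP.
  by apply: (eliminate (k := b * r * n 0 j) (l := - (a * r * n 0 j)) k1 k0 (erefl 0)); ring.
by apply: (eliminate (k := - (a * n 0 j)) (l := - (b * n 0 j)) k1 k0 (erefl 0)); ring.
Qed.

Let pTF q : D q -> pd 0 T q = - sg%:R *: W q + K q *: cross (W q) (T q) /\ pd 1 T q = 0.
Proof.
move=> Dq; have [[h1 h2] [h3 h4]] := pF q.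
have h i := is_derive_pd (is_dD (is_dscale (is_dN (df0 q i 1)) (dy 0 i Dq)) (is_dscale
    (df0 q i 0) (dy 1 i Dq))).
have [_ _ _ ->] := onbF Dq.
have k0 := kern Dq 0; have k1 := kern Dq 1; have S := hformC oB sy 1 0 Dq.
rewrite S in k0; rewrite /T !h /W h1 h2 h3 h4 S /= !ptE0 !ptE1.
move: (pd 0 y (F q)) (pd 1 y (F q)) (unit_cross y (F q)) k0 k1 => u v n.
rewrite /K; move: (rho _ _) (f _ 0 0) (f _ 0 1) (hform y 0 0 _) (hform y 0 1 _) (hform y
    1 1 _) (sg%:R : R) => r a b l m k g k0 k1.
split; apply/rowP => j; rewrite ?rvE ?mxE ?rvE; apply/eqP; rewrite -subr_eq0; apply/eqP.
  by ring.
by apply: (eliminate (k := b * n 0 j) (l := - (a * n 0 j)) k1 k0 (erefl 0)); ring.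
Qed.

Lemma ruled_frame q0 d : 0 < d -> ball q0 d `<=` D ->
  exists k k1 k2 g w T', [/\ frame_on sg k [set s : R | `|s - q0 0 0| < d] g w T',
  forall q, ball q0 d q -> y (F q) = surf g w q,
  forall q, ball q0 d q -> rho sg (q 0 1) * curv y (F q) = k (q 0 0) &
  forall s, `|s - q0 0 0| < d -> is_derive s 1 k (k1 s) /\ is_derive s 1 k1 (k2 s)].
Proof.
move=> d0 bD.
have sub (n : normedModType R) (h : 'rV[R]_2 -> n) : smooth_on D h -> smooth_on (ball q0
    d) h by exact: smooth_subset.
have sfD : smooth_on D (fun q => f (q 0 0)) by exact: smooth_subset sf.
have syF j : smooth_on D (fun q => pd j y (F q)).
  exact: (smooth_vcomp oD oB FD (smooth_pd j sy) sF).
have shF i j : smooth_on D (fun q => hform y i j (F q)).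
  exact: (smooth_comp oD oB FD (smooth_hform_flat oB sy iy i j) sF).
have sY : smooth_on D Y by exact: (smooth_vcomp oD oB FD sy sF).
have sf0 j : smooth_on D (fun q => f (q 0 0) 0 j) := smooth_comp_mx oD j sfD.
have sr : smooth_on D (fun q => rho sg (q 0 1)).
  apply: smoothD => //; first exact: smooth_cst.
  by apply: smoothM => //; [exact: smooth_cst|exact: smooth_coord].
have sW : smooth_on D W :=
  smooth_vadd oD (smooth_scale oD (sf0 0) (syF 0)) (smooth_scale oD (sf0 1) (syF 1)).
have sT : smooth_on D T :=
  smooth_vadd oD (smooth_scale oD (smoothN oD (sf0 1)) (syF 0)) (smooth_scale oD (sf0 0)
      (syF 1)).
have sK : smooth_on D K := smoothM oD sr (smoothD oD (smoothD oD
  (smoothM oD (smoothX oD (sf0 1) 2) (shF 0 0)) (smoothN oD (smoothM oD (smoothM oD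
  (smoothM oD (smooth_cst oD (2 : R)) (sf0 0)) (sf0 1)) (shF 0 1))))
  (smoothM oD (smoothX oD (sf0 0) 2) (shF 1 1))).
have pYF q : ball q0 d q -> pd 0 Y q = rho sg (q 0 1) *: T q /\ pd 1 Y q = W q.
  move=> /bD Dq; have [[h1 h2] [h3 h4]] := pF q.
  have h i := is_derive_pd (pd_vcomp_is_derive oB FD sF i sy Dq).
  by rewrite !h h1 h2 h3 h4 /T scalerDr !scalerA.
have [|k [k1 [k2 [g [w [T' [a1 a2 a3 a4]]]]]]] := frame_of_pde d0 (sub _ _ sY) (sub _ _
    sW) (sub _ _ sT)
  (sub _ _ sK) pYF (fun q Bq => pWF (bD q Bq)) (fun q Bq => pTF (bD q Bq)).
  by move=> q /bD Dq; have [] := onbF Dq.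
by exists k, k1, k2, g, w, T'; split => // q Bq; rewrite -a3// ruled_curvature//; exact: bD.
Qed.

End FlatRuled.

(** * Local classification: planar pieces, cylinders and cones *)

Section LocalModels.
Variable R : realType.

(** The Laplacian depends only on the germ of the patch. This is the case of the identity in the
    invariance under changes of parameters, which needs regularity of only one of the two maps. *)
Lemma laplacian_ext (U : set 'rV[R]_2) (y y' : 'rV[R]_2 -> 'rV[R]_3) q : regular_patch U
    y' -> U q ->
  (forall z, U z -> y z = y' z) ->
  laplacian y (mean_curvature y) q = laplacian y' (mean_curvature y') q.
Proof.
move=> [oU sy' n0'] Uq yy.
have sid : smooth_on U (fun z => z : 'rV[R]_2).
  by apply/(smooth_mx oU) => i; exact: smooth_coord oU i.
have c i (j : 'I_2) z := is_derive_pd (is_dcoord j (is_derive_id z (e_ i))).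
have J z : 0 < 1 * jac (fun z : 'rV[R]_2 => z 0 0) (fun z : 'rV[R]_2 => z 0 1) z.
  by rewrite /jac !c !mxE /= !mul1r mulr0 subr0.
rewrite -[RHS]mul1r.
exact: (reparam_laplacian oU oU (t := fun z => z) (fun z h => h) sid sy' n0' yy (mulr1 1)
    (fun z _ => J z) Uq).
Qed.

Lemma angle (a b : R) : a ^+ 2 + b ^+ 2 = 1 -> exists s : R, cos s = a /\ sin s = b.
Proof.
move=> ab; have a1 : -1 <= a <= 1.
  have : a ^+ 2 <= 1 by rewrite -ab lerDl sqr_ge0.
  by move=> h; apply/andP; split; nra.
have s0 := sin_acos a1; have c0 : cos (acos a) = a by rewrite acosK.
have sq : Num.sqrt (1 - a ^+ 2) = `|b|.
  by rewrite -ab addrC addKr sqrtr_sqr.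
have [b0|b0] := leP 0 b.
  by exists (acos a); rewrite c0 s0 sq ger0_norm.
by exists (- acos a); rewrite cosN sinN c0 s0 sq ltr0_norm// opprK.
Qed.

Variables (M : topologicalType) (x : M -> 'rV[R]_3).

Definition modelled (sg : bool) J g w m := exists U phi, [/\ local_chart x U phi, (phi @` U) m,
  U `<=` dom sg J & forall q, U q -> x (phi q) = surf g w q].

Definition planar_near m := exists U phi n c, [/\ local_chart x U phi, (phi @` U) m, n != 0 &
  forall q, U q -> dot (x (phi q)) n = c].

Lemma chart_nbhs U phi q p V psi : local_chart x U phi -> local_chart x V psi ->
  U q -> V p -> phi q = psi p -> exists2 d, 0 < d & forall z, ball p d z ->
    V z /\ exists2 q', U q' & phi q' = psi z.
Proof.
move=> [_ _ ophi [oU _ _]] [cpsi _ _ [oV _ _]] Uq Vp E.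
have oW : open (phi @` U) by apply: ophi.
have : nbhs p (psi @^-1` (phi @` U)).
  by apply: cpsi => //; apply: open_nbhs_nbhs; split => //; exists q.
have : nbhs p V by apply: open_nbhs_nbhs; split.
move=> nV nW; have /nbhs_ballP[d d0 dB] : nbhs p (V `&` (psi @^-1` (phi @` U))) by exact:
    filterI.
by exists d => // z /dB[Vz [q' Uq' e]]; split => //; exists q'.
Qed.

Section FromFlat.
Hypothesis harm : harmonic_mean_curvature x.
Variables (p : 'rV[R]_2) (r : R) (psi : 'rV[R]_2 -> M).
Let B := ball p r.
Let y := x \o psi.
Hypotheses (r0 : 0 < r) (cpsi : local_chart x B psi) (iy : isometric_on B y).

Let oB : open B. Proof. exact: ball_open. Qed.
Let sy : smooth_on B y. Proof. by have [_ _ _ []] := cpsi. Qed.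

Let Bp : B p. Proof. by apply/rVballP; rewrite subrr normr0. Qed.

(** Harmonicity along the line through [q0] is the equation k'' = - sigma k, hence the form [kap].
    If both coefficients were zero, the trace of the second form would vanish near p, against the
    density of its nonzero values. *)
Lemma ruled_local (sg : bool) (Z0 : 'rV[R]_2) (f : R -> 'rV[R]_2) q0 :
  (forall s, f s 0 0 ^+ 2 + f s 0 1 ^+ 2 = 1) ->
  (forall s : R, is_derive s 1 f (sg%:R *: pt (- f s 0 1) (f s 0 0))) ->
  smooth_on [set: 'rV[R]_2] (fun q => f (q 0 0)) ->
  (forall q, B (ruled_plane sg Z0 f q) -> forall i,
    f (q 0 0) 0 0 * hform y 0 i (ruled_plane sg Z0 f q) +
    f (q 0 0) 0 1 * hform y 1 i (ruled_plane sg Z0 f q) = 0) ->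
  ruled_plane sg Z0 f q0 = p -> 0 < rho sg (q0 0 1) ->
  (forall z d, 0 < d -> B z -> exists w, [/\ ball z d w, B w & curv y w != 0]) ->
  exists sg a b J g w T, [/\ (a != 0) || (b != 0), frame_on sg (kap sg a b) J g w T &
    modelled sg J g w (psi p)].
Proof.
move=> f1 df sf kern q0p r00 dens.
set F := ruled_plane sg Z0 f in kern q0p.
have sF : smooth_on [set: 'rV[R]_2] F by exact: ruled_plane_smooth.
pose V := [set q : 'rV[R]_2 | B (F q) /\ 0 < rho sg (q 0 1)].
have oD : open [set q | B (F q)].
  by apply: (open_comp (D := B)) => // q _; exact: smooth_continuous sF I.
have oV : open V.
  rewrite (_ : V = [set q | B (F q)] `&` dom sg setT); first by apply: openI => //;
      exact: open_dom openT.
  by apply/seteqP; split => q [h1 h2]; split => //; case: h2.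
have Vq : V q0 by split => //; rewrite q0p.
have Jn : jac (fun z => F z 0 0) (fun z => F z 0 1) q0 != 0.
  by rewrite ruled_plane_jac// oppr_eq0 gt_eqF.
have [r' [r'0 bV cF]] := chart_comp cpsi oV (smooth_subset (@subsetT _ _) sF) (fun v h =>
    h.1) Vq Jn.
have bD : ball q0 r' `<=` [set q | B (F q)] by move=> q /bV[].
have [k [k1 [k2 [g [w [T [[oiJ fr] yE KE dk]]]]]]] := ruled_frame oB sy iy f1 df sf kern r'0 bD.
set J := [set s : R | _] in oiJ fr.
have bJ q : ball q0 r' q -> dom sg J q.
  by move=> bq; have [_ h] := bV q bq; split => //; have [] := (ball2P q0 q r'0).1 bq.
have reg : regular_patch (ball q0 r') (surf g w).
  have [_ _ _ [ob sb _]] := cF; split => //; first exact: smooth_ext ob yE sb.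
  by move=> z /bJ Dz; exact: (normal_surf_neq0 fr).
have k2E s : J s -> k2 s = - (sg%:R * k s).
  move=> Js; pose q := pt s (q0 0 1).
  have bq : ball q0 r' q by apply/ball2P => //; rewrite ptE0 ptE1 subrr normr0.
  have := harm cF bq; rewrite (laplacian_ext reg bq yE).
  rewrite (laplacian_surf oiJ.1 fr (fun s Js => (dk s Js).1) (fun s Js => (dk s Js).2)
      (bJ q bq)).
  rewrite ptE0 ptE1 => /eqP; rewrite oppr_eq0 mulf_eq0 invr_eq0 mulf_eq0 pnatr_eq0 expf_eq0 /=.
  by rewrite (gt_eqF r00) orbF addr_eq0 => /eqP.
have J0 : J (q0 0 0) by rewrite /J /= subrr normr0.
have [|a [b kE]] := kap_ode (sg := sg) oiJ.2 J0 (fun s Js => (dk s Js).1).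
  by move=> s Js; rewrite -k2E//; exact: (dk s Js).2.
exists sg, a, b, J, g, w, T; split.
- rewrite -negb_and; apply/negP => /andP[/eqP a0 /eqP b0].
  have q0b : ball q0 r' q0 by apply/rVballP; rewrite subrr normr0.
  have E : (psi \o F) q0 = psi p by rewrite /= q0p.
  have [d d0 dB] := chart_nbhs cF cpsi q0b Bp E.
  have [z [pz Bz cz]] := dens p d d0 Bp.
  have [_ [q' bq' Eq]] := dB z pz.
  have [_ ipsi _ _] := cpsi.
  have zE : F q' = z by apply: ipsi Eq; apply/mem_set => //; exact: bD bq'.
  have := KE q' bq'; rewrite -/(F q') zE kE; last by have [] := bJ q' bq'.
  move/eqP; rewrite a0 b0 (_ : kap _ _ _ _ = 0); last by rewrite /kap; case: (sg);
      rewrite !mul0r addr0.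
  by rewrite mulf_eq0 (negbTE cz) orbF gt_eqF//; have [] := bV q' bq'.
- by split => // s Js; rewrite -kE//; exact: fr.
- exists (ball q0 r'), (psi \o F); split => //.
  by exists q0; [apply/rVballP; rewrite subrr normr0|rewrite /= q0p].
Qed.

(** A symmetric matrix with zero trace and zero determinant is zero. By the Weingarten equation the
    unit normal is then constant. *)
Lemma planar_local : (forall z, B z -> curv y z = 0) -> flat x -> planar_near (psi p).
Proof.
move=> c0 fl.
have h0 z i j : B z -> hform y i j z = 0.
  move=> Bz; have g := gauss_flat oB sy iy Bz (fl _ _ cpsi z Bz).
  have := c0 z Bz; rewrite /curv => /eqP; rewrite addr_eq0 => /eqP L.
  move: g; rewrite L mulNr => /eqP; rewrite eq_sym -subr_eq0 opprK -expr2.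
  rewrite paddr_eq0 ?sqr_ge0// !sqrf_eq0 => /andP[/eqP K /eqP N].
  have h00 : hform y 0 0 z = 0 by rewrite L N oppr0.
  have h10 : hform y 1 0 z = 0 by rewrite (hformC oB sy)// K.
  by have [->|->] := ord2 i; have [->|->] := ord2 j.
have n0 z : B z -> unit_cross y z = unit_cross y p.
  move=> Bz; apply/rowP => j; apply: (pd0_cst (f := fun z => unit_cross y z 0 j)) Bz => v Bv i.
  apply: is_derive_eq (is_dcoord j (smooth_is_derive i (smooth_unit_cross oB sy) Bv)) _.
  by rewrite (pd_unit_cross oB sy iy)// !h0// !scale0r addr0 oppr0 mxE.
exists B, psi, (unit_cross y p), (dot (y p) (unit_cross y p)); split;
    [exact: cpsi|by exists p| |].
- by rewrite -dot_eq0 (unit_cross1 iy)// oner_eq0.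
- move=> q Bq; apply: (pd0_cst (f := fun z => dot (y z) (unit_cross y p))) Bq => v Bv i.
  apply: is_derive_eq (is_ddot (smooth_is_derive i sy Bv) (is_dC v (e_ i) (unit_cross y p))) _.
  rewrite dot0r addr0 -(n0 v Bv) /unit_cross dotC.
  by have [->|->] := ord2 i; rewrite ?dot_crossl ?dot_crossr.
Qed.

End FromFlat.

(** The three outcomes of [flat_trichotomy] give a planar piece, a cylinder through Cartesian
    coordinates along the kernel, and a cone through polar coordinates about the common point of the
    rulings. *)
Lemma local_model m : immersed_surface x -> flat x -> harmonic_mean_curvature x ->
  planar_near m \/
  exists sg a b J g w T, [/\ (a != 0) || (b != 0), frame_on sg (kap sg a b) J g w T &
    modelled sg J g w m].
Proof.
move=> im fl harm; have [p [r [psi [r0 cpsi <- iy]]]] := flat_chart m im fl.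
have [_ _ _ [oB sy _]] := cpsi; set B := ball p r in oB sy iy cpsi.
set y := x \o psi in sy iy.
have sh := smooth_hform_flat oB sy iy.
have S z : B z -> hform y 1 0 z = hform y 0 1 z by exact: (hformC oB sy).
have Bp : B p by apply/rVballP; rewrite subrr normr0.
have := @flat_trichotomy R p r (hform y 0 0) (hform y 0 1) (hform y 1 1) (sh 0 0) (sh 0
    1) (sh 1 1).
case.
- by move=> z Bz; have g := gauss_flat oB sy iy Bz (fl _ _ cpsi z Bz); exact: g.
- by move=> z Bz; rewrite (codazzi oB sy iy 0 0 1 Bz) (pd_ext 0 oB Bz S).
- by move=> z Bz; have g := codazzi oB sy iy 0 1 1 Bz; exact: g.
- by move=> z Bz; have g := curv_harmonic oB sy iy Bz (harm _ _ cpsi z Bz); exact: g.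
- by move=> c0; left; exact: (planar_local r0 cpsi iy c0 fl).
case=> dens [[f0 [f1 [u kern]]]|[V HV]]; right.
- apply: (@ruled_local harm p r psi r0 cpsi iy false p (fun=> pt f0 f1) (pt 0 0)) => //.
  + by move=> s; rewrite ptE0 ptE1.
  + by move=> s; rewrite scale0r; exact: is_dC.
  + by apply: smooth_vcst; exact: openT.
  + move=> q Bq i; rewrite ptE0 ptE1; have [k0 k1] := kern _ Bq; have S' := S _ Bq.
    by have [->|->] := ord2 i; rewrite ?S' mulrC (mulrC f1).
  + by apply: rV2P; rewrite /ruled_plane !rvE !(ptE0, ptE1); ring.
  + by rewrite /rho mul0r addr0 subr0 ltr01.
have [pV _ _] := HV p Bp.
pose n2 := (p 0 0 - V 0 0) ^+ 2 + (p 0 1 - V 0 1) ^+ 2.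
have n20 : n2 != 0.
  rewrite /n2 paddr_eq0 ?sqr_ge0// !sqrf_eq0 !subr_eq0; apply/negP => /andP[/eqP h0 /eqP h1].
  by apply: pV; exact: rV2P.
have n0 : 0 < Num.sqrt n2 by rewrite sqrtr_gt0 lt_def n20 addr_ge0 ?sqr_ge0.
have nn : Num.sqrt n2 ^+ 2 = n2 by rewrite sqr_sqrtr ?addr_ge0 ?sqr_ge0.
set n := Num.sqrt n2 in n0 nn; have nz : n != 0 by rewrite gt_eqF.
(* [s0] and [n] are the polar coordinates of p about the vertex [V]. *)
have [|s0 [cs sn]] := @angle ((p 0 0 - V 0 0) / n) ((p 0 1 - V 0 1) / n).
  by rewrite !exprMn -mulrDl -/n2 -nn -exprMn mulfV// expr1n.
apply: (@ruled_local harm p r psi r0 cpsi iy true V (fun s => pt (cos s) (sin s)) (pt s0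
    n)) => //.
- by move=> s; rewrite ptE0 ptE1 cos2Dsin2.
- move=> s; rewrite scale1r; apply/is_derive_mx => i; have [->|->] := ord2 i.
    rewrite (_ : (fun _ => _) = cos); last by apply/funext => z; rewrite ptE0.
    by rewrite !ptE0 ptE1; apply: is_derive_eq (is_dcos (is_derive_id s 1)) _; rewrite mulr1.
  rewrite (_ : (fun _ => _) = sin); last by apply/funext => z; rewrite ptE1.
  by rewrite !ptE1 ptE0; apply: is_derive_eq (is_dsin (is_derive_id s 1)) _; rewrite mulr1.
- have oT : open [set: 'rV[R]_2] by exact: openT.
  have sc := smooth_coord oT 0.
  apply/(smooth_mx oT) => i; have [->|->] := ord2 i.
    apply: (@smooth_ext _ _ _ (fun q => cos (q 0 0))) => //; first by move=> z _; rewrite ptE0.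
    exact: (smooth_cos oT sc).
  apply: (@smooth_ext _ _ _ (fun q => sin (q 0 0))) => //; first by move=> z _; rewrite ptE1.
  exact: (smooth_sin oT sc).
- set F := ruled_plane _ _ _ => q Bq i; have [FV k0 k1] := HV _ Bq; have S' := S _ Bq.
  have F0 : F q 0 0 - V 0 0 = q 0 1 * cos (q 0 0).
    by rewrite /F /ruled_plane !rvE !ptE0 !ptE1 subrr; ring.
  have F1 : F q 0 1 - V 0 1 = q 0 1 * sin (q 0 0).
    by rewrite /F /ruled_plane !rvE !ptE0 !ptE1 subrr; ring.
  have q1 : q 0 1 != 0.
    apply/negP => /eqP q10; apply: FV; apply: rV2P; apply/eqP; rewrite -subr_eq0.
      by rewrite F0 q10 mul0r.
    by rewrite F1 q10 mul0r.
  rewrite F0 F1 in k0 k1; rewrite ptE0 ptE1.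
  apply: (mulfI q1); rewrite mulr0.
  have [->|->] := ord2 i; rewrite ?S'.
    by rewrite -[RHS]k0; ring.
  by rewrite -[RHS]k1; ring.
- apply: rV2P; rewrite /ruled_plane !rvE !ptE0 !ptE1 subrr ?cs ?sn !mul0r addr0 mulrCA
    mulfV// mulr1 addrC subrK//.
- by rewrite /rho subrr add0r mul1r ptE1.
Qed.

End LocalModels.

(** * Global models *)

Section Overlap.
Variable R : realType.

Lemma smooth_kap sg (a b : R) (U : set 'rV[R]_2) : open U ->
  smooth_on U (fun q => kap sg a b (q 0 0)).
Proof.
move=> oU; have sc := smooth_coord oU 0; rewrite /kap; case: sg.
  apply: smoothD => //; apply: smoothM => //; try exact: smooth_cst.
    exact: smooth_cos.
  exact: smooth_sin.
apply: smoothD => //; last exact: smooth_cst.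
by apply: smoothM => //; exact: smooth_cst.
Qed.

Lemma surf_kap_smooth sg (a b : R) J g w T : frame_on sg (kap sg a b) J g w T ->
  smooth_on (dom sg J) (surf g w).
Proof.
move=> [[oJ _] fr]; have h := smooth_kap sg a b (@open_coord _ _ 0 oJ).
have h' := surf_smooth oJ fr h.
by apply: (smooth_subset _ h') => q [].
Qed.

Lemma affine_of_derive (p : 'rV[R]_2) (r : R) (f : 'rV[R]_2 -> R) (a b : R) : smooth_on
    (ball p r) f ->
  (forall z, ball p r z -> pd 0 f z = a /\ pd 1 f z = b) ->
  exists c, forall z, ball p r z -> f z = a * z 0 0 + b * z 0 1 + c.
Proof.
move=> sf pf; exists (f p - (a * p 0 0 + b * p 0 1)) => z Bz.
have H : f z - (a * z 0 0 + b * z 0 1) = f p - (a * p 0 0 + b * p 0 1).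
  apply: (pd0_cst (f := fun z => f z - (a * z 0 0 + b * z 0 1))) Bz => v Bv i.
  have [f0 f1] := pf v Bv.
  apply: is_derive_eq (is_dD (smooth_is_derive i sf Bv) (is_dN (is_dD
    (is_dM (is_dC v (e_ i) a) (is_dcoord 0 (is_derive_id v (e_ i))))
    (is_dM (is_dC v (e_ i) b) (is_dcoord 1 (is_derive_id v (e_ i))))))) _.
  by rewrite !mxE; have [->|->] := ord2 i; rewrite ?f0 ?f1 /=; ring.
by rewrite -H addrC subrK.
Qed.

Lemma sign_cst (p : 'rV[R]_2) (r : R) (f : 'rV[R]_2 -> R) : smooth_on (ball p r) f ->
  (forall z, ball p r z -> f z * f z = 1) -> forall z, ball p r z -> f z = f p.
Proof.
move=> sf f2; apply: pd0_cst => z Bz i.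
have f0 := sqr1_neq0 (f2 z Bz).
have d := smooth_is_derive i sf Bz.
have := is_derive_pd (is_dM d d); rewrite (pd_ext i (ball_open p r) Bz f2).
rewrite (is_derive_pd (is_dC z (e_ i) (1 : R))) => /esym/eqP.
by rewrite -mulr2n mulrn_eq0 /= mulf_eq0 (negbTE f0) /= => /eqP <-.
Qed.

Section TwoModels.
Variables (sg sg' : bool) (a b a' b' : R) (J J' : set R) (g w T g' w' T' : R -> 'rV[R]_3).
Hypotheses (fr : frame_on sg (kap sg a b) J g w T) (fr' : frame_on sg' (kap sg' a' b') J'
    g' w' T').
Variables (q1 : 'rV[R]_2) (d : R) (t : 'rV[R]_2 -> 'rV[R]_2) (s : R).
Let B := ball q1 d.
Hypotheses (d0 : 0 < d) (BD : B `<=` dom sg J) (st : smooth_on B t)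
  (tD : forall z, B z -> dom sg' J' (t z)).
Hypothesis k0 : forall z, B z -> kap sg a b (z 0 0) != 0.
Hypotheses (s2 : s * s = 1) (sJ : forall z, B z -> 0 < s * jac (fun z => t z 0 0) (fun z
    => t z 0 1) z).
Hypothesis yt : forall z, B z -> surf g w z = surf g' w' (t z).

Let oB : open B. Proof. exact: ball_open. Qed.
Let oD' : open (dom sg' J'). Proof. by apply: open_dom; have [[]] := fr'. Qed.
Let sy' : smooth_on (dom sg' J') (surf g' w'). Proof. exact: surf_kap_smooth fr'. Qed.
Let n0' z : dom sg' J' z -> normal (surf g' w') z != 0.
Proof. by have [[oJ' _] f'] := fr' => Dz; exact: (normal_surf_neq0 f' Dz). Qed.

Notation t0 := (fun z : 'rV[R]_2 => t z 0 0).
Notation t1 := (fun z : 'rV[R]_2 => t z 0 1).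

Let st0 : smooth_on B t0. Proof. exact: (smooth_comp_mx oB 0 st). Qed.
Let st1 : smooth_on B t1. Proof. exact: (smooth_comp_mx oB 1 st). Qed.

(** As k is nonzero, the kernel of the second form is exactly the ruling direction, so the
    transition map sends rulings to rulings. Comparison of the metrics then makes its Jacobian
    matrix diagonal. *)
Let metric z : B z -> [/\ pd 1 t0 z = 0, pd 0 t1 z = 0, pd 1 t1 z * pd 1 t1 z = 1 &
  rho sg (z 0 1) ^+ 2 = pd 0 t0 z ^+ 2 * rho sg' (t1 z) ^+ 2].
Proof.
move=> Bz; have [[oJ _] f] := fr; have [[oJ' _] f'] := fr'.
have Dz := BD Bz; have Dz' := tD Bz.
have G i j := reparam_gram oB oD' tD st sy' yt i j Bz.
have H i j := reparam_hform oB oD' tD st sy' n0' yt s2 sJ i j Bz.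
have := H 1 1; have := H 0 0; have := G 0 0; have := G 0 1; have := G 1 1.
have [-> -> ->] := gram_surf f Dz; have [-> -> ->] := gram_surf f' Dz'.
have [-> _ _ ->] := hform_surf oJ f Dz; have [-> -> -> ->] := hform_surf oJ' f' Dz'.
have [_ r0] := Dz; have [_ r0'] := Dz'; have kz := k0 Bz.
have s0 := sqr1_neq0 s2.
move: (rho sg (z 0 1)) (rho sg' (t z 0 1)) r0 r0' (kap sg a b (z 0 0)) kz (kap sg' a' b'
    (t z 0 0)) => r r' r0 r0' k kz k'.
move: (pd 0 t0 z) (pd 1 t0 z) (pd 0 t1 z) (pd 1 t1 z) => t00 t01 t10 t11 g11 g01 g00 h00 h11.
have rk : r' * k' != 0.
  apply/eqP => rk; move: h00; rewrite rk oppr0 !(mulr0, addr0) => /eqP.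
  by rewrite oppr_eq0 mulf_eq0 gt_eqF//= (negbTE kz).
have t010 : t01 = 0.
  move: h11 => /esym/eqP; rewrite !(mulr0, addr0) mulf_eq0 (negbTE s0) /= mulrA mulrN oppr_eq0.
  by rewrite mulf_eq0 (negbTE rk) orbF mulf_eq0 orbb => /eqP.
move: g11 g01 g00; rewrite t010 !(mul0r, mulr0, add0r, addr0, mulr1) => g11 g01 g00.
have t110 := sqr1_neq0 (esym g11).
have t100 : t10 = 0 by move: g01 => /esym/eqP; rewrite mulf_eq0 (negbTE t110) orbF => /eqP.
by split => //; rewrite g00 t100 mul0r addr0 -expr2.
Qed.

Let B1 : B q1. Proof. by apply/rVballP; rewrite subrr normr0. Qed.

Let rho_derive (F : 'rV[R]_2 -> R) h z i dF : is_derive z (e_ i) F dF ->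
  is_derive z (e_ i) (fun z => rho h (F z)) (h%:R * dF).
Proof.
move=> dF'; apply: is_derive_eq (is_dD (is_dC z (e_ i) (1 - h%:R : R)) (is_dM (is_dC z
    (e_ i) (h%:R : R)) dF')) _.
by rewrite mulr0 addr0 add0r.
Qed.

(** The metric identities make [t] split into a function of s and a function of t, the latter with
    slope +1 or -1. Differentiating rho^2 = P^2 rho'^2 along the rulings distinguishes cylinders
    from cones and leaves P = +1 or P = -1; constant signs on a ball give affine functions. *)
Lemma transition_affine : sg' = sg /\ exists eps ep c c1, [/\ eps * eps = 1, ep * ep = 1,
  sg -> ep = 1 /\ c1 = 0 & forall z, B z -> t z = pt (eps * z 0 0 + c) (ep * z 0 1 + c1)].
Proof.
pose P := pd 0 t0; pose ep := pd 1 t1 q1.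
have sP : smooth_on B P by exact: smooth_pd.
have ep2 : ep * ep = 1 by have [] := metric B1.
have t1E z : B z -> pd 1 t1 z = ep.
  apply: (sign_cst (f := pd 1 t1)); first exact: smooth_pd.
  by move=> v Bv; have [] := metric Bv.
have [|c1 t1A] := affine_of_derive (a := 0) (b := ep) st1.
  by move=> z Bz; have [_ h _ _] := metric Bz; split => //; exact: t1E.
have dP z : B z -> pd 1 P z = 0.
  move=> Bz; rewrite /P (schwarz 1 0 oB st0 Bz) (pd_ext 0 oB Bz (g := fun=> 0)).
    exact: is_derive_pd (is_dC _ _ _).
  by move=> v Bv; have [] := metric Bv.
(* The derivative of the metric identity along the rulings. One side carries the factor [sg'] and
   the other [sg], with nonzero cofactors, whence [sg' = sg]. *)
have E z : B z -> P z ^+ 2 * rho sg' (t1 z) * (sg'%:R * ep) = rho sg (z 0 1) * sg%:R.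
  move=> Bz; have H v (Bv : B v) : rho sg (v 0 1) ^+ 2 = P v ^+ 2 * rho sg' (t1 v) ^+ 2
      by have [] := metric Bv.
  have := pd_ext 1 oB Bz H.
  rewrite (is_derive_pd (is_dX 2 (rho_derive sg (is_dcoord 1 (is_derive_id z (e_ 1)))))).
  rewrite (is_derive_pd (is_dM (is_dX 2 (smooth_is_derive 1 sP Bz)) (is_dX 2 (rho_derive
      sg' (smooth_is_derive 1 st1 Bz))))).
  rewrite t1E// dP// !mxE /= !mulr0 addr0 !expr1 => h.
  have n2 : (2 : R) != 0 by rewrite pnatr_eq0.
  apply: (mulfI n2); move: h; rewrite mulr1.
  by move: (rho _ _) (rho _ _) (P z) => u v w0 h; rewrite [RHS]mulrA h; ring.
have pos z : B z -> [/\ 0 < rho sg (z 0 1), 0 < rho sg' (t1 z) & rho sg (z 0 1) ^+ 2 = P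
    z ^+ 2 * rho sg' (t1 z) ^+ 2].
  move=> Bz; have [_ h] := BD Bz; have [_ h'] := tD Bz; split => //.
  by have [] := metric Bz.
have P0 z : B z -> P z != 0.
  move=> /pos[h h' e]; apply/eqP => Pz; move: e; rewrite Pz expr0n mul0r => /eqP.
  by rewrite sqrf_eq0 gt_eqF.
have ep0 := sqr1_neq0 ep2.
have sgE : sg' = sg.
  have := E q1 B1; have [h h' _] := pos q1 B1; have := P0 q1 B1; move: h h'.
  move: (rho sg _) (rho sg' _) (P q1) => u v p u0 v0 p0.
  case: (sg); case: (sg') => //; rewrite ?mulr1n ?mulr0n ?mul0r ?mul1r ?mulr0 ?mulr1.
    by move=> /esym/eqP; rewrite gt_eqF.
  by move=> /eqP; rewrite !mulf_eq0 (negbTE p0) (gt_eqF v0) (negbTE ep0).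
have [P2 epc] : (forall z, B z -> P z * P z = 1) /\ (sg -> ep = 1 /\ c1 = 0).
  have R1 z : rho true z = z by rewrite /rho mulr1n subrr add0r mul1r.
  have R0 z : rho false z = 1 by rewrite /rho mulr0n subr0 mul0r addr0.
  have ep1 : ep = 1 \/ ep = -1.
    by have /eqP := ep2; rewrite -expr2 sqrf_eq1 => /orP[] /eqP ->; [left|right].
  have A z : B z -> sg -> [/\ P z * P z = 1, ep = 1 & t1 z = z 0 1].
    move=> Bz sgT; have := E z Bz; have [] := pos z Bz; have := P0 z Bz.
    rewrite sgE sgT !R1 mulr1n mul1r mulr1; move: (P z) (z 0 1) (t z 0 1) => p u v p0 u0
        v0 h1 h2.
    have v2 : v != 0 by rewrite gt_eqF.
    have p2 : p * p = 1.
      have nz : p ^+ 2 * v ^+ 2 != 0 by rewrite mulf_neq0 ?expf_neq0.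
      apply: (mulfI nz); rewrite mulr1 -{2}h1 -h2 !exprMn;
          rewrite -[ep ^+ 2]/(ep * ep) ep2; ring.
    have uv : u = v * ep by rewrite -h2 expr2 p2 mul1r.
    have e1 : ep = 1.
      case: ep1 => // e; move: u0; rewrite uv e mulrN1 oppr_gt0 => /lt_trans/(_ v0).
      by rewrite ltxx.
    by split => //; rewrite uv e1 mulr1.
  split.
    move=> z Bz; case sgT: (sg); first by have [] := A z Bz sgT.
    have [_ _] := pos z Bz; rewrite sgE sgT !R0 expr1n mulr1 expr2 => <- //.
  move=> sgT; have [_ e1 h] := A q1 B1 sgT; split => //.
  by move: h; rewrite t1A// mul0r add0r e1 mul1r => /eqP; rewrite -subr_eq0 addrC addKr => /eqP.
pose eps := P q1.
have PE z : B z -> P z = eps by apply: (sign_cst sP).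
have [|c t0A] := affine_of_derive (a := eps) (b := 0) st0.
  by move=> z Bz; have [h _ _ _] := metric Bz; split => //; exact: PE.
split => //; exists eps, ep, c, c1; split => //; first exact: P2.
move=> z Bz; apply: rV2P; rewrite ?ptE0 ?ptE1; first by rewrite t0A// mul0r addr0.
by rewrite t1A// mul0r add0r.
Qed.

End TwoModels.

(** The derivative along the rulings recovers w, the other one T after division by rho, and the
    surface itself then recovers g; the curvatures are compared through T'. *)
Lemma affine_agree sg (k k' : R -> R) J J' g w T g' w' T' (q1 : 'rV[R]_2) d :
  frame_on sg k J g w T -> frame_on sg k' J' g' w' T' -> 0 < d ->
  ball q1 d `<=` dom sg J -> (forall z, ball q1 d z -> J' (z 0 0)) ->
  (forall z, ball q1 d z -> surf g w z = surf g' w' z) ->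
  forall s, `|s - q1 0 0| < d -> [/\ g s = g' s, w s = w' s, T s = T' s & k s = k' s].
Proof.
move=> [[oJ iJ] f] [[oJ' iJ'] f'] d0 bD bJ' E.
have oB : open (ball q1 d) by exact: ball_open.
have bs s : `|s - q1 0 0| < d -> ball q1 d (pt s (q1 0 1)).
  by move=> h; apply/ball2P => //; rewrite ptE0 ptE1 subrr normr0.
have A s : `|s - q1 0 0| < d -> [/\ g s = g' s, w s = w' s & T s = T' s].
  move=> /bs Bz; have [Jz r0] := bD _ Bz; have Jz' := bJ' _ Bz.
  have [h0 h1] := surf_derive f Jz; have [h0' h1'] := surf_derive f' Jz'.
  have e0 := pd_ext 0 oB Bz E; have e1 := pd_ext 1 oB Bz E; have e := E _ Bz.
  rewrite h0 h0' in e0; rewrite h1 h1' in e1; rewrite /surf e1 in e.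
  rewrite !ptE0 !ptE1 in e0 e1 e r0; split => //; first exact: addIr e.
  have rn : rho sg (q1 0 1) != 0 by rewrite gt_eqF.
  by apply: (scalerI rn).
move=> s Js; have [g1 w1 T1] := A s Js; split => //.
have Bz := bs s Js; have [Jz _] := bD _ Bz; have Jz' := bJ' _ Bz; rewrite ptE0 in Jz Jz'.
have [_ _ dT [ww TT wT]] := f s Jz; have [_ _ dT' _] := f' s Jz'.
have oI : open [set s : R | `|s - q1 0 0| < d] by exact: open_disc.
have [_ h] := is_derive_open_ext oI Js (fun z h => let: And3 _ _ e := A z h in e) dT.
have [_ h'] := dT'; move: h; rewrite h' w1 T1 => /addrI/(congr1 (dot (cross (w' s) (T' s)))).
by rewrite !dotZr cross_dot -w1 -T1 ww TT wT mul0r subr0 !mulr1 => ->.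
Qed.

End Overlap.

(** * From local models to a single global one *)

Section Glue.
Variables (R : realType) (M : topologicalType) (x : M -> 'rV[R]_3).

(** [transition_affine] needs a nonvanishing curvature, so the comparison is made near a nearby
    point [q1]. The relation between the curvatures obtained there holds for all s, since [kap] is
    determined by its germ, and the agreement of the frames at one parameter [s1] suffices by
    uniqueness. *)
Lemma overlap (sg sg' : bool) (a b a' b' : R) J J' (g w T g' w' T' : R -> 'rV[R]_3) U phi
    U' phi' q q' :
  (a != 0) || (b != 0) ->
  frame_on sg (kap sg a b) J g w T -> frame_on sg' (kap sg' a' b') J' g' w' T' ->
  (a' != 0) || (b' != 0) ->
  local_chart x U phi -> local_chart x U' phi' -> U `<=` dom sg J -> U' `<=` dom sg' J' ->
  (forall z, U z -> x (phi z) = surf g w z) -> (forall z, U' z -> x (phi' z) = surf g' w' z) ->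
  U q -> U' q' -> phi q = phi' q' ->
  sg' = sg /\ exists eps ep c c1, [/\ eps * eps = 1, ep * ep = 1, sg -> ep = 1 /\ c1 = 0,
    forall s, eps * ep * kap sg a' b' (eps * s + c) = kap sg a b s &
    exists s1, [/\ J s1, J' (eps * s1 + c), g s1 = g' (eps * s1 + c) + c1 *: w' (eps * s1 + c),
      w s1 = ep *: w' (eps * s1 + c) & T s1 = eps *: T' (eps * s1 + c)]].
Proof.
move=> ab fr fr' ab' cU cU' UD UD' E E' Uq Uq' pq.
have [r [t [s [r0 bU st [tq s2 tP] _]]]] := transition cU cU' Uq Uq' pq.
have oI : open [set z : R | `|z - q 0 0| < r] by exact: open_disc.
have [s1 s1r k1] : exists2 z, [set z : R | `|z - q 0 0| < r] z & kap sg a b z != 0.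
  by apply: (kap_neq0_dense sg ab oI (s := q 0 0)); rewrite /= subrr normr0.
pose q1 := pt s1 (q 0 1).
have Bq1 : ball q r q1 by apply/ball2P => //; rewrite ptE0 ptE1 subrr normr0.
have sk2 : smooth_on (ball q r) (fun z => kap sg a b (z 0 0) ^+ 2).
  have oB : open (ball q r) by exact: ball_open.
  have sk := smooth_kap sg a b oB.
  exact: (smoothX oB sk 2).
have k2 : 0 < kap sg a b (q1 0 0) ^+ 2 by rewrite ptE0 lt_def sqr_ge0 sqrf_eq0 k1.
have [d d0 dB] := smooth_pos_ball (ball_open q r) sk2 Bq1 k2.
have bb : ball q1 d `<=` ball q r by move=> z /dB[].
have BD : ball q1 d `<=` dom sg J by move=> z /bb/bU/UD.
have yt z : ball q1 d z -> surf g w z = surf g' w' (t z).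
  by move=> /bb Bz; have [Utz e _] := tP z Bz; rewrite -E ?e ?E'//; exact: bU.
have [|||sgE [eps [ep [c [c1 [e2 p2 H tE]]]]]] :=
  transition_affine fr fr' d0 BD (smooth_subset bb st) _ _ s2 _ yt.
- by move=> z /bb/tP[/UD'].
- by move=> z /dB[_]; apply: contraTneq => ->; rewrite expr0n ltxx.
- by move=> z /bb/tP[].
rewrite sgE in fr'.
have fr2 := frame_affine c e2 p2 H fr'.
have bJ z : ball q1 d z -> J' (eps * z 0 0 + c).
  by move=> Bz; have [Utz _ _] := tP z (bb z Bz); have [] := UD' _ Utz; rewrite tE// ptE0.
have E2 z : ball q1 d z -> surf g w z = surf (fun s => g' (eps * s + c) + c1 *: w' (eps *
    s + c))
    (fun s => ep *: w' (eps * s + c)) z.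
  by move=> Bz; rewrite surf_affine -tE// yt.
have A := affine_agree fr fr2 d0 BD bJ E2.
have [a2 [b2 [ab2 kE]]] := kap_affine sg c e2 p2 ab'.
have {}A s' : `|s' - q1 0 0| < d -> [/\ g s' = g' (eps * s' + c) + c1 *: w' (eps * s' + c),
  w s' = ep *: w' (eps * s' + c), T s' = eps *: T' (eps * s' + c) & kap sg a b s' = kap
      sg a2 b2 s'].
  by move=> h; rewrite -kE; exact: A.
have q1d : `|q1 0 0 - q1 0 0| < d by rewrite subrr normr0.
split => //; exists eps, ep, c, c1; split => //.
  have oI' : open [set z : R | `|z - q1 0 0| < d] by exact: open_disc.
  have [] := kap_inj_open (sg := sg) (a := a) (b := b) (a' := a2) (b' := b2) oI' q1d.
    by move=> z /A[].
  by move=> -> -> z; rewrite kE.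
have B1 : ball q1 d q1 by apply/rVballP; rewrite subrr normr0.
exists (q1 0 0); have [h1 h2 h3 _] := A _ q1d; split => //; first by have [] := BD _ B1.
exact: bJ.
Qed.

Lemma chart_affine U phi v (al be c c1 : R) : local_chart x U phi -> U v -> al != 0 -> be
    != 0 ->
  exists V u, [/\ local_chart x V (fun q => phi (pt (al * q 0 0 + c) (be * q 0 1 + c1))), V u,
    pt (al * u 0 0 + c) (be * u 0 1 + c1) = v &
    forall q, V q -> U (pt (al * q 0 0 + c) (be * q 0 1 + c1))].
Proof.
move=> cU Uv al0 be0.
pose F (q : 'rV[R]_2) := pt (al * q 0 0 + c) (be * q 0 1 + c1).
have oT : open [set: 'rV[R]_2] by exact: openT.
have c0 := smooth_coord oT 0; have c1' := smooth_coord oT 1.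
have sF : smooth_on [set: 'rV[R]_2] F.
  apply/(smooth_mx oT) => i; have [->|->] := ord2 i.
    apply: (@smooth_ext _ _ _ (fun q => al * q 0 0 + c)) => //; first by move=> z _;
        rewrite ptE0.
    exact: (smoothD oT (smoothM oT (smooth_cst oT al) c0) (smooth_cst oT c)).
  apply: (@smooth_ext _ _ _ (fun q => be * q 0 1 + c1)) => //; first by move=> z _;
      rewrite ptE1.
  exact: (smoothD oT (smoothM oT (smooth_cst oT be) c1') (smooth_cst oT c1)).
have [_ _ _ [oU _ _]] := cU.
pose V := [set q | U (F q)].
have oV : open V by apply: (open_comp (D := U)) => // z _; exact: smooth_continuous sF I.
pose u := pt (al^-1 * (v 0 0 - c)) (be^-1 * (v 0 1 - c1)).
have Fu : F u = v.
  by apply: rV2P; rewrite /F /u !(ptE0, ptE1) mulrA mulfV// mul1r subrK.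
have Vu : V u by rewrite /V /= Fu.
have Jn : jac (fun z => F z 0 0) (fun z => F z 0 1) u != 0.
  have d0 i : is_derive u (e_ i) (fun z => F z 0 0) (al * (i == 0)%:R).
    rewrite (_ : (fun _ => _) = (fun z : 'rV[R]_2 => al * z 0 0 + c));
        last by apply/funext => z; rewrite ptE0.
    apply: is_derive_eq (is_dD (is_dM (is_dC u (e_ i) al) (is_dcoord 0 (is_derive_id u
        (e_ i)))) (is_dC u (e_ i) c)) _.
    by rewrite mxE mulr0 !addr0 eq_sym.
  have d1 i : is_derive u (e_ i) (fun z => F z 0 1) (be * (i == 1)%:R).
    rewrite (_ : (fun _ => _) = (fun z : 'rV[R]_2 => be * z 0 1 + c1));
        last by apply/funext => z; rewrite ptE1.
    apply: is_derive_eq (is_dD (is_dM (is_dC u (e_ i) be) (is_dcoord 1 (is_derive_id u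
        (e_ i)))) (is_dC u (e_ i) c1)) _.
    by rewrite mxE mulr0 !addr0 eq_sym.
  by rewrite /jac !(is_derive_pd (d0 _)) !(is_derive_pd (d1 _)) /= !mulr1 !mulr0 subr0
      mulf_neq0.
have [r [r0 rV cF]] := chart_comp cU oV (smooth_subset (@subsetT _ _) sF) (fun z h => h) Vu Jn.
exists (ball u r), u; split => //; first by apply/rVballP; rewrite subrr normr0.
Qed.

Lemma modelled_affine (sg : bool) (eps ep c c1 : R) J g w m : eps * eps = 1 -> ep * ep = 1 ->
  (sg -> ep = 1 /\ c1 = 0) -> modelled x sg J g w m ->
  modelled x sg [set s | J (eps * s + c)] (fun s => g (eps * s + c) + c1 *: w (eps * s + c))
    (fun s => ep *: w (eps * s + c)) m.
Proof.
move=> e2 p2 H [U [phi [cU [v Uv <-] UD E]]].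
have [V [u [cV Vu uv VU]]] := chart_affine c c1 cU Uv (sqr1_neq0 e2) (sqr1_neq0 p2).
exists V, (fun q => phi (pt (eps * q 0 0 + c) (ep * q 0 1 + c1))); split => //.
- by exists u => //; rewrite uv.
- move=> z /VU/UD[]; rewrite ptE0 ptE1 => h h'; split => //.
  by move: h'; rewrite /rho; case: (sg) H => [/(_ isT)[-> ->]|_];
      rewrite ?mulr1n ?mulr0n ?mul0r ?mul1r ?addr0.
- by move=> z /VU Vz; rewrite surf_affine E.
Qed.

Section Maximal.
Variables (sg : bool) (a b : R) (J : set R) (g w T : R -> 'rV[R]_3).
Hypotheses (ab : (a != 0) || (b != 0)) (fr : frame_on sg (kap sg a b) J g w T).
Hypothesis mx : forall J' g' w' T' s1, frame_on sg (kap sg a b) J' g' w' T' -> J' s1 -> J s1 ->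
      g' s1 = g s1 -> w' s1 = w s1 -> T' s1 = T s1 ->
      forall s, J' s -> [/\ J s, g' s = g s, w' s = w s & T' s = T s].

(** After an affine change, a model that meets the maximal one has the same curvature function and
    the same frame at one parameter; it is therefore a restriction of the maximal one. *)
Lemma modelled_spread (sg' : bool) (a' b' : R) J' g' w' T' U' phi' q' m :
  frame_on sg' (kap sg' a' b') J' g' w' T' -> (a' != 0) || (b' != 0) ->
  local_chart x U' phi' -> U' `<=` dom sg' J' -> (forall z,
      U' z -> x (phi' z) = surf g' w' z) ->
  U' q' -> modelled x sg J g w (phi' q') -> (phi' @` U') m -> modelled x sg J g w m.
Proof.
move=> fr' ab' cU' UD' E' Uq' [U [phi [cU [q Uq pq] UD E]]] [v Uv <-].
have [sgE [eps [ep [c [c1 [e2 p2 H kE [s1 [Js1 Js1' h1 h2 h3]]]]]]]] :=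
  overlap ab fr fr' ab' cU cU' UD UD' E E' Uq Uq' pq.
rewrite sgE in fr' UD'.
have fr2 := frame_affine c e2 p2 H fr'.
have kE' : (fun s => eps * ep * kap sg a' b' (eps * s + c)) = kap sg a b by apply/funext.
rewrite kE' in fr2.
have maxE s (Js : J' (eps * s + c)) := mx fr2 Js1' Js1 (esym h1) (esym h2) (esym h3) Js.
have [U2 [phi2 [cU2 Um U2D E2]]] : modelled x sg [set s | J' (eps * s + c)]
    (fun s => g' (eps * s + c) + c1 *: w' (eps * s + c)) (fun s => ep *: w' (eps * s +
        c)) (phi' v).
  by apply: (modelled_affine c e2 p2 H); exists U', phi'; split => //; exists v.
exists U2, phi2; split => //.
  by move=> z /U2D[h r0]; split => //; have [] := maxE _ h.
move=> z Uz; have [h _] := U2D z Uz; have [_ e1 e3 _] := maxE _ h.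
by rewrite E2// /surf e1 e3.
Qed.

(** A normal vector of a plane containing the piece is orthogonal to w and T on an interval.
    Differentiating its product with T at a parameter where k is nonzero makes it orthogonal to w x
    T too, hence zero. *)
Lemma not_planar m : modelled x sg J g w m -> planar_near x m -> False.
Proof.
move=> [U [phi [cU [q Uq pq] UD E]]] [U' [phi' [n [c0 [cU' [q' Uq' pq'] n0 pl]]]]].
have [r [t [s [r0 bU st [tq s2 tP] _]]]] := transition cU cU' Uq Uq' (etrans pq (esym pq')).
have oB : open (ball q r) by exact: ball_open.
have [[oJ iJ] f] := fr.
have sy : smooth_on (ball q r) (surf g w).
  by apply: (smooth_subset _ (surf_kap_smooth fr)) => z /bU/UD.
have N z : ball q r z -> dot (surf g w z) n = c0.
  by move=> Bz; have [Utz e _] := tP z Bz; rewrite -E ?e ?pl//; exact: bU.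
have N1 z i : ball q r z -> dot (pd i (surf g w) z) n = 0.
  move=> Bz; have := pd_ext i oB Bz N.
  rewrite (is_derive_pd (is_ddot (smooth_is_derive i sy Bz) (is_dC z (e_ i) n))) dot0r
      addr0 => ->.
  exact: is_derive_pd (is_dC _ _ _).
have oI : open [set z : R | `|z - q 0 0| < r] by exact: open_disc.
have wT z : `|z - q 0 0| < r -> dot (w z) n = 0 /\ dot (T z) n = 0.
  move=> h; have Bz : ball q r (pt z (q 0 1)) by apply/ball2P => //;
      rewrite ptE0 ptE1 subrr normr0.
  have := N1 _ 0 Bz; have := N1 _ 1 Bz; have [Jz r1] := UD _ (bU _ Bz).
  have [-> ->] := surf_derive f Jz; rewrite dotZl ptE0 => -> /eqP.
  by rewrite mulf_eq0 gt_eqF//= => /eqP.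
have [s1 s1r k1] : exists2 z, [set z : R | `|z - q 0 0| < r] z & kap sg a b z != 0.
  by apply: (kap_neq0_dense sg ab oI (s := q 0 0)); rewrite /= subrr normr0.
have Js1 : J s1.
  have Bz : ball q r (pt s1 (q 0 1)) by apply/ball2P => //; rewrite ptE0 ptE1 subrr normr0.
  by have [] := UD _ (bU _ Bz); rewrite ptE0.
have [_ _ dT [ww TT wT0]] := f s1 Js1.
have [_] := is_derive_open_ext oI s1r (fun z h => (wT z h).2) (is_ddot dT (is_dC s1 (1 : R) n)).
have [_ ->] := is_dC s1 (1 : R) (0 : R).
have [w0 T0] := wT s1 s1r.
rewrite dot0r addr0 dotDl !dotZl w0 mulr0 add0r => /esym/eqP;
    rewrite mulf_eq0 (negbTE k1) /= => /eqP N0.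
move/eqP: n0; apply; rewrite (orthonormal_basis n ww TT wT0).
by rewrite ![dot n _]dotC w0 T0 N0 !scale0r !addr0.
Qed.

End Maximal.

Lemma clopen_full (Om : set M) : connected [set: M] -> Om !=set0 ->
  (forall m, Om m -> exists U phi, [/\ local_chart x U phi, (phi @` U) m & phi @` U `<=` Om]) ->
  (forall m, closure Om m -> Om m) -> forall m, Om m.
Proof.
move=> cM O0 op cl.
have oO : open Om.
  rewrite openE => m Om_m; have [U [phi [[_ _ ophi [oU _ _]] Um UO]]] := op m Om_m.
  have : nbhs m (phi @` U) by apply: open_nbhs_nbhs; split => //; exact: ophi.
  by apply: filterS.
have E : Om = [set: M].
  apply: cM => //; first by exists Om; rewrite ?setTI.
  exists Om; rewrite ?setTI// => m; exact: cl.
by move=> m; rewrite E.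
Qed.

Lemma closure_chart (Om : set M) m U phi : closure Om m -> local_chart x U phi ->
  (phi @` U) m -> exists2 q, U q & Om (phi q).
Proof.
move=> cm [_ _ ophi [oU _ _]] Um.
have /cm[m' [Om1 [q Uq qm]]] : nbhs m (phi @` U) by apply: open_nbhs_nbhs; split => //;
    exact: ophi.
by exists q => //; rewrite qm.
Qed.

(** If some point is not planar, the set described by its maximal model is open and closed: a limit
    point cannot be planar by [not_planar], and a ruled neighbourhood is absorbed by
    [modelled_spread]. Otherwise all points are planar, and the plane is propagated in the same
    way. *)
Lemma global_model : immersed_surface x -> flat x -> harmonic_mean_curvature x ->
  (exists n c, n != 0 /\ forall m, dot (x m) n = c) \/
  exists sg a b J g w T, [/\ (a != 0) || (b != 0), frame_on sg (kap sg a b) J g w T &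
    forall m, modelled x sg J g w m].
Proof.
move=> im fl harm; have [_ _ cM _] := im.
have [[m0 np]|pl] := pselect (exists m, ~ planar_near x m).
  right; have [//|[sg [a [b [J0 [g0 [w0 [T0 [ab fr0 mod0]]]]]]]]] := local_model m0 im fl harm.
  have [U [phi [cU [q Uq pq] UD E]]] := mod0.
  have Js0 : J0 (q 0 0) by have [] := UD q Uq.
  have [J [g [w [T [fr Js e mx]]]]] := maximal_frame fr0 Js0.
  have mx0 := mx _ _ _ _ _ fr0 Js0 Js.
  have {}mx0 : forall s, J0 s -> [/\ J s, g0 s = g s, w0 s = w s & T0 s = T s].
    by have [e1 e2 e3] := e; apply: mx0.
  exists sg, a, b, J, g, w, T; split => //.
  apply: (clopen_full cM).
  - exists m0, U, phi; split => //; first by exists q.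
      by move=> z /UD[Jz ?]; split => //; have [] := mx0 _ Jz.
    move=> z Uz; rewrite E// /surf; have [Jz _] := UD _ Uz.
    by have [_ -> -> _] := mx0 _ Jz.
  - move=> m [V [psi [cV Vm VD EV]]]; exists V, psi; split => // _ [z Vz <-].
    by exists V, psi; split => //; exists z.
  - move=> m cm; have [[U' [phi' [n [c [cU' Um n0 Epl]]]]]|] := local_model m im fl harm.
      have [q' Uq' Om'] := closure_chart cm cU' Um.
      exfalso; apply: (not_planar ab fr Om').
      by exists U', phi', n, c; split => //; exists q'.
    move=> [sg' [a' [b' [J' [g' [w' [T' [ab' fr' [U' [phi' [cU' Um UD' E']]]]]]]]]]].
    have [q' Uq' Om'] := closure_chart cm cU' Um.
    exact: (modelled_spread ab fr mx fr' ab' cU' UD' E' Uq' Om' Um).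
left; have [[m0 _]|e] := pselect (exists m : M, True); last first.
  (* On an empty surface any nonzero vector serves as normal. *)
  exists (delta_mx 0 0), 0; split; last by move=> m; exfalso; apply: e; exists m.
  by apply/eqP => /rowP/(_ 0)/eqP; rewrite !mxE eqxx oner_eq0.
have {}pl m : planar_near x m by apply: contrapT => np; apply: pl; exists m.
have [U [phi [n [c [cU Um n0 E]]]]] := pl m0.
exists n, c; split => //.
suff H : forall m, exists U phi, [/\ local_chart x U phi, (phi @` U) m & forall q,
    U q -> dot (x (phi q)) n = c].
  by move=> m; have [V [psi [cV [q Vq <-] EV]]] := H m; exact: EV.
apply: (clopen_full (Om := [set m | exists U phi, [/\ local_chart x U phi,
    (phi @` U) m & forall q, U q -> dot (x (phi q)) n = c]]) cM).
- by exists m0, U, phi.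
- move=> m [V [psi [cV Vm VE]]]; exists V, psi; split => // _ [z Vz <-].
  by exists V, psi; split => //; exists z.
- move=> m cm; have [V [psi [n' [c' [cV Vm n'0 EV]]]]] := pl m.
  exists V, psi; split => //.
  have [v Vv [W [chi [cW [z Wz pz] EW]]]] := closure_chart cm cV Vm.
  have [r [t [s [r0 bW st [tq s2 tP] _]]]] := transition cW cV Wz Vv pz.
  have [_ _ _ [oW sW nW]] := cW.
  have n1 i u : W u -> dot (pd i (x \o chi) u) n = 0.
    move=> Wu; have := pd_ext i oW Wu (EW : forall u, W u -> dot ((x \o chi) u) n = c).
    rewrite (is_derive_pd (is_ddot (smooth_is_derive i sW Wu) (is_dC u (e_ i) n))) dot0r
        addr0 => ->.
    exact: is_derive_pd (is_dC _ _ _).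
  have zz : ball z r z by apply/rVballP; rewrite subrr normr0.
  have EW' u : ball z r u -> dot ((x \o chi) u) n' = c'.
    by move=> Bu; have [Vtu e _] := tP u Bu; rewrite /= e EV.
  have n2 i : dot (pd i (x \o chi) z) n' = 0.
    have := pd_ext i (ball_open z r) zz EW'.
    rewrite (is_derive_pd (is_ddot (smooth_is_derive i sW Wz) (is_dC z (e_ i) n'))) dot0r
        addr0 => ->.
    exact: is_derive_pd (is_dC _ _ _).
  have := nW z Wz; rewrite -dot_eq0 normal_pdE => N0.
  (* Vectors orthogonal to both coordinate vectors are multiples of their cross product; so the
     normals n and n' of two overlapping planar pieces are proportional, and their planes
     coincide. *)
  have par u : dot (pd 0 (x \o chi) z) u = 0 -> dot (pd 1 (x \o chi) z) u = 0 ->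
      dot (cross (pd 0 (x \o chi) z) (pd 1 (x \o chi) z)) (cross (pd 0 (x \o chi) z) (pd
          1 (x \o chi) z)) *: u =
      dot u (cross (pd 0 (x \o chi) z) (pd 1 (x \o chi) z)) *: cross (pd 0 (x \o chi) z)
          (pd 1 (x \o chi) z).
    by move=> h0 h1; rewrite cross_basis ![dot u (pd _ _ _)]dotC h0 h1 !mul0r !subr0
        !scale0r !add0r.
  have := par n (n1 0 z Wz) (n1 1 z Wz); have := par n' (n2 0) (n2 1).
  move: (cross _ _) N0 => N N0 p' p.
  have N' : dot n' N != 0.
    apply/eqP => h; move: p'; rewrite h scale0r => /eqP; rewrite scaler_eq0 (negbTE N0) /=.
    by rewrite (negbTE n'0).
  have nE : n = (dot n N / dot n' N) *: n'.
    apply: (scalerI N0); rewrite p scalerA mulrC -scalerA p' scalerA mulfVK//.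
  have cE : c = dot n N / dot n' N * c'.
    by rewrite -(EW z Wz) -(EW' z zz) {1}nE dotZr.
  by move=> q Vq; rewrite {1}nE dotZr EV// -cE.
Qed.

End Glue.

(** * The four families *)

Section Frames3.
Variable R : realType.

Definition rows3 (a b c : 'rV[R]_3) : 'M[R]_3 := \matrix_(i, j) nth 0 [:: a; b; c] i 0 j.

Lemma rows3E a b c : [/\ row 0 (rows3 a b c) = a, row 1 (rows3 a b c) = b & row 2 (rows3
    a b c) = c].
Proof. by split; apply/rowP => j; rewrite !mxE. Qed.

Lemma vec3_mul (s t u : R) (A : 'M[R]_3) :
  vec3 s t u *m A = s *: row 0 A + t *: row 1 A + u *: row 2 A.
Proof.
apply/rowP => j; rewrite !mxE !big_ord_recl big_ord0 !mxE /= addr0 addrA.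
by congr (_ * _ + _ * _ + _ * _); congr (A _ j); apply: val_inj.
Qed.

Lemma orthogonal_rows (A : 'M[R]_3) : orthogonal_mx A <->
  forall i j, dot (row i A) (row j A) = (i == j)%:R.
Proof.
have E i j : (A *m A^T) i j = dot (row i A) (row j A).
  by rewrite mxE; apply: eq_bigr => k _; rewrite !mxE.
split=> [AA i j|H]; first by rewrite -E AA mxE.
by apply/matrixP => i j; rewrite E H mxE.
Qed.

Lemma rows3_orthogonal (a b c : 'rV[R]_3) : dot a a = 1 -> dot b b = 1 -> dot c c = 1 ->
  dot a b = 0 -> dot a c = 0 -> dot b c = 0 -> orthogonal_mx (rows3 a b c).
Proof.
move=> aa bb cc ab ac bc; have [r0 r1 r2] := rows3E a b c.
apply/orthogonal_rows => i j.
by have [->|->|->] := ord3 i; have [->|->|->] := ord3 j; rewrite ?r0 ?r1 ?r2 // dotC.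
Qed.

(** Any nonzero cross product with n, normalized, gives a, and its cross product with n gives b. *)
Lemma orthonormal_completion (n : 'rV[R]_3) : dot n n = 1 -> exists a b, [/\ dot a a = 1,
    dot b b = 1,
  dot a b = 0, dot a n = 0 & dot b n = 0].
Proof.
move=> nn; have [v v0] : exists v : 'rV[R]_3, cross n v != 0.
  apply: contrapT => H.
  have c0 v : cross n v = 0 by apply/eqP/negPn/negP => h; apply: H; exists v.
  have E (v : 'rV[R]_3) : dot v v = dot n v * dot n v.
    have := cross_dot n v n v; rewrite c0 dot0l nn mul1r => /esym/eqP.
    by rewrite subr_eq0 (dotC v n) => /eqP.
  (* If n were parallel to every vector, its first two coordinates would satisfy a^2 = b^2 = 1 and
     (a + b)^2 = 2, hence both a b = 0 and (a b)^2 = 1. *)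
  have h0 := E (vec3 1 0 0); have h1 := E (vec3 0 1 0).
  have E2 := E (vec3 1 1 0); move: h0 h1 E2.
  rewrite !dot3E !vec3E; move: (n 0 0) (n 0 1) => a b h0 h1 h2.
  have ab : (a * b) * (a * b) = 1.
    have -> : a * b * (a * b) = (a * a) * (b * b) by ring.
    have -> : a * a = 1 by lra.
    have -> : b * b = 1 by lra.
    by rewrite mulr1.
  have ab0 : a * b = 0 by lra.
  by move: ab; rewrite ab0 mul0r => /esym/eqP; rewrite oner_eq0.
pose l := Num.sqrt (dot (cross n v) (cross n v)).
have l2 : l * l = dot (cross n v) (cross n v) by rewrite -expr2 sqr_sqrtr// dot_ge0.
have l0 : l != 0.
  by apply/eqP => h; move: l2; rewrite h mul0r => /esym/eqP; rewrite dot_eq0 (negbTE v0).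
pose a := l^-1 *: cross n v.
have aa : dot a a = 1 by rewrite dotZl dotZr -l2; field.
have an : dot a n = 0 by rewrite dotZl dot_crossl mulr0.
exists a, (cross n a); split => //.
- by rewrite cross_dot nn aa (dotC n a) an mul0r subr0 mulr1.
- by rewrite dotC dot_crossr.
- exact: dot_crossl.
Qed.

End Frames3.

(** * Derivatives of parametrized curves *)

Section Curves.
Variable R : realType.

Lemma derive1_is (n : nat) (c : R -> 'rV[R]_n) (s : R) d : is_derive s 1 c d -> derive1 c s = d.
Proof. by move=> [_ <-]; rewrite derive1E. Qed.

Lemma is_derive1 (n : nat) (c : R -> 'rV[R]_n) (s : R) : derivable c s 1 ->
  is_derive s 1 c (derive1 c s).
Proof. by move=> h; split => //; rewrite derive1E. Qed.

(** Passes from smoothness as a function on the plane, in which frames are known to be smooth, to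
    iterated ordinary derivatives, by restriction to the line t = 0. *)
Lemma smooth_curve n (J : set R) (c : R -> 'rV[R]_n) : open J ->
  smooth_on [set q : 'rV[R]_2 | J (q 0 0)] (fun q => c (q 0 0)) -> smooth_curve_on J c.
Proof.
move=> oJ sc; set U := [set q | _] in sc.
have slice (f : 'rV[R]_2 -> 'rV[R]_n) (s : R) : smooth_on U f -> J s ->
    is_derive s 1 (fun s => f (pt s 0)) (pd 0 f (pt s 0)).
  by move=> sf Js; apply: is_derive_slice sf _; rewrite /U /= ptE0.
have H k : forall s, J s -> derive1n k c s = iter k (pd 0) (fun q => c (q 0 0)) (pt s 0).
  elim: k => [|k IH] s Js; first by rewrite /= ptE0.
  rewrite derive1nS; apply: derive1_is.
  have sk : smooth_on U (iter k (pd 0) (fun q => c (q 0 0))).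
    by elim: k {IH} => [//|k IH]; exact: smooth_pd.
  by apply: is_derive_open_ext oJ Js _ (slice _ _ sk Js) => z Jz; rewrite IH.
move=> k s Js.
have sk : smooth_on U (iter k (pd 0) (fun q => c (q 0 0))).
  by elim: k => [//|k IH]; exact: smooth_pd.
by have [h _] := is_derive_open_ext oJ Js (fun z Jz => esym (H k z Jz)) (slice _ _ sk Js).
Qed.

Lemma derive1n2 n (J : set R) (c c1 c2 : R -> 'rV[R]_n) : open J ->
  (forall s, J s -> is_derive s 1 c (c1 s)) -> (forall s, J s -> is_derive s 1 c1 (c2 s)) ->
  forall s, J s -> derive1 c s = c1 s /\ derive1n 2 c s = c2 s.
Proof.
move=> oJ d1 d2 s Js; split; first exact: derive1_is (d1 s Js).
apply: derive1_is; apply: is_derive_open_ext oJ Js _ (d2 s Js) => z Jz.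
by rewrite (derive1_is (d1 z Jz)).
Qed.

Lemma smooth_curve_derive n (J : set R) (c : R -> 'rV[R]_n) s : smooth_curve_on J c -> J s ->
  is_derive s 1 c (derive1 c s) /\ is_derive s 1 (derive1 c) (derive1n 2 c s).
Proof.
move=> sc Js; split; first exact: is_derive1 (sc 0 s Js).
exact: is_derive1 (sc 1 s Js).
Qed.

End Curves.

(** * From the global model to the four families *)

Section Forward.
Variables (R : realType) (M : topologicalType) (x : M -> 'rV[R]_3).

(** The products of x with two orthonormal directions of the plane have independent differentials
    and serve as coordinates of a chart. The sign [de] records whether n is the cross product of a
    and b or its opposite. *)
Lemma plane_form n c : immersed_surface x -> n != 0 -> (forall m, dot (x m) n = c) ->
  exists (A : 'M[R]_3) (p : 'rV[R]_3),
    orthogonal_mx A /\ open_part_of x [set: 'rV[R]_2] (plane A p).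
Proof.
move=> [_ _ _ atl] n0 E.
pose l := Num.sqrt (dot n n); pose n1 := l^-1 *: n; pose c1 := l^-1 * c.
have l2 : l * l = dot n n by rewrite -expr2 sqr_sqrtr// dot_ge0.
have l0 : l != 0.
  by apply/eqP => h; move: l2; rewrite h mul0r => /esym/eqP; rewrite dot_eq0 (negbTE n0).
have nn : dot n1 n1 = 1 by rewrite dotZl dotZr -l2; field.
have {}E m : dot (x m) n1 = c1 by rewrite dotZr E.
move: n1 c1 nn E => {n0 l2 l0 l n c} n c nn E.
have [a [b [aa bb ab an bn]]] := orthonormal_completion nn.
have [de nE] : exists de, n = de *: cross a b.
  exists (dot n (cross a b)).
  by rewrite {1}(orthonormal_basis n aa bb ab) (dotC n a) (dotC n b) an bn !scale0r !add0r.
have de2 : de * de = 1.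
  by rewrite -[RHS]nn nE dotZl dotZr cross_dot aa bb ab mul0r subr0 !mulr1.
exists (rows3 a b n), (c *: n); split; first exact: rows3_orthogonal.
move=> m; have [U [phi [cU [q Uq <-]]]] := atl m; have [_ _ _ [oU sy n0]] := cU.
have sa : smooth_on U (fun z => dot ((x \o phi) z) a).
  by apply: smooth_dot => //; exact: smooth_vcst.
have sb : smooth_on U (fun z => dot ((x \o phi) z) b).
  by apply: smooth_dot => //; exact: smooth_vcst.
have D i v : pd i (fun z => dot ((x \o phi) z) v) q = dot (pd i (x \o phi) q) v.
  rewrite (is_derive_pd (is_ddot (smooth_is_derive i sy Uq) (is_dC q (e_ i) v))).
  by rewrite dot0r addr0.
have tn i : dot (pd i (x \o phi) q) n = 0.
  rewrite -D (pd_ext i oU Uq (g := fun=> c)); last by move=> z _; exact: E.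
  exact: is_derive_pd (is_dC _ _ _).
have dec v : v = dot v a *: a + dot v b *: b + dot v n *: n.
  rewrite {1}(orthonormal_basis v aa bb ab); congr (_ + _).
  by rewrite nE dotZr scalerA (mulrC de) -mulrA de2 mulr1.
have Jn : jac (fun z => dot ((x \o phi) z) a) (fun z => dot ((x \o phi) z) b) q != 0.
  have := n0 q Uq; rewrite normal_pdE /jac !D; apply: contra => /eqP J0.
  rewrite (dec (pd 0 (x \o phi) q)) (dec (pd 1 (x \o phi) q)) !tn !scale0r !addr0 cross_lin2.
  by rewrite (mulrC (dot (pd 0 _ _) b)) in J0 *; rewrite (mulrC (dot (pd 1 (x \o phi) q)
      a)) in J0 *; rewrite J0 scale0r.
have [V [G [cV oV sG GV [Vq Gq]]]] := chart_inverse cU sa sb Uq Jn.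
exists V, (phi \o G); split => //.
- by exists (pt (dot (x (phi q)) a) (dot (x (phi q)) b)); rewrite //= -[X in phi X]/(G _) Gq.
- move=> v Vv; have [_ h0 h1] := GV v Vv.
  rewrite /plane vec3_mul; have [-> -> _] := rows3E a b n.
  by rewrite scale0r addr0 -h0 -h1 /= {1}(dec (x (phi (G v)))) E.
Qed.

Lemma rotate_orthonormal (u v w : 'rV[R]_3) (a b : R) : a ^+ 2 + b ^+ 2 = 1 ->
  dot u u = 1 -> dot v v = 1 -> dot u v = 0 -> dot u w = 0 -> dot v w = 0 ->
  let u' := a *: u - b *: v in let v' := b *: u + a *: v in
  [/\ dot u' u' = 1, dot v' v' = 1, dot u' v' = 0, dot u' w = 0 & dot v' w = 0].
Proof.
move=> ab uu vv uv uw vw /=.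
rewrite !(dotDl, dotDr, dotNl, dotNr, dotZl, dotZr) (dotC v u) uu vv uv uw vw.
by split; [rewrite -[RHS]ab|rewrite -[RHS]ab| | |]; ring.
Qed.

Section Cylinder.
Variables (a b : R) (J : set R) (g w T : R -> 'rV[R]_3) (s0 : R).
Hypotheses (fr : frame_on false (kap false a b) J g w T) (Js0 : J s0).

Let oJ : open J. Proof. by have [[]] := fr. Qed.
Let iJ : is_interval J. Proof. by have [[]] := fr. Qed.
Let f s : J s -> frame_at false (kap false a b s) g w T s. Proof. by have [_] := fr; exact. Qed.

Let w_cst s : J s -> w s = w s0.
Proof.
move=> Js; apply: (vcst_on iJ) => // z /f[_ dw _ _].
by apply: is_derive_eq dw _; rewrite scale0r.
Qed.

Let dg s : J s -> is_derive s 1 g (T s).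
Proof. by move=> /f[d _ _ _]; apply: is_derive_eq d _; rewrite subr0 scale1r. Qed.

Let dT s : J s -> is_derive s 1 T ((a * s + b) *: cross (w s0) (T s)).
Proof.
move=> Js; have [_ _ d _] := f Js; apply: is_derive_eq d _.
by rewrite oppr0 scale0r add0r w_cst.
Qed.

Let orth : [/\ dot (w s0) (w s0) = 1, forall s, J s -> dot (T s) (T s) = 1 &
  forall s, J s -> dot (w s0) (T s) = 0].
Proof.
split; first by have [_ _ _ []] := f Js0.
  by move=> s /f[_ _ _ []].
by move=> s Js; have [_ _ _ [_ _]] := f Js; rewrite (w_cst Js).
Qed.

Let gw s : J s -> dot (g s) (w s0) = dot (g s0) (w s0).
Proof.
have [_ _ wT] := orth; move=> Js; apply: (cst_on (F := fun s => dot (g s) (w s0)) iJ) =>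
    // z Jz.
apply: is_derive_eq (is_ddot (dg Jz) (is_dC z (1 : R) (w s0))) _.
by rewrite dot0r addr0 dotC wT.
Qed.

(** The ruling direction w is constant, so the height of the base curve along it is constant too and
    becomes the translation p. The plane curve consists of the remaining two coordinates, in the
    frame of the parameter [s0]. *)
Lemma cornu_form : a != 0 -> (forall m, modelled x false J g w m) ->
  exists (A : 'M[R]_3) (p : 'rV[R]_3) (J : set R) (c : R -> 'rV[R]_2),
    [/\ orthogonal_mx A, cornu_spiral J c &
        open_part_of x [set q : 'rV[R]_2 | J (q 0 0)] (right_cylinder A p c)].
Proof.
move=> a0 mod; have [ww TT wT] := orth.
pose T0 := T s0; pose w0 := w s0; pose N0 := cross w0 T0.
have NN : dot N0 N0 = 1 by rewrite cross_dot ww TT// wT// mul0r subr0 mulr1.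
have TN : dot T0 N0 = 0 by rewrite dotC dot_crossr.
have Nw : dot N0 w0 = 0 by rewrite dot_crossl.
pose A := rows3 T0 N0 w0; pose p := dot (g s0) w0 *: w0.
pose co (v : 'rV[R]_3) := pt (dot v T0) (dot v N0).
have dco (F : R -> 'rV[R]_3) (s : R) dF : is_derive s 1 F dF -> is_derive s 1 (fun s =>
    co (F s)) (co dF).
  move=> d; apply/is_derive_mx => i; have [->|->] := ord2 i.
    rewrite (_ : (fun _ => _) = (fun s => dot (F s) T0)); last by apply/funext => z;
        rewrite ptE0.
    by apply: is_derive_eq (is_ddot d (is_dC s (1 : R) T0)) _; rewrite dot0r addr0 ptE0.
  rewrite (_ : (fun _ => _) = (fun s => dot (F s) N0)); last by apply/funext => z; rewrite ptE1.
  by apply: is_derive_eq (is_ddot d (is_dC s (1 : R) N0)) _; rewrite dot0r addr0 ptE1.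
pose c s := co (g s).
have dc s : J s -> is_derive s 1 c (co (T s)) by move=> Js; exact: dco (dg Js).
have dc1 s : J s -> is_derive s 1 (fun s => co (T s)) (co ((a * s + b) *: cross w0 (T s))).
  by move=> Js; exact: dco (dT Js).
have cE := derive1n2 oJ dc dc1.
have bas := orthonormal_basis _ ww (TT _ Js0) (wT _ Js0).
have dot2 (u v : 'rV[R]_2) : dot u v = u 0 0 * v 0 0 + u 0 1 * v 0 1 by rewrite /dot sum2E.
have T1 s : J s -> dot (T s) T0 * dot (T s) T0 + dot (T s) N0 * dot (T s) N0 = 1.
  move=> Js; have := congr1 (dot (T s)) (bas (T s)).
  by rewrite !dotDr !dotZr TT// (dotC (T s) (w s0)) wT// mul0r add0r => <-.
exists A, p, J, c; split.
- apply: rows3_orthogonal => //; first exact: TT.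
  by rewrite dotC; exact: wT.
- split; first split.
  + by have [] := fr.
  + apply: smooth_curve => //; have oU : open [set q : 'rV[R]_2 | J (q 0 0)] by exact:
      open_coord.
    have [sg _ _] := frame_smooth oJ f (smooth_kap false a b oU).
    apply/(smooth_mx oU) => i; have [->|->] := ord2 i.
      apply: (@smooth_ext _ _ _ (fun q => dot (g (q 0 0)) T0)) => //;
          first by move=> z _; rewrite ptE0.
      by apply: smooth_dot => //; exact: smooth_vcst.
    apply: (@smooth_ext _ _ _ (fun q => dot (g (q 0 0)) N0)) => //; first by move=> z _;
        rewrite ptE1.
    by apply: smooth_dot => //; exact: smooth_vcst.
  + by move=> s Js; have [-> _] := cE s Js; rewrite dot2 !ptE0 !ptE1 T1.
  + exists a, b; split => // s Js; have [e1 e2] := cE s Js.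
    rewrite /plane_curvature e1 e2 !ptE0 !ptE1 !dotZl.
    have k1 : dot (cross w0 (T s)) N0 = dot (T s) T0.
      by rewrite cross_dot ww (wT s0 Js0) mul0r subr0 mul1r.
    have k2 : dot (cross w0 (T s)) T0 = - dot (T s) N0.
      by rewrite /N0 !dot3E !crossE; ring.
    rewrite k1 k2 -[RHS]mulr1 -(T1 s Js); ring.
- move=> m; have [U [phi [cU Um UD E]]] := mod m; exists U, phi; split => //.
    by move=> z /UD[].
  move=> q /[dup] Uq /UD[Jq _]; rewrite E// /right_cylinder vec3_mul.
  have [-> -> ->] := rows3E T0 N0 w0; rewrite !ptE0 !ptE1 /surf {1}(bas (g (q 0 0))).
  rewrite gw// (w_cst Jq) -/w0 -/T0 -/N0 -/p.
  by rewrite -!addrA addrC -!addrA.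
Qed.

(** The vectors u = - (w x T) and T turn with constant speed b in the plane orthogonal to w. Turning
    them back gives the constant axes [A0] and [A1]; the constant point [C] is the centre, at
    distance 1 / |b| from the base curve. The parameter of the circle is b s. *)
Lemma circle_form : a = 0 -> b != 0 -> (forall m, modelled x false J g w m) ->
  exists (A : 'M[R]_3) (p : 'rV[R]_3) (r : R), [/\ orthogonal_mx A, 0 < r &
    open_part_of x [set: 'rV[R]_2] (right_cylinder A p (circle r))].
Proof.
move=> a0 b0 mod; have [ww TT wT] := orth; pose w0 := w s0.
pose u s := - cross w0 (T s).
have du s : J s -> is_derive s 1 u (b *: T s).
  move=> Js; apply: is_derive_eq (is_dN (is_dcross (is_dC s (1 : R) w0) (dT Js))) _.
  rewrite a0 mul0r add0r crossZr cross_cross ww (dotC w0) (dotC _ w0) wT// scale0r sub0r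
      scale1r.
  rewrite (_ : cross 0 _ = 0) ?add0r ?scalerN ?opprK//.
  by apply: rV3P; rewrite crossE !mxE; ring.
have dT' s : J s -> is_derive s 1 T (- b *: u s).
  by move=> Js; apply: is_derive_eq (dT Js) _; rewrite a0 mul0r add0r /u scalerN scaleNr opprK.
have dcs (s : R) : is_derive s 1 (fun s => cos (b * s)) (- (b * sin (b * s))) /\
    is_derive s 1 (fun s => sin (b * s)) (b * cos (b * s)).
  have d : is_derive s 1 (fun s => b * s) b.
    by apply: is_derive_eq (is_dM (is_dC s (1 : R) b) (is_derive_id s (1 : R))) _; ring.
  by split; [apply: is_derive_eq (is_dcos d) _|apply: is_derive_eq (is_dsin d) _]; ring.
have Z j : (0 : 'rV[R]_3) 0 j = 0 by rewrite mxE.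
pose A0 s := cos (b * s) *: u s + - (sin (b * s) *: T s).
pose A1 s := sin (b * s) *: u s + cos (b * s) *: T s.
have cA0 s : J s -> A0 s = A0 s0.
  move=> Js; apply: (vcst_on iJ) => // z Jz; have [dc ds] := dcs z.
  apply: is_derive_eq (is_dD (is_dscale dc (du z Jz)) (is_dN (is_dscale ds (dT' z Jz)))) _.
  by apply/rowP => j; rewrite !rvE Z; ring.
have cA1 s : J s -> A1 s = A1 s0.
  move=> Js; apply: (vcst_on iJ) => // z Jz; have [dc ds] := dcs z.
  apply: is_derive_eq (is_dD (is_dscale ds (du z Jz)) (is_dscale dc (dT' z Jz))) _.
  by apply/rowP => j; rewrite !rvE Z; ring.
pose C s := g s - b^-1 *: u s.
have cC s : J s -> C s = C s0.
  move=> Js; apply: (vcst_on iJ) => // z Jz.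
  apply: is_derive_eq (is_dD (dg Jz) (is_dN (is_dscale (is_dC z (1 : R) b^-1) (du z Jz)))) _.
  by rewrite scale0r add0r scalerA mulVf// scale1r subrr.
have uE s : u s = cos (b * s) *: A0 s + sin (b * s) *: A1 s.
  have cs := cos2Dsin2 (b * s); apply/rowP => j; rewrite !rvE.
  by rewrite -[LHS]mul1r -cs; ring.
have u1 : dot (u s0) (u s0) = 1.
  by rewrite /u dotNl dotNr opprK cross_dot ww TT// wT// mul0r subr0 mulr1.
have uT : dot (u s0) (T s0) = 0 by rewrite /u dotNl dot_crossr oppr0.
have uw : dot (u s0) w0 = 0 by rewrite /u dotNl dot_crossl oppr0.
have T1 := TT s0 Js0; have Tw : dot (T s0) w0 = 0 by rewrite dotC; exact: wT.
(* The sign of b. It is absorbed in the axes because the radius of the model must be positive. *)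
pose e := `|b| / b.
have ee : e * e = 1.
  rewrite /e mulrACA -normrM ger0_norm -?invfM ?mulfV ?mulf_neq0// -expr2 sqr_ge0//.
have nb : `|b| != 0 by rewrite normr_eq0.
have cs := cos2Dsin2 (b * s0).
have [AA0 AA1 A01 A0w A1w] := rotate_orthonormal cs u1 T1 uT uw Tw.
exists (rows3 (e *: A0 s0) (e *: A1 s0) w0), (C s0), `|b|^-1; split.
- by apply: rows3_orthogonal; rewrite ?(dotZl, dotZr) ?AA0 ?AA1 ?A01 ?A0w ?A1w ?mulr0 ?mulr1.
- by rewrite invr_gt0 normr_gt0.
- move=> m; have [U [phi [cU [v Uv <-] UD E]]] := mod m.
  have bi0 : b^-1 != 0 by rewrite invr_eq0.
  have [V [z [cV Vz zv VU]]] := chart_affine 0 0 cU Uv bi0 (oner_neq0 R).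
  exists V, (fun q => phi (pt (b^-1 * q 0 0 + 0) (1 * q 0 1 + 0))); split => //.
    by exists z => //; rewrite zv.
  move=> q /VU Uq; rewrite E// /surf /right_cylinder vec3_mul ptE0 ptE1.
  have [+ _] := UD _ Uq; rewrite ptE0 => Js; rewrite (w_cst Js) -/w0.
  have gE : g (b^-1 * q 0 0 + 0) = C s0 + b^-1 *: u (b^-1 * q 0 0 + 0) by rewrite -(cC _
      Js) subrK.
  rewrite gE uE (cA0 _ Js) (cA1 _ Js); have [-> -> ->] := rows3E (e *: A0 s0) (e *: A1 s0) w0.
  rewrite addr0 mulrA mulfV// !mul1r addr0 /circle !mxE /=.
  have bE : b^-1 = `|b|^-1 * e by rewrite /e mulrA mulVf// mul1r.
  rewrite [in LHS]bE; apply/rowP => j; rewrite !rvE; ring.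
Qed.

End Cylinder.

Lemma cone_form_nondegenerate (a b : R) J g w T s0 : frame_on true (kap true a b) J g w T
    -> J s0 ->
  a != 0 -> b != 0 -> (forall m, modelled x true J g w m) ->
  exists (p : 'rV[R]_3) (J : set R) (beta : R -> 'rV[R]_3) (c1 c2 : R),
    [/\ arclength_curve J beta, curve_on_unit_sphere p J beta, c1 != 0 /\ c2 != 0,
        forall s, J s -> sphere_curvature p beta s = c1 * cos s + c2 * sin s &
        open_part_of x [set q : 'rV[R]_2 | J (q 0 0) /\ 0 < q 0 1] (cone p beta)].
Proof.
move=> [[oJ iJ] f] Js0 a0 b0 mod.
have gE s : J s -> g s = g s0.
  move=> Js; apply: (vcst_on iJ) => // z /f[d _ _ _].
  by apply: is_derive_eq d _; rewrite subrr scale0r.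
pose beta s := g s0 + w s.
have db s : J s -> is_derive s 1 beta (T s).
  move=> /f[_ d _ _]; apply: is_derive_eq (is_dD (is_dC s (1 : R) (g s0)) d) _.
  by rewrite add0r scale1r.
have dT s : J s -> is_derive s 1 T (- 1 *: w s + kap true a b s *: cross (w s) (T s)).
  by move=> /f[_ _ d _].
have E := derive1n2 oJ db dT.
have bg s : beta s - g s0 = w s by rewrite /beta addrC addKr.
exists (g s0), J, beta, a, b; split.
- split => //; last first.
    by move=> s Js; have [-> _] := E s Js; have [_ _ _ []] := f s Js.
  apply: smooth_curve => //; have oU : open [set q : 'rV[R]_2 | J (q 0 0)] by exact: open_coord.
  have [_ sw _] := frame_smooth oJ f (smooth_kap true a b oU).
  by apply: smooth_vadd => //; exact: smooth_vcst.
- by move=> s Js; rewrite bg; have [_ _ _ []] := f s Js.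
- by [].
- move=> s Js; have [e1 e2] := E s Js; have [_ _ _ [ww TT wT]] := f s Js.
  rewrite /sphere_curvature bg e1 e2 dotDl !dotZl cross_dot ww TT wT [dot (w s) (cross _
      _)]dotC dot_crossl.
  by rewrite /kap; ring.
- move=> m; have [U [phi [cU Um UD Ep]]] := mod m; exists U, phi; split => //.
    by move=> q /UD[Jq]; rewrite /rho subrr add0r mul1r.
  by move=> q /[dup] Uq /UD[Jq _]; rewrite Ep// /surf /cone bg gE.
Qed.

Lemma cone_form (a b : R) J g w T s0 : frame_on true (kap true a b) J g w T -> J s0 ->
  (a != 0) || (b != 0) -> (forall m, modelled x true J g w m) ->
  exists (p : 'rV[R]_3) (J : set R) (beta : R -> 'rV[R]_3) (c1 c2 : R),
    [/\ arclength_curve J beta, curve_on_unit_sphere p J beta, c1 != 0 /\ c2 != 0,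
        forall s, J s -> sphere_curvature p beta s = c1 * cos s + c2 * sin s &
        open_part_of x [set q : 'rV[R]_2 | J (q 0 0) /\ 0 < q 0 1] (cone p beta)].
Proof.
move=> fr Js0 ab mod.
have [/andP[a0 b0]|] := boolP ((a != 0) && (b != 0)).
  exact: cone_form_nondegenerate fr Js0 a0 b0 mod.
rewrite negb_and !negbK => ab0.
(* Exactly one of a, b vanishes in this case, so the shifted coefficients are, up to sign, the other
   one times cos c and sin c; both factors are nonzero at pi / 4. *)
pose c : R := pi / 4.
have pi0 := pi_gt0 R.
have c0 : cos c != 0 by rewrite gt_eqF// cos_gt0_pihalf// /c; apply/andP; split; lra.
have d0 : sin c != 0 by rewrite gt_eqF// sin_gt0_pi// /c; apply/andP; split; lra.
have H : true -> 1 = 1 :> R /\ 0 = 0 :> R by [].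
have fr2 := frame_affine c (mulr1 1) (mulr1 1) H fr.
rewrite (_ : (fun s => _) = kap true (a * cos c + b * sin c) (b * cos c - a * sin c)) in
    fr2; last first.
  by apply/funext => s; rewrite /kap !mul1r cosD sinD; ring.
apply: (cone_form_nondegenerate (s0 := s0 - c) fr2).
- by rewrite /= mul1r subrK.
- case/orP: ab0 ab => /eqP ->; rewrite ?eqxx ?orbF ?mul0r ?add0r ?addr0 => h;
    by rewrite mulf_neq0.
- case/orP: ab0 ab => /eqP ->; rewrite ?eqxx ?orbF ?mul0r ?add0r ?subr0 ?sub0r ?oppr_eq0
    => h; by rewrite mulf_neq0.
- by move=> m; exact: modelled_affine (mulr1 1) (mulr1 1) H (mod m).
Qed.

End Forward.

(** * Harmonicity of the mean curvature in the four families *)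

Section Backward.
Variables (R : realType) (M : topologicalType) (x : M -> 'rV[R]_3).

(** Harmonicity is required in every chart, but a change of charts multiplies the Laplacian of the
    mean curvature only by a sign, so one chart around each point suffices. *)
Lemma harmonic_of_charts : (forall m, exists V psi, [/\ local_chart x V psi, (psi @` V) m &
    forall q, V q -> laplacian (x \o psi) (mean_curvature (x \o psi)) q = 0]) ->
  harmonic_mean_curvature x.
Proof.
move=> H U phi cU q Uq; have [V [psi [cV [v Vv pv] L]]] := H (phi q).
have [r [t [s [r0 bU st [tq s2 tP] _]]]] := transition cU cV Uq Vv (esym pv).
have [_ _ _ [oV sV nV]] := cV.
have qq : ball q r q by apply/rVballP; rewrite subrr normr0.
rewrite (reparam_laplacian (ball_open q r) oV (t := t) _ st sV nV (s := s) _ s2 _ qq).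
- by rewrite L ?mulr0//; have [] := tP q qq.
- by move=> z /tP[].
- by move=> z /tP[_ e _]; rewrite /= e.
- by move=> z /tP[].
Qed.

Lemma modelled_harmonic (sg : bool) (a b : R) J g w T : frame_on sg (kap sg a b) J g w T ->
  (forall m, modelled x sg J g w m) -> harmonic_mean_curvature x.
Proof.
move=> fr mod; apply: harmonic_of_charts => m; have [V [psi [cV Vm VD E]]] := mod m.
exists V, psi; split => // q Vq; have [[oJ _] f] := fr; have [_ _ _ [oV sV nV]] := cV.
have reg : regular_patch V (surf g w).
  split => //; first exact: smooth_ext oV E sV.
  by move=> z /VD Dz; exact: (normal_surf_neq0 f Dz).
rewrite (laplacian_ext reg Vq E).
rewrite (laplacian_surf oJ f (fun s _ => kap_derive sg a b s) (fun s _ => dkap_derive sg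
    a b s) (VD q Vq)).
by rewrite addNr mul0r oppr0.
Qed.

(** The first derivatives are constant in the given chart, so the second form is zero and the mean
    curvature vanishes identically. *)
Lemma plane_harmonic (A : 'M[R]_3) p : open_part_of x [set: 'rV[R]_2] (plane A p) ->
  harmonic_mean_curvature x.
Proof.
move=> op; apply: harmonic_of_charts => m; have [V [psi [cV Vm _ E]]] := op m.
exists V, psi; split => // q Vq; have [_ _ _ [oV sV nV]] := cV.
have [v Hv] : exists v : 'I_2 -> 'rV[R]_3, forall i z, V z -> pd i (x \o psi) z = v i.
  exists (fun i => (i == 0)%:R *: row 0 A + (i == 1)%:R *: row 1 A) => i z Vz.
  rewrite (pd_ext i oV Vz (g := fun z => (z 0 0 *: row 0 A + z 0 1 *: row 1 A) + p));
      last first.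
    by move=> u Vu; rewrite /= E// /plane vec3_mul scale0r addr0.
  rewrite (is_derive_pd (is_dD (is_dD
    (is_dscale (is_dcoord 0 (is_derive_id z (e_ i))) (is_dC z (e_ i) (row 0 A)))
    (is_dscale (is_dcoord 1 (is_derive_id z (e_ i))) (is_dC z (e_ i) (row 1 A))))
    (is_dC z (e_ i) p))).
  by rewrite !scaler0 !addr0 !mxE eqxx /= (eq_sym 0 i) (eq_sym 1 i).
have h0 i j z : V z -> hform (x \o psi) i j z = 0.
  move=> Vz; rewrite /hform (pd_ext i oV Vz (Hv j)).
  by rewrite (is_derive_pd (is_dC z (e_ i) (v j))) dot0l.
have m0 z : V z -> mean_curvature (x \o psi) z = 0.
  by move=> Vz; rewrite mean_curvatureE ?nV// !h0// addr0 !mulr0 subr0 addr0 mul0r.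
have p0 i z : V z -> pd i (mean_curvature (x \o psi)) z = 0.
  by move=> Vz; rewrite (pd_ext i oV Vz m0); exact: is_derive_pd (is_dC z (e_ i) (0 : R)).
have W0 z : V z -> lapW0 (x \o psi) (mean_curvature (x \o psi)) z = 0.
  by move=> Vz; rewrite /lapW0 !p0// !mulr0 subr0 mul0r.
have W1 z : V z -> lapW1 (x \o psi) (mean_curvature (x \o psi)) z = 0.
  by move=> Vz; rewrite /lapW1 !p0// !mulr0 subr0 mul0r.
rewrite (laplacianE _ oV nV Vq) (pd_ext 0 oV Vq W0) (pd_ext 1 oV Vq W1).
by rewrite !(is_derive_pd (is_dC q (e_ _) (0 : R))) addr0 mulr0.
Qed.

(** [de] is the determinant of A, +1 or -1. It compares the orientation of the plane of the curve
    with that of w x T, and so relates the plane curvature to the curvature of the frame. *)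
Lemma cylinder_frame (A : 'M[R]_3) p J (c c1 c2 : R -> 'rV[R]_2) (a b : R) :
  orthogonal_mx A -> open_interval J -> (forall s, J s -> is_derive s 1 c (c1 s)) ->
  (forall s, J s -> is_derive s 1 c1 (c2 s)) -> (forall s, J s -> dot (c1 s) (c1 s) = 1) ->
  (forall s, J s -> c1 s 0 0 * c2 s 0 1 - c1 s 0 1 * c2 s 0 0 = a * s + b) ->
  exists a' b', frame_on false (kap false a' b') J
    (fun s => c s 0 0 *: row 0 A + c s 0 1 *: row 1 A + p) (fun=> row 2 A)
    (fun s => c1 s 0 0 *: row 0 A + c1 s 0 1 *: row 1 A).
Proof.
move=> /orthogonal_rows oA oiJ d1 d2 n1 k.
pose de := dot (cross (row 2 A) (row 0 A)) (row 1 A).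
exists (de * a), (de * b); split => // s Js.
have dot2 (u v : 'rV[R]_2) : dot u v = u 0 0 * v 0 0 + u 0 1 * v 0 1 by rewrite /dot sum2E.
have D (f : R -> 'rV[R]_2) df : is_derive s 1 f df ->
    is_derive s 1 (fun s => f s 0 0 *: row 0 A + f s 0 1 *: row 1 A) (df 0 0 *: row 0 A +
        df 0 1 *: row 1 A).
  move=> d; apply: is_derive_eq (is_dD (is_dscale (is_dcoord 0 d) (is_dC s (1 : R) (row 0 A)))
    (is_dscale (is_dcoord 1 d) (is_dC s (1 : R) (row 1 A)))) _.
  by rewrite !scaler0 !addr0.
pose T := c1 s 0 0 *: row 0 A + c1 s 0 1 *: row 1 A.
have TT : dot T T = 1.
  by rewrite /T !(dotDl, dotDr, dotZl, dotZr) !oA /= -[RHS](n1 s Js) dot2; ring.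
have wT : dot (row 2 A) T = 0 by rewrite /T !(dotDr, dotZr) !oA /=; ring.
split.
- apply: is_derive_eq (is_dD (D c (c1 s) (d1 s Js)) (is_dC s (1 : R) p)) _.
  by rewrite addr0 subr0 scale1r.
- by rewrite scale0r; exact: is_dC.
- apply: is_derive_eq (D c1 (c2 s) (d2 s Js)) _.
  rewrite oppr0 scale0r add0r -/T.
  set X := c2 s 0 0 *: row 0 A + _.
  have oJ : open J by have [] := oiJ.
  have XT : dot X T = 0.
    have := is_derive_open_ext oJ Js n1 (is_ddot (d2 s Js) (d2 s Js)).
    move=> [_]; have [_ ->] := is_dC s (1 : R) (1 : R).
    rewrite (dotC (c1 s)) !dot2 => h.
    rewrite /X /T !(dotDl, dotDr, dotZl, dotZr) !oA /=; lra.
  have Xw : dot X (row 2 A) = 0 by rewrite /X !(dotDl, dotZl) !oA /=; ring.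
  rewrite {1}(orthonormal_basis X (oA 2 2) TT wT) Xw XT !scale0r !add0r; congr (_ *: _).
  rewrite /kap -mulrA -mulrDr -(k s Js) /X /T crossDr !crossZr !(dotDl, dotDr, dotZl, dotZr).
  have e1 : dot (row 0 A) (cross (row 2 A) (row 0 A)) = 0 by rewrite dotC dot_crossr.
  have e2 : dot (row 1 A) (cross (row 2 A) (row 1 A)) = 0 by rewrite dotC dot_crossr.
  have e3 : dot (row 1 A) (cross (row 2 A) (row 0 A)) = de by rewrite dotC.
  have e4 : dot (row 0 A) (cross (row 2 A) (row 1 A)) = - de.
    by rewrite /de !dot3E !crossE; ring.
  by rewrite e1 e2 e3 e4; ring.
- by split; rewrite ?oA.
Qed.

Lemma cornu_harmonic (A : 'M[R]_3) p J c : orthogonal_mx A -> cornu_spiral J c ->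
  open_part_of x [set q : 'rV[R]_2 | J (q 0 0)] (right_cylinder A p c) ->
  harmonic_mean_curvature x.
Proof.
move=> oA [[oiJ sc n1] [a [b [_ k]]]] op.
have [a' [b' fr]] := cylinder_frame p oA oiJ (fun s Js => (smooth_curve_derive sc Js).1)
  (fun s Js => (smooth_curve_derive sc Js).2) n1 k.
apply: (modelled_harmonic fr) => m; have [U [phi [cU Um UD E]]] := op m.
exists U, phi; split => //.
  by move=> q /UD Jq; split => //; rewrite /rho subr0 mul0r addr0 ltr01.
by move=> q Uq; rewrite E// /right_cylinder vec3_mul /surf addrAC.
Qed.

(** In arclength the circle has the constant curvature 1 / r, an affine function of slope 0. The
    change of parameter from angle to arclength is made in the charts as well. *)
Lemma circle_harmonic (A : 'M[R]_3) p r : orthogonal_mx A -> 0 < r ->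
  open_part_of x [set: 'rV[R]_2] (right_cylinder A p (circle r)) ->
  harmonic_mean_curvature x.
Proof.
move=> oA r0 op; have rn : r != 0 by rewrite gt_eqF.
have ri : r^-1 != 0 by rewrite invr_eq0.
pose c s := circle r (r^-1 * s + 0).
pose c1 (s : R) := pt (- sin (r^-1 * s + 0)) (cos (r^-1 * s + 0)).
pose c2 (s : R) := pt (- (r^-1 * cos (r^-1 * s + 0))) (- (r^-1 * sin (r^-1 * s + 0))).
have dl (s : R) : is_derive s 1 (fun s => r^-1 * s + 0) r^-1.
  by apply: is_derive_eq (is_dD (is_dM (is_dC s (1 : R) r^-1) (is_derive_id s (1 : R)))
      (is_dC s (1 : R) (0 : R))) _; ring.
have d1 s : [set: R] s -> is_derive s 1 c (c1 s).
  move=> _; apply/is_derive_mx => i; have [->|->] := ord2 i.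
    rewrite (_ : (fun _ => _) = (fun s => r * cos (r^-1 * s + 0)));
        last by apply/funext => z; rewrite mxE.
    by apply: is_derive_eq (is_dM (is_dC s (1 : R) r) (is_dcos (dl s))) _; rewrite ptE0; field.
  rewrite (_ : (fun _ => _) = (fun s => r * sin (r^-1 * s + 0)));
      last by apply/funext => z; rewrite mxE.
  by apply: is_derive_eq (is_dM (is_dC s (1 : R) r) (is_dsin (dl s))) _; rewrite ptE1; field.
have d2 s : [set: R] s -> is_derive s 1 c1 (c2 s).
  move=> _; apply/is_derive_mx => i; have [->|->] := ord2 i.
    rewrite (_ : (fun _ => _) = (fun s => - sin (r^-1 * s + 0)));
        last by apply/funext => z; rewrite ptE0.
    by apply: is_derive_eq (is_dN (is_dsin (dl s))) _; rewrite ptE0 mulrC.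
  rewrite (_ : (fun _ => _) = (fun s => cos (r^-1 * s + 0))); last by apply/funext => z;
      rewrite ptE1.
  by apply: is_derive_eq (is_dcos (dl s)) _; rewrite ptE1 mulNr mulrC.
have n1 s : [set: R] s -> dot (c1 s) (c1 s) = 1.
  by move=> _; rewrite /dot sum2E ptE0 ptE1 -[RHS](cos2Dsin2 (r^-1 * s + 0)); ring.
have k s : [set: R] s -> c1 s 0 0 * c2 s 0 1 - c1 s 0 1 * c2 s 0 0 = 0 * s + r^-1.
  move=> _; rewrite !ptE0 !ptE1 mul0r add0r -[RHS]mulr1 -(cos2Dsin2 (r^-1 * s + 0)); ring.
have oiT : open_interval [set: R] by split; [exact: openT|].
have [a' [b' fr]] := cylinder_frame p oA oiT d1 d2 n1 k.
apply: (modelled_harmonic fr) => m; have [U [phi [cU [v Uv <-] UD E]]] := op m.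
have [V [z [cV Vz zv VU]]] := chart_affine 0 0 cU Uv ri (oner_neq0 R).
exists V, (fun q => phi (pt (r^-1 * q 0 0 + 0) (1 * q 0 1 + 0))); split => //.
- by exists z => //; rewrite zv.
- by move=> q _; split => //; rewrite /rho subr0 mul0r addr0 ltr01.
- by move=> q /VU Uq; rewrite E// /right_cylinder vec3_mul /surf ptE0 ptE1 mul1r [q 0 1 +
    0]addr0 addrAC.
Qed.

(** Differentiating the constant products of w and T gives the components -1 and 0 of beta'' along
    them; the remaining one, along w x T, is the geodesic curvature. These are the frame equations
    of a cone with fixed vertex p. *)
Lemma cone_harmonic p J beta c1 c2 : arclength_curve J beta -> curve_on_unit_sphere p J beta ->
  (forall s, J s -> sphere_curvature p beta s = c1 * cos s + c2 * sin s) ->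
  open_part_of x [set q : 'rV[R]_2 | J (q 0 0) /\ 0 < q 0 1] (cone p beta) ->
  harmonic_mean_curvature x.
Proof.
move=> [oiJ sc n1] sph k op; have oJ : open J by have [] := oiJ.
pose w s := beta s - p; pose T := derive1 beta.
have db s (Js : J s) := (smooth_curve_derive sc Js).1.
have dT s (Js : J s) := (smooth_curve_derive sc Js).2.
have dw s : J s -> is_derive s 1 w (T s).
  by move=> Js; apply: is_derive_eq (is_dD (db s Js) (is_dC s (1 : R) (- p))) _; rewrite addr0.
have wT s : J s -> dot (w s) (T s) = 0.
  move=> Js; have [_] := is_derive_open_ext oJ Js sph (is_ddot (dw s Js) (dw s Js)).
  have [_ ->] := is_dC s (1 : R) (1 : R).
  rewrite (dotC (T s)) => h; lra.
have fr : frame_on true (kap true c1 c2) J (fun=> p) w T.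
  split => // s Js; split.
  - by rewrite subrr scale0r; exact: is_dC.
  - by rewrite scale1r; exact: dw.
  - apply: is_derive_eq (dT s Js) _.
    have ww := sph s Js; have TT := n1 s Js; have wTs := wT s Js.
    have Tw' : dot (derive1n 2 beta s) (w s) = - 1.
      have [_] := is_derive_open_ext oJ Js wT (is_ddot (dw s Js) (dT s Js)).
      have [_ ->] := is_dC s (1 : R) (0 : R).
      rewrite TT (dotC (w s)) => h; lra.
    have TT' : dot (derive1n 2 beta s) (T s) = 0.
      have [_] := is_derive_open_ext oJ Js n1 (is_ddot (dT s Js) (dT s Js)).
      have [_ ->] := is_dC s (1 : R) (1 : R).
      rewrite (dotC (derive1 beta s)) => h; lra.
    rewrite {1}(orthonormal_basis (derive1n 2 beta s) ww TT wTs) -/(w s) -/(T s) Tw' TT'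
        scale0r addr0.
    by congr (_ + _ *: _); rewrite -/(sphere_curvature p beta s) k.
  - by split; [exact: sph|exact: n1|exact: wT].
apply: (modelled_harmonic fr) => m; have [U [phi [cU Um UD E]]] := op m.
exists U, phi; split => //.
by move=> q /UD[Jq q0]; split => //; rewrite /rho subrr add0r mul1r.
Qed.

End Backward.

Theorem theorem2p5 (R : realType) (M : topologicalType) (x : M -> 'rV[R]_3)
    (Msurf : immersed_surface x) (Mflat : flat x) :
  harmonic_mean_curvature x <->
  [\/ exists (A : 'M[R]_3) (p : 'rV[R]_3),
        orthogonal_mx A /\ open_part_of x [set: 'rV[R]_2] (plane A p),
      exists (A : 'M[R]_3) (p : 'rV[R]_3) (r : R),
        [/\ orthogonal_mx A, 0 < r &
            open_part_of x [set: 'rV[R]_2] (right_cylinder A p (circle r))],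
      exists (A : 'M[R]_3) (p : 'rV[R]_3) (J : set R) (c : R -> 'rV[R]_2),
        [/\ orthogonal_mx A, cornu_spiral J c &
            open_part_of x [set q : 'rV[R]_2 | J (q 0 0)] (right_cylinder A p c)] |
      exists (p : 'rV[R]_3) (J : set R) (beta : R -> 'rV[R]_3) (c1 c2 : R),
        [/\ arclength_curve J beta,
            curve_on_unit_sphere p J beta,
            c1 != 0 /\ c2 != 0,
            forall s, J s ->
              sphere_curvature p beta s = c1 * cos s + c2 * sin s &
            open_part_of x [set q : 'rV[R]_2 | J (q 0 0) /\ 0 < q 0 1] (cone p beta)]].
Proof.
split=> [harm|[[A [p [_ op]]]|[A [p [r [oA r0 op]]]]|[A [p [J [c [oA co op]]]]]|
  [p [J [beta [c1 [c2 [ar sp _ k op]]]]]]]].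
- have [[n [c [n0 E]]]|[sg [a [b [J [g [w [T [ab fr mod]]]]]]]]] := global_model Msurf
    Mflat harm.
    by constructor 1; exact: plane_form Msurf n0 E.
  (* The reduction to a normal form needs a parameter in the interval of the frame, which a point of
     M provides. If M is empty, any plane will do. *)
  have [[m _]|e] := pselect (exists m : M, True); last first.
    constructor 1; apply: (plane_form Msurf (n := delta_mx 0 0) (c := 0)).
      by apply/eqP => /rowP/(_ 0)/eqP; rewrite !mxE eqxx oner_eq0.
    by move=> m; exfalso; apply: e; exists m.
  have [U [phi [_ [q Uq _] UD _]]] := mod m; have [Jq _] := UD q Uq.
  case: sg fr mod {UD} => fr mod.
    by constructor 4; exact: cone_form fr Jq ab mod.
  have [a0|a0] := eqVneq a 0; last by constructor 3; exact: cornu_form fr Jq a0 mod.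
  move: ab; rewrite a0 eqxx /= => b0; constructor 2.
  exact: circle_form fr Jq a0 b0 mod.
- exact: plane_harmonic op.
- exact: circle_harmonic oA r0 op.
- exact: cornu_harmonic oA co op.
- exact: cone_harmonic ar sp k op.
Qed.
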